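(* Let $N\ge1$, $0<s<1$, assume (V$_1$) and ($f_1$)–($f_5$), and assume that $f$ does not depend on $x$ (i.e. $f(x,u)=f(u)$). Assume moreover (V$_3$) $\liminf_{|x|\to+\infty}V(x)=V_\infty$ and (V$_4$) $V\le V_\infty$ on $\mathbb{R}^N$ but $V$ is not identically equal to $V_\infty$, for some constant $V_\infty>0$. Then $c$ is a critical value of $J$.
   Context: $\hat u$ denotes the Fourier transform. (V$_1$) $V\in C^1(\mathbb{R}^N)$, $\inf V=V_0>0$. ($f_1$) $f\in C^1$. ($f_2$) $f(0)=0=f'(0)$. ($f_3$) $|f'(s)|\le a_1+a_2|s|^{p-1}$ for constants $a_1,a_2>0$ and some $1<p<\frac{N+2s}{N-2s}$ (in particular $N>2s$). ($f_4$) $0<\mu F(s)\le sf(s)$ for $s\ne0$ with some $\mu>2$, $F(s)=\int_0^sf(t)dt$. ($f_5$) $t\mapsto t^{-1}sf(ts)$ is increasing on $(0,\infty)$ for every $s$. $E^s=\{u\in L^2:\|u\|<\infty\}$, $\|u\|^2=\int|\xi|^{2s}|\hat u|^2d\xi+\int V|u|^2dx$; $J(u)=\frac12\|u\|^2-\int F(u)dx$; $\Gamma=\{g\in C([0,1],E^s):g(0)=0,J(g(1))<0\}$, $c=\inf_{g\in\Gamma}\max_{t\in[0,1]}J(g(t))$. *)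

(* Defs.v *)
(* Fractional Schroedinger functional on R^N,
   points of R^N are represented as N.-tuple R (product sigma-algebra). *)
From mathcomp Require Import all_boot all_order all_algebra.
From mathcomp Require Import all_classical all_reals all_analysis.

Set Implicit Arguments.
Unset Strict Implicit.
Unset Printing Implicit Defensive.
Import Order.TTheory GRing.Theory Num.Theory.
Import numFieldNormedType.Exports.
Local Open Scope classical_set_scope.
Local Open Scope ring_scope.

Section Defs.
Variable R : realType.

Definition dotN (N : nat) (x y : N.-tuple R) : R :=
  \sum_(i < N) tnth x i * tnth y i.
Definition euclN (N : nat) (x : N.-tuple R) : R := Num.sqrt (dotN x x).

Definition rv2t (N : nat) (x : 'rV[R]_N) : N.-tuple R := [tuple x ord0 i | i < N].

(* Lebesgue integral over R^N of a [0,+oo]-valued function, as iterated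
   one-dimensional Lebesgue integrals (equal to the integral w.r.t.
   N-dimensional Lebesgue measure for measurable integrands, by Tonelli). *)
Fixpoint iintN (N : nat) : (N.-tuple R -> \bar R) -> \bar R :=
  match N with
  | 0 => fun f => f [tuple]
  | n.+1 => fun f =>
      (\int[@lebesgue_measure R]_t iintN (fun y : n.-tuple R => f (cons_tuple t y)))%E
  end.

(* Lebesgue integral over R^N of a real function (meaningful when integrable) *)
Definition RintN (N : nat) (h : N.-tuple R -> R) : R :=
  fine (iintN (fun x => (Num.max (h x) 0)%:E)) -
  fine (iintN (fun x => (Num.max (- h x) 0)%:E)).

(* Fourier transform of an L^1 function,
   \hat h(xi) = (2 pi)^(-N/2) \int h(x) e^{-i x.xi} dx : real and imaginary parts *)
Definition FTconst (N : nat) : R := ((Num.sqrt (2 * pi))^-1) ^+ N.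
Definition FTre (N : nat) (h : N.-tuple R -> R) (xi : N.-tuple R) : R :=
  FTconst N * RintN (fun x => h x * cos (dotN x xi)).
Definition FTim (N : nat) (h : N.-tuple R -> R) (xi : N.-tuple R) : R :=
  - (FTconst N * RintN (fun x => h x * sin (dotN x xi))).

Definition trunc (N : nat) (u : N.-tuple R -> R) (k : nat) (x : N.-tuple R) : R :=
  if euclN x <= k%:R then u x else 0.

(* (gr, gi) is (real part, imaginary part of) the L^2 Fourier transform
   (Plancherel) of u: the L^2-limit of the Fourier transforms of the
   truncations of u. *)
Definition is_FT (N : nat) (u : N.-tuple R -> R) (gr gi : N.-tuple R -> R) : Prop :=
  measurable_fun setT gr /\ measurable_fun setT gi /\
  ((fun k : nat => iintN (fun xi =>
       ((FTre (trunc u k) xi - gr xi) ^+ 2 + (FTim (trunc u k) xi - gi xi) ^+ 2)%:E))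
     @ \oo --> 0%E).

(* \int |xi|^{2s} |\hat u(xi)|^2 dxi  (all choices of \hat u agree a.e.) *)
Definition kineticE (N : nat) (s : R) (u : N.-tuple R -> R) : \bar R :=
  ereal_inf [set e | exists gr gi, is_FT u gr gi /\
     e = iintN (fun xi => (powR (euclN xi) (2 * s) * (gr xi ^+ 2 + gi xi ^+ 2))%:E)].

Definition Esnormsq (N : nat) (s : R) (V : N.-tuple R -> R) (u : N.-tuple R -> R) : \bar R :=
  (kineticE s u + iintN (fun x => (V x * u x ^+ 2)%:E))%E.

Definition inEs (N : nat) (s : R) (V : N.-tuple R -> R) (u : N.-tuple R -> R) : Prop :=
  measurable_fun setT u /\ (iintN (fun x => (u x ^+ 2)%:E) < +oo)%E /\
  (Esnormsq s V u < +oo)%E.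

Definition Esnorm (N : nat) (s : R) (V : N.-tuple R -> R) (u : N.-tuple R -> R) : R :=
  Num.sqrt (fine (Esnormsq s V u)).

Definition primitive (f : R -> R) (t : R) : R :=
  if 0 <= t then Rintegral (@lebesgue_measure R) `[0, t] f
  else - Rintegral (@lebesgue_measure R) `[t, 0] f.

Definition Jfun (N : nat) (s : R) (V : N.-tuple R -> R) (f : R -> R)
  (u : N.-tuple R -> R) : R :=
  2^-1 * fine (Esnormsq s V u) - RintN (fun x => primitive f (u x)).

Definition Gamma (N : nat) (s : R) (V : N.-tuple R -> R) (f : R -> R)
  (g : R -> N.-tuple R -> R) : Prop :=
  (forall t, t \in `[0, 1] -> inEs s V (g t)) /\
  (forall t, t \in `[0, 1] -> forall e, 0 < e -> exists2 d, 0 < d &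
     forall t', t' \in `[0, 1] -> `|t' - t| < d ->
       Esnorm s V (fun x => g t' x - g t x) < e) /\
  Esnorm s V (g 0) = 0 /\
  Jfun s V f (g 1) < 0.

Definition mp_level (N : nat) (s : R) (V : N.-tuple R -> R) (f : R -> R) : \bar R :=
  ereal_inf [set ereal_sup [set (Jfun s V f (g t))%:E | t in `[0, 1]%classic]
            | g in Gamma s V f].

(* u is a critical point of J: J is Frechet differentiable at u (in E^s)
   with derivative 0 *)
Definition critical_point (N : nat) (s : R) (V : N.-tuple R -> R) (f : R -> R)
  (u : N.-tuple R -> R) : Prop :=
  inEs s V u /\
  forall e, 0 < e -> exists2 d, 0 < d &
    forall h, inEs s V h -> Esnorm s V h < d ->
      `|Jfun s V f (fun x => u x + h x) - Jfun s V f u| <= e * Esnorm s V h.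

Definition critical_value (N : nat) (s : R) (V : N.-tuple R -> R) (f : R -> R)
  (c : \bar R) : Prop :=
  exists u, critical_point s V f u /\ c = (Jfun s V f u)%:E.

End Defs.

(* Main.v *)
(* The kinetic energy K(u) = int |xi|^(2s) |u^|^2 controls translations:
   |u(. + h) - u|_2^2 <= 4 |h|^(2s) K(u), by Plancherel and |e^(ia) - 1|^2 <= 4 |a|^(2s).
   Comparing u with its means over cubes of side 2^-k then gives, with no interpolation or
   Sobolev theory, the subcritical embedding, Lions' nonvanishing lemma and local
   compactness of bounded sequences.

   The level c equals the minimum of J on the Nehari set Phi(u) = |u|^2 - int f(u)u = 0,
   u <> 0: rays through Nehari points are admissible paths on which J is maximal at the
   Nehari point (f5), and every admissible path crosses the Nehari set.  For a minimizing
   sequence, Lions' lemma gives translations along which it converges locally to some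
   w <> 0, the translated potentials converging to W >= V (W = V or W = V_oo).  The
   Brezis-Lieb splitting excludes Phi_W(w) > 0, since otherwise the remainders w_n - w
   could be projected on the Nehari set below the level c.  Hence Phi_V(w) <= Phi_W(w) <= 0,
   some t w with 0 < t <= 1 lies on the Nehari set, and J(t w) = int G(t w) <= int G(w) <= c
   with G(z) = f(z)z/2 - F(z) by Fatou's lemma, so t w is a minimizer.  A minimizer is a
   critical point: a descent direction phi would yield Nehari points t(u + e phi), t near 1,
   with J below c. *)

Require Import Defs.
From mathcomp Require Import all_boot all_order all_algebra.
From mathcomp Require Import all_classical all_reals all_analysis.
From HB Require Import structures.
From mathcomp Require Import measurable_realfun ring lra zify.
Set Implicit Arguments.
Unset Strict Implicit.
Unset Printing Implicit Defensive.
Import Order.TTheory GRing.Theory Num.Theory.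
Import numFieldNormedType.Exports.
Local Open Scope classical_set_scope.
Local Open Scope ring_scope.

(** * Real-valued integrals *)

(** Plancherel is obtained without an inversion theorem. If an integrable weight g has, up to the
    normalising constant, a transform k >= 0 that is even and of mass 1, Fubini gives int g |v^|^2 =
    |v|_2^2 - 1/2 int k(h) |v(. + h) - v|_2^2 dh. Letting g tend to 1 concentrates k at the origin,
    where continuity of translations in L2 removes the last term. The weight exp(-|x_1| - ... -
    |x_N|) is chosen because its transform is an explicit product of Cauchy kernels. The obstacle is
    the loss of compactness under translations. It is met on the Nehari set rather than through
    Palais-Smale sequences: there J equals int G(u), and G is nonnegative and nondecreasing along
    rays from 0. This bounds minimizing sequences, lets almost everywhere convergence suffice in
    Fatou's lemma, and shows that projecting along a ray with t <= 1 does not raise the energy.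
    Subcriticality, with r = p - 1, reads r (N - 2s) < 4s. It says exactly that the layers of u
    between successive bounds of its cube means contribute a convergent geometric series to int
    |u|^(2 + r). *)

Section RealIntegral.
Context d (T : measurableType d) (R : realType)
  (mu : {measure set T -> \bar R}).
Implicit Types (f g h : T -> R).

Definition itg h := mu.-integrable setT (EFin \o h).
Definition II h : R := Rintegral mu setT h.

Lemma itg_meas h : itg h -> measurable_fun setT h.
Proof. by move=> /measurable_int /measurable_EFinP. Qed.

Lemma II_EFin h : itg h -> (II h)%:E = (\int[mu]_x (h x)%:E)%E.
Proof. by move=> ih; rewrite /II /Rintegral fineK// integrable_fin_num. Qed.

Lemma itg_le g h : measurable_fun setT h -> (forall x, `|h x| <= g x) ->
  itg g -> itg h.
Proof.
move=> mh hg; apply: le_integrable => //; first exact/measurable_EFinP.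
by move=> x _ /=; rewrite lee_fin (le_trans (hg x))// ler_norm.
Qed.

Lemma itg_ge0 h : measurable_fun setT h -> (forall x, 0 <= h x) ->
  (\int[mu]_x (h x)%:E < +oo)%E -> itg h.
Proof.
move=> mh h0 hoo; apply/integrableP; split; first exact/measurable_EFinP.
by under eq_integral do rewrite /= ger0_norm//.
Qed.

Lemma itgD g h : itg g -> itg h -> itg (fun x => g x + h x).
Proof.
move=> ig ih; rewrite /itg (_ : _ \o _ = (EFin \o g) \+ (EFin \o h))%E//.
exact: integrableD.
Qed.

Lemma itgZ k h : itg h -> itg (fun x => k * h x).
Proof.
move=> ih; rewrite /itg (_ : _ \o _ = (fun x => k%:E * (EFin \o h) x)%E)//.
exact: integrableZl.
Qed.

Lemma itgB g h : itg g -> itg h -> itg (fun x => g x - h x).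
Proof.
move=> ig /(itgZ (-1)) ih.
by rewrite (_ : (fun _ => _) = (fun x => g x + -1 * h x));
  [exact: itgD|apply/funext => x; rewrite mulN1r].
Qed.

Lemma itgN h : itg h -> itg (fun x => - h x).
Proof.
move=> /(itgZ (-1)).
by congr itg; apply/funext => x; rewrite mulN1r.
Qed.

Lemma itg_abs h : itg h -> itg (fun x => `|h x|).
Proof.
move=> ih; apply: (@itg_le (fun x => `|h x|)); last exact: integrable_abse ih.
- by apply: measurableT_comp => //; exact: itg_meas.
- by move=> x; rewrite normr_id.
Qed.

Lemma IID g h : itg g -> itg h -> II (fun x => g x + h x) = II g + II h.
Proof. by move=> ig ih; rewrite /II RintegralD. Qed.

Lemma IIB g h : itg g -> itg h -> II (fun x => g x - h x) = II g - II h.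
Proof. by move=> ig ih; rewrite /II RintegralB. Qed.

Lemma IIZ k h : itg h -> II (fun x => k * h x) = k * II h.
Proof. by move=> ih; rewrite /II RintegralZl. Qed.

Lemma IIN h : itg h -> II (fun x => - h x) = - II h.
Proof.
move=> ih; rewrite -mulN1r -IIZ//.
by congr II; apply/funext => x; rewrite mulN1r.
Qed.

Lemma II_cst0 : II (fun=> 0) = 0.
Proof. by rewrite /II /Rintegral integral0. Qed.

Lemma II_le g h : itg g -> itg h -> (forall x, g x <= h x) -> II g <= II h.
Proof. by move=> ig ih gh; apply: le_Rintegral. Qed.

Lemma II_ge0 h : (forall x, 0 <= h x) -> 0 <= II h.
Proof. by move=> h0; apply: Rintegral_ge0. Qed.

Lemma II_abs h : itg h -> `|II h| <= II (fun x => `|h x|).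
Proof. by move=> ih; apply: le_normr_Rintegral. Qed.

Lemma eq_II g h : g =1 h -> II g = II h.
Proof. by move=> /funext ->. Qed.

Lemma II_absle g h : itg g -> measurable_fun setT h ->
  (forall x, `|h x| <= g x) -> `|II h| <= II g.
Proof.
move=> ig mh hg; have ih := itg_le mh hg ig.
apply: (le_trans (II_abs ih)).
by apply: II_le => //; exact: itg_abs.
Qed.

Lemma II_ae_eq g h : measurable_fun setT g -> measurable_fun setT h ->
  {ae mu, forall x, g x = h x} -> II g = II h.
Proof.
move=> mg mh gh; rewrite /II /Rintegral; congr fine.
apply: ae_eq_integral => //; [exact/measurable_EFinP..|].
by apply: filterS gh => x /= -> _.
Qed.

Lemma II_eq0_ae h : (forall x, 0 <= h x) -> itg h -> II h = 0 ->
  {ae mu, forall x, h x = 0}.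
Proof.
move=> h0 ih I0; have mh := itg_meas ih.
have := II_EFin ih; rewrite I0 => /esym E.
have /ae_eq_integral_abs : measurable_fun setT (EFin \o h).
  exact/measurable_EFinP.
move=> /(_ mu measurableT) [+ _].
under eq_integral do rewrite /= ger0_norm//.
by move=> /(_ E); apply: filterS => x /= /(_ I) [].
Qed.

Lemma II_dct (h_ : nat -> T -> R) h g :
  (forall n, measurable_fun setT (h_ n)) -> measurable_fun setT h ->
  {ae mu, forall x, h_ ^~ x @ \oo --> h x} ->
  (forall n x, `|h_ n x| <= g x) -> itg g ->
  itg h /\ (II \o h_) @ \oo --> II h.
Proof.
move=> mh_ mh ch hg ig.
have [] := @dominated_convergence _ _ _ mu _ measurableT
  (fun n => EFin \o h_ n) (EFin \o h) (EFin \o g).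
- by move=> n; exact/measurable_EFinP.
- exact/measurable_EFinP.
- apply: filterS ch => x /= + _ => cx.
  by apply: cvg_EFin; [exact: nearW|exact: cx].
- exact: ig.
- by apply: aeW => x n _ /=; rewrite lee_fin.
move=> ih _ c; split => //.
have ih_ n : itg (h_ n) by apply: itg_le (hg n) ig.
have : [sequence (\int[mu]_x (h_ n x)%:E)%E]_n @ \oo --> (II h)%:E.
  by rewrite II_EFin.
by move=> /fine_cvg.
Qed.

(** Fatou in the form used throughout: a uniform bound on the integrals passes to an almost
    everywhere limit, whose integrability is part of the conclusion rather than an assumption. *)
Lemma II_fatou (h_ : nat -> T -> R) h M :
  (forall n, itg (h_ n)) -> measurable_fun setT h ->
  (forall n x, 0 <= h_ n x) -> (forall x, 0 <= h x) ->
  {ae mu, forall x, h_ ^~ x @ \oo --> h x} ->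
  (forall n, II (h_ n) <= M) -> itg h /\ II h <= M.
Proof.
move=> ih_ mh h0 h00 ch hM.
have L : (\int[mu]_x (h x)%:E <= M%:E)%E.
  have F : (\int[mu]_x limn_einf (fun n => (h_ n x)%:E) <= M%:E)%E.
    apply: le_trans (@fatou _ _ _ mu _ measurableT (fun n x => (h_ n x)%:E) _ _) _.
    - by move=> n; apply/measurable_EFinP; exact: itg_meas (ih_ n).
    - by move=> n x _; rewrite lee_fin.
    (* The lower limit is the limit of the infima over tails, and each infimum is at most the first
       term of its tail. *)
    - rewrite limn_einf_lim; apply: lime_le; first exact: is_cvg_einfs.
      apply: nearW => n; apply: le_trans (_ : ((II (h_ n))%:E <= _)%E).
        by rewrite II_EFin//; apply: ereal_inf_lbound; exists n => //=.
      by rewrite lee_fin.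
  apply: le_trans F; apply: ae_ge0_le_integral => //.
  - by move=> x _; rewrite lee_fin.
  - exact/measurable_EFinP.
  - move=> x _; rewrite limn_einf_lim; apply: lime_ge; first exact: is_cvg_einfs.
    apply: nearW => n; apply: le_ereal_inf_tmp => _ [m /= _ <-].
    by rewrite lee_fin.
  - apply: (@measurableT_comp _ _ _ _ _ _ (@oppe R)) => //.
    apply: measurable_fun_limn_esup => n; apply: measurableT_comp => //.
    by apply/measurable_EFinP; exact: itg_meas (ih_ n).
  - apply: filterS ch => x cx _.
    have /cvg_limn_einf_sup[-> _] : (h_ n x)%:E @[n --> \oo] --> (h x)%:E.
      by apply: cvg_EFin; [exact: nearW|exact: cx].
    by [].
have ih : itg h.
  by apply: itg_ge0 => //; exact: le_lt_trans L (ltry _).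
by split => //; rewrite -lee_fin II_EFin.
Qed.

Lemma II_gt0 h : (forall x, 0 <= h x) -> itg h ->
  ~ {ae mu, forall x, h x = 0} -> 0 < II h.
Proof.
move=> h0 ih nae; rewrite lt_neqAle II_ge0// andbT eq_sym.
by apply: contra_notN nae => /eqP; exact: II_eq0_ae.
Qed.

Lemma II_ge0_le g h : measurable_fun setT g -> (forall x, 0 <= g x <= h x) ->
  itg h -> itg g /\ II g <= II h.
Proof.
move=> mg gh ih.
have ig : itg g.
  by apply: itg_le ih => // x; have /andP[g0 ?] := gh x; rewrite ger0_norm.
by split => //; apply: II_le => // x; have /andP[] := gh x.
Qed.

Lemma itg_bound g h M : itg g -> measurable_fun setT h ->
  (forall x, `|h x| <= M) -> itg (fun x => g x * h x).
Proof.
move=> ig mh hM.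
apply: (@itg_le (fun x => M * `|g x|)); last by apply/itgZ/itg_abs.
  by apply: measurable_funM => //; exact: itg_meas.
by move=> x; rewrite normrM mulrC ler_wpM2r.
Qed.

Lemma itg_sqrM g h : measurable_fun setT g -> measurable_fun setT h ->
  itg (fun x => g x ^+ 2) -> itg (fun x => h x ^+ 2) -> itg (fun x => g x * h x).
Proof.
move=> mg mh ig ih; apply: (@itg_le (fun x => g x ^+ 2 + h x ^+ 2)).
- exact: measurable_funM.
- move=> x; rewrite ler_norml; have := sqr_ge0 (g x - h x).
  have := sqr_ge0 (g x + h x); rewrite sqrrB sqrrD !expr2 => *.
  by apply/andP; split; nra.
- exact: itgD.
Qed.

Lemma itg_sqrD g h : measurable_fun setT g -> measurable_fun setT h ->
  itg (fun x => g x ^+ 2) -> itg (fun x => h x ^+ 2) ->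
  itg (fun x => (g x + h x) ^+ 2).
Proof.
move=> mg mh ig ih.
apply: (@itg_le (fun x => 2 * (g x ^+ 2 + h x ^+ 2))).
- by apply: measurable_funX; exact: measurable_funD.
- move=> x; rewrite ger0_norm ?sqr_ge0//.
  have := sqr_ge0 (g x - h x); have := sqr_ge0 (g x + h x).
  by rewrite sqrrB sqrrD; nra.
- by apply: itgZ; exact: itgD.
Qed.

Lemma itg_sqrB g h : measurable_fun setT g -> measurable_fun setT h ->
  itg (fun x => g x ^+ 2) -> itg (fun x => h x ^+ 2) ->
  itg (fun x => (g x - h x) ^+ 2).
Proof.
move=> mg mh ig ih.
apply: (@itg_le (fun x => 2 * (g x ^+ 2 + h x ^+ 2))).
- by apply: measurable_funX; exact: measurable_funB.
- move=> x; rewrite ger0_norm ?sqr_ge0//.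
  have := sqr_ge0 (g x - h x); have := sqr_ge0 (g x + h x).
  by rewrite sqrrB sqrrD; nra.
- by apply: itgZ; exact: itgD.
Qed.

(** Integrates [e * (g +- e^-1 * h)^2 >= 0]. It serves in place of the Cauchy-Schwarz inequality;
    the weight [e] is tuned at each use. *)
Lemma II_young g h (e : R) : 0 < e -> measurable_fun setT g ->
  measurable_fun setT h ->
  itg (fun x => g x ^+ 2) -> itg (fun x => h x ^+ 2) ->
  2 * `|II (fun x => g x * h x)| <=
  e * II (fun x => g x ^+ 2) + e^-1 * II (fun x => h x ^+ 2).
Proof.
move=> e0 mg mh ig ih.
have igh := itg_sqrM mg mh ig ih.
rewrite -!IIZ// -IID; [|exact: itgZ..].
rewrite -[X in X * `|_|](@ger0_norm _ 2)// -normrM -IIZ//.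
apply: II_absle; [by apply: itgD; exact: itgZ| |].
  by apply: measurable_funM => //; exact: measurable_funM.
move=> x; have ei : e * e^-1 = 1 by rewrite divff// gt_eqF.
have i0 : 0 < e^-1 by rewrite invr_gt0.
rewrite ler_norml; apply/andP; split.
  have : 0 <= e * (g x + e^-1 * h x) ^+ 2.
    by rewrite mulr_ge0 ?sqr_ge0// ltW.
  have -> : e * (g x + e^-1 * h x) ^+ 2 =
    e * g x ^+ 2 + (e * e^-1) * (2 * (g x * h x)) +
    (e * e^-1) * (e^-1 * h x ^+ 2) by ring.
  by rewrite ei !mul1r; lra.
have : 0 <= e * (g x - e^-1 * h x) ^+ 2.
  by rewrite mulr_ge0 ?sqr_ge0// ltW.
have -> : e * (g x - e^-1 * h x) ^+ 2 =
  e * g x ^+ 2 - (e * e^-1) * (2 * (g x * h x)) +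
  (e * e^-1) * (e^-1 * h x ^+ 2) by ring.
by rewrite ei !mul1r; lra.
Qed.

End RealIntegral.

(** * L2 limits and the Brezis-Lieb lemma *)

(** A choice function on pairs [(k, m)] is iterated: asking for an index at least [(phi k).+1] makes
    the extraction strictly increasing. *)
Lemma extract (P : nat -> nat -> Prop) :
  (forall k m, exists2 n, (m <= n)%N & P k n) ->
  exists2 phi : nat -> nat, (forall k, (phi k < phi k.+1)%N) &
    forall k, P k (phi k).
Proof.
move=> H.
have /choice[g hg] : forall km : nat * nat,
    exists n, (km.2 <= n)%N /\ P km.1 n.
  by move=> [k m]; have [n ? ?] := H k m; exists n.
pose phi := fix phi k := if k is k'.+1 then g (k, (phi k').+1) else g (0%N, 0%N).
exists phi => [k|[|k]]; first by have [] := hg (k.+1, (phi k).+1).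
  by have [] := hg (0%N, 0%N).
by have [] := hg (k.+1, (phi k).+1).
Qed.

Lemma extract_ge (phi : nat -> nat) :
  (forall k, (phi k < phi k.+1)%N) -> forall k, (k <= phi k)%N.
Proof. by move=> H; elim=> // k IH; exact: leq_ltn_trans IH (H k). Qed.

Lemma extract_le (phi : nat -> nat) :
  (forall k, (phi k < phi k.+1)%N) -> forall j k, (j <= k)%N -> (phi j <= phi k)%N.
Proof.
move=> H j; elim=> [|k IH]; first by rewrite leqn0 => /eqP ->.
rewrite leq_eqVlt ltnS => /orP[/eqP ->//|/IH h].
exact: leq_trans h (ltnW (H k)).
Qed.

Lemma cvg_eps (R : realType) (u : nat -> R) (l : R) :
  (forall e : R, 0 < e -> exists m, forall n, (m <= n)%N -> `|u n - l| <= e) ->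
  u @ \oo --> l.
Proof.
move=> H; apply/cvgrPdist_le => e e0; have [m hm] := H e e0.
by exists m => // n /= mn; rewrite distrC; exact: hm.
Qed.

Lemma eps_cvg (R : realType) (u : nat -> R) (l : R) : u @ \oo --> l ->
  forall e, 0 < e -> exists m, forall n, (m <= n)%N -> `|u n - l| <= e.
Proof.
move=> /cvgrPdist_le H e /H [m _ hm]; exists m => n mn.
by rewrite distrC; exact: hm.
Qed.

Lemma cvg_extract (R : realType) (u : nat -> R) (l : R) (phi : nat -> nat) :
  (forall k, (phi k < phi k.+1)%N) -> u @ \oo --> l -> (u \o phi) @ \oo --> l.
Proof.
move=> hphi cu; apply: cvg_eps => e e0; have [m hm] := eps_cvg cu e0.
exists m => n mn; apply: hm; exact: leq_trans mn (extract_ge hphi n).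
Qed.

Lemma geo_sum_le (R : realType) (q : R) n : 0 <= q < 1 ->
  \sum_(i < n) q ^+ i <= (1 - q)^-1.
Proof.
move=> /andP[q0 q1]; have d0 : 0 < 1 - q by rewrite subr_gt0.
rewrite -(ler_pM2l d0) mulfV ?gt_eqF// -[X in X * _]opprB mulNr -subrX1.
by rewrite opprB gerBl exprn_ge0.
Qed.

Lemma half_sum_le (R : realType) n : \sum_(i < n) (2^-1 : R) ^+ i <= 2.
Proof.
have h : 0 <= (2^-1 : R) < 1 by lra.
by apply: le_trans (geo_sum_le n h) _; rewrite le_eqVlt; apply/orP; left; apply/eqP; field.
Qed.

Lemma norm_le_sqr (R : realType) (x e : R) : 0 <= e -> x ^+ 2 <= e ^+ 2 -> `|x| <= e.
Proof.
move=> e0; rewrite -[x ^+ 2]real_normK ?num_real//.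
by rewrite ler_pXn2r// nnegrE.
Qed.

Section Complete.
Context d (T : measurableType d) (R : realType)
  (mu : {measure set T -> \bar R}).
Local Notation itg := (itg mu).
Local Notation II := (II mu).

(** Monotone convergence: the sum of the series has integral at most [M], hence is finite almost
    everywhere. *)
Lemma ae_sum_bounded (h_ : nat -> T -> R) (M : R) :
  (forall n, itg (h_ n)) -> (forall n x, 0 <= h_ n x) ->
  (forall n, \sum_(i < n) II (h_ i) <= M) ->
  {ae mu, forall x, exists C : R, forall n, \sum_(i < n) h_ i x <= C}.
Proof.
move=> ih h0 hM.
pose S x := (\sum_(n <oo) (h_ n x)%:E)%E.
have mh n : measurable_fun setT (fun x => (h_ n x)%:E).
  by apply/measurable_EFinP; exact: itg_meas (ih n).
have mS : measurable_fun setT S.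
  by apply: ge0_emeasurable_sum => // n x _ _; rewrite lee_fin.
have SM : (\int[mu]_x S x <= M%:E)%E.
  rewrite integral_nneseries//; last by move=> n x _; rewrite lee_fin.
  apply: lime_le.
    apply: is_cvg_nneseries => n _ _; apply: integral_ge0 => x _.
    by rewrite lee_fin.
  apply: nearW => n; rewrite big_mkord.
  under eq_bigr do rewrite -II_EFin//.
  by rewrite sumEFin lee_fin.
have S0 x : (0 <= S x)%E by apply: nneseries_ge0 => n _ _; rewrite lee_fin.
have iS : mu.-integrable setT S.
  apply/integrableP; split => //.
  under eq_integral do rewrite gee0_abs//.
  exact: le_lt_trans SM (ltry _).
have := integrable_ae measurableT iS; apply: filterS => x /(_ I) fS.
exists (fine (S x)) => n; rewrite -lee_fin fineK// -sumEFin.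
rewrite -(big_mkord xpredT (fun i => (h_ i x)%:E)).
by apply: nneseries_lim_ge => k _ _; rewrite lee_fin.
Qed.

Lemma ae_cvg0_fast (h_ : nat -> T -> R) (M : R) :
  (forall n, itg (h_ n)) -> (forall n x, 0 <= h_ n x) ->
  (forall n, \sum_(i < n) II (h_ i) <= M) ->
  {ae mu, forall x, h_ ^~ x @ \oo --> (0 : R)}.
Proof.
move=> ih h0 hM; have := ae_sum_bounded ih h0 hM.
apply: filterS => x [C hC].
have ns : nondecreasing_seq (series (h_ ^~ x)).
  by apply/nondecreasing_seqP => n; rewrite !seriesEnat/= big_nat_recr//= lerDl.
apply: cvg_series_cvg_0; apply: nondecreasing_is_cvgn => //.
by exists C => _ [n _ <-]; rewrite seriesEnat /= big_mkord.
Qed.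

(** A total and always measurable candidate for the pointwise limit; [fine] supplies a real value
    where the upper limit is infinite. *)
Definition lims (f_ : nat -> T -> R) x : R :=
  fine (limn_esup (fun n => (f_ n x)%:E)).

Lemma meas_lims (f_ : nat -> T -> R) :
  (forall n, measurable_fun setT (f_ n)) -> measurable_fun setT (lims f_).
Proof.
move=> mf; apply: measurableT_comp => //.
by apply: measurable_fun_limn_esup => n; apply/measurable_EFinP.
Qed.

Lemma lims_cvg (f_ : nat -> T -> R) x l : f_ ^~ x @ \oo --> l ->
  lims f_ x = l.
Proof.
move=> cx; rewrite /lims.
have /cvg_limn_einf_sup[_ ->//] : (f_ n x)%:E @[n --> \oo] --> l%:E.
by apply: cvg_EFin; [exact: nearW|exact: cx].
Qed.

(** Riesz-Fischer: a rapidly Cauchy subsequence converges almost everywhere, Fatou compares it with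
    its limit, and the Cauchy property carries the estimate to the full sequence. *)
Lemma L2_complete (f_ : nat -> T -> R) :
  (forall n, measurable_fun setT (f_ n)) ->
  (forall n, itg (fun x => f_ n x ^+ 2)) ->
  (forall e : R, 0 < e -> exists m, forall i j, (m <= i)%N -> (m <= j)%N ->
     II (fun x => (f_ i x - f_ j x) ^+ 2) <= e) ->
  exists f : T -> R, [/\ measurable_fun setT f, itg (fun x => f x ^+ 2) &
    (fun n => II (fun x => (f_ n x - f x) ^+ 2)) @ \oo --> (0 : R)].
Proof.
move=> mf i2f cf.
have i2B i j : itg (fun x => (f_ i x - f_ j x) ^+ 2) by exact: itg_sqrB.
have [phi ip hphi] : exists2 phi : nat -> nat, (forall k, (phi k < phi k.+1)%N) &
  forall k, forall j, (phi k <= j)%N ->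
   II (fun x => (f_ (phi k) x - f_ j x) ^+ 2) <= 8^-1 ^+ k.
  apply: (extract (P := fun k n => forall j, (n <= j)%N ->
    II (fun x => (f_ n x - f_ j x) ^+ 2) <= 8^-1 ^+ k)) => k m.
  have /cf[m' hm'] : 0 < 8^-1 ^+ k :> R by rewrite exprn_gt0.
  exists (maxn m m'); first exact: leq_maxl.
  by move=> j jm; apply: hm'; [exact: leq_maxr|exact: leq_trans (leq_maxr _ _) jm].
pose g k x := f_ (phi k) x.
(* The integrals are at most [4 ^+ k * 8^-1 ^+ k], hence summable, while a pointwise bound [C] on
   the sum of the [h k x] makes the increments of [g] at most [sqrt C / 2 ^+ k]. *)
pose h k x := 4 ^+ k * (g k x - g k.+1 x) ^+ 2.
have ih k : itg (h k) by exact: (itgZ (4 ^+ k) (i2B _ _)).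
have hb : {ae mu, forall x, exists C : R, forall n, \sum_(i < n) h i x <= C}.
  apply: (@ae_sum_bounded _ 2) => //.
    by move=> n x; rewrite mulr_ge0 ?sqr_ge0 ?exprn_ge0.
  move=> n; apply: le_trans (_ : \sum_(i < n) 2^-1 ^+ i <= _).
    apply: ler_sum => i _; rewrite /h IIZ//.
    apply: le_trans (_ : 4 ^+ i * 8^-1 ^+ i <= _).
      by rewrite ler_pM2l ?exprn_gt0//; apply: hphi; exact: ltnW.
    by rewrite -exprMn lerXn2r ?nnegrE//; lra.
    exact: i2B.
  exact: half_sum_le.
have cg : {ae mu, forall x, cvgn (g ^~ x)}.
  apply: filterS hb => x [C hC].
  have hle k : h k x <= C.
    apply: le_trans (hC k.+1); rewrite big_ord_recr /= lerDr sumr_ge0// => i _.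
    by rewrite mulr_ge0 ?sqr_ge0 ?exprn_ge0.
  have C0 : 0 <= C by apply: le_trans (hle 0%N); rewrite mulr_ge0 ?sqr_ge0.
  have D k : `|telescope (g ^~ x) k| <= geometric (Num.sqrt C) 2^-1 k.
    rewrite /telescope /= distrC; apply: norm_le_sqr.
      by rewrite mulr_ge0 ?sqrtr_ge0 ?exprn_ge0.
    rewrite exprMn sqr_sqrtr// -exprM mulnC exprM.
    have -> : 2^-1 ^+ 2 = 4^-1 :> R by field.
    by rewrite exprVn ler_pdivlMr ?exprn_gt0// mulrC; exact: hle.
  have : cvgn (series (telescope (g ^~ x))).
    apply: normed_cvg; apply: (series_le_cvg _ _ D) => //.
      by move=> n; rewrite mulr_ge0 ?sqrtr_ge0 ?exprn_ge0.
    apply: is_cvg_geometric_series; rewrite ger0_norm//; lra.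
  move=> /cvg_ex[l cl]; apply/cvg_ex; exists (l + g 0%N x).
  have -> : g ^~ x = (fun n => series (telescope (g ^~ x)) n + g 0%N x).
    by apply/funext => n; rewrite telescopeK subrK.
  by apply: cvgD => //; exact: cvg_cst.
pose f := lims g.
have cgf : {ae mu, forall x, g ^~ x @ \oo --> f x}.
  by apply: filterS cg => x /cvg_ex[l cl]; rewrite /f (lims_cvg cl).
have mf' : measurable_fun setT f by apply: meas_lims => n; exact: mf.
(* In the application of Fatou, [maxn k j] keeps the second index at least [k], so the bound holds
   for every [j] and not only eventually. *)
have F k : itg (fun x => (g k x - f x) ^+ 2) /\
    II (fun x => (g k x - f x) ^+ 2) <= 8^-1 ^+ k.
  apply: (@II_fatou _ _ _ _ (fun j x => (g k x - g (maxn k j) x) ^+ 2)) => //.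
  - by move=> j; exact: i2B.
  - by apply: measurable_funX; apply: measurable_funB => //; exact: mf.
  - by move=> *; exact: sqr_ge0.
  - by move=> *; exact: sqr_ge0.
  - apply: filterS cgf => x cx.
    have c' : (fun j => g (maxn k j) x) @ \oo --> f x.
      apply: cvg_eps => e /(eps_cvg cx)[m hm]; exists m => n mn.
      by apply: hm; exact: leq_trans mn (leq_maxr _ _).
    by under eq_fun do rewrite expr2; rewrite expr2; apply: cvgM;
      apply: cvgB => //; exact: cvg_cst.
  - by move=> n; apply: hphi; apply: extract_le => //; exact: leq_maxl.
exists f; split => //.
  have -> : (fun x => f x ^+ 2) = (fun x => (g 0%N x - (g 0%N x - f x)) ^+ 2).
    by apply/funext => x; congr (_ ^+ 2); ring.
  apply: itg_sqrB; [exact: mf| |exact: i2f|exact: (F 0%N).1].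
  by apply: measurable_funB => //; exact: mf.
apply: cvg_eps => e e0.
have e4 : 0 < e / 4 by rewrite divr_gt0.
have /cf[m hm] := e4.
have [k km ke] : exists2 k, (m <= k)%N & 8^-1 ^+ k <= e / 4.
  have /eps_cvg/(_ _ e4)[m' hm'] : (fun n => 8^-1 ^+ n : R) @ \oo --> (0 : R).
    by apply: cvg_expr; rewrite ger0_norm; lra.
  exists (maxn m m'); first exact: leq_maxl.
  by have := hm' _ (leq_maxr m m'); rewrite subr0; apply: le_trans; rewrite ler_norm.
exists m => n mn; rewrite subr0 ger0_norm; last by apply: II_ge0 => x; exact: sqr_ge0.
have ink := i2B n (phi k).
apply: le_trans (_ : 2 * II (fun x => (f_ n x - g k x) ^+ 2) +
                     2 * II (fun x => (g k x - f x) ^+ 2) <= _).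
  rewrite -!IIZ//; [|exact: (F k).1]; rewrite -IID; [|by apply: itgZ|by apply/itgZ/(F k).1].
  apply: (II_ge0_le _ _ _).2 => [|x|].
  - by apply: measurable_funX; apply: measurable_funB.
  - rewrite sqr_ge0 /=.
    have := sqr_ge0 ((f_ n x - g k x) - (g k x - f x)).
    have -> : f_ n x - f x = (f_ n x - g k x) + (g k x - f x) by ring.
    by rewrite sqrrB sqrrD; nra.
  - by apply: itgD; apply: itgZ => //; exact: (F k).1.
have h1 : II (fun x => (f_ n x - g k x) ^+ 2) <= e / 4.
  by apply: hm => //; exact: leq_trans km (extract_ge ip k).
have h2 := (F k).2; lra.
Qed.

Lemma II_dct0 (h_ : nat -> T -> R) (g : T -> R) :
  (forall n, measurable_fun setT (h_ n)) ->
  {ae mu, forall x, h_ ^~ x @ \oo --> (0 : R)} ->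
  (forall n x, `|h_ n x| <= g x) -> itg g ->
  (fun n => II (h_ n)) @ \oo --> (0 : R).
Proof.
move=> mh ch hg ig.
have [_] := II_dct mh (measurable_cst (0 : R)) ch hg ig.
by rewrite II_cst0.
Qed.

(** After subtraction of [eta * S_ n], the positive part of what remains is dominated by a multiple
    of [|Tt|] and tends to 0, so dominated convergence applies; the part removed has integral at
    most [eta * M]. *)
Lemma brezis_lieb (d_ S_ : nat -> T -> R) (Tt : T -> R) (M : R) :
  (forall n, measurable_fun setT (d_ n)) ->
  {ae mu, forall x, d_ ^~ x @ \oo --> (0 : R)} ->
  (forall n, itg (S_ n)) -> (forall n x, 0 <= S_ n x) ->
  (forall n, II (S_ n) <= M) -> itg Tt ->
  (forall e : R, 0 < e -> exists C : R, forall n x, `|d_ n x| <= e * S_ n x + C * Tt x) ->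
  (forall n, itg (d_ n)) /\ (fun n => II (fun x => `|d_ n x|)) @ \oo --> (0 : R).
Proof.
move=> md cd iS S0 SM iT dST.
have idn n : itg (d_ n).
  have [C hC] := dST _ (@ltr01 R).
  by apply: (itg_le (md n) (hC n)); apply: itgD; exact: itgZ.
split => //; apply: cvg_eps => e e0.
have M0 : 0 <= M by apply: le_trans (SM 0%N); exact: II_ge0.
pose eta := e / (2 * (M + 1)).
have eta0 : 0 < eta by rewrite divr_gt0// mulr_gt0//; lra.
have [C hC] := dST _ eta0.
pose W n x := Num.max (`|d_ n x| - eta * S_ n x) 0.
have mW n : measurable_fun setT (W n).
  apply: measurable_maxr => //; apply: measurable_funB.
    exact: measurableT_comp.
  by apply: measurable_funM => //; exact: itg_meas (iS n).
have WT n x : `|W n x| <= `|C * Tt x|.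
  rewrite ger0_norm ?le_max ?lexx ?orbT// ge_max normr_ge0 andbT.
  by rewrite lerBlDl (le_trans (hC n x))// lerD2l ler_norm.
have cW : {ae mu, forall x, W ^~ x @ \oo --> (0 : R)}.
  apply: filterS cd => x cx; apply: cvg_eps => e1 /(eps_cvg cx)[m hm].
  exists m => n mn; rewrite subr0 ger0_norm ?le_max ?lexx ?orbT// ge_max.
  apply/andP; split; last by apply: le_trans (hm n mn).
  apply: le_trans (_ : `|d_ n x| <= _).
    by rewrite gerBl mulr_ge0// ltW.
  by have := hm n mn; rewrite subr0.
have iC : itg (fun x => `|C * Tt x|) by apply: itg_abs; exact: itgZ.
have [_ /eps_cvg] := II_dct mW (measurable_cst _) cW WT iC.
have e2 : 0 < e / 2 by rewrite divr_gt0.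
move=> /(_ _ e2)[m hm]; exists m => n mn.
rewrite subr0 ger0_norm; last by apply: II_ge0.
have iW : itg (W n) by apply: itg_le (WT n) iC.
apply: le_trans (_ : II (W n) + eta * II (S_ n) <= _).
  rewrite -IIZ// -IID//; last exact: itgZ.
  apply: II_le; [exact: itg_abs|by apply: itgD => //; exact: itgZ|move=> x].
  by rewrite -lerBlDr le_max lexx.
have := hm n mn; rewrite /comp II_cst0 subr0 => /ler_normlW hW.
have : eta * II (S_ n) <= eta * (M + 1).
  by rewrite ler_pM2l// (le_trans (SM n))//; lra.
have -> : eta * (M + 1) = e / 2 by rewrite /eta; field; lra.
lra.
Qed.

(** Index [phi k] is chosen for the [k]-th cutoff with error [2 ^- k]. The weighted squares then
    tend to 0 almost everywhere, and at a given point the cutoffs are eventually 1. *)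
Lemma L2loc_ae_subseq (u_ : nat -> T -> R) (w : T -> R) (B : nat -> T -> R) :
  (forall n, measurable_fun setT (u_ n)) -> measurable_fun setT w ->
  (forall k, measurable_fun setT (B k)) -> (forall k x, 0 <= B k x) ->
  (forall n, itg (fun x => u_ n x ^+ 2)) -> itg (fun x => w x ^+ 2) ->
  (forall k x, B k x <= 1) ->
  (forall x, exists m, forall k, (m <= k)%N -> B k x = 1) ->
  (forall k, (fun n => II (fun x => B k x * (u_ n x - w x) ^+ 2)) @ \oo --> (0 : R)) ->
  exists2 phi : nat -> nat, (forall k, (phi k < phi k.+1)%N) &
    {ae mu, forall x, (fun k => u_ (phi k) x) @ \oo --> w x}.
Proof.
move=> mu_ mw mB B0 iu iw B1 Bex c.
have iB k n : itg (fun x => B k x * (u_ n x - w x) ^+ 2).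
  apply: (itg_le (g := fun x => (u_ n x - w x) ^+ 2)).
  - by apply: measurable_funM => //; apply: measurable_funX; exact: measurable_funB.
  - move=> x; have s0 := sqr_ge0 (u_ n x - w x).
    rewrite normrM (ger0_norm (B0 k x)) (ger0_norm s0).
    exact: ler_piMl.
  - exact: itg_sqrB.
have [phi ip hphi] : exists2 phi : nat -> nat, (forall k, (phi k < phi k.+1)%N) &
    forall k, II (fun x => B k x * (u_ (phi k) x - w x) ^+ 2) <= 2^-1 ^+ k.
  apply: (@extract (fun k n =>
    II (fun x => B k x * (u_ n x - w x) ^+ 2) <= 2^-1 ^+ k)).
  move=> k m; have k0 : 0 < 2^-1 ^+ k :> R by rewrite exprn_gt0.
  have [m' hm'] := eps_cvg (c k) k0.
  exists (maxn m m'); first exact: leq_maxl.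
  by have := hm' _ (leq_maxr m m'); rewrite subr0 => /ler_normlW.
exists phi => //.
have : {ae mu, forall x, (fun k => B k x * (u_ (phi k) x - w x) ^+ 2) @ \oo --> (0:R)}.
  apply: (@ae_cvg0_fast _ 2) => //.
    by move=> n x; rewrite mulr_ge0 ?sqr_ge0.
  move=> n; apply: le_trans (_ : \sum_(i < n) 2^-1 ^+ i <= _).
    by apply: ler_sum => i _; exact: hphi.
  exact: half_sum_le.
apply: filterS => x cx; apply: cvg_eps => e e0.
have [m hm] := Bex x.
have /(eps_cvg cx)[m' hm'] : 0 < e ^+ 2 by rewrite exprn_gt0.
exists (maxn m m') => n; rewrite geq_max => /andP[mn mn'].
have := hm' n mn'; rewrite subr0 hm// mul1r ger0_norm ?sqr_ge0//.
by apply: norm_le_sqr; exact: ltW.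
Qed.

End Complete.

(** * Lebesgue measure on tuples *)

Lemma sigma_finite_prod d1 d2 (T1 : measurableType d1) (T2 : measurableType d2)
  (R : realType) (m1 : {sigma_finite_measure set T1 -> \bar R})
  (m2 : {sigma_finite_measure set T2 -> \bar R}) : sigma_finite setT (m1 \x m2)%E.
Proof.
have /sigma_finiteP[F [TF ndF Foo]] := sigma_finiteT m1.
have /sigma_finiteP[G [TG ndG Goo]] := sigma_finiteT m2.
exists (fun n => F n `*` G n).
  apply/seteqP; split=> // -[x y] _.
  have [n _ Fx] : (\bigcup_n F n) x by rewrite -TF.
  have [k _ Gy] : (\bigcup_n G n) y by rewrite -TG.
  exists (maxn n k) => //; split => /=.
    by move: x Fx; exact/subsetPset/ndF/leq_maxl.
  by move: y Gy; exact/subsetPset/ndG/leq_maxr.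
move=> k; have [? ?] := Foo k; have [? ?] := Goo k.
split; first exact: measurableX.
by rewrite product_measure1E// lte_mul_pinfty// ge0_fin_numE.
Qed.

Section IteratedII.
Context d1 d2 (T1 : measurableType d1) (T2 : measurableType d2) (R : realType)
  (m1 : {sigma_finite_measure set T1 -> \bar R})
  (m2 : {sigma_finite_measure set T2 -> \bar R}).

Lemma measurable_sectionl (F : T1 * T2 -> R) x : measurable_fun setT F ->
  measurable_fun setT (fun y => F (x, y)).
Proof. by move=> mF; exact: (measurableT_comp mF (pair1_measurable x)). Qed.

Lemma measurable_sectionr (F : T1 * T2 -> R) y : measurable_fun setT F ->
  measurable_fun setT (fun x => F (x, y)).
Proof. by move=> mF; exact: (measurableT_comp mF (pair2_measurable y)). Qed.

(** The real integral is [fine] of the difference of the integrals of the positive and negative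
    parts, each measurable by Tonelli. Thus the sections of [F] may fail to be integrable. *)
Lemma measurable_IIl (F : T1 * T2 -> R) : measurable_fun setT F ->
  measurable_fun setT (fun x => II m2 (fun y => F (x, y))).
Proof.
move=> mF; pose P z := Num.max (F z) 0; pose Q z := Num.max (- F z) 0.
have mP : measurable_fun setT (fun z => (P z)%:E).
  by apply/measurable_EFinP; exact: measurable_maxr.
have mQ : measurable_fun setT (fun z => (Q z)%:E).
  by apply/measurable_EFinP; apply: measurable_maxr => //; exact: measurableT_comp.
have P0 z : (0 <= (P z)%:E)%E by rewrite lee_fin le_max lexx orbT.
have Q0 z : (0 <= (Q z)%:E)%E by rewrite lee_fin le_max lexx orbT.
rewrite (_ : (fun x => _) = (fun x => fine
   (fubini_F m2 (EFin \o P) x - fubini_F m2 (EFin \o Q) x)%E)); last first.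
  apply/funext => x; rewrite /II /Rintegral integralE; congr fine.
  by congr (_ - _)%E; apply: eq_integral => y _;
    rewrite ?funeposE ?funenegE /= ?EFin_max.
apply: measurableT_comp => //; apply: emeasurable_funB.
  exact: (@measurable_fun_fubini_tonelli_F _ _ _ _ _ m2 (EFin \o P)).
exact: (@measurable_fun_fubini_tonelli_F _ _ _ _ _ m2 (EFin \o Q)).
Qed.

Lemma measurable_IIr (F : T1 * T2 -> R) : measurable_fun setT F ->
  measurable_fun setT (fun y => II m1 (fun x => F (x, y))).
Proof.
move=> mF; pose P z := Num.max (F z) 0; pose Q z := Num.max (- F z) 0.
have mP : measurable_fun setT (fun z => (P z)%:E).
  by apply/measurable_EFinP; exact: measurable_maxr.
have mQ : measurable_fun setT (fun z => (Q z)%:E).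
  by apply/measurable_EFinP; apply: measurable_maxr => //; exact: measurableT_comp.
have P0 z : (0 <= (P z)%:E)%E by rewrite lee_fin le_max lexx orbT.
have Q0 z : (0 <= (Q z)%:E)%E by rewrite lee_fin le_max lexx orbT.
rewrite (_ : (fun y => _) = (fun y => fine
   (fubini_G m1 (EFin \o P) y - fubini_G m1 (EFin \o Q) y)%E)); last first.
  apply/funext => y; rewrite /II /Rintegral integralE; congr fine.
  by congr (_ - _)%E; apply: eq_integral => x _;
    rewrite ?funeposE ?funenegE /= ?EFin_max.
apply: measurableT_comp => //; apply: emeasurable_funB.
  exact: (@measurable_fun_fubini_tonelli_G _ _ _ _ _ m1 (EFin \o P)).
exact: (@measurable_fun_fubini_tonelli_G _ _ _ _ _ m1 (EFin \o Q)).
Qed.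

Lemma II_tonelli (F : T1 * T2 -> R) :
  measurable_fun setT F -> (forall z, 0 <= F z) ->
  (forall x, itg m2 (fun y => F (x, y))) -> (forall y, itg m1 (fun x => F (x, y))) ->
  itg m1 (fun x => II m2 (fun y => F (x, y))) ->
  itg m2 (fun y => II m1 (fun x => F (x, y))) /\
  II m1 (fun x => II m2 (fun y => F (x, y))) =
  II m2 (fun y => II m1 (fun x => F (x, y))).
Proof.
move=> mF F0 i2 i1 io.
have E : ((\int[m1]_x (II m2 (fun y => F (x, y)))%:E) =
          (\int[m2]_y (II m1 (fun x => F (x, y)))%:E))%E.
  under eq_integral do rewrite II_EFin//.
  under [RHS]eq_integral do rewrite II_EFin//.
  apply: (@fubini_tonelli _ _ _ _ _ m1 m2 (EFin \o F)).
    exact/measurable_EFinP.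
  by move=> z; rewrite lee_fin.
have i' : itg m2 (fun y => II m1 (fun x => F (x, y))).
  apply: itg_ge0; [exact: measurable_IIr|by move=> y; exact: II_ge0|].
  by rewrite -E -II_EFin// ltry.
by split => //; apply: EFin_inj; rewrite !II_EFin.
Qed.

(** The product majorant gives every integrability at once: of all sections, of both partial
    integrals and of [F] on the product. *)
Lemma II_fubini (F : T1 * T2 -> R) a b :
  measurable_fun setT F -> (forall x y, `|F (x, y)| <= a x * b y) ->
  itg m1 a -> itg m2 b ->
  [/\ forall x, itg m2 (fun y => F (x, y)), forall y, itg m1 (fun x => F (x, y)),
      itg m1 (fun x => II m2 (fun y => F (x, y))),
      itg m2 (fun y => II m1 (fun x => F (x, y))) &
  II m1 (fun x => II m2 (fun y => F (x, y))) =
  II m2 (fun y => II m1 (fun x => F (x, y)))].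
Proof.
move=> mF Fab ia ib.
have i2 x : itg m2 (fun y => F (x, y)).
  by apply: itg_le (Fab x) (itgZ (a x) ib); exact: measurable_sectionl.
have i1 y : itg m1 (fun x => F (x, y)).
  apply: (itg_le _ _ (itgZ (b y) ia)); first exact: measurable_sectionr.
  by move=> x; rewrite mulrC.
have o1 : itg m1 (fun x => II m2 (fun y => F (x, y))).
  apply: (@itg_le _ _ _ _ (fun x => `|II m2 b * a x|)).
  - exact: measurable_IIl.
  - move=> x; rewrite [in leRHS](_ : II m2 b * a x = II m2 (fun y => a x * b y)).
    rewrite [leRHS]ger0_norm.
      by apply: II_absle => //; [exact: itgZ|exact: measurable_sectionl].
    by apply: II_ge0 => y; apply: le_trans (Fab x y).
    by rewrite IIZ// mulrC.
  - by apply: itg_abs; exact: itgZ.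
have o2 : itg m2 (fun y => II m1 (fun x => F (x, y))).
  apply: (@itg_le _ _ _ _ (fun y => `|II m1 a * b y|)).
  - exact: measurable_IIr.
  - move=> y; rewrite [in leRHS](_ : II m1 a * b y = II m1 (fun x => b y * a x)).
    rewrite [leRHS]ger0_norm.
      apply: II_absle => //; [exact: itgZ|exact: measurable_sectionr|].
      by move=> x; rewrite mulrC.
    by apply: II_ge0 => x; rewrite mulrC; apply: le_trans (Fab x y).
    by rewrite IIZ// mulrC.
  - by apply: itg_abs; exact: itgZ.
split => //; apply: EFin_inj; rewrite !II_EFin//.
under eq_integral do rewrite II_EFin//.
under [RHS]eq_integral do rewrite II_EFin//.
apply: (@Fubini _ _ _ _ _ m1 m2 (EFin \o F)).
apply/integrable12ltyP; first exact/measurable_EFinP.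
apply: (@le_lt_trans _ _ (\int[m1]_x (`|II m2 b * a x|)%:E)%E).
  apply: ge0_le_integral => //.
  - by move=> x _; exact: integral_ge0.
  - apply: (@measurable_fun_fubini_tonelli_F _ _ _ _ _ m2
      (fun z => (`|F z|)%:E)) => //.
    by apply/measurable_EFinP; exact: measurableT_comp.
  - apply/measurable_EFinP; apply: measurableT_comp => //.
    by apply: measurable_funM => //; exact: itg_meas ia.
  move=> x _ /=; rewrite -(II_EFin (itg_abs (i2 x))) lee_fin.
  apply: le_trans (ler_norm _); rewrite mulrC -IIZ//.
  by apply: II_le; [exact: itg_abs|exact: itgZ|move=> y; exact: Fab].
by rewrite -II_EFin ?ltry//; apply: itg_abs; exact: itgZ.
Qed.

End IteratedII.

(** Reduces invariance of real integrals to nonnegative extended functions through positive and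
    negative parts; translations and the reflection of the line are both instances. *)
Lemma II_invariant d (T : measurableType d) (R : realType)
    (mu : {measure set T -> \bar R}) (phi : T -> T) :
  measurable_fun setT phi ->
  (forall h : T -> \bar R, measurable_fun setT h -> (forall x, 0 <= h x)%E ->
    \int[mu]_x h (phi x) = \int[mu]_x h x)%E ->
  forall h : T -> R, itg mu h -> itg mu (h \o phi) /\ II mu (h \o phi) = II mu h.
Proof.
move=> mphi inv h ih; have mh := itg_meas ih.
have mhp : measurable_fun setT (h \o phi) by exact: measurableT_comp.
split.
  move/integrableP : (ih) => [_ hoo]; apply/integrableP; split.
    exact/measurable_EFinP.
  rewrite /= (inv (fun x => `|(h x)%:E|)%E)//.
  by apply: measurableT_comp => //; exact/measurable_EFinP.
rewrite /II /Rintegral; congr fine; rewrite integralE [RHS]integralE.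
congr (_ - _)%E.
- rewrite -(inv (fun x => ((fun y => (h y)%:E)^\+ x)%E))//; last first.
    by apply: measurable_funepos; exact/measurable_EFinP.
  by apply: eq_integral => x _; rewrite !funeposE.
- rewrite -(inv (fun x => ((fun y => (h y)%:E)^\- x)%E))//; last first.
    by apply: measurable_funeneg; exact/measurable_EFinP.
  by apply: eq_integral => x _; rewrite !funenegE.
Qed.

(** * Lebesgue measure on tuples, built one coordinate at a time *)

Section TupleMeasure.
Variable R : realType.
Local Notation lebR := (@lebesgue_measure R).

Local Notation mR := (measurableTypeR R).

Definition constup n (p : mR * n.-tuple R) : n.+1.-tuple R := cons_tuple p.1 p.2.
Definition unconstup n (x : n.+1.-tuple R) : mR * n.-tuple R :=
  (thead x, [tuple of behead x]).

Lemma constupK n : cancel (@constup n) (@unconstup n).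
Proof.
by move=> [t y]; congr (_, _); apply/val_inj.
Qed.

Lemma meas_constup n : measurable_fun setT (@constup n).
Proof.
apply: (@measurable_cons _ _ (mR * n.-tuple R)%type R fst n snd).
  exact: (@measurable_fst _ _ mR (n.-tuple R)).
exact: measurable_snd.
Qed.

Lemma meas_unconstup n : measurable_fun setT (@unconstup n).
Proof.
apply/measurable_fun_pairP; split.
  exact: (@measurable_tnth _ R n.+1 ord0).
exact: measurable_behead.
Qed.

Section Step.
Variables (n : nat) (m : {sigma_finite_measure set (n.-tuple R) -> \bar R}).

Definition muS := pushforward (lebR \x m)%E (@constup n).

Let muS0 : muS set0 = 0%E.
Proof. by rewrite /muS /pushforward preimage_set0 measure0. Qed.

Let muS_ge0 A : (0 <= muS A)%E.
Proof. by rewrite /muS /pushforward; exact: measure_ge0. Qed.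

Let muS_sigma_additive : semi_sigma_additive muS.
Proof.
move=> F mF tF mUF; rewrite /muS /pushforward preimage_bigcup.
apply: measure_semi_sigma_additive.
- by move=> i; rewrite -[X in measurable X]setTI; exact: meas_constup.
- apply/trivIsetP => /= i j _ _ ij; rewrite -preimage_setI.
  by move/trivIsetP : tF => /(_ _ _ _ _ ij) ->//; rewrite preimage_set0.
- by rewrite -preimage_bigcup -[X in measurable X]setTI; exact: meas_constup.
Qed.

HB.instance Definition _ := isMeasure.Build _ _ _
  muS muS0 muS_ge0 muS_sigma_additive.

Let muS_sigma_finite : sigma_finite setT muS.
Proof.
have [F FT mF] := sigma_finite_prod lebR m.
exists (fun k => @unconstup n @^-1` F k).
  by apply/seteqP; split => // x _; have : setT (unconstup x) by []; rewrite FT.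
move=> k; have [mFk Fk] := mF k; split.
  by rewrite -[X in measurable X]setTI; exact: meas_unconstup.
rewrite /muS /pushforward -comp_preimage (_ : _ \o _ = id)//.
by apply/funext => x /=; rewrite constupK.
Qed.

HB.instance Definition _ := Measure_isSigmaFinite.Build _ _ _ muS muS_sigma_finite.

Lemma ge0_integral_muS (h : n.+1.-tuple R -> \bar R) :
  measurable_fun setT h -> (forall x, 0 <= h x)%E ->
  (\int[muS]_x h x = \int[lebR]_t \int[m]_y h (cons_tuple t y))%E.
Proof.
move=> mh h0.
rewrite (@ge0_integral_pushforward _ _ _ _ _ _ (@meas_constup n) (lebR \x m)%E)//.
rewrite preimage_setT fubini_tonelli1//; last by move=> x; exact: h0.
exact: measurableT_comp (@meas_constup n).
Qed.

End Step.

(** The measure behind [iintN]: general integration theory applies to it, and [iintN_muN] transfers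
    the results to the iterated integrals. On the single 0-tuple it is the unit mass. *)
Fixpoint muN n : {sigma_finite_measure set (n.-tuple R) -> \bar R} :=
  match n with
  | 0 => @dirac _ (0.-tuple R) [tuple] R
  | n'.+1 => muS (muN n')
  end.

Lemma iintN_muN n (h : n.-tuple R -> \bar R) :
  measurable_fun setT h -> (forall x, 0 <= h x)%E ->
  (iintN h = \int[muN n]_x h x)%E.
Proof.
elim: n h => [|n IH] h mh h0 /=.
  by rewrite integral_dirac// diracT mul1e.
rewrite ge0_integral_muS//; apply: eq_integral => t _; apply: IH => //.
apply: (measurableT_comp mh).
exact: (@measurable_cons _ _ _ _ (fun=> t) n id).
Qed.

Lemma iintN_EFin n (h : n.-tuple R -> R) :
  itg (muN n) h -> (forall x, 0 <= h x) ->
  (iintN (fun x => (h x)%:E) = (II (muN n) h)%:E)%E.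
Proof.
move=> ih h0; rewrite II_EFin// iintN_muN//.
by apply/measurable_EFinP; exact: itg_meas ih.
Qed.

Lemma iintN_itg n (h : n.-tuple R -> R) :
  measurable_fun setT h -> (forall x, 0 <= h x) ->
  (iintN (fun x => (h x)%:E) < +oo)%E -> itg (muN n) h.
Proof.
move=> mh h0; rewrite iintN_muN//; first exact: itg_ge0.
exact/measurable_EFinP.
Qed.

Lemma RintN_II n (h : n.-tuple R -> R) : itg (muN n) h -> RintN h = II (muN n) h.
Proof.
move=> ih; rewrite /RintN.
have mh := itg_meas ih.
have ip : itg (muN n) (fun x => Num.max (h x) 0).
  apply: (itg_le _ _ (itg_abs ih)); first exact: measurable_maxr.
  move=> x; rewrite ger0_norm ?le_max ?lexx ?orbT// ge_max normr_ge0 andbT.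
  exact: ler_norm.
have im : itg (muN n) (fun x => Num.max (- h x) 0).
  apply: (itg_le _ _ (itg_abs ih)).
    by apply: measurable_maxr => //; exact: measurableT_comp.
  move=> x; rewrite ger0_norm ?le_max ?lexx ?orbT// ge_max normr_ge0 andbT.
  by rewrite -normrN ler_norm.
rewrite !iintN_EFin//=; [|by move=> x; rewrite le_max lexx orbT..].
rewrite -IIB//; apply: eq_II => x.
by case: (lerP (h x) 0) => hx; case: (lerP (- h x) 0) => hx'; lra.
Qed.

(** By uniqueness of Lebesgue measure it is enough to compare the image measure on half-open
    intervals. *)
Lemma lebesgue_measure_translation (a : R) (A : set R) : measurable A ->
  pushforward lebR (fun t : mR => t + a : mR) A = lebR A.
Proof.
move=> mA; apply/esym/lebesgue_measure_unique => //=.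
  exact: measurable_funD.
move=> mf _ [[x y]] _ <- /=.
rewrite /pushforward (_ : _ @^-1` _ = `]x - a, y - a]%classic).
  rewrite !lebesgue_measure_itv /= !lte_fin ltrD2r.
  by case: ifPn => //= _; congr EFin; ring.
by apply/seteqP; split => t /=; rewrite !in_itv /= ltrBlDr lerBrDr.
Qed.

Lemma ge0_integral_translation (a : R) (h : R -> \bar R) :
  measurable_fun setT h -> (forall t, 0 <= h t)%E ->
  (\int[lebR]_t h (t + a)%R = \int[lebR]_t h t)%E.
Proof.
move=> mh h0.
have mt : measurable_fun setT (fun t : mR => t + a : mR).
  exact: measurable_funD.
rewrite -[LHS](@ge0_integral_pushforward _ _ _ _ _ _ mt lebR setT h)//.
by apply: eq_measure_integral => A mA _; exact: lebesgue_measure_translation.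
Qed.

Definition addT n (x y : n.-tuple R) : n.-tuple R :=
  [tuple tnth x i + tnth y i | i < n].
Definition oppT n (x : n.-tuple R) : n.-tuple R := [tuple - tnth x i | i < n].

Lemma addT_cons n (t s : R) (x y : n.-tuple R) :
  addT (cons_tuple t x) (cons_tuple s y) = cons_tuple (t + s) (addT x y).
Proof.
apply: eq_from_tnth => i; rewrite tnth_mktuple.
case: (unliftP ord0 i) => [j ->|->]; last by [].
by rewrite !tnthS tnth_mktuple.
Qed.

Lemma meas_tnth n (i : 'I_n) : measurable_fun setT (fun x : n.-tuple R => tnth x i).
Proof. exact: measurable_tnth. Qed.

Lemma meas_mktuple d (T : measurableType d) n (F : T -> 'I_n -> R) :
  (forall i, measurable_fun setT (fun x => F x i)) ->
  measurable_fun setT (fun x => [tuple F x i | i < n]).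
Proof.
move=> H; apply/measurable_fun_tnthP => i.
rewrite (_ : _ \o _ = (fun x => F x i)); first exact: H.
by apply/funext => x /=; rewrite tnth_mktuple.
Qed.

Lemma meas_addT d (T : measurableType d) n (f g : T -> n.-tuple R) :
  measurable_fun setT f -> measurable_fun setT g ->
  measurable_fun setT (fun x => addT (f x) (g x)).
Proof.
move=> mf mg; apply: meas_mktuple => i; apply: measurable_funD.
  exact: (measurableT_comp (@meas_tnth n i) mf).
exact: (measurableT_comp (@meas_tnth n i) mg).
Qed.

Lemma ge0_muN_translation n (a : n.-tuple R) (h : n.-tuple R -> \bar R) :
  measurable_fun setT h -> (forall x, 0 <= h x)%E ->
  (\int[muN n]_x h (addT x a) = \int[muN n]_x h x)%E.
Proof.
elim: n a h => [|n IH] a h mh h0.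
  by congr (integral _ _ _); apply/funext => x; rewrite (tuple0 (addT x a)) (tuple0 x).
have ma : measurable_fun setT (fun x => h (addT x a)).
  by apply: (measurableT_comp mh); apply: meas_addT.
rewrite /= !ge0_integral_muS//; case/tupleP: a ma => a0 a ma.
have mh2 : measurable_fun setT (h \o @constup n).
  exact: measurableT_comp (@meas_constup n).
transitivity (\int[lebR]_t \int[muN n]_y h (cons_tuple (t + a0)%R y))%E.
  apply: eq_integral => t _.
  under eq_integral do rewrite addT_cons.
  apply: (IH a (fun y => h (cons_tuple (t + a0) y))) => //.
  apply: (measurableT_comp mh).
  exact: (@measurable_cons _ _ _ _ (fun=> t + a0) n id).
pose H t := (\int[muN n]_y h (cons_tuple t y))%E.
have mH : measurable_fun setT (H : mR -> _).
  apply: (@measurable_fun_fubini_tonelli_F _ _ mR _ _ (muN n) (h \o @constup n)) => //.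
  by move=> x; exact: h0.
by apply: (@ge0_integral_translation a0 H) => // t; exact: integral_ge0.
Qed.

Lemma ge0_muN_prod n (g : 'I_n -> R -> \bar R) :
  (forall i, measurable_fun setT (g i)) -> (forall i t, 0 <= g i t)%E ->
  (\int[muN n]_x \prod_(i < n) g i (tnth x i) =
   \prod_(i < n) \int[lebR]_t g i t)%E.
Proof.
elim: n g => [|n IH] g mg g0.
  under eq_integral do rewrite big_ord0.
  by rewrite big_ord0 integral_dirac// diracT mul1e.
have mp m (gg : 'I_m -> R -> \bar R) : (forall i, measurable_fun setT (gg i)) ->
   measurable_fun setT (fun x : m.-tuple R => (\prod_(i < m) gg i (tnth x i))%E).
  move=> mgg; elim: m gg mgg => [|m IHm] gg mgg.
    by under eq_fun do rewrite big_ord0; exact: measurable_cst.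
  under eq_fun do rewrite big_ord_recl.
  apply: emeasurable_funM; first exact: measurableT_comp (mgg _) (meas_tnth _).
  rewrite (_ : (fun _ => _) =
    (fun y : m.-tuple R => \prod_(i < m) gg (lift ord0 i) (tnth y i))%E \o
    (fun x : m.+1.-tuple R => [tuple of behead x])); last first.
    by apply/funext => x /=; apply: eq_bigr => i _; rewrite [in LHS](tuple_eta x) tnthS.
  apply: measurableT_comp; last exact: measurable_behead.
  exact: (IHm (fun i => gg (lift ord0 i))).
have pp m (gg : 'I_m -> \bar R) : (forall i, 0 <= gg i)%E ->
    (0 <= \prod_(i < m) gg i)%E.
  by move=> ?; apply: prode_ge0.
rewrite ge0_integral_muS; [|exact: mp|by move=> x; exact: pp].
rewrite big_ord_recl -IH//.
set C := (\int[muN n]_x _)%E.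
transitivity (\int[lebR]_t (g ord0 t * C))%E.
  apply: eq_integral => t _.
  rewrite -ge0_integralZl//; last 2 first.
  - exact: (mp _ (fun i => g (lift ord0 i))).
  - by move=> x _; exact: pp.
  by apply: eq_integral => y _; rewrite big_ord_recl; congr (_ * _)%E;
    apply: eq_bigr => i _; rewrite tnthS.
rewrite ge0_integralZr//; first exact: mg.
by apply: integral_ge0 => x _; exact: pp.
Qed.

Lemma itg_shift n (a : n.-tuple R) (h : n.-tuple R -> R) :
  itg (muN n) h -> itg (muN n) (fun x => h (addT x a)).
Proof.
move=> ih; apply: (II_invariant _ _ ih).1; first exact: meas_addT.
exact: ge0_muN_translation.
Qed.

Lemma II_shift n (a : n.-tuple R) (h : n.-tuple R -> R) :
  itg (muN n) h -> II (muN n) (fun x => h (addT x a)) = II (muN n) h.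
Proof.
move=> ih; apply: (II_invariant _ _ ih).2; first exact: meas_addT.
exact: ge0_muN_translation.
Qed.

Lemma addTC n (x y : n.-tuple R) : addT x y = addT y x.
Proof. by apply: eq_from_tnth => i; rewrite !tnth_mktuple addrC. Qed.

Lemma addTA n (x y z : n.-tuple R) : addT x (addT y z) = addT (addT x y) z.
Proof. by apply: eq_from_tnth => i; rewrite !tnth_mktuple addrA. Qed.

Lemma addTK n (x y : n.-tuple R) : addT (addT x y) (oppT y) = x.
Proof. by apply: eq_from_tnth => i; rewrite !tnth_mktuple addrK. Qed.

Lemma addTNK n (x y : n.-tuple R) : addT (addT x (oppT y)) y = x.
Proof. by apply: eq_from_tnth => i; rewrite !tnth_mktuple subrK. Qed.

Lemma dotN_addl n (x y z : n.-tuple R) : dotN (addT x y) z = dotN x z + dotN y z.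
Proof.
by rewrite /dotN -big_split /=; apply: eq_bigr => i _; rewrite tnth_mktuple mulrDl.
Qed.

Lemma dotN_oppl n (x z : n.-tuple R) : dotN (oppT x) z = - dotN x z.
Proof.
by rewrite /dotN -sumrN; apply: eq_bigr => i _; rewrite tnth_mktuple mulNr.
Qed.

Lemma dotNC n (x y : n.-tuple R) : dotN x y = dotN y x.
Proof. by apply: eq_bigr => i _; rewrite mulrC. Qed.

Lemma meas_dotN d (T : measurableType d) n (f g : T -> n.-tuple R) :
  measurable_fun setT f -> measurable_fun setT g ->
  measurable_fun setT (fun x => dotN (f x) (g x)).
Proof.
move=> mf mg; apply: measurable_sum => i; apply: measurable_funM.
  exact: (measurableT_comp (@meas_tnth n i) mf).
exact: (measurableT_comp (@meas_tnth n i) mg).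
Qed.

Lemma meas_euclN n : measurable_fun setT (@euclN R n).
Proof.
apply: (@measurableT_comp _ _ _ _ _ _ (@Num.sqrt R)); last exact: meas_dotN.
by apply: continuous_measurable_fun; exact: sqrt_continuous.
Qed.

Lemma muN_prodR n (g : 'I_n -> R -> R) :
  (forall i, itg lebR (g i)) -> (forall i t, 0 <= g i t) ->
  itg (muN n) (fun x => \prod_(i < n) g i (tnth x i)) /\
  II (muN n) (fun x => \prod_(i < n) g i (tnth x i)) =
  \prod_(i < n) II lebR (g i).
Proof.
move=> ig g0.
have mg i : measurable_fun setT (EFin \o g i).
  by apply/measurable_EFinP; exact: (itg_meas (ig i)).
have E := @ge0_muN_prod n (fun i => EFin \o g i) mg (fun i t => g0 i t).
have E2 : (\prod_(i < n) \int[lebR]_t (g i t)%:E = (\prod_(i < n) II lebR (g i))%:E)%E.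
  under eq_bigr do rewrite -II_EFin//.
  by rewrite prodEFin.
have i1 : itg (muN n) (fun x => \prod_(i < n) g i (tnth x i)).
  apply: itg_ge0.
  - apply: measurable_prod => i _.
    by apply: (@measurableT_comp _ _ _ _ _ _ (g i)); [exact: itg_meas (ig i)|exact: meas_tnth].
  - by move=> x; apply: prodr_ge0.
  - under eq_integral do rewrite -prodEFin.
    by rewrite E E2 ltry.
split => //; apply: EFin_inj; rewrite II_EFin// -E2 -E.
by apply: eq_integral => x _; rewrite prodEFin.
Qed.

End TupleMeasure.

(** * Continuity of translations *)

Section Scaling.
Variable R : realType.
Local Notation lebR := (@lebesgue_measure R).
Local Notation mR := (measurableTypeR R).

Lemma lebesgue_measure_scale (e : R) (A : set R) : 0 < e -> measurable A ->
  (lebR A = e%:E * pushforward lebR (fun t : mR => (e * t)%R : mR) A)%E.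
Proof.
move=> e0 mA.
have mt : measurable_fun setT (fun t : mR => e * t : mR) by exact: mulrl_measurable.
pose en : {nonneg R} := NngNum (ltW e0).
pose pm : {measure set mR -> \bar R} :=
  measure_function_pushforward__canonical__measure_function_Measure lebR mt.
rewrite -[RHS]/(mscale en pm A).
apply: lebesgue_measure_unique => // _ [[x y]] _ <- /=.
rewrite /mscale /= /pushforward (_ : _ @^-1` _ = `]x / e, y / e]%classic).
  rewrite !lebesgue_measure_itv /= !lte_fin ltr_pM2r ?invr_gt0//.
  case: ifPn => //= _; last by rewrite mule0.
  by rewrite -!EFinB -EFinM; congr EFin; field; rewrite gt_eqF.
by apply/seteqP; split => t /=; rewrite !in_itv /= ltr_pdivrMr// ler_pdivlMr// ![e * _]mulrC.
Qed.

Lemma ge0_integral_scale (e : R) (h : R -> \bar R) : 0 < e ->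
  measurable_fun setT h -> (forall t, 0 <= h t)%E ->
  (\int[lebR]_t h t = e%:E * \int[lebR]_t h (e * t)%R)%E.
Proof.
move=> e0 mh h0.
have mt : measurable_fun setT (fun t : mR => e * t : mR) by exact: mulrl_measurable.
pose en : {nonneg R} := NngNum (ltW e0).
pose pm : {measure set mR -> \bar R} :=
  measure_function_pushforward__canonical__measure_function_Measure lebR mt.
rewrite -[X in (_ * X)%E](@ge0_integral_pushforward _ _ _ _ _ _ mt lebR setT h)//.
rewrite -[RHS](ge0_integral_mscale pm measurableT en)//.
apply: eq_measure_integral => A mA _ /=.
by rewrite (lebesgue_measure_scale e0 mA).
Qed.

Definition scaleT n (e : R) (x : n.-tuple R) : n.-tuple R :=
  [tuple e * tnth x i | i < n].

Lemma meas_scaleT n (e : R) : measurable_fun setT (@scaleT n e).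
Proof.
apply: meas_mktuple => i; apply: measurable_funM => //; exact: meas_tnth.
Qed.

Lemma ge0_muN_scale n (e : R) (h : n.-tuple R -> \bar R) : 0 < e ->
  measurable_fun setT h -> (forall x, 0 <= h x)%E ->
  (\int[muN R n]_x h x = (e ^+ n)%:E * \int[muN R n]_x h (scaleT e x))%E.
Proof.
move=> e0; elim: n h => [|n IH] h mh h0.
  rewrite expr0 mul1e.
  by congr (integral _ _ _); apply/funext => x; rewrite (tuple0 (scaleT e x)) (tuple0 x).
have ma : measurable_fun setT (fun x => h (scaleT e x)).
  by apply: (measurableT_comp mh); exact: meas_scaleT.
have sc (t : R) (y : n.-tuple R) :
    scaleT e (cons_tuple t y) = cons_tuple (e * t) (scaleT e y).
  apply: eq_from_tnth => i; rewrite tnth_mktuple.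
  case: (unliftP ord0 i) => [j ->|->]; last by [].
  by rewrite !tnthS tnth_mktuple.
rewrite /= !ge0_integral_muS//.
pose H t := (\int[muN R n]_y h (cons_tuple t y))%E.
have mH : measurable_fun setT (H : mR -> _).
  apply: (@measurable_fun_fubini_tonelli_F _ _ mR _ _ (muN R n) (h \o @constup R n)).
    exact: measurableT_comp (@meas_constup R n).
  by move=> x; exact: h0.
have H0 t : (0 <= H t)%E by exact: integral_ge0.
pose H2 (t : mR) := (\int[muN R n]_y h (scaleT e (cons_tuple t y)))%E.
have H2E t : H (e * t) = ((e ^+ n)%:E * H2 t)%E.
  rewrite /H IH//; last first.
    apply: (measurableT_comp mh).
    exact: (@measurable_cons _ _ _ _ (fun=> e * t) n id).
  by congr (_ * _)%E; apply: eq_integral => y _; rewrite sc.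
have mH2 : measurable_fun setT H2.
  apply: (@measurable_fun_fubini_tonelli_F _ _ mR _ _ (muN R n)
    ((fun x => h (scaleT e x)) \o @constup R n)).
    exact: measurableT_comp (@meas_constup R n).
  by move=> x; exact: h0.
rewrite (@ge0_integral_scale e H)// exprS EFinM -muleA; congr (_ * _)%E.
rewrite -ge0_integralZl//; last 2 first.
- by move=> t _; exact: integral_ge0.
- by rewrite lee_fin exprn_ge0// ltW.
by apply: eq_integral => t _; rewrite H2E.
Qed.

Lemma II_scale n (e : R) (h : n.-tuple R -> R) : 0 < e -> (forall x, 0 <= h x) ->
  itg (muN R n) h ->
  itg (muN R n) (fun x => h (scaleT e x)) /\
  II (muN R n) h = e ^+ n * II (muN R n) (fun x => h (scaleT e x)).
Proof.
move=> e0 h0 ih.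
have mh := itg_meas ih.
have E := @ge0_muN_scale n e (EFin \o h) e0 _ (fun x => h0 x).
have {}E := E (iffRL (measurable_EFinP _ _) mh).
have en : 0 < e ^+ n by rewrite exprn_gt0.
have i1 : itg (muN R n) (fun x => h (scaleT e x)).
  apply: itg_ge0 => //; first exact: measurableT_comp mh (@meas_scaleT n e).
  rewrite ltey; apply/eqP => Eoo; move: E; rewrite /= Eoo.
  by rewrite -II_EFin// gt0_muley ?lte_fin.
split => //; apply: EFin_inj; rewrite II_EFin//.
by move: E => /= ->; rewrite -II_EFin// -EFinM.
Qed.

End Scaling.

(** The map [a -> a * |a|] sends L2 into L1; the inequality brings L1 estimates of [v * |v|] back to
    L2 estimates of [v]. *)
Lemma sqr_dist_le (R : realType) (a b : R) :
  (a - b) ^+ 2 <= 2 * `|a * `|a| - b * `|b| |.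
Proof.
have := ler_norm (a * `|a| - b * `|b|); have := ler_norm (- (a * `|a| - b * `|b|)).
rewrite normrN; move: (`|a * `|a| - b * `|b| | : R) => q.
case: (ger0P a) => a0; case: (ger0P b) => b0 q1 q2.
- by case: (lerP a b) => ab; nra.
- by have := sqr_ge0 (a + b); nra.
- by have := sqr_ge0 (a + b); nra.
- by case: (lerP a b) => ab; nra.
Qed.

Import HBNNSimple.

(** * Continuity of translations in L1, then in L2 *)

Section TranslationContinuity.
Variables (R : realType) (N : nat).
Local Notation T := (N.-tuple R).
Local Notation mu := (muN R N).
Local Notation lebR := (@lebesgue_measure R).
Implicit Types f g : T -> R.

Definition to0 (h : nat -> T) := forall i, (fun n => tnth (h n) i) @ \oo --> (0 : R).

(** The class of integrable functions along which translations are continuous. It is stable under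
    linear combinations, lattice operations and L1 limits, and is shown to contain every integrable
    function by a sigma-algebra argument, without density of continuous functions. *)
Definition TC f := itg mu f /\ forall h, to0 h ->
  (fun n => II mu (fun x => `|f (addT x (h n)) - f x|)) @ \oo --> (0 : R).

Lemma itg_dist f a : itg mu f -> itg mu (fun x => `|f (addT x a) - f x|).
Proof. by move=> fi; apply: itg_abs; apply: itgB => //; exact: itg_shift. Qed.

Lemma TC_comb f g (a b : R) : TC f -> TC g -> TC (fun x => a * f x + b * g x).
Proof.
move=> [fi cf] [ig cg]; split; first by apply: itgD; exact: itgZ.
move=> h h0.
have L : (fun n => `|a| * II mu (fun x => `|f (addT x (h n)) - f x|) +
    `|b| * II mu (fun x => `|g (addT x (h n)) - g x|)) @ \oo --> (0 : R).
  have -> : 0 = `|a| * 0 + `|b| * 0 :> R by rewrite !mulr0 addr0.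
  by apply: cvgD; apply: cvgM; [exact: cvg_cst|exact: cf|exact: cvg_cst|exact: cg].
apply: (@squeeze_cvgr _ _ _ _ (fun=> 0) _ _ _ _ _ L); last exact: cvg_cst.
apply: nearW => n; rewrite II_ge0//=.
rewrite -!IIZ; [|exact: itg_dist..]; rewrite -IID; [|by apply: itgZ; exact: itg_dist..].
apply: II_le.
- by apply: (@itg_dist (fun x => a * f x + b * g x)); apply: itgD; exact: itgZ.
- by apply: itgD; apply: itgZ; exact: itg_dist.
move=> x; rewrite -!normrM.
by apply: le_trans (ler_normD _ _); rewrite le_eqVlt; apply/orP; left; apply/eqP; congr `|_|; ring.
Qed.

(** From [|min a c - min b d| <= |a - b| + |c - d|]. Lattice operations are what turns the class of
    admissible sets into one stable under unions. *)
Lemma TC_min f g : TC f -> TC g -> TC (fun x => Num.min (f x) (g x)).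
Proof.
move=> [fi cf] [ig cg].
have im : itg mu (fun x => Num.min (f x) (g x)).
  apply: (@itg_le _ _ _ _ (fun x => `|f x| + `|g x|)).
  - by apply: measurable_minr; [exact: itg_meas fi|exact: itg_meas ig].
  - by move=> x; rewrite minElt; case: ifP => _; rewrite ?lerDl ?lerDr normr_ge0.
  - by apply: itgD; exact: itg_abs.
split => // h h0.
have L : (fun n => II mu (fun x => `|f (addT x (h n)) - f x|) +
    II mu (fun x => `|g (addT x (h n)) - g x|)) @ \oo --> (0 : R).
  by rewrite -[X in _ --> X](addr0 0); apply: cvgD; [exact: cf|exact: cg].
apply: (@squeeze_cvgr _ _ _ _ (fun=> 0) _ _ _ _ _ L); last exact: cvg_cst.
apply: nearW => n; rewrite II_ge0//= -IID; [|exact: itg_dist..].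
apply: II_le.
- exact: (@itg_dist (fun x => Num.min (f x) (g x))).
- by apply: itgD; exact: itg_dist.
move=> x; move: (f _) (f x) (g _) (g x) => a b c d.
have := ler_norm (a - b); have := ler_norm (c - d).
have := ler_norm (- (a - b)); have := ler_norm (- (c - d)); rewrite !normrN.
by rewrite ler_norml; case: (leP a c) => ?; case: (leP b d) => ? *; apply/andP; split; lra.
Qed.

Lemma TC_lim (f_ : nat -> T -> R) f : (forall k, TC (f_ k)) -> itg mu f ->
  (fun k => II mu (fun x => `|f_ k x - f x|)) @ \oo --> (0 : R) -> TC f.
Proof.
move=> Tf fi cf; split => // h h0; apply: cvg_eps => e e0.
have e3 : 0 < e / 3 by rewrite divr_gt0.
have [k hk] := eps_cvg cf e3; have {hk} := hk k (leqnn _).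
rewrite subr0 => /ler_normlW hk.
have [ik ck] := Tf k; have [m hm] := eps_cvg (ck h h0) e3.
exists m => n mn; have := hm n mn; rewrite !subr0 => /ler_normlW hn.
rewrite ger0_norm ?II_ge0//.
have idk : itg mu (fun x => `|f_ k x - f x|) by apply: itg_abs; exact: itgB.
have idk' := itg_shift (h n) idk.
apply: le_trans (_ : II mu (fun x => `|f_ k (addT x (h n)) - f (addT x (h n))| +
   (`|f_ k (addT x (h n)) - f_ k x| + `|f_ k x - f x|)) <= _).
  apply: II_le; [exact: itg_dist|by apply: itgD => //; apply: itgD => //; exact: itg_dist|].
  move=> x; rewrite (_ : f (addT x (h n)) - f x =
   - (f_ k (addT x (h n)) - f (addT x (h n))) +
   ((f_ k (addT x (h n)) - f_ k x) + (f_ k x - f x))); last by ring.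
  apply: le_trans (ler_normD _ _) _; rewrite normrN lerD2l; exact: ler_normD.
rewrite IID//; last by apply: itgD => //; exact: itg_dist.
rewrite (IID (itg_dist _ ik) idk) (II_shift (h n) idk); lra.
Qed.

Lemma TC_max f g : TC f -> TC g -> TC (fun x => Num.max (f x) (g x)).
Proof.
move=> Tf Tg.
have H0 := TC_min (TC_comb (-1) 0 Tf Tg) (TC_comb 0 (-1) Tf Tg).
have := TC_comb (-1) 0 H0 Tf; congr TC; apply/funext => x.
by rewrite mul0r addr0 !mul0r add0r addr0 !mulN1r oppr_min !opprK.
Qed.

(** A positive integrable weight, which makes the indicator of any measurable set integrable. After
    dilation it is also the Fourier multiplier that approximates 1. *)
Definition wexp (x : T) : R := \prod_(i < N) expR (- `|tnth x i|).

Lemma II_neg1 (h : R -> R) : itg lebR h ->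
  itg lebR (h \o -%R) /\ II lebR (h \o -%R) = II lebR h.
Proof.
have mt : measurable_fun setT (-%R : measurableTypeR R -> measurableTypeR R).
  exact: oppr_measurable.
apply: (@II_invariant _ _ _ lebR _ mt) => H mH H0.
rewrite -[LHS](@ge0_integral_pushforward _ _ _ _ _ _ mt lebR setT H)//.
by apply: eq_measure_integral => A mA _; exact: lebesgue_measureN.
Qed.

(** Dominated by the exponential density plus its reflection. *)
Lemma itg_exp_abs : itg lebR (fun t => expR (- `|t|)).
Proof.
have i1 : itg lebR (exponential_pdf 1) by exact: integrable_exponential_pdf.
have [i2 _] := II_neg1 i1.
have c : measurable_fun setT (fun t : R => expR (- `|t|)).
  apply: measurableT_comp => //; apply: measurableT_comp => //.
apply: (@itg_le _ (measurableTypeR R) R lebR _ _ c _ (itgD i1 i2)) => t /=.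
rewrite ger0_norm ?expR_ge0//.
have p0 (z : R) : 0 <= exponential_pdf 1 z by exact: exponential_pdf_ge0.
have [t0|t0] := lerP 0 t.
  by rewrite (exponential_pdfE _ t0) mul1r mulN1r (ger0_norm t0) lerDl.
have t0' : 0 <= - t by rewrite oppr_ge0 ltW.
rewrite (exponential_pdfE _ t0').
by rewrite mul1r mulN1r (ltr0_norm t0) lerDr.
Qed.

Lemma wexp_gt0 x : 0 < wexp x.
Proof. by apply: prodr_gt0 => i _; exact: expR_gt0. Qed.

Lemma itg_wexp : itg mu wexp.
Proof.
by apply: (@muN_prodR R N (fun=> fun t => expR (- `|t|)) _ _).1 => [i|i t];
  [exact: itg_exp_abs|exact: expR_ge0].
Qed.

Lemma cvg_prod_ord n (u : 'I_n -> nat -> R) (l : 'I_n -> R) :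
  (forall i, u i @ \oo --> l i) ->
  (fun k => \prod_(i < n) u i k) @ \oo --> \prod_(i < n) l i.
Proof.
elim: n u l => [|n IH] u l c.
  by under eq_fun do rewrite big_ord0; rewrite big_ord0; exact: cvg_cst.
under eq_fun do rewrite big_ord_recl.
by rewrite big_ord_recl; apply: cvgM => //; exact: (IH (fun i => u (lift ord0 i))).
Qed.

Lemma cvg_addT_tnth x h i : to0 h ->
  (fun n => tnth (addT x (h n)) i) @ \oo --> tnth x i.
Proof.
move=> h0; apply: cvg_eps => e e0; have [m hm] := eps_cvg (h0 i) e0.
exists m => n mn; have := hm n mn; rewrite subr0 tnth_mktuple.
by rewrite addrC addKr.
Qed.

Lemma cvg_minr (u v : nat -> R) (a b : R) : u @ \oo --> a -> v @ \oo --> b ->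
  (fun n => Num.min (u n) (v n)) @ \oo --> Num.min a b.
Proof.
move=> ua vb; under eq_fun do rewrite minr_absE; rewrite minr_absE.
apply: cvgM; last exact: cvg_cst.
by apply: cvgB; [exact: cvgD|apply: cvg_norm; exact: cvgB].
Qed.

Lemma cvg_maxr (u v : nat -> R) (a b : R) : u @ \oo --> a -> v @ \oo --> b ->
  (fun n => Num.max (u n) (v n)) @ \oo --> Num.max a b.
Proof.
move=> ua vb; under eq_fun do rewrite maxr_absE; rewrite maxr_absE.
apply: cvgM; last exact: cvg_cst.
by apply: cvgD; [exact: cvgD|apply: cvg_norm; exact: cvgB].
Qed.

Lemma to0_le1 h : to0 h -> exists m, forall n, (m <= n)%N -> forall i, `|tnth (h n) i| <= 1.
Proof.
move=> h0.
have /choice[m hm] : forall i, exists m, forall n, (m <= n)%N -> `|tnth (h n) i| <= 1.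
  move=> i; have [m hm] := eps_cvg (h0 i) ltr01; exists m => n mn.
  by have := hm n mn; rewrite subr0.
exists (\max_(i < N) m i) => n mn i; apply: hm.
by apply: leq_trans mn; exact: leq_bigmax.
Qed.

(** Provides one integrable majorant for all small translates of [wexp], as dominated convergence
    requires. *)
Lemma wexp_shift x (a : T) : (forall i, `|tnth a i| <= 1) ->
  wexp (addT x a) <= expR 1 ^+ N * wexp x.
Proof.
move=> a1; rewrite /wexp -[X in _ ^+ X](card_ord N) -prodr_const -big_split /=.
apply: ler_prod => i _; rewrite expR_ge0 /= tnth_mktuple -expRD ler_expR.
have := ler_normB (tnth x i + tnth a i) (tnth a i); rewrite addrK.
by have := a1 i; lra.
Qed.

Lemma TC_wexp (phi : T -> R) : measurable_fun setT phi -> (forall x, `|phi x| <= 1) ->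
  (forall x h, to0 h -> (fun n => phi (addT x (h n))) @ \oo --> phi x) ->
  TC (fun x => phi x * wexp x).
Proof.
move=> mphi p1 cphi.
have ipw : itg mu (fun x => phi x * wexp x).
  have := itg_bound itg_wexp mphi p1.
  by congr itg; apply/funext => x; rewrite mulrC.
split => // h h0; have [m hm] := to0_le1 h0.
rewrite -(cvg_shiftn m).
have sf n : itg mu (fun x => `|phi (addT x (h (n + m)%N)) * wexp (addT x (h (n + m)%N))
   - phi x * wexp x|) := itg_dist (h (n + m)%N) ipw.
apply: (II_dct0 (g := fun x => (expR 1 ^+ N + 1) * wexp x)).
- by move=> n; exact: itg_meas (sf n).
- apply: aeW => x; rewrite -(normr0 R) -(subrr (phi x * wexp x)).
  apply: cvg_norm; apply: cvgB; last exact: cvg_cst.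
  apply: cvgM.
    by rewrite (cvg_shiftn m (fun n => phi (addT x (h n)))); exact: cphi.
  rewrite (cvg_shiftn m (fun n => wexp (addT x (h n)))).
  apply: cvg_prod_ord => i.
  apply: (@cvg_comp _ _ _ _ expR); last exact: continuous_expR.
  apply: cvgN; apply: cvg_norm.
  exact: cvg_addT_tnth.
- move=> n x; rewrite normr_id mulrDl mul1r; apply: le_trans (ler_normB _ _) _.
  rewrite !normrM !(ger0_norm (ltW (wexp_gt0 _))); apply: lerD.
    apply: le_trans (_ : 1 * wexp (addT x (h (n + m)%N)) <= _).
      by rewrite ler_wpM2r// ltW// wexp_gt0.
    by rewrite mul1r; apply: wexp_shift => i; apply: hm; exact: leq_addl.
  by rewrite -[leRHS]mul1r ler_wpM2r// ltW// wexp_gt0.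
- by apply: itgZ; exact: itg_wexp.
Qed.

Definition TCset (A : set T) := TC (fun x => \1_A x * wexp x).

Lemma TCset_setT : TCset setT.
Proof.
have := @TC_wexp (fun=> 1) (measurable_cst _); rewrite /TCset.
move=> /(_ _ _); rewrite (_ : (fun x => 1 * wexp x) = (fun x => \1_setT x * wexp x)).
  by apply => // [x|x h _]; [rewrite normr1|exact: cvg_cst].
by apply/funext => x; rewrite indicT.
Qed.

Lemma TCset_lim (A_ : nat -> set T) A : (forall k, TCset (A_ k)) ->
  (forall x, (fun k => \1_(A_ k) x) @ \oo --> (\1_A x : R)) -> TCset A.
Proof.
move=> TA cA.
have mA k : measurable_fun setT (fun x => \1_(A_ k) x * wexp x).
  exact: itg_meas (TA k).1.
have cw x : (fun k => \1_(A_ k) x * wexp x) @ \oo --> (\1_A x : R) * wexp x.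
  by apply: cvgM => //; exact: cvg_cst.
have mAl : measurable_fun setT (fun x => \1_A x * wexp x).
  by apply: measurable_fun_cvg mA _ => x _; exact: cw.
have dom (B : set T) x : `|\1_B x * wexp x| <= wexp x.
  rewrite normrM (ger0_norm (ltW (wexp_gt0 x))) -[leRHS]mul1r ler_wpM2r//.
    by rewrite ltW// wexp_gt0.
  by rewrite indicE; case: (_ \in _); rewrite ?normr1 ?normr0.
have iAl : itg mu (fun x => \1_A x * wexp x) by apply: itg_le (dom A) itg_wexp.
have iA_ k : itg mu (fun x => \1_(A_ k) x * wexp x) := (TA k).1.
apply: (TC_lim TA iAl).
apply: (II_dct0 (g := fun x => 2 * wexp x)).
- by move=> n; exact: itg_meas (itg_abs (itgB (iA_ n) iAl)).
- apply: aeW => x; rewrite -(normr0 R) -(subrr (\1_A x * wexp x)).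
  by apply: cvg_norm; apply: cvgB => //; exact: cvg_cst.
- move=> n x; rewrite normr_id; apply: le_trans (ler_normB _ _) _.
  by have := dom (A_ n) x; have := dom A x; lra.
- by apply: itgZ; exact: itg_wexp.
Qed.

Lemma TCsetC A : TCset A -> TCset (~` A).
Proof.
move=> TA; have := TC_comb 1 (-1) TCset_setT TA; congr TC; apply/funext => x.
by rewrite indicT !indicE in_setC; case: (x \in A) => /=; ring.
Qed.

Lemma TCsetU A B : TCset A -> TCset B -> TCset (A `|` B).
Proof.
move=> TA TB; have := TC_max TA TB; congr TC; apply/funext => x.
rewrite !indicE in_setU.
case: (x \in A); case: (x \in B) => /=; rewrite ?mul1r ?mul0r ?maxxx//.
  by apply/max_idPl; rewrite ltW// wexp_gt0.
by apply/max_idPr; rewrite ltW// wexp_gt0.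
Qed.

(** Complements come from linear combinations, finite unions from maxima, and countable unions as
    pointwise limits of finite ones. *)
Lemma TCset_sigma_algebra : sigma_algebra setT TCset.
Proof.
have T0 : TCset set0 by rewrite -setCT; apply: TCsetC; exact: TCset_setT.
split => // [A TA|A TA]; first by rewrite setTD; exact: TCsetC.
apply: (@TCset_lim (fun k => \big[setU/set0]_(i < k) A i)).
  by elim=> [|k IH]; rewrite ?big_ord0// big_ord_recr /=; exact: TCsetU.
move=> x; have [[k _ Akx]|nx] := pselect ((\bigcup_i A i) x).
  apply: cvg_eps => e e0; exists k.+1 => n kn.
  rewrite !indicE (mem_set (_ : (\bigcup_i A i) x)); last by exists k.
  rewrite mem_set ?subrr ?normr0 ?ltW//.
  by rewrite -bigcup_mkord; exists k.
apply: cvg_eps => e e0; exists 0%N => n _.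
rewrite !indicE memNset ?memNset ?subrr ?normr0 ?ltW//.
by rewrite -bigcup_mkord => -[k _ Akx]; apply: nx; exists k.
Qed.

(** The indicator of the open half-space is the limit of the continuous ramps
    [min 1 (k * max (x_i - a) 0)]. *)
Lemma TCset_ray (i : 'I_N) (a : R) : TCset [set x | a < tnth x i].
Proof.
pose phi k x := Num.min 1 (k%:R * Num.max (tnth x i - a) 0) : R.
have phi0 k x : 0 <= phi k x by rewrite le_min ler01 /= mulr_ge0// le_max lexx orbT.
have phi1 k x : phi k x <= 1 by rewrite ge_min lexx.
have mphi k : measurable_fun setT (phi k).
  apply: measurable_minr => //; apply: measurable_funM => //.
  apply: measurable_maxr => //; apply: measurable_funB => //; exact: meas_tnth.
have Tphi k : TC (fun x => phi k x * wexp x).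
  apply: TC_wexp => //.
    by move=> x; rewrite ger0_norm.
  move=> x h h0; have c : (fun n => tnth (addT x (h n)) i) @ \oo --> tnth x i.
    exact: cvg_addT_tnth.
  apply: cvg_minr; first exact: cvg_cst.
  apply: cvgM; first exact: cvg_cst.
  by apply: cvg_maxr; [apply: cvgB => //|]; exact: cvg_cst.
have mA : measurable [set x : T | a < tnth x i].
  have := @meas_tnth R N i measurableT _ (measurable_itv `]a, +oo[).
  rewrite setTI; congr measurable; apply/seteqP; split => x /=; by rewrite in_itv /= andbT.
have dom x : `|\1_[set x : T | a < tnth x i] x * wexp x| <= wexp x.
  rewrite normrM (ger0_norm (ltW (wexp_gt0 x))) -[leRHS]mul1r ler_wpM2r//.
    by rewrite ltW// wexp_gt0.
  by rewrite indicE; case: (_ \in _); rewrite ?normr1 ?normr0.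
have iA : itg mu (fun x => \1_[set x : T | a < tnth x i] x * wexp x).
  apply: itg_le dom itg_wexp; apply: measurable_funM; last exact: itg_meas itg_wexp.
  exact: measurable_indic.
apply: (TC_lim Tphi iA).
apply: (II_dct0 (g := fun x => 2 * wexp x)).
- by move=> n; exact: itg_meas (itg_abs (itgB (Tphi n).1 iA)).
- apply: aeW => x; rewrite -(normr0 R) -(subrr (\1_[set x : T | a < tnth x i] x * wexp x)).
  apply: cvg_norm; apply: cvgB; last exact: cvg_cst.
  apply: cvgM; last exact: cvg_cst.
  rewrite indicE; case: (ltP a (tnth x i)) => ax.
    rewrite mem_set//; apply: cvg_eps => e e0.
    exists (Num.bound (tnth x i - a)^-1) => n mn; rewrite /phi.
    have d0 : 0 < tnth x i - a by rewrite subr_gt0.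
    rewrite (max_idPl (ltW d0)) (min_idPl _) ?subrr ?normr0 ?(ltW e0)//.
    rewrite -ler_pdivrMr// mul1r.
    have x0 : 0 <= (tnth x i - a)^-1 by rewrite invr_ge0 subr_ge0 ltW.
    by apply: le_trans (ltW (archi_boundP x0)) _; rewrite ler_nat.
  rewrite memNset/=; last by rewrite ltNge ax.
  apply: cvg_eps => e e0; exists 0%N => n _; rewrite /phi.
  by rewrite (max_idPr _) ?subr_le0// mulr0 (min_idPr _) ?subrr ?normr0 ?(ltW e0).
- move=> n x; rewrite normr_id; apply: le_trans (ler_normB _ _) _.
  have : `|phi n x * wexp x| <= wexp x.
    rewrite normrM !ger0_norm ?(ltW (wexp_gt0 x))//.
    by rewrite -[leRHS]mul1r ler_wpM2r// ltW// wexp_gt0.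
  by have := dom x; lra.
- by apply: itgZ; exact: itg_wexp.
Qed.

(** Both levels of generation are used: the product sigma-algebra is generated by the coordinates,
    and the Borel sets of the line by open rays. *)
Lemma TCset_measurable A : measurable A -> TCset A.
Proof.
suff H (i : 'I_N) (B : set R) : measurable B -> TCset ((fun x : T => tnth x i) @^-1` B).
  have : @measurable _ T `<=` TCset; last by move=> + mA; apply.
  apply: smallest_sub; first exact: TCset_sigma_algebra.
  move=> X; rewrite -bigcup_seq => -[i _ [B mB <-]].
  by rewrite setTI; exact: H.
have [T0 TC_ TU] := TCset_sigma_algebra.
have : @measurable _ (measurableTypeR R) `<=`
    [set B | TCset ((fun x : T => tnth x i) @^-1` B)]; last by move=> + mB; apply.
rewrite RGenOInfty.measurableE; apply: smallest_sub.
  split => /= [|X TX|F TF].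
  - by rewrite preimage_set0.
  - by rewrite setTD preimage_setC; exact: TCsetC.
  - by rewrite preimage_bigcup; exact: TU.
move=> _ [a ->] /=; rewrite (_ : _ @^-1` _ = [set x | a < tnth x i]).
  exact: TCset_ray.
by apply/seteqP; split => x /=; rewrite in_itv /= andbT.
Qed.

(** Simple functions increasing to [f / wexp], multiplied by [wexp], are combinations of weighted
    indicators and converge to [f] in L1. *)
Lemma TC_itg_ge0 f : (forall x, 0 <= f x) -> itg mu f -> TC f.
Proof.
move=> f0 fi; have mf := itg_meas fi.
have mw := itg_meas itg_wexp.
pose b x := f x / wexp x.
have mb : measurable_fun setT (EFin \o b).
  apply/measurable_EFinP; apply: measurable_funM => //.
  rewrite (_ : (fun x => _) = (fun x => \prod_(i < N) expR `|tnth x i|)).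
    apply: measurable_prod => i _; apply: measurableT_comp => //.
    by apply: measurableT_comp => //; exact: meas_tnth.
  by apply/funext => x; rewrite /wexp -prodfV; apply: eq_bigr => i _; rewrite -expRN opprK.
have b0 x : (0 <= (b x)%:E)%E.
  by rewrite lee_fin divr_ge0// ltW// wexp_gt0.
pose gs := nnsfun_approx measurableT mb.
pose g k x : R := gs k x.
have gb x : (g ^~ x) @ \oo --> b x.
  have := @cvg_nnsfun_approx _ _ _ _ measurableT _ mb (fun x _ => b0 x) x I.
  by move=> /fine_cvg.
have gle k x : g k x <= b x.
  rewrite -(cvg_lim _ (gb x))//; apply: nondecreasing_cvgn_le.
    by move=> m n mn; exact/lefP/nd_nnsfun_approx.
  by apply/cvg_ex; exists (b x).
have bw x : b x * wexp x = f x by rewrite /b divfK// gt_eqF// wexp_gt0.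
have Tg k : TC (fun x => g k x * wexp x).
  have [r rE] : exists r : seq R, forall x,
      g k x = \sum_(y <- r) y * \1_(gs k @^-1` [set y]) x.
    by eexists => x; rewrite /g {1}fimfunE fsbig_finite.
  have -> : (fun x => g k x * wexp x) =
    (fun x => \sum_(y <- r) y * (\1_(gs k @^-1` [set y]) x * wexp x)).
    apply/funext => x; rewrite rE mulr_suml.
    by apply: eq_bigr => y _; rewrite mulrA.
  elim: r {rE} => [|y r IH].
    have := TC_comb 0 0 TCset_setT TCset_setT; congr TC.
    by apply/funext => x; rewrite big_nil !mul0r addr0.
  have TA : TCset (gs k @^-1` [set y]).
    by apply: TCset_measurable; rewrite -[X in measurable X]setTI; exact: measurable_funP.
  have := TC_comb y 1 TA IH; congr TC; apply/funext => x.
  by rewrite big_cons mul1r.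
apply: (TC_lim Tg fi); apply: (II_dct0 (g := fun x => 2 * f x)).
- by move=> n; exact: itg_meas (itg_abs (itgB (Tg n).1 fi)).
- apply: aeW => x; rewrite -(normr0 R) -(subrr (f x)).
  apply: cvg_norm; apply: cvgB; last exact: cvg_cst.
  by rewrite -bw; apply: cvgM => //; exact: cvg_cst.
- move=> n x; rewrite normr_id; apply: le_trans (ler_normB _ _) _.
  rewrite (ger0_norm (f0 x)) ger0_norm; last by rewrite mulr_ge0// ltW// wexp_gt0.
  have : g n x * wexp x <= f x by rewrite -bw ler_wpM2r// ltW// wexp_gt0.
  lra.
- exact: itgZ.
Qed.

Lemma TC_itg f : itg mu f -> TC f.
Proof.
move=> fi; have mf := itg_meas fi.
have i1 : itg mu (fun x => (`|f x| + f x) / 2).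
  by under eq_fun do rewrite mulrC; apply: itgZ; apply: itgD => //; exact: itg_abs.
have i2 : itg mu (fun x => (`|f x| - f x) / 2).
  by under eq_fun do rewrite mulrC; apply: itgZ; apply: itgB => //; exact: itg_abs.
have T1 : TC (fun x => (`|f x| + f x) / 2).
  apply: TC_itg_ge0 => // x; have := ler_norm (- f x); rewrite normrN; lra.
have T2 : TC (fun x => (`|f x| - f x) / 2).
  apply: TC_itg_ge0 => // x; have := ler_norm (f x); lra.
have := TC_comb 1 (-1) T1 T2; congr TC; apply/funext => x; by field.
Qed.

Lemma L2_translation (v : T -> R) (h : nat -> T) : measurable_fun setT v ->
  itg mu (fun x => v x ^+ 2) -> to0 h ->
  (fun n => II mu (fun x => (v (addT x (h n)) - v x) ^+ 2)) @ \oo --> (0 : R).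
Proof.
move=> mv iv h0.
have ivv : itg mu (fun x => v x * `|v x|).
  apply: itg_le iv => [|x]; last by rewrite normrM normr_id -normrM -expr2 ger0_norm// sqr_ge0.
  by apply: measurable_funM => //; exact: measurableT_comp.
have [_ /(_ h h0) c] := TC_itg ivv.
have L : (fun n => 2 * II mu (fun x => `|v (addT x (h n)) * `|v (addT x (h n))| -
    v x * `|v x| |)) @ \oo --> (0 : R).
  by rewrite -[X in _ --> X](mulr0 2); apply: cvgM => //; exact: cvg_cst.
apply: (@squeeze_cvgr _ _ _ _ (fun=> 0) _ _ _ _ _ L); last exact: cvg_cst.
apply: nearW => n; rewrite II_ge0/=; last by move=> x; exact: sqr_ge0.
rewrite -IIZ; last exact: (itg_dist (h n) ivv).
have mva : measurable_fun setT (fun x => v (addT x (h n))).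
  by apply: (measurableT_comp mv); exact: meas_addT.
apply: II_le.
- by apply: itg_sqrB => //; exact: (itg_shift (h n) iv).
- by apply: itgZ; exact: (itg_dist (h n) ivv).
by move=> x; exact: sqr_dist_le.
Qed.

End TranslationContinuity.

(** * Fourier transform and Plancherel *)

Lemma cvgn_uniqueR (R : realType) (u : nat -> R) (a b : R) :
  u @ \oo --> a -> u @ \oo --> b -> a = b.
Proof. by move=> ua ub; rewrite -(cvg_lim (@Rhausdorff R) ua); apply/cvg_lim. Qed.

(** * The cosine transform of exp(-|t|) and the mass of its Cauchy kernel *)

Section Poisson1.
Variable R : realType.
Local Notation lebR := (@lebesgue_measure R).
Local Notation mR := (measurableTypeR R).

(** An antiderivative in [t] of [expR (- t) * cos (z * t)]. *)
Let G (z t : R) : R := expR (- t) * (z * sin (z * t) - cos (z * t)) / (1 + z ^+ 2).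
Let g (z t : R) : R := expR (- t) * cos (z * t).

Lemma denom_gt0 (z : R) : 0 < 1 + z ^+ 2.
Proof. by have := sqr_ge0 z; lra. Qed.

Lemma is_derive_scalel (z t : R) : is_derive t (1 : R) (fun t : R => z * t) z.
Proof.
have d := is_deriveZ z (is_derive_id t (1 : R)).
by apply: is_derive_eq d _; exact: mulr1.
Qed.

Lemma is_derive_expN (t : R) : is_derive t (1 : R) (fun t : R => expR (- t)) (- expR (- t)).
Proof.
by apply: is_derive_eq; rewrite mulrN1.
Qed.

Lemma is_derive_G (z t : R) : is_derive t (1 : R) (G z) (g z t).
Proof.
have dz := is_derive_scalel z t.
have dc : is_derive t (1 : R) (fun t => cos (z * t)) (- sin (z * t) * z).
  exact: (@is_derive1_comp _ cos (fun t => z * t) t).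
have ds : is_derive t (1 : R) (fun t => sin (z * t)) (cos (z * t) * z).
  exact: (@is_derive1_comp _ sin (fun t => z * t) t).
have de := is_derive_expN t.
have d1 := is_deriveB (is_deriveZ z ds) dc.
have d2 := is_deriveM de d1.
have d3 := is_deriveZ (1 + z ^+ 2)^-1 d2.
have -> : G z = (fun t => (1 + z ^+ 2)^-1 *: (expR (- t) * (z *: sin (z * t) - cos (z * t)))).
  by apply/funext => u; rewrite /G mulrC.
apply: is_derive_eq d3 _; transitivity ((1 + z ^+ 2)^-1 * (expR (- t) * (z * (cos (z * t) * z) -
  - sin (z * t) * z) + (z * sin (z * t) - cos (z * t)) * - expR (- t))) => //.
rewrite /g; by field; rewrite gt_eqF// denom_gt0.
Qed.

Lemma continuous_g (z : R) : continuous (g z).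
Proof.
move=> t; apply: cvgM.
  by apply: continuous_comp; [exact: opp_continuous|exact: continuous_expR].
by apply: continuous_comp; [exact: mulrl_continuous|exact: continuous_cos].
Qed.

Lemma II_set_indic (A : set mR) (h : R -> R) : measurable A ->
  II lebR (fun t => \1_A t * h t) = (\int[lebR]_(t in A) h t)%R.
Proof.
move=> mA; rewrite Rintegral_mkcond; apply: eq_II => t.
by rewrite patchE indicE; case: (t \in A); rewrite ?mul1r ?mul0r.
Qed.

Lemma int_exp_cos_n (z : R) n :
  II lebR (fun t => \1_(`[0, n.+1%:R]%classic : set mR) t * g z t) =
  G z n.+1%:R - G z 0.
Proof.
rewrite II_set_indic// /Rintegral (@continuous_FTC2 _ (g z) (G z))//.
- by apply: continuous_subspaceT; exact: continuous_g.
- split.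
  + by move=> x _; have [] := is_derive_G z x.
  + apply: cvg_at_right_filter.
    by apply: differentiable_continuous; apply/derivable1_diffP; have [] := is_derive_G z 0.
  + apply: cvg_at_left_filter.
    by apply: differentiable_continuous; apply/derivable1_diffP; have [] := is_derive_G z n.+1%:R.
- by move=> x _; rewrite derive1E; have [_ ->] := is_derive_G z x.
Qed.

Lemma measurable_cosM (z : R) : measurable_fun setT (fun t : R => cos (z * t)).
Proof.
apply: continuous_measurable_fun => t.
by apply: continuous_comp; [exact: mulrl_continuous|exact: continuous_cos].
Qed.

Lemma measurable_sinM (z : R) : measurable_fun setT (fun t : R => sin (z * t)).
Proof.
apply: continuous_measurable_fun => t.
by apply: continuous_comp; [exact: mulrl_continuous|exact: continuous_sin].
Qed.

Lemma cos_abs_le1 (x : R) : `|cos x| <= 1.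
Proof. by rewrite ler_norml cos_geN1 cos_le1. Qed.

Lemma sin_abs_le1 (x : R) : `|sin x| <= 1.
Proof. by rewrite ler_norml sin_geN1 sin_le1. Qed.

Lemma itg_exp_cos (z : R) : itg lebR (fun t => expR (- `|t|) * cos (z * t)).
Proof.
exact: (@itg_bound _ mR _ lebR _ _ 1 (itg_exp_abs R) (measurable_cosM z)
  (fun t => cos_abs_le1 (z * t))).
Qed.

Lemma itg_exp_sin (z : R) : itg lebR (fun t => expR (- `|t|) * sin (z * t)).
Proof.
exact: (@itg_bound _ mR _ lebR _ _ 1 (itg_exp_abs R) (measurable_sinM z)
  (fun t => sin_abs_le1 (z * t))).
Qed.

Lemma II_exp_sin (z : R) : II lebR (fun t => expR (- `|t|) * sin (z * t)) = 0.
Proof.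
have i := itg_exp_sin z; have [_ E] := II_neg1 i.
have : II lebR (fun t => expR (- `|t|) * sin (z * t)) =
   - II lebR (fun t => expR (- `|t|) * sin (z * t)).
  rewrite -{1}E -IIN//; apply: eq_II => t /=.
  by rewrite normrN mulrN sinN mulrN.
by move=> ?; lra.
Qed.

(** By evenness twice the half-line integral, which is the limit of the integrals over [[0, n + 1]]
    given by the fundamental theorem of calculus. *)
Lemma II_exp_cos (z : R) :
  II lebR (fun t => expR (- `|t|) * cos (z * t)) = 2 / (1 + z ^+ 2).
Proof.
pose h1 t : R := \1_(`[0, +oo[%classic : set mR) t * g z t.
have mg : measurable_fun setT (g z).
  by apply: continuous_measurable_fun; exact: continuous_g.
have dom (A : set mR) t : A `<=` `[0, +oo[%classic -> `|\1_A t * g z t| <= expR (- `|t|).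
  move=> A0; rewrite indicE; have [At|_] := boolP (t \in A); last first.
    by rewrite mul0r normr0 expR_ge0.
  have : t \in `[0, +oo[ by apply: A0; rewrite inE in At.
  rewrite in_itv /= andbT => t0.
  rewrite mul1r normrM (ger0_norm (expR_ge0 _)) (ger0_norm t0).
  by rewrite -[leRHS]mulr1 ler_wpM2l ?expR_ge0// cos_abs_le1.
have ih1 : itg lebR h1.
  apply: (@itg_le _ mR _ lebR _ _ _ _ (itg_exp_abs R)).
    by apply: measurable_funM => //; exact: measurable_indic.
  by move=> t; apply: dom.
have [ih1n E1n] := II_neg1 ih1.
have -> : II lebR (fun t => expR (- `|t|) * cos (z * t)) = 2 * II lebR h1.
  rewrite [RHS]mulrC mulr_natr mulr2n -{2}E1n -IID//.
  apply: II_ae_eq.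
  - exact: itg_meas (itg_exp_cos z).
  - exact: itg_meas (itgD ih1 ih1n).
  (* The indicators of the two closed half-lines overlap at 0, so the identity holds only off this
     null set. *)
  - exists [set 0]; split; [exact: measurable_set1|exact: lebesgue_measure_set1|].
    move=> t /= tn; apply/eqP; apply: contrapT => /negP t0; apply: tn.
    rewrite /h1 !indicE /g !mem_setE !in_itv /= !andbT oppr_ge0.
    case: (ltgtP t 0) => tt.
    - by rewrite mul0r add0r mul1r (ltr0_norm tt) opprK mulrN cosN.
    - by rewrite mul0r addr0 mul1r (gtr0_norm tt).
    - by move: t0; rewrite tt eqxx.
have cn : (fun n => II lebR (fun t => \1_(`[0, n.+1%:R]%classic : set mR) t * g z t))
    @ \oo --> II lebR h1.
  apply: (@II_dct _ mR _ lebR _ _ (fun t => expR (- `|t|)) _ _ _ _ _).2.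
  - by move=> n; apply: measurable_funM => //; exact: measurable_indic.
  - exact: itg_meas ih1.
  - apply: aeW => t; apply: cvg_eps => e e0.
    exists (Num.bound `|t|) => n mn.
    rewrite /h1 (_ : \1_(`[0, n.+1%:R]%classic : set mR) t =
      \1_(`[0, +oo[%classic : set mR) t) ?subrr ?normr0 ?(ltW e0)//.
    rewrite !indicE; congr (_%:R : R); congr nat_of_bool; rewrite !mem_setE !in_itv /= andbT.
    case: (lerP 0 t) => //= t0.
    apply: le_trans (ler_norm t) _; apply: le_trans (ltW (archi_boundP (normr_ge0 t))) _.
    by rewrite ler_nat (leq_trans mn).
  - move=> n t; apply: dom => u /=; rewrite !in_itv /= => /andP[->//].
  - exact: itg_exp_abs.
have cG : (fun n => G z n.+1%:R - G z 0) @ \oo --> (1 + z ^+ 2)^-1.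
  have -> : (1 + z ^+ 2)^-1 = 0 - G z 0.
    by rewrite /G oppr0 expR0 mulr0 sin0 cos0 mulr0 sub0r mul1r sub0r mulN1r opprK.
  apply: cvgB; last exact: cvg_cst.
  (* [C * expR (- t)] bounds [|G z t|], and [expR (- n.+1)] is at most [harmonic n]. *)
  pose C : R := (`|z| + 1) / (1 + z ^+ 2).
  have L : (fun n => C * harmonic n) @ \oo --> (0 : R).
    by rewrite -[X in _ --> X](mulr0 C); apply: cvgM; [exact: cvg_cst|exact: cvg_harmonic].
  have L' : (fun n => - (C * harmonic n)) @ \oo --> (0 : R).
    by rewrite -[X in _ --> X]oppr0; exact: cvgN.
  apply: (squeeze_cvgr _ L' L); apply: nearW => n; rewrite -ler_norml.
  have i0 : 0 < (1 + z ^+ 2)^-1 by rewrite invr_gt0 denom_gt0.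
  rewrite /G /C normrM (gtr0_norm i0) mulrAC ler_pM2r// normrM (ger0_norm (expR_ge0 _)).
  rewrite mulrC; apply: ler_pM => //; last first.
    rewrite expRN lef_pV2 ?posrE ?expR_gt0 ?ltr0n//.
    by apply: le_trans (expR_ge1Dx _); rewrite lerDr.
  apply: le_trans (ler_normB _ _) _; apply: lerD; last exact: cos_abs_le1.
  by rewrite normrM -[leRHS]mulr1 ler_wpM2l ?sin_abs_le1.
have -> : II lebR h1 = (1 + z ^+ 2)^-1.
  move: cn; under eq_fun do rewrite int_exp_cos_n.
  by move=> cn; exact: cvgn_uniqueR cn cG.
by [].
Qed.

Lemma II_poisson1 : itg lebR (fun t : R => (pi * (1 + t ^+ 2))^-1) /\
  II lebR (fun t : R => (pi * (1 + t ^+ 2))^-1) = 1.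
Proof.
have c : continuous (fun t : R => (1 + t ^+ 2)^-1) := @continuous_oneDsqrV R.
have p0 := @pi_gt0 R.
have E : (\int[lebR]_t ((1 + t ^+ 2)^-1)%:E = pi%:E)%E.
  rewrite (ge0_symfun_integralT _ c); last 2 first.
  - by move=> t; rewrite invr_ge0 ltW// denom_gt0.
  - by move=> t /=; rewrite sqrrN.
  rewrite -set_itvcy integral0y_oneDsqr -EFinM; congr EFin; by field.
have i1 : itg lebR (fun t : R => (1 + t ^+ 2)^-1).
  apply: itg_ge0; [exact: continuous_measurable_fun c| |].
    by move=> t; rewrite invr_ge0 ltW// denom_gt0.
  by rewrite E ltry.
have -> : (fun t : R => (pi * (1 + t ^+ 2))^-1) = (fun t => pi^-1 * (1 + t ^+ 2)^-1).
  by apply/funext => t; rewrite invfM.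
split; first exact: (itgZ pi^-1 i1).
rewrite IIZ//; have -> : II lebR (fun t : R => (1 + t ^+ 2)^-1) = pi.
  by apply: EFin_inj; rewrite II_EFin.
by rewrite mulVf// gt_eqF.
Qed.

End Poisson1.

Lemma II_muN0 (R : realType) (h : 0.-tuple R -> R) : II (muN R 0) h = h [tuple].
Proof.
rewrite (_ : h = cst (h [tuple])); last by apply/funext => x; rewrite (tuple0 x).
have -> : II (muN R 0) (cst (h [tuple])) =
  fine (\int[@dirac _ (0.-tuple R) [tuple] R]_x (h [tuple])%:E)%E by [].
by rewrite integral_dirac ?diracT ?mul1e.
Qed.

Global Opaque itg II.

(** * Signed Fubini on tuples and the transform of the product weight *)

Section MuS.
Variable R : realType.
Local Notation lebR := (@lebesgue_measure R).

Lemma muN_fubini_ge0 n (h : n.+1.-tuple R -> R) : (forall x, 0 <= h x) ->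
  itg (muN R n.+1) h -> (forall t, itg (muN R n) (fun y => h (cons_tuple t y))) ->
  itg lebR (fun t => II (muN R n) (fun y => h (cons_tuple t y))) /\
  II (muN R n.+1) h = II lebR (fun t => II (muN R n) (fun y => h (cons_tuple t y))).
Proof.
move=> h0 ih it; have mh := itg_meas ih.
have mH : measurable_fun setT
    (fun t : measurableTypeR R => II (muN R n) (fun y => h (cons_tuple t y))).
  apply: (@measurable_IIl _ _ (measurableTypeR R) _ _ (muN R n) (h \o @constup R n)).
  exact: measurableT_comp (@meas_constup R n).
have E : (\int[muN R n.+1]_x (h x)%:E =
   \int[lebR]_t (II (muN R n) (fun y => h (cons_tuple t y)))%:E)%E.
  rewrite /= ge0_integral_muS//; last exact/measurable_EFinP.
  by apply: eq_integral => t _; rewrite II_EFin.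
have i1 : itg lebR (fun t => II (muN R n) (fun y => h (cons_tuple t y))).
  apply: itg_ge0 => //; first by move=> t; exact: II_ge0.
  by rewrite -E -II_EFin// ltry.
by split => //; apply: EFin_inj; rewrite !II_EFin.
Qed.

(** Both [|h| + h] and [|h|] are nonnegative, and the signed integral is the difference of their
    integrals. *)
Lemma muN_fubini n (h : n.+1.-tuple R -> R) :
  itg (muN R n.+1) h -> (forall t, itg (muN R n) (fun y => h (cons_tuple t y))) ->
  II (muN R n.+1) h = II lebR (fun t => II (muN R n) (fun y => h (cons_tuple t y))).
Proof.
move=> ih it.
have p0 (x : R) : 0 <= `|x| + x by have := ler_norm (- x); rewrite normrN; lra.
have ip := itgD (itg_abs ih) ih.
have [i1 E1] := muN_fubini_ge0 (fun x => p0 (h x)) ip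
  (fun t => itgD (itg_abs (it t)) (it t)).
have [i2 E2] := muN_fubini_ge0 (fun x => normr_ge0 (h x)) (itg_abs ih)
  (fun t => itg_abs (it t)).
rewrite (_ : II (muN R n.+1) h =
  II (muN R n.+1) (fun x => `|h x| + h x) - II (muN R n.+1) (fun x => `|h x|)); last first.
  by rewrite IID//; [ring|exact: itg_abs].
rewrite E1 E2 -(IIB i1 i2); apply: eq_II => t.
by rewrite (IID (itg_abs (it t)) (it t)); ring.
Qed.

Lemma II_scaleR n (e : R) (h : n.-tuple R -> R) : 0 < e -> itg (muN R n) h ->
  itg (muN R n) (fun x => h (scaleT e x)) /\
  II (muN R n) h = e ^+ n * II (muN R n) (fun x => h (scaleT e x)).
Proof.
move=> e0 ih.
have p0 (x : R) : 0 <= `|x| + x by have := ler_norm (- x); rewrite normrN; lra.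
have [i1 E1] := II_scale e0 (fun x => p0 (h x)) (itgD (itg_abs ih) ih).
have [i2 E2] := II_scale e0 (fun x => normr_ge0 (h x)) (itg_abs ih).
have E x : h (scaleT e x) = (`|h (scaleT e x)| + h (scaleT e x)) - `|h (scaleT e x)|.
  by ring.
have i : itg (muN R n) (fun x => h (scaleT e x)).
  by under eq_fun do rewrite E; exact: itgB.
split => //.
rewrite (_ : II (muN R n) h =
  II (muN R n) (fun x => `|h x| + h x) - II (muN R n) (fun x => `|h x|)); last first.
  by rewrite IID//; [ring|exact: itg_abs].
by rewrite E1 E2 -mulrBr -IIB//; congr (_ * _); apply: eq_II => x; ring.
Qed.

Lemma wexp_cons n (t : R) (y : n.-tuple R) :
  wexp (cons_tuple t y) = expR (- `|t|) * wexp y.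
Proof.
by rewrite /wexp big_ord_recl; congr (_ * _); apply: eq_bigr => i _; rewrite tnthS.
Qed.

Lemma dotN_cons n (s t : R) (x y : n.-tuple R) :
  dotN (cons_tuple s x) (cons_tuple t y) = s * t + dotN x y.
Proof.
by rewrite /dotN big_ord_recl; congr (_ + _); apply: eq_bigr => i _; rewrite !tnthS.
Qed.

Lemma meas_cosdot n (z : n.-tuple R) : measurable_fun setT (fun x => cos (dotN z x)).
Proof.
apply: (@measurableT_comp _ _ _ _ _ _ (@cos R)); last exact: meas_dotN.
by apply: continuous_measurable_fun; exact: continuous_cos.
Qed.

Lemma meas_sindot n (z : n.-tuple R) : measurable_fun setT (fun x => sin (dotN z x)).
Proof.
apply: (@measurableT_comp _ _ _ _ _ _ (@sin R)); last exact: meas_dotN.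
by apply: continuous_measurable_fun; exact: continuous_sin.
Qed.

Lemma itg_cosdot n (h : n.-tuple R -> R) z : itg (muN R n) h ->
  itg (muN R n) (fun x => h x * cos (dotN z x)).
Proof.
move=> ih; apply: itg_bound ih (meas_cosdot z) _ => x; exact: cos_abs_le1.
Qed.

Lemma itg_sindot n (h : n.-tuple R -> R) z : itg (muN R n) h ->
  itg (muN R n) (fun x => h x * sin (dotN z x)).
Proof.
move=> ih; apply: itg_bound ih (meas_sindot z) _ => x; exact: sin_abs_le1.
Qed.

(** Induction on the dimension by the addition formulas; cosine and sine have to be carried together
    because each formula involves both. *)
Lemma II_wexp_cs n (z : n.-tuple R) :
  II (muN R n) (fun x => wexp x * cos (dotN z x)) = \prod_(i < n) (2 / (1 + tnth z i ^+ 2)) /\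
  II (muN R n) (fun x => wexp x * sin (dotN z x)) = 0.
Proof.
elim: n z => [|n IH] z.
  rewrite big_ord0 !II_muN0.
  by rewrite /wexp /dotN !big_ord0 cos0 sin0 mulr1 mulr0.
case/tupleP: z => z0 z; have [IC IS] := IH z.
have iw := itg_wexp R n.
have iwc := itg_cosdot z iw; have iws := itg_sindot z iw.
have EC (t : R) (y : n.-tuple R) :
   wexp (cons_tuple t y) * cos (dotN (cons_tuple z0 z) (cons_tuple t y)) =
   expR (- `|t|) * cos (z0 * t) * (wexp y * cos (dotN z y)) -
   expR (- `|t|) * sin (z0 * t) * (wexp y * sin (dotN z y)).
  by rewrite wexp_cons dotN_cons cosD; ring.
have ES (t : R) (y : n.-tuple R) :
   wexp (cons_tuple t y) * sin (dotN (cons_tuple z0 z) (cons_tuple t y)) =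
   expR (- `|t|) * sin (z0 * t) * (wexp y * cos (dotN z y)) +
   expR (- `|t|) * cos (z0 * t) * (wexp y * sin (dotN z y)).
  by rewrite wexp_cons dotN_cons sinD; ring.
split.
  rewrite muN_fubini; [|exact: itg_cosdot (itg_wexp R n.+1)|].
  - under eq_II do (under eq_II do rewrite EC); rewrite big_ord_recl.
    under eq_II => t.
      rewrite IIB; [|exact: itgZ..]; rewrite !IIZ// IS mulr0 subr0 IC mulrC.
      over.
    rewrite IIZ; last exact: itg_exp_cos.
    rewrite II_exp_cos mulrC; congr (_ * _).
    by apply: eq_bigr => i _; rewrite tnthS.
  - by move=> t; under eq_fun do rewrite EC; apply: itgB; exact: itgZ.
rewrite muN_fubini; [|exact: itg_sindot (itg_wexp R n.+1)|].
- under eq_II do (under eq_II do rewrite ES).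
  under eq_II => t.
    rewrite IID; [|exact: itgZ..]; rewrite !IIZ// IS mulr0 addr0 IC mulrC.
    over.
  rewrite IIZ; last exact: itg_exp_sin.
  by rewrite II_exp_sin mulr0.
- by move=> t; under eq_fun do rewrite ES; apply: itgD; exact: itgZ.
Qed.

End MuS.

(** * The Fourier transform on L1 and Plancherel's identity *)

Section Fourier.
Variables (R : realType) (N : nat).
Local Notation T := (N.-tuple R).
Local Notation mu := (muN R N).
Local Notation c := (FTconst R N).
Implicit Types (v g : T -> R) (x y z xi : T).

Lemma c_ge0 : 0 <= c.
Proof. by rewrite exprn_ge0// invr_ge0 sqrtr_ge0. Qed.

Lemma FTreE v xi : itg mu v -> FTre v xi = c * II mu (fun x => v x * cos (dotN x xi)).
Proof.
move=> iv; rewrite /FTre; congr (_ * _); rewrite RintN_II//.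
by under eq_fun do rewrite dotNC; exact: itg_cosdot.
Qed.

Lemma FTimE v xi : itg mu v -> FTim v xi = - (c * II mu (fun x => v x * sin (dotN x xi))).
Proof.
move=> iv; rewrite /FTim; congr (- (_ * _)); rewrite RintN_II//.
by under eq_fun do rewrite dotNC; exact: itg_sindot.
Qed.

Let Fc v (p : T * T) : R := v p.1 * cos (dotN p.1 p.2).
Let Fs v (p : T * T) : R := v p.1 * sin (dotN p.1 p.2).

Lemma meas_cosdot2 : measurable_fun setT (fun p : T * T => cos (dotN p.1 p.2)).
Proof.
apply: (@measurableT_comp _ _ _ _ _ _ (@cos R)); last exact: meas_dotN.
by apply: continuous_measurable_fun; exact: continuous_cos.
Qed.

Lemma meas_sindot2 : measurable_fun setT (fun p : T * T => sin (dotN p.1 p.2)).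
Proof.
apply: (@measurableT_comp _ _ _ _ _ _ (@sin R)); last exact: meas_dotN.
by apply: continuous_measurable_fun; exact: continuous_sin.
Qed.

Lemma FTre_meas v : itg mu v -> measurable_fun setT (FTre v).
Proof.
move=> iv; rewrite (_ : FTre v = (fun xi => c * II mu (fun x => Fc v (x, xi)))).
  apply: measurable_funM => //; apply: measurable_IIr.
  apply: measurable_funM; last exact: meas_cosdot2.
  by apply: measurableT_comp => //; exact: itg_meas iv.
by apply/funext => xi; rewrite FTreE.
Qed.

Lemma FTim_meas v : itg mu v -> measurable_fun setT (FTim v).
Proof.
move=> iv; rewrite (_ : FTim v = (fun xi => - (c * II mu (fun x => Fs v (x, xi))))).
  apply: measurableT_comp => //; apply: measurable_funM => //; apply: measurable_IIr.
  apply: measurable_funM; last exact: meas_sindot2.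
  by apply: measurableT_comp => //; exact: itg_meas iv.
by apply/funext => xi; rewrite FTimE.
Qed.

Lemma FTre_bound v xi : itg mu v -> `|FTre v xi| <= c * II mu (fun x => `|v x|).
Proof.
move=> iv; rewrite FTreE// normrM (ger0_norm c_ge0) ler_wpM2l ?c_ge0//.
apply: II_absle; first exact: itg_abs.
  apply: measurable_funM; first exact: itg_meas iv.
  by under eq_fun do rewrite dotNC; exact: meas_cosdot.
by move=> x; rewrite normrM -[leRHS]mulr1 ler_wpM2l// cos_abs_le1.
Qed.

Lemma FTim_bound v xi : itg mu v -> `|FTim v xi| <= c * II mu (fun x => `|v x|).
Proof.
move=> iv; rewrite FTimE// normrN normrM (ger0_norm c_ge0) ler_wpM2l ?c_ge0//.
apply: II_absle; first exact: itg_abs.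
  apply: measurable_funM; first exact: itg_meas iv.
  by under eq_fun do rewrite dotNC; exact: meas_sindot.
by move=> x; rewrite normrM -[leRHS]mulr1 ler_wpM2l// sin_abs_le1.
Qed.

Lemma itg_FTreM v g : itg mu v -> itg mu g -> itg mu (fun xi => FTre v xi * g xi).
Proof.
move=> iv ig; under eq_fun do rewrite mulrC.
by apply: itg_bound ig (FTre_meas iv) _ => xi; exact: FTre_bound.
Qed.

Lemma itg_FTimM v g : itg mu v -> itg mu g -> itg mu (fun xi => FTim v xi * g xi).
Proof.
move=> iv ig; under eq_fun do rewrite mulrC.
by apply: itg_bound ig (FTim_meas iv) _ => xi; exact: FTim_bound.
Qed.

(** The multiplication formula: Fubini applied to [v x * g xi * cos (x . xi)], a kernel symmetric in
    [x] and [xi]. *)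
Lemma FTre_adj v g : itg mu v -> itg mu g ->
  II mu (fun xi => FTre v xi * g xi) = II mu (fun x => v x * FTre g x).
Proof.
move=> iv ig.
pose F (p : T * T) := v p.1 * g p.2 * cos (dotN p.1 p.2).
have mF : measurable_fun setT F.
  apply: measurable_funM; last exact: meas_cosdot2.
  by apply: measurable_funM; apply: measurableT_comp => //;
    [exact: itg_meas iv|exact: itg_meas ig].
have bF x y : `|F (x, y)| <= `|v x| * `|g y|.
  by rewrite /F /= !normrM -[leRHS]mulr1 ler_wpM2l ?mulr_ge0// cos_abs_le1.
have [i1 i2 o1 o2 E] := II_fubini mF bF (itg_abs iv) (itg_abs ig).
have il xi : itg mu (fun x => v x * cos (dotN x xi)).
  by under eq_fun do rewrite dotNC; exact: itg_cosdot.
have ir x : itg mu (fun xi => g xi * cos (dotN xi x)).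
  by under eq_fun do rewrite dotNC; exact: itg_cosdot.
transitivity (c * II mu (fun xi => II mu (fun x => F (x, xi)))).
  rewrite -(IIZ c o2); apply: eq_II => xi.
  rewrite (FTreE _ iv) -mulrA; congr (_ * _).
  by rewrite mulrC -(IIZ _ (il xi)); apply: eq_II => x; rewrite /F /=; ring.
rewrite -E -(IIZ c o1); apply: eq_II => x; rewrite (FTreE _ ig) [RHS]mulrCA; congr (_ * _).
by rewrite -(IIZ _ (ir x)); apply: eq_II => xi; rewrite /F /= dotNC; ring.
Qed.

Lemma FTim_adj v g : itg mu v -> itg mu g ->
  II mu (fun xi => FTim v xi * g xi) = II mu (fun x => v x * FTim g x).
Proof.
move=> iv ig.
pose F (p : T * T) := v p.1 * g p.2 * sin (dotN p.1 p.2).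
have mF : measurable_fun setT F.
  apply: measurable_funM; last exact: meas_sindot2.
  by apply: measurable_funM; apply: measurableT_comp => //;
    [exact: itg_meas iv|exact: itg_meas ig].
have bF x y : `|F (x, y)| <= `|v x| * `|g y|.
  by rewrite /F /= !normrM -[leRHS]mulr1 ler_wpM2l ?mulr_ge0// sin_abs_le1.
have [i1 i2 o1 o2 E] := II_fubini mF bF (itg_abs iv) (itg_abs ig).
have il xi : itg mu (fun x => v x * sin (dotN x xi)).
  by under eq_fun do rewrite dotNC; exact: itg_sindot.
have ir x : itg mu (fun xi => g xi * sin (dotN xi x)).
  by under eq_fun do rewrite dotNC; exact: itg_sindot.
transitivity (- c * II mu (fun xi => II mu (fun x => F (x, xi)))).
  rewrite -(IIZ (- c) o2); apply: eq_II => xi.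
  rewrite (FTimE _ iv) mulNr mulNr -mulrA; congr (- (_ * _)).
  by rewrite mulrC -(IIZ _ (il xi)); apply: eq_II => x; rewrite /F /=; ring.
rewrite -E -(IIZ (- c) o1); apply: eq_II => x; rewrite (FTimE _ ig) mulrN mulNr; congr (- _).
rewrite [RHS]mulrCA; congr (_ * _).
by rewrite -(IIZ _ (ir x)); apply: eq_II => xi; rewrite /F /= dotNC; ring.
Qed.

(** The multiplication formula, used twice, takes both transforms off [v]; the cosine and sine parts
    recombine into [cos ((x - y) . xi)]. *)
Lemma FT_weight v g : itg mu v -> itg mu g ->
  itg mu (fun xi => g xi * (FTre v xi ^+ 2 + FTim v xi ^+ 2)) /\
  II mu (fun xi => g xi * (FTre v xi ^+ 2 + FTim v xi ^+ 2)) =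
  II mu (fun x => v x * II mu (fun y => v y *
    (c ^+ 2 * II mu (fun xi => g xi * cos (dotN (addT x (oppT y)) xi))))).
Proof.
move=> iv ig.
have igr := itg_FTreM iv ig; have igi := itg_FTimM iv ig.
have irr := itg_FTreM iv igr; have iii := itg_FTimM iv igi.
have Esum : (fun xi => g xi * (FTre v xi ^+ 2 + FTim v xi ^+ 2)) =
  (fun xi => FTre v xi * (FTre v xi * g xi) + FTim v xi * (FTim v xi * g xi)).
  by apply/funext => xi; ring.
split; first by rewrite Esum; exact: itgD.
rewrite Esum IID// FTre_adj// FTim_adj//.
have mv := itg_meas iv.
have b1 : itg mu (fun x => v x * FTre (fun xi => FTre v xi * g xi) x).
  apply: itg_bound iv (FTre_meas igr) _ => x; exact: FTre_bound.
have b2 : itg mu (fun x => v x * FTim (fun xi => FTim v xi * g xi) x).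
  apply: itg_bound iv (FTim_meas igi) _ => x; exact: FTim_bound.
rewrite -IID//; apply: eq_II => x; rewrite -mulrDr; congr (_ * _).
rewrite FTreE// FTimE//.
have igc := itg_cosdot x ig; have igs := itg_sindot x ig.
have -> : II mu (fun xi => FTre v xi * g xi * cos (dotN xi x)) =
  II mu (fun y => v y * FTre (fun xi => g xi * cos (dotN x xi)) y).
  by rewrite -FTre_adj//; apply: eq_II => xi; rewrite dotNC mulrA.
have -> : II mu (fun xi => FTim v xi * g xi * sin (dotN xi x)) =
  II mu (fun y => v y * FTim (fun xi => g xi * sin (dotN x xi)) y).
  by rewrite -FTim_adj//; apply: eq_II => xi; rewrite dotNC mulrA.
have c1 : itg mu (fun y => v y * FTre (fun xi => g xi * cos (dotN x xi)) y).
  apply: itg_bound iv (FTre_meas igc) _ => y; exact: FTre_bound.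
have c2 : itg mu (fun y => v y * FTim (fun xi => g xi * sin (dotN x xi)) y).
  apply: itg_bound iv (FTim_meas igs) _ => y; exact: FTim_bound.
rewrite -mulrBr -IIB// -IIZ; last exact: itgB.
apply: eq_II => y; rewrite FTreE// FTimE//.
have j1 : itg mu (fun xi => g xi * cos (dotN x xi) * cos (dotN xi y)).
  by under eq_fun do rewrite [dotN _ y]dotNC; exact: itg_cosdot.
have j2 : itg mu (fun xi => g xi * sin (dotN x xi) * sin (dotN xi y)).
  by under eq_fun do rewrite [dotN _ y]dotNC; exact: itg_sindot.
have -> : II mu (fun xi => g xi * cos (dotN (addT x (oppT y)) xi)) =
   II mu (fun xi => g xi * cos (dotN x xi) * cos (dotN xi y)) +
   II mu (fun xi => g xi * sin (dotN x xi) * sin (dotN xi y)).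
  rewrite -IID//; apply: eq_II => xi.
  by rewrite dotN_addl dotN_oppl cosB [dotN xi y]dotNC; ring.
ring.
Qed.

Definition L12 v := [/\ measurable_fun setT v, itg mu v & itg mu (fun x => v x ^+ 2)].

Definition omega v (h : T) := II mu (fun x => (v (addT x h) - v x) ^+ 2).

Lemma meas_shift v (a : T) : measurable_fun setT v ->
  measurable_fun setT (fun x => v (addT x a)).
Proof. by move=> mv; apply: (measurableT_comp mv); exact: meas_addT. Qed.

Lemma itg_omega v (a : T) : measurable_fun setT v -> itg mu (fun x => v x ^+ 2) ->
  itg mu (fun x => (v (addT x a) - v x) ^+ 2).
Proof.
move=> mv i2; apply: itg_sqrB; [exact: meas_shift|exact: mv| |exact: i2].
exact: (itg_shift a i2).
Qed.

Lemma omega_le v (a : T) : measurable_fun setT v -> itg mu (fun x => v x ^+ 2) ->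
  0 <= omega v a <= 4 * II mu (fun x => v x ^+ 2).
Proof.
move=> mv i2; apply/andP; split; first by apply: II_ge0 => x; exact: sqr_ge0.
have is_ := itg_shift a i2.
rewrite [leRHS](_ : _ = II mu (fun x => 2 * (v (addT x a) ^+ 2 + v x ^+ 2))).
  apply: II_le; [exact: itg_omega|by apply: itgZ; exact: itgD|move=> x].
  move: (v _) (v x) => p q; have := sqr_ge0 (p + q); nra.
by rewrite (IIZ 2 (itgD is_ i2)) (IID is_ i2) (II_shift a i2); ring.
Qed.

Lemma meas_omega v : measurable_fun setT v -> measurable_fun setT (omega v).
Proof.
move=> mv; apply: (@measurable_IIl _ _ _ _ _ mu
  (fun p : T * T => (v (addT p.2 p.1) - v p.2) ^+ 2)).
apply: measurable_funX; apply: measurable_funB; last exact: measurableT_comp.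
by apply: (measurableT_comp mv); exact: meas_addT.
Qed.

Section Kernel.
Variables (k : T -> R) (M : R).
Hypotheses (k0 : forall z, 0 <= k z) (kM : forall z, k z <= M) (ik : itg mu k)
  (Ik : II mu k = 1) (kN : forall z, k (oppT z) = k z).

(** After [y = x + h] and evenness of [k], the identity [2 v(x) v(x + h) = v(x)^2 + v(x + h)^2 -
    (v(x + h) - v(x))^2] is integrated against [k]. Tonelli and translation invariance turn the
    first two terms into two copies of the squared norm, as [k] has mass 1. *)
Lemma conv_form v : L12 v ->
  itg mu (fun h => k h * omega v h) /\
  II mu (fun x => v x * II mu (fun y => v y * k (addT x (oppT y)))) =
  II mu (fun x => v x ^+ 2) - 2^-1 * II mu (fun h => k h * omega v h).
Proof.
move=> [mv iv i2]; have mk := itg_meas ik.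
have ikom : itg mu (fun h => k h * omega v h).
  apply: (itg_bound (M := 4 * II mu (fun x => v x ^+ 2)) ik (meas_omega mv)) => h.
  by have /andP[h0 h1] := omega_le h mv i2; rewrite ger0_norm.
split => //.
have kb (u : T -> R) x : measurable_fun setT u -> itg mu u -> itg mu (fun h => k h * u h).
  move=> mu_ iu; under eq_fun do rewrite mulrC.
  by apply: (itg_bound (M := M) iu mk) => h; rewrite ger0_norm.
have isx (u : T -> R) x : itg mu u -> itg mu (fun h => u (addT x h)).
  by move=> iu; under eq_fun do rewrite addTC; exact: itg_shift.
have msx (u : T -> R) x : measurable_fun setT u -> measurable_fun setT (fun h => u (addT x h)).
  by move=> mu_; under eq_fun do rewrite addTC; exact: meas_shift.
have inner x : II mu (fun y => v y * k (addT x (oppT y))) =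
    II mu (fun h => k h * v (addT x h)).
  pose H y := v y * k (addT x (oppT y)).
  have HE y : H (addT y x) = k y * v (addT x y).
    rewrite /H mulrC (addTC y x); congr (_ * _).
    rewrite -(kN y); congr k; apply: eq_from_tnth => i.
    by rewrite !tnth_mktuple; ring.
  have iH : itg mu H.
    have iS := kb _ x (msx v x mv) (isx v x iv).
    have := itg_shift (oppT x) iS; congr itg; apply/funext => y.
    by rewrite -HE addTNK.
  by rewrite -(II_shift x iH); apply: eq_II => y; exact: HE.
have i2x x := kb _ x (msx _ x (itg_meas i2)) (isx _ x i2).
have ivx x := kb _ x (msx v x mv) (isx v x iv).
pose S x := II mu (fun h => k h * v (addT x h) ^+ 2).
pose D x := II mu (fun h => k h * (v (addT x h) - v x) ^+ 2).
have iDx x : itg mu (fun h => k h * (v (addT x h) - v x) ^+ 2).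
  have -> : (fun h => k h * (v (addT x h) - v x) ^+ 2) =
    (fun h => k h * v (addT x h) ^+ 2 - (2 * v x) * (k h * v (addT x h)) + v x ^+ 2 * k h).
    by apply/funext => h; ring.
  by apply: itgD; [apply: itgB => //; exact: itgZ|exact: itgZ].
have E x : v x * II mu (fun y => v y * k (addT x (oppT y))) =
   2^-1 * (v x ^+ 2 + S x - D x).
  rewrite inner; have -> : D x = S x - (2 * v x) * II mu (fun h => k h * v (addT x h)) + v x ^+ 2.
    rewrite -(IIZ _ (ivx x)) -(IIB (i2x x) (itgZ _ (ivx x))).
    rewrite [in RHS](_ : v x ^+ 2 = II mu (fun h => v x ^+ 2 * k h)); last first.
      by rewrite (IIZ _ ik) Ik mulr1.
    rewrite -(IID (itgB (i2x x) (itgZ _ (ivx x))) (itgZ _ ik)).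
    by apply: eq_II => h; ring.
  by field.
have madd : measurable_fun setT (fun p : T * T => v (addT p.2 p.1)).
  by apply: (measurableT_comp mv); exact: meas_addT.
have mk1 : measurable_fun setT (fun p : T * T => k p.1) by exact: measurableT_comp.
have [iS ES] : itg mu S /\ II mu (fun h => k h * II mu (fun x => v x ^+ 2)) = II mu S.
  have := @II_tonelli _ _ _ _ _ mu mu (fun p : T * T => k p.1 * v (addT p.2 p.1) ^+ 2).
  have Eh h : II mu (fun x => k h * v (addT x h) ^+ 2) = k h * II mu (fun x => v x ^+ 2).
    by rewrite (IIZ _ (itg_shift h i2)) (II_shift h i2).
  have -> : (fun h => k h * II mu (fun x => v x ^+ 2)) =
    (fun h => II mu (fun x => k h * v (addT x h) ^+ 2)).
    by apply/funext => h; rewrite Eh.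
  apply.
  - by apply: measurable_funM => //; exact: measurable_funX.
  - by move=> p; rewrite mulr_ge0// sqr_ge0.
  - by move=> h /=; exact: (itgZ (k h) (itg_shift h i2)).
  - exact: i2x.
  - under eq_fun do rewrite Eh mulrC.
    exact: itgZ ik.
have [iD ED] : itg mu D /\ II mu (fun h => k h * omega v h) = II mu D.
  have := @II_tonelli _ _ _ _ _ mu mu (fun p : T * T => k p.1 * (v (addT p.2 p.1) - v p.2) ^+ 2).
  have Eh h : II mu (fun x => k h * (v (addT x h) - v x) ^+ 2) = k h * omega v h.
    by rewrite (IIZ _ (itg_omega h mv i2)).
  have -> : (fun h => k h * omega v h) =
    (fun h => II mu (fun x => k h * (v (addT x h) - v x) ^+ 2)).
    by apply/funext => h; rewrite Eh.
  apply.
  - apply: measurable_funM => //; apply: measurable_funX; apply: measurable_funB => //.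
    exact: measurableT_comp.
  - by move=> p; rewrite mulr_ge0// sqr_ge0.
  - by move=> h /=; exact: (itgZ (k h) (itg_omega h mv i2)).
  - exact: iDx.
  - under eq_fun do rewrite Eh; exact: ikom.
under eq_II do rewrite E.
rewrite (IIZ _ (itgB (itgD i2 iS) iD)) (IIB (itgD i2 iS) iD) (IID i2 iS) -ED -ES.
under [X in _ + X - _]eq_II do rewrite mulrC.
by rewrite (IIZ _ ik) Ik; field.
Qed.

End Kernel.

(** The product of Cauchy densities. It is [c ^+ 2] times the transform of [wexp]: the constant
    [(2 pi)^-N] turns each factor [2 / (1 + z_i^2)] into a probability density. *)
Definition k1 (z : T) : R := \prod_(i < N) (pi * (1 + tnth z i ^+ 2))^-1.

Lemma c_sqr : c ^+ 2 = (2 * pi)^-1 ^+ N.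
Proof.
rewrite /FTconst -exprM mulnC exprM; congr (_ ^+ N).
by rewrite exprVn sqr_sqrtr// mulr_ge0// ltW// pi_gt0.
Qed.

Lemma k1_ge0 z : 0 <= k1 z.
Proof.
by apply: prodr_ge0 => i _; rewrite invr_ge0 mulr_ge0 ?(ltW (pi_gt0 R))// ltW// denom_gt0.
Qed.

Lemma k1_le z : k1 z <= pi^-1 ^+ N.
Proof.
rewrite -[X in _ ^+ X](card_ord N) -prodr_const; apply: ler_prod => i _.
have p0 := pi_gt0 R.
apply/andP; split; first by rewrite invr_ge0 mulr_ge0 ?(ltW p0)// ltW// denom_gt0.
rewrite invfM -[leRHS]mulr1 ler_wpM2l ?invr_ge0 ?(ltW p0)//.
by rewrite invf_le1 ?denom_gt0// lerDl sqr_ge0.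
Qed.

Lemma itg_k1 : itg mu k1.
Proof.
have [i E] := II_poisson1 R.
apply: (@muN_prodR R N (fun=> fun t => (pi * (1 + t ^+ 2))^-1) _ _).1 => // j t.
by rewrite invr_ge0 mulr_ge0 ?(ltW (pi_gt0 R))// ltW// denom_gt0.
Qed.

Lemma II_k1 : II mu k1 = 1.
Proof.
have [i E] := II_poisson1 R.
rewrite (@muN_prodR R N (fun=> fun t => (pi * (1 + t ^+ 2))^-1) _ _).2 => //.
  by rewrite E big1.
by move=> j t; rewrite invr_ge0 mulr_ge0 ?(ltW (pi_gt0 R))// ltW// denom_gt0.
Qed.

Lemma k1E z : c ^+ 2 * II mu (fun xi => wexp xi * cos (dotN z xi)) = k1 z.
Proof.
rewrite (II_wexp_cs z).1 c_sqr /k1 -[X in _ ^+ X](card_ord N) -prodr_const -big_split /=.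
apply: eq_bigr => i _.
by rewrite !invfM mulrACA mulVf ?mul1r// pnatr_eq0.
Qed.

Lemma to0_scale (e : nat -> R) (h : T) : e @ \oo --> (0 : R) ->
  to0 (fun n => scaleT (e n) h).
Proof.
move=> ce i.
have -> : (fun n => tnth (scaleT (e n) h) i) = (fun n => e n * tnth h i).
  by apply/funext => n; rewrite tnth_mktuple.
by rewrite -[X in _ --> X](mul0r (tnth h i)); apply: cvgM => //; exact: cvg_cst.
Qed.

Section Scaled.
Variable e : R.
Hypothesis e0 : 0 < e.
(** As [e] tends to 0, [gk] tends to 1 while the corresponding kernel [ke] concentrates at the
    origin with constant mass. *)
Definition gk xi := wexp (scaleT e xi).
Definition ke z := e^-1 ^+ N * k1 (scaleT e^-1 z).

Let ei0 : 0 < e^-1. Proof. by rewrite invr_gt0. Qed.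

Lemma itg_gk : itg mu gk.
Proof. exact: (II_scaleR e0 (itg_wexp R N)).1. Qed.

Lemma itg_ke : itg mu ke.
Proof. by apply: itgZ; exact: (II_scaleR ei0 itg_k1).1. Qed.

Lemma II_ke : II mu ke = 1.
Proof.
have [i E] := II_scaleR ei0 itg_k1.
by rewrite (IIZ _ i) -E II_k1.
Qed.

Lemma keE z : c ^+ 2 * II mu (fun xi => gk xi * cos (dotN z xi)) = ke z.
Proof.
rewrite /ke -k1E.
have [_ ->] := II_scaleR e0 (itg_cosdot (scaleT e^-1 z) (itg_wexp R N)).
rewrite [RHS]mulrCA; congr (_ * _).
rewrite mulrA -exprMn mulVf ?gt_eqF// expr1n mul1r.
apply: eq_II => xi; congr (_ * cos _); apply: eq_bigr => i _.
by rewrite !tnth_mktuple mulrACA mulVf ?gt_eqF// mul1r.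
Qed.

Lemma ke_scale h : ke (scaleT e h) = e^-1 ^+ N * k1 h.
Proof.
rewrite /ke; congr (_ * k1 _); apply: eq_from_tnth => i.
by rewrite !tnth_mktuple mulKf// gt_eqF.
Qed.

Lemma plancherel_scaled v : L12 v ->
  itg mu (fun xi => gk xi * (FTre v xi ^+ 2 + FTim v xi ^+ 2)) /\
  itg mu (fun h => k1 h * omega v (scaleT e h)) /\
  II mu (fun xi => gk xi * (FTre v xi ^+ 2 + FTim v xi ^+ 2)) =
  II mu (fun x => v x ^+ 2) - 2^-1 * II mu (fun h => k1 h * omega v (scaleT e h)).
Proof.
move=> Lv; have [mv iv i2] := Lv.
have [i1 ->] := FT_weight iv itg_gk.
have ke0 z : 0 <= ke z by rewrite mulr_ge0 ?k1_ge0// exprn_ge0// ltW.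
have keM z : ke z <= e^-1 ^+ N * pi^-1 ^+ N.
  by rewrite ler_wpM2l ?k1_le// exprn_ge0// ltW.
have keN z : ke (oppT z) = ke z.
  rewrite /ke; congr (_ * _); apply: eq_bigr => i _.
  by rewrite !tnth_mktuple mulrN sqrrN.
have [i3 E3] := conv_form ke0 keM itg_ke II_ke keN Lv.
have kom0 h : 0 <= ke h * omega v h.
  by rewrite mulr_ge0//; have /andP[] := omega_le h mv i2.
have [i4 E4] := II_scaleR e0 i3.
have i5 : itg mu (fun h => k1 h * omega v (scaleT e h)).
  have := itgZ (e ^+ N) i4; congr itg; apply/funext => h.
  by rewrite ke_scale !mulrA -exprMn mulfV ?gt_eqF// expr1n mul1r.
split; first exact: i1.
split; first exact: i5.
have -> : II mu (fun h => k1 h * omega v (scaleT e h)) = II mu (fun h => ke h * omega v h).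
  rewrite E4; under [in RHS]eq_II do rewrite ke_scale -mulrA.
  by rewrite (IIZ _ i5) mulrA -exprMn mulfV ?gt_eqF// expr1n mul1r.
rewrite -E3; apply: eq_II => x; congr (_ * _); apply: eq_II => y.
by rewrite keE.
Qed.

End Scaled.

Theorem plancherel v : L12 v ->
  itg mu (fun xi => FTre v xi ^+ 2 + FTim v xi ^+ 2) /\
  II mu (fun xi => FTre v xi ^+ 2 + FTim v xi ^+ 2) = II mu (fun x => v x ^+ 2).
Proof.
move=> Lv; have [mv iv i2] := Lv.
pose e n : R := n.+1%:R^-1.
have e0 n : 0 < e n by rewrite invr_gt0.
have ce : e @ \oo --> (0 : R) := @cvg_harmonic R.
pose S xi := FTre v xi ^+ 2 + FTim v xi ^+ 2.
have S0 xi : 0 <= S xi by rewrite addr_ge0// sqr_ge0.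
have mS : measurable_fun setT S.
  by apply: measurable_funD; apply: measurable_funX; [exact: FTre_meas|exact: FTim_meas].
have gle n xi : gk (e n) xi <= 1.
  apply: le_trans (_ : \prod_(i < N) 1 <= _); last by rewrite big1.
  by apply: ler_prod => i _; rewrite expR_ge0 /= -expR0 ler_expR oppr_le0.
have g0 n xi : 0 <= gk (e n) xi by rewrite ltW// wexp_gt0.
have P n := plancherel_scaled (e0 n) Lv.
have om0 n : 0 <= II mu (fun h => k1 h * omega v (scaleT (e n) h)).
  apply: II_ge0 => h; rewrite mulr_ge0 ?k1_ge0//.
  by have /andP[] := omega_le (scaleT (e n) h) mv i2.
(* The translation term enters the weighted identity with a minus sign, so Fatou yields
   integrability and one inequality. *)
have [iS SM] : itg mu S /\ II mu S <= II mu (fun x => v x ^+ 2).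
  apply: (@II_fatou _ _ _ mu (fun n xi => gk (e n) xi * S xi)) => //.
  - by move=> n; exact: (P n).1.
  - by move=> n xi; rewrite mulr_ge0.
  - apply: aeW => xi; rewrite -[X in _ --> X]mul1r; apply: cvgM; last exact: cvg_cst.
    have -> : 1 = \prod_(i < N) expR (- `|0 * tnth xi i|) :> R.
      by rewrite big1// => i _; rewrite mul0r normr0 oppr0 expR0.
    apply: cvg_prod_ord => i.
    apply: (@cvg_comp _ _ _ _ expR); last exact: continuous_expR.
    apply: cvgN; apply: cvg_norm; under eq_fun do rewrite tnth_mktuple.
    by apply: cvgM => //; exact: cvg_cst.
  - by move=> n; rewrite (P n).2.2; have := om0 n; lra.
split => //; apply/eqP; rewrite eq_le SM /=.
(* Dominated convergence in [h], with [4 |v|_2^2 * k1] as majorant and pointwise limit 0 by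
   continuity of translations. *)
have L : (fun n => II mu (fun h => k1 h * omega v (scaleT (e n) h))) @ \oo --> (0 : R).
  apply: (II_dct0 (g := fun h => 4 * II mu (fun x => v x ^+ 2) * k1 h)).
  - by move=> n; exact: itg_meas (P n).2.1.
  - apply: aeW => h; rewrite -[X in _ --> X](mulr0 (k1 h)); apply: cvgM; first exact: cvg_cst.
    exact: (L2_translation mv i2 (to0_scale h ce)).
  - move=> n h; have /andP[q0 q1] := omega_le (scaleT (e n) h) mv i2.
    rewrite ger0_norm; last by rewrite mulr_ge0 ?k1_ge0.
    by rewrite mulrC ler_wpM2r ?k1_ge0.
  - by apply: itgZ; exact: itg_k1.
apply/ler_addgt0Pl => d d0; have d2 : 0 < 2 * d by rewrite mulr_gt0.
have [m hm] := eps_cvg L d2; have := hm m (leqnn m); rewrite subr0 => /ler_normlW hm'.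
(* The weight is at most 1, so the identity at a small dilation gives the reverse inequality up to
   [d]. *)
have : II mu (fun xi => gk (e m) xi * S xi) <= II mu S.
  apply: II_le; [exact: (P m).1|exact: iS|move=> xi].
  by rewrite -[leRHS]mul1r ler_wpM2r.
rewrite (P m).2.2; lra.
Qed.

End Fourier.

(** * The L2 Fourier transform *)

Lemma eq_cvgR (R : realType) (u v : nat -> R) (l : R) : u =1 v ->
  u @ \oo --> l -> v @ \oo --> l.
Proof. by move=> /funext ->. Qed.

(** * Squared L2 norms and L2 convergence *)

Section L2space.
Context d (T : measurableType d) (R : realType)
  (mu : {measure set T -> \bar R}).
Local Notation itg := (itg mu).
Local Notation II := (II mu).
Implicit Types (a b : T -> R).

Definition L2 a := measurable_fun setT a /\ itg (fun x => a x ^+ 2).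
(** Squared norms are used instead of norms: the triangle inequality becomes a bound with factor 2,
    and no square roots appear. *)
Definition nsq a := II (fun x => a x ^+ 2).
Definition L2cvg (a_ : nat -> T -> R) a :=
  (fun n => nsq (fun x => a_ n x - a x)) @ \oo --> (0 : R).

Lemma nsq_ge0 a : 0 <= nsq a.
Proof. by apply: II_ge0 => x; exact: sqr_ge0. Qed.

Lemma L2_comb a b (p q : R) : L2 a -> L2 b -> L2 (fun x => p * a x + q * b x).
Proof.
move=> [ma ia] [mb ib].
have mpa : measurable_fun setT (fun x => p * a x) by exact: measurable_funM.
have mqb : measurable_fun setT (fun x => q * b x) by exact: measurable_funM.
split; first exact: measurable_funD.
apply: itg_sqrD => //.
  by have := itgZ (p ^+ 2) ia; congr itg; apply/funext => x; rewrite exprMn.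
by have := itgZ (q ^+ 2) ib; congr itg; apply/funext => x; rewrite exprMn.
Qed.

Lemma L2D a b : L2 a -> L2 b -> L2 (fun x => a x + b x).
Proof.
move=> La Lb; have := L2_comb 1 1 La Lb.
by congr L2; apply/funext => x; rewrite !mul1r.
Qed.

Lemma L2B a b : L2 a -> L2 b -> L2 (fun x => a x - b x).
Proof.
move=> La Lb; have := L2_comb 1 (-1) La Lb.
by congr L2; apply/funext => x; rewrite mul1r mulN1r.
Qed.

Lemma L2Z a (p : R) : L2 a -> L2 (fun x => p * a x).
Proof.
move=> La; have := L2_comb p 0 La La.
by congr L2; apply/funext => x; rewrite mul0r addr0.
Qed.

Lemma L2_itgM a b : L2 a -> L2 b -> itg (fun x => a x * b x).
Proof. by move=> [ma ia] [mb ib]; exact: itg_sqrM. Qed.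

Lemma L2_bound a b (M : R) : L2 a -> measurable_fun setT b -> (forall x, `|b x| <= M) ->
  L2 (fun x => b x * a x).
Proof.
move=> [ma ia] mb bM; split; first exact: measurable_funM.
have M0 (x : T) : 0 <= M by apply: le_trans (bM x).
apply: (itg_le _ _ (itgZ (M ^+ 2) ia)).
  by apply: measurable_funX; exact: measurable_funM.
move=> x; rewrite ger0_norm ?sqr_ge0// exprMn ler_wpM2r ?sqr_ge0//.
rewrite -[b x ^+ 2]real_normK ?num_real// ler_pXn2r// nnegrE//.
exact: M0 x.
Qed.

Lemma nsq_comb a b (p q : R) : L2 a -> L2 b ->
  nsq (fun x => p * a x + q * b x) =
  p ^+ 2 * nsq a + 2 * p * q * II (fun x => a x * b x) + q ^+ 2 * nsq b.
Proof.
move=> La Lb; have iab := L2_itgM La Lb; have [_ ia] := La; have [_ ib] := Lb.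
rewrite /nsq -(IIZ _ ia) -(IIZ _ iab) -(IIZ _ ib).
rewrite -(IID (itgZ _ ia) (itgZ _ iab)) -(IID (itgD (itgZ _ ia) (itgZ _ iab)) (itgZ _ ib)).
by apply: eq_II => x; ring.
Qed.

Lemma pair_young a b (e : R) : 0 < e -> L2 a -> L2 b ->
  2 * `|II (fun x => a x * b x)| <= e * nsq a + e^-1 * nsq b.
Proof. by move=> e0 [ma ia] [mb ib]; exact: II_young. Qed.

Lemma nsqB_le a b : L2 a -> L2 b ->
  nsq (fun x => a x - b x) <= 2 * nsq a + 2 * nsq b.
Proof.
move=> La Lb; have := nsq_comb 1 (-1) La Lb.
have -> : (fun x => 1 * a x + -1 * b x) = (fun x => a x - b x).
  by apply/funext => x; rewrite mul1r mulN1r.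
move=> ->; have := pair_young (@ltr01 R) La Lb.
by rewrite invr1; have := ler_norm (- II (fun x => a x * b x)); rewrite normrN; lra.
Qed.

Lemma nsqD_le a b : L2 a -> L2 b ->
  nsq (fun x => a x + b x) <= 2 * nsq a + 2 * nsq b.
Proof.
move=> La Lb; have := nsq_comb 1 1 La Lb.
have -> : (fun x => 1 * a x + 1 * b x) = (fun x => a x + b x).
  by apply/funext => x; rewrite !mul1r.
move=> ->; have := pair_young (@ltr01 R) La Lb.
by rewrite invr1; have := ler_norm (II (fun x => a x * b x)); lra.
Qed.

Lemma nsq_sub_le a b c : L2 a -> L2 b -> L2 c ->
  nsq (fun x => a x - c x) <= 2 * nsq (fun x => a x - b x) + 2 * nsq (fun x => b x - c x).
Proof.
move=> La Lb Lc; have := nsqD_le (L2B La Lb) (L2B Lb Lc).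
by congr (_ <= _); congr nsq; apply/funext => x; ring.
Qed.

Lemma nsq_subC a b : nsq (fun x => a x - b x) = nsq (fun x => b x - a x).
Proof. by apply: eq_II => x; rewrite -sqrrN opprB. Qed.

Lemma squeeze0 (u v : nat -> R) : (forall n, 0 <= u n <= v n) ->
  v @ \oo --> (0 : R) -> u @ \oo --> (0 : R).
Proof.
move=> uv cv; apply: (squeeze_cvgr _ (cvg_cst 0) cv); exact: nearW.
Qed.

Lemma cvg0_lin2 (u v : nat -> R) (p q : R) : u @ \oo --> (0 : R) -> v @ \oo --> (0 : R) ->
  (fun n => p * u n + q * v n) @ \oo --> (0 : R).
Proof.
move=> cu cv; have -> : 0 = p * 0 + q * 0 :> R by rewrite !mulr0 addr0.
by apply: cvgD; apply: cvgM => //; exact: cvg_cst.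
Qed.

Lemma L2cvg_pair (a_ : nat -> T -> R) a b : (forall n, L2 (a_ n)) -> L2 a -> L2 b ->
  L2cvg a_ a -> (fun n => II (fun x => a_ n x * b x)) @ \oo --> II (fun x => a x * b x).
Proof.
move=> La_ La Lb ca; apply: cvg_eps => e e0.
pose eta := e / (nsq b + 1).
have nb := nsq_ge0 b.
have eta0 : 0 < eta by rewrite divr_gt0// ltr_wpDl.
have d0 : 0 < e * eta by rewrite mulr_gt0.
have [m hm] := eps_cvg ca d0; exists m => n mn.
rewrite -(IIB (L2_itgM (La_ n) Lb) (L2_itgM La Lb)).
have -> : II (fun x => a_ n x * b x - a x * b x) = II (fun x => (a_ n x - a x) * b x).
  by apply: eq_II => x; ring.
have i0 : 0 < eta^-1 by rewrite invr_gt0.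
have := pair_young i0 (L2B (La_ n) La) Lb; rewrite invrK.
have := hm n mn; rewrite subr0 => /ler_normlW h1.
have : eta^-1 * nsq (fun x => a_ n x - a x) <= e.
  by rewrite ler_pdivrMl// mulrC.
have : eta * nsq b <= e.
  rewrite /eta mulrAC ler_pdivrMr ?ltr_wpDl//.
  by rewrite ler_wpM2l ?(ltW e0)// lerDl.
lra.
Qed.

Lemma L2cvg_nsq (a_ : nat -> T -> R) a : (forall n, L2 (a_ n)) -> L2 a ->
  L2cvg a_ a -> (fun n => nsq (a_ n)) @ \oo --> nsq a.
Proof.
move=> La_ La ca.
have cp := L2cvg_pair La_ La La ca.
have -> : (fun n => nsq (a_ n)) =
  (fun n => nsq (fun x => a_ n x - a x) + 2 * II (fun x => a_ n x * a x) - nsq a).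
  apply/funext => n; have := nsq_comb 1 (-1) (La_ n) La.
  have -> : (fun x => 1 * a_ n x + -1 * a x) = (fun x => a_ n x - a x).
    by apply/funext => x; rewrite mul1r mulN1r.
  by move=> ->; ring.
have {2}-> : nsq a = 0 + 2 * II (fun x => a x * a x) - nsq a.
  have -> : II (fun x => a x * a x) = nsq a by apply: eq_II => x; rewrite expr2.
  by ring.
by apply: cvgB; [apply: cvgD => //; apply: cvgM => //; exact: cvg_cst|exact: cvg_cst].
Qed.

Lemma L2cvg_unique (a_ : nat -> T -> R) a b : (forall n, L2 (a_ n)) -> L2 a -> L2 b ->
  L2cvg a_ a -> L2cvg a_ b -> {ae mu, forall x, a x = b x}.
Proof.
move=> La_ La Lb ca cb.
have E : nsq (fun x => a x - b x) = 0.
  apply/eqP; rewrite eq_le nsq_ge0 andbT; apply/ler_addgt0Pl => e e0; rewrite addr0.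
  have /eps_cvg/(_ e e0)[m hm] := cvg0_lin2 2 2 ca cb.
  have := hm m (leqnn _); rewrite subr0 => /ler_normlW; apply: le_trans.
  by have := nsq_sub_le La (La_ m) Lb; rewrite (nsq_subC a (a_ m)).
have [_ iab] := L2B La Lb.
have := II_eq0_ae (fun x => sqr_ge0 _) iab E.
by apply: filterS => x /eqP; rewrite sqrf_eq0 subr_eq0 => /eqP.
Qed.

Lemma L2cvg_comb (a_ b_ : nat -> T -> R) a b (p q : R) :
  (forall n, L2 (a_ n)) -> L2 a -> (forall n, L2 (b_ n)) -> L2 b ->
  L2cvg a_ a -> L2cvg b_ b ->
  L2cvg (fun n x => p * a_ n x + q * b_ n x) (fun x => p * a x + q * b x).
Proof.
move=> La_ La Lb_ Lb ca cb.
apply: squeeze0 (cvg0_lin2 (2 * p ^+ 2) (2 * q ^+ 2) ca cb) => n.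
rewrite nsq_ge0 /=.
have LA := L2B (La_ n) La; have LB := L2B (Lb_ n) Lb.
have := nsqD_le (L2Z p LA) (L2Z q LB).
have nZ (r : R) f : L2 f -> nsq (fun x => r * f x) = r ^+ 2 * nsq f.
  by move=> [_ i]; rewrite /nsq -(IIZ _ i); apply: eq_II => x; rewrite exprMn.
rewrite !nZ// !mulrA; apply: le_trans.
by rewrite le_eqVlt; apply/orP; left; apply/eqP; congr nsq; apply/funext => x; ring.
Qed.

End L2space.

(** * The L2 Fourier transform as a limit of transforms of truncations *)

Section FTL2.
Variables (R : realType) (N : nat).
Local Notation T := (N.-tuple R).
Local Notation mu := (muN R N).
Local Notation c := (FTconst R N).
Implicit Types (u v w g : T -> R) (x y z xi : T).

Definition chi (r : R) x : R := if euclN x <= r then 1 else 0.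

Lemma chi01 r x : 0 <= chi r x <= 1.
Proof. by rewrite /chi; case: ifP => _; rewrite ?lexx ?ler01. Qed.

Lemma chi_abs r x : `|chi r x| <= 1.
Proof. by have /andP[h0 h1] := chi01 r x; rewrite ger0_norm. Qed.

Lemma chi_sqr r x : chi r x ^+ 2 = chi r x.
Proof. by rewrite /chi; case: ifP => _; rewrite ?expr1n ?expr0n. Qed.

Lemma meas_chi r : measurable_fun setT (chi r).
Proof.
apply: measurable_fun_ifT => //; apply: measurable_fun_ler => //.
exact: meas_euclN.
Qed.

Lemma dotN_ge0 x : 0 <= dotN x x.
Proof. by apply: sumr_ge0 => i _; rewrite -expr2 sqr_ge0. Qed.

Lemma tnth_le_eucl x i : `|tnth x i| <= euclN x.
Proof.
rewrite -sqrtr_sqr ler_wsqrtr// /dotN (bigD1 i)//= -expr2 lerDl.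
by apply: sumr_ge0 => j _; rewrite -expr2 sqr_ge0.
Qed.

(** On the ball every factor [expR (r - |x_i|)] is at least 1, so a multiple of [wexp] is an
    integrable majorant. *)
Lemma itg_chi r : itg mu (chi r).
Proof.
apply: (itg_le (meas_chi r) _ (itgZ (expR r ^+ N) (itg_wexp R N))) => x.
rewrite ger0_norm; last by have /andP[] := chi01 r x.
rewrite /chi; case: ifPn => xr; last first.
  by rewrite mulr_ge0 ?exprn_ge0 ?expR_ge0// ltW// wexp_gt0.
rewrite -[X in _ ^+ X](card_ord N) -prodr_const /wexp -big_split /=.
apply: le_trans (_ : \prod_(i < N) (1 : R) <= _); first by rewrite big1.
apply: ler_prod => i _; rewrite ler01 /= -expRD -[leLHS]expR0 ler_expR subr_ge0.
exact: le_trans (tnth_le_eucl x i) xr.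
Qed.

Lemma chi_cvg x : (fun k : nat => chi k%:R x) @ \oo --> (1 : R).
Proof.
apply: cvg_eps => e e0; exists (Num.bound (euclN x)) => n mn.
rewrite /chi ifT ?subrr ?normr0 ?(ltW e0)//.
have x0 : 0 <= euclN x by exact: sqrtr_ge0.
by apply: le_trans (ltW (archi_boundP x0)) _; rewrite ler_nat.
Qed.

Lemma truncE u k x : trunc u k x = chi k%:R x * u x.
Proof. by rewrite /trunc /chi; case: ifP => _; rewrite ?mul1r ?mul0r. Qed.

Lemma L12_chi u r : L2 mu u -> L12 (fun x => chi r x * u x).
Proof.
move=> [mu_ iu]; have mc := meas_chi r.
have [m2 i2] := L2_bound (conj mu_ iu) mc (chi_abs r).
split => //; apply: (itg_le m2 _ (itgD (itg_chi r) iu)) => x.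
rewrite normrM; have /andP[h0 h1] := chi01 r x; rewrite (ger0_norm h0).
rewrite -[u x ^+ 2]real_normK ?num_real//; have := normr_ge0 (u x).
rewrite /chi; case: ifP => _ n0; rewrite ?mul1r ?mul0r ?add0r ?sqr_ge0//.
by have := sqr_ge0 (`|u x| - 1); nra.
Qed.

Lemma L12_trunc u k : L2 mu u -> L12 (trunc u k).
Proof.
move=> Lu; have := L12_chi k%:R Lu.
by congr L12; apply/funext => x; rewrite truncE.
Qed.

Lemma L12_L2 u : L12 u -> L2 mu u.
Proof. by case. Qed.

Lemma trunc_L2cvg u : L2 mu u -> L2cvg mu (trunc u) u.
Proof.
move=> Lu; have [mu_ iu] := Lu; apply: (II_dct0 (g := fun x => u x ^+ 2)).
- by move=> n; exact: itg_meas (L2B (L12_L2 (L12_trunc n Lu)) Lu).2.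
- apply: aeW => x.
  have c1 : (fun n => trunc u n x - u x) @ \oo --> (0 : R).
    rewrite -(subrr (u x)); apply: cvgB; last exact: cvg_cst.
    have -> : (fun n => trunc u n x) = (fun n => chi n%:R x * u x).
      by apply/funext => n; rewrite truncE.
    rewrite -[X in _ --> X]mul1r; apply: cvgM; last exact: cvg_cst.
    exact: chi_cvg.
  rewrite -(mulr0 (0 : R)); under eq_fun do rewrite expr2.
  exact: cvgM.
- move=> n x; rewrite ger0_norm ?sqr_ge0// truncE /chi.
  by case: ifP => _; rewrite ?mul1r ?mul0r ?subrr ?expr0n ?sqr_ge0// sub0r sqrrN.
- exact: iu.
Qed.

Lemma L12_comb u v (a b : R) : L12 u -> L12 v -> L12 (fun x => a * u x + b * v x).
Proof.
move=> Lu Lv; have [m i] := L2_comb a b (L12_L2 Lu) (L12_L2 Lv).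
have [_ iu _] := Lu; have [_ iv _] := Lv.
by split => //; apply: itgD; exact: itgZ.
Qed.

Lemma L12B u v : L12 u -> L12 v -> L12 (fun x => u x - v x).
Proof.
move=> Lu Lv; have := L12_comb 1 (-1) Lu Lv.
by congr L12; apply/funext => x; rewrite mul1r mulN1r.
Qed.

Lemma FTre_comb u v (a b : R) xi : itg mu u -> itg mu v ->
  FTre (fun x => a * u x + b * v x) xi = a * FTre u xi + b * FTre v xi.
Proof.
move=> iu iv; have iuv := itgD (itgZ a iu) (itgZ b iv).
have ic h : itg mu h -> itg mu (fun x => h x * cos (dotN x xi)).
  by move=> ih; under eq_fun do rewrite dotNC; exact: itg_cosdot.
rewrite (FTreE _ iuv) (FTreE _ iu) (FTreE _ iv) [RHS](_ : _ =
  c * (a * II mu (fun x => u x * cos (dotN x xi)) +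
       b * II mu (fun x => v x * cos (dotN x xi)))); last by ring.
rewrite -(IIZ _ (ic _ iu)) -(IIZ _ (ic _ iv)) -(IID (itgZ _ (ic _ iu)) (itgZ _ (ic _ iv))).
by congr (_ * _); apply: eq_II => x; ring.
Qed.

Lemma FTim_comb u v (a b : R) xi : itg mu u -> itg mu v ->
  FTim (fun x => a * u x + b * v x) xi = a * FTim u xi + b * FTim v xi.
Proof.
move=> iu iv; have iuv := itgD (itgZ a iu) (itgZ b iv).
have ic h : itg mu h -> itg mu (fun x => h x * sin (dotN x xi)).
  by move=> ih; under eq_fun do rewrite dotNC; exact: itg_sindot.
rewrite (FTimE _ iuv) (FTimE _ iu) (FTimE _ iv) [RHS](_ : _ =
  - (c * (a * II mu (fun x => u x * sin (dotN x xi)) +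
       b * II mu (fun x => v x * sin (dotN x xi))))); last by ring.
rewrite -(IIZ _ (ic _ iu)) -(IIZ _ (ic _ iv)) -(IID (itgZ _ (ic _ iu)) (itgZ _ (ic _ iv))).
by congr (- (_ * _)); apply: eq_II => x; ring.
Qed.

Lemma L2_FT u : L12 u -> L2 mu (FTre u) /\ L2 mu (FTim u).
Proof.
move=> Lu; have [_ iu _] := Lu; have [ip _] := plancherel Lu.
have mr := FTre_meas iu; have mi := FTim_meas iu.
split; split => //; apply: itg_le ip; try exact: measurable_funX.
  by move=> xi; rewrite ger0_norm ?sqr_ge0// lerDl sqr_ge0.
by move=> xi; rewrite ger0_norm ?sqr_ge0// lerDr sqr_ge0.
Qed.

Lemma nsq_FT u : L12 u -> nsq mu (FTre u) + nsq mu (FTim u) = nsq mu u.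
Proof.
move=> Lu; have [[_ ir] [_ ii]] := L2_FT Lu; have [_ E] := plancherel Lu.
by rewrite /nsq -E (IID ir ii).
Qed.

Lemma nsq_FTB u v : L12 u -> L12 v ->
  nsq mu (fun xi => FTre u xi - FTre v xi) + nsq mu (fun xi => FTim u xi - FTim v xi) =
  nsq mu (fun x => u x - v x).
Proof.
move=> Lu Lv; rewrite -(nsq_FT (L12B Lu Lv)).
have [_ iu _] := Lu; have [_ iv _] := Lv.
have E : (fun x => u x - v x) = (fun x => 1 * u x + -1 * v x).
  by apply/funext => x; rewrite mul1r mulN1r.
congr (_ + _); congr nsq; apply/funext => xi; rewrite E.
  by rewrite (FTre_comb _ _ _ iu iv) mul1r mulN1r.
by rewrite (FTim_comb _ _ _ iu iv) mul1r mulN1r.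
Qed.

(** Equivalent to [is_FT] for square integrable [u], but with square integrability stated and the
    two parts converging separately. *)
Definition FTL2 u gr gi := [/\ L2 mu gr, L2 mu gi,
  L2cvg mu (fun k => FTre (trunc u k)) gr & L2cvg mu (fun k => FTim (trunc u k)) gi].

Lemma FTL2_isFT u gr gi : L2 mu u -> FTL2 u gr gi -> is_FT u gr gi.
Proof.
move=> Lu [Lr Li cr ci]; split; first exact: Lr.1.
split; first exact: Li.1.
have L k := L2_FT (L12_trunc k Lu).
have Ik k : (iintN (fun xi => ((FTre (trunc u k) xi - gr xi) ^+ 2 +
    (FTim (trunc u k) xi - gi xi) ^+ 2)%:E) =
    (nsq mu (fun xi => FTre (trunc u k) xi - gr xi) +
     nsq mu (fun xi => FTim (trunc u k) xi - gi xi))%:E)%E.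
  have ir := (L2B (L k).1 Lr).2; have ii := (L2B (L k).2 Li).2.
  rewrite (iintN_EFin (itgD ir ii)); first by rewrite (IID ir ii).
  by move=> x; rewrite addr_ge0 ?sqr_ge0.
under eq_fun do rewrite Ik.
apply: cvg_EFin; first exact: nearW.
rewrite -[X in _ --> X](addr0 0); exact: cvgD.
Qed.

Lemma isFT_FTL2 u gr gi : L2 mu u -> is_FT u gr gi -> FTL2 u gr gi.
Proof.
move=> Lu [mr [mi cv]]; have L k := L2_FT (L12_trunc k Lu).
pose Q k xi := (FTre (trunc u k) xi - gr xi) ^+ 2 + (FTim (trunc u k) xi - gi xi) ^+ 2.
have mQ k : measurable_fun setT (Q k).
  by apply: measurable_funD; apply: measurable_funX; apply: measurable_funB => //;
    [exact: (L k).1.1|exact: (L k).2.1].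
have Q0 k xi : 0 <= Q k xi by rewrite addr_ge0 ?sqr_ge0.
(* Convergence to 0 in the extended reals makes the integrals finite only from some index [m] on;
   that single index already shows that [gr] and [gi] are square integrable. *)
have [fin cv'] := (fine_cvgP _ _).1 cv.
have [m _ hm] := fin.
have iQ k : (m <= k)%N -> itg mu (Q k).
  move=> mk; apply: iintN_itg => //; rewrite ltey_eq.
  by have := hm k mk => /= ->.
have sq (a b : T -> R) : L2 mu b -> measurable_fun setT a ->
    itg mu (fun x => (b x - a x) ^+ 2) -> L2 mu a.
  move=> Lb ma iab; have := L2B Lb (conj (measurable_funB Lb.1 ma) iab).
  by congr L2; apply/funext => x /=; ring.
have imr k : (m <= k)%N -> itg mu (fun x => (FTre (trunc u k) x - gr x) ^+ 2).
  move=> mk; apply: itg_le (iQ k mk).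
    by apply: measurable_funX; apply: measurable_funB => //; exact: (L k).1.1.
  by move=> x; rewrite ger0_norm ?sqr_ge0// lerDl sqr_ge0.
have imi k : (m <= k)%N -> itg mu (fun x => (FTim (trunc u k) x - gi x) ^+ 2).
  move=> mk; apply: itg_le (iQ k mk).
    by apply: measurable_funX; apply: measurable_funB => //; exact: (L k).2.1.
  by move=> x; rewrite ger0_norm ?sqr_ge0// lerDr sqr_ge0.
have Lr := sq _ _ (L m).1 mr (imr m (leqnn _)).
have Li := sq _ _ (L m).2 mi (imi m (leqnn _)).
have E k : fine (iintN (fun xi => (Q k xi)%:E)) =
    nsq mu (fun xi => FTre (trunc u k) xi - gr xi) +
    nsq mu (fun xi => FTim (trunc u k) xi - gi xi).
  have ir := (L2B (L k).1 Lr).2; have ii := (L2B (L k).2 Li).2.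
  rewrite /Q (iintN_EFin (itgD ir ii)); last exact: (Q0 k).
  by rewrite -[RHS](IID ir ii).
have cE : (fun k => nsq mu (fun xi => FTre (trunc u k) xi - gr xi) +
    nsq mu (fun xi => FTim (trunc u k) xi - gi xi)) @ \oo --> (0 : R).
  by under eq_fun do rewrite -E; exact: cv'.
split => //; apply: squeeze0 cE => n; rewrite nsq_ge0 /=.
  by rewrite lerDl nsq_ge0.
by rewrite lerDr nsq_ge0.
Qed.

(** Any approximating sequence computes the transform: by Plancherel the transforms of [v_ k] and of
    the truncations differ by as much as the functions themselves. *)
Lemma FTL2_approx u gr gi (v_ : nat -> T -> R) : L2 mu u -> (forall k, L12 (v_ k)) ->
  L2cvg mu v_ u -> L2 mu gr -> L2 mu gi ->
  L2cvg mu (fun k => FTre (v_ k)) gr -> L2cvg mu (fun k => FTim (v_ k)) gi ->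
  FTL2 u gr gi.
Proof.
move=> Lu Lv cv Lr Li cr ci.
have Lt k := L12_trunc k Lu.
have ct := trunc_L2cvg Lu.
have cd : (fun k => nsq mu (fun x => trunc u k x - v_ k x)) @ \oo --> (0 : R).
  apply: squeeze0 (cvg0_lin2 2 2 ct cv) => k; rewrite nsq_ge0 /=.
  by rewrite (nsq_subC mu (v_ k)); apply: nsq_sub_le => //; exact: L12_L2.
split; [exact: Lr|exact: Li| |].
- apply: squeeze0 (cvg0_lin2 2 2 cd cr) => k; rewrite nsq_ge0 /=.
  apply: le_trans (nsq_sub_le (L2_FT (Lt k)).1 (L2_FT (Lv k)).1 Lr) _.
  rewrite lerD2r ler_pM2l// -(nsq_FTB (Lt k) (Lv k)).
  by rewrite lerDl nsq_ge0.
- apply: squeeze0 (cvg0_lin2 2 2 cd ci) => k; rewrite nsq_ge0 /=.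
  apply: le_trans (nsq_sub_le (L2_FT (Lt k)).2 (L2_FT (Lv k)).2 Li) _.
  rewrite lerD2r ler_pM2l// -(nsq_FTB (Lt k) (Lv k)).
  by rewrite lerDr nsq_ge0.
Qed.

Lemma FTL2_L12 u : L12 u -> FTL2 u (FTre u) (FTim u).
Proof.
move=> Lu; have [Lr Li] := L2_FT Lu.
have z (a : T -> R) : L2cvg mu (fun=> a) a.
  rewrite /L2cvg (_ : (fun _ => _) = (fun=> 0)); first exact: cvg_cst.
  apply/funext => n; rewrite /nsq -[RHS](@II_cst0 _ _ _ mu).
  by apply: eq_II => x; rewrite subrr expr0n.
exact: (@FTL2_approx _ _ _ (fun=> u) (L12_L2 Lu) (fun=> Lu) (z u) Lr Li (z _) (z _)).
Qed.

Lemma FTL2_exists u : L2 mu u -> exists gr gi, FTL2 u gr gi.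
Proof.
move=> Lu; have L k := L2_FT (L12_trunc k Lu).
have ct := trunc_L2cvg Lu.
have cau (e : R) : 0 < e -> exists m, forall i j, (m <= i)%N -> (m <= j)%N ->
   nsq mu (fun x => trunc u i x - trunc u j x) <= e.
  move=> e0; have e4 : 0 < e / 4 by rewrite divr_gt0.
  have [m hm] := eps_cvg ct e4; exists m => i j mi mj.
  have := hm i mi; have := hm j mj; rewrite !subr0 => /ler_normlW hj /ler_normlW hi.
  have Li := L12_L2 (L12_trunc i Lu); have Lj := L12_L2 (L12_trunc j Lu).
  have := nsq_sub_le Li Lu Lj; rewrite (nsq_subC mu u); lra.
have [|gr [mr ir cr]] := @L2_complete _ _ _ mu (fun k => FTre (trunc u k))
  (fun k => (L k).1.1) (fun k => (L k).1.2).
  move=> e /cau[m hm]; exists m => i j mi mj; apply: le_trans (hm i j mi mj).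
  by rewrite -(nsq_FTB (L12_trunc i Lu) (L12_trunc j Lu)) lerDl nsq_ge0.
have [|gi [mi ii ci]] := @L2_complete _ _ _ mu (fun k => FTim (trunc u k))
  (fun k => (L k).2.1) (fun k => (L k).2.2).
  move=> e /cau[m hm]; exists m => i j mi mj; apply: le_trans (hm i j mi mj).
  by rewrite -(nsq_FTB (L12_trunc i Lu) (L12_trunc j Lu)) lerDr nsq_ge0.
by exists gr, gi; split.
Qed.

Lemma FTL2_unique u gr gi hr hi : L2 mu u -> FTL2 u gr gi -> FTL2 u hr hi ->
  {ae mu, forall xi, gr xi = hr xi} /\ {ae mu, forall xi, gi xi = hi xi}.
Proof.
move=> Lu [Lr Li cr ci] [Lr' Li' cr' ci']; have L k := L2_FT (L12_trunc k Lu).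
split; first exact: L2cvg_unique (fun k => (L k).1) Lr Lr' cr cr'.
exact: L2cvg_unique (fun k => (L k).2) Li Li' ci ci'.
Qed.

Lemma FTL2_comb u v gr gi hr hi (a b : R) : L2 mu u -> L2 mu v ->
  FTL2 u gr gi -> FTL2 v hr hi ->
  FTL2 (fun x => a * u x + b * v x) (fun xi => a * gr xi + b * hr xi)
    (fun xi => a * gi xi + b * hi xi).
Proof.
move=> Lu Lv [Lr Li cr ci] [Lr' Li' cr' ci'].
have L k := L2_FT (L12_trunc k Lu); have L' k := L2_FT (L12_trunc k Lv).
have Et k : trunc (fun x => a * u x + b * v x) k =
    (fun x => a * trunc u k x + b * trunc v k x).
  by apply/funext => x; rewrite !truncE; ring.
have iu k : itg mu (trunc u k) by case: (L12_trunc k Lu).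
have iv k : itg mu (trunc v k) by case: (L12_trunc k Lv).
split; [exact: L2_comb|exact: L2_comb| |].
- have -> : (fun k => FTre (trunc (fun x => a * u x + b * v x) k)) =
     (fun k xi => a * FTre (trunc u k) xi + b * FTre (trunc v k) xi).
    by apply/funext => k; apply/funext => xi; rewrite Et (FTre_comb _ _ _ (iu k) (iv k)).
  exact: L2cvg_comb (fun k => (L k).1) Lr (fun k => (L' k).1) Lr' cr cr'.
- have -> : (fun k => FTim (trunc (fun x => a * u x + b * v x) k)) =
     (fun k xi => a * FTim (trunc u k) xi + b * FTim (trunc v k) xi).
    by apply/funext => k; apply/funext => xi; rewrite Et (FTim_comb _ _ _ (iu k) (iv k)).
  exact: L2cvg_comb (fun k => (L k).2) Li (fun k => (L' k).2) Li' ci ci'.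
Qed.

Lemma FTL2_nsq u gr gi : L2 mu u -> FTL2 u gr gi -> nsq mu gr + nsq mu gi = nsq mu u.
Proof.
move=> Lu [Lr Li cr ci]; have L k := L2_FT (L12_trunc k Lu).
have c1 := L2cvg_nsq (fun k => L12_L2 (L12_trunc k Lu)) Lu (trunc_L2cvg Lu).
have c2 : (fun k => nsq mu (FTre (trunc u k)) + nsq mu (FTim (trunc u k))) @ \oo -->
    nsq mu gr + nsq mu gi.
  by apply: cvgD; [exact: L2cvg_nsq (fun k => (L k).1) Lr cr|
    exact: L2cvg_nsq (fun k => (L k).2) Li ci].
apply: cvgn_uniqueR c2 _; apply: eq_cvgR c1 => k.
by rewrite -(nsq_FT (L12_trunc k Lu)).
Qed.

Lemma FTL2_adj u gr gi phi : L2 mu u -> FTL2 u gr gi -> L12 phi ->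
  II mu (fun xi => gr xi * phi xi) = II mu (fun x => u x * FTre phi x) /\
  II mu (fun xi => gi xi * phi xi) = II mu (fun x => u x * FTim phi x).
Proof.
move=> Lu [Lr Li cr ci] Lp; have L k := L2_FT (L12_trunc k Lu).
have Lt k := L12_L2 (L12_trunc k Lu); have ct := trunc_L2cvg Lu.
have [Lpr Lpi] := L2_FT Lp; have Lp2 := L12_L2 Lp.
have [_ ip _] := Lp.
have it k : itg mu (trunc u k) by case: (L12_trunc k Lu).
split.
- apply: cvgn_uniqueR (L2cvg_pair (fun k => (L k).1) Lr Lp2 cr) _.
  apply: eq_cvgR (L2cvg_pair Lt Lu Lpr ct) => k.
  by rewrite (FTre_adj (it k) ip).
- apply: cvgn_uniqueR (L2cvg_pair (fun k => (L k).2) Li Lp2 ci) _.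
  apply: eq_cvgR (L2cvg_pair Lt Lu Lpi ct) => k.
  by rewrite (FTim_adj (it k) ip).
Qed.

Lemma L2_shift u (h : T) : L2 mu u -> L2 mu (fun x => u (addT x h)).
Proof.
move=> [mu_ iu]; split; first exact: meas_shift.
exact: (itg_shift h iu).
Qed.

Lemma nsq_shift u (h : T) : L2 mu u -> nsq mu (fun x => u (addT x h)) = nsq mu u.
Proof. by move=> [_ iu]; rewrite /nsq (II_shift h iu). Qed.

Lemma FT_shift v (h : T) xi : itg mu v ->
  FTre (fun x => v (addT x h)) xi = cos (dotN h xi) * FTre v xi - sin (dotN h xi) * FTim v xi /\
  FTim (fun x => v (addT x h)) xi = cos (dotN h xi) * FTim v xi + sin (dotN h xi) * FTre v xi.
Proof.
move=> iv; have ivh := itg_shift h iv.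
have ic : itg mu (fun x => v x * cos (dotN x xi)).
  by under eq_fun do rewrite dotNC; exact: itg_cosdot.
have is_ : itg mu (fun x => v x * sin (dotN x xi)).
  by under eq_fun do rewrite dotNC; exact: itg_sindot.
pose H (tr : R -> R) x := v x * tr (dotN x xi - dotN h xi).
have HE tr : (fun x => v (addT x h) * tr (dotN x xi)) = (fun x => H tr (addT x h)).
  by apply/funext => x; rewrite /H dotN_addl addrK.
have Hc : H cos = (fun x => cos (dotN h xi) * (v x * cos (dotN x xi)) +
    sin (dotN h xi) * (v x * sin (dotN x xi))).
  by apply/funext => x; rewrite /H cosB; ring.
have Hs : H sin = (fun x => cos (dotN h xi) * (v x * sin (dotN x xi)) -
    sin (dotN h xi) * (v x * cos (dotN x xi))).
  by apply/funext => x; rewrite /H sinB; ring.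
have iHc : itg mu (H cos) by rewrite Hc; apply: itgD; exact: itgZ.
have iHs : itg mu (H sin) by rewrite Hs; apply: itgB; exact: itgZ.
rewrite (FTreE _ ivh) (FTimE _ ivh) (FTreE _ iv) (FTimE _ iv) !HE.
rewrite (II_shift h iHc) (II_shift h iHs) Hc Hs.
rewrite (IID (itgZ _ ic) (itgZ _ is_)) (IIB (itgZ _ is_) (itgZ _ ic)).
rewrite !(IIZ _ ic) !(IIZ _ is_).
by split; ring.
Qed.

Section Rotation.
Variables (h : T) (gr gi : T -> R).
(** Real part of the product of [gr + i gi] with [exp (i h . xi)], the effect of a translation by
    [h] on a transform; [rotim] is the imaginary part. *)
Definition rotre xi := cos (dotN h xi) * gr xi - sin (dotN h xi) * gi xi.
Definition rotim xi := cos (dotN h xi) * gi xi + sin (dotN h xi) * gr xi.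
End Rotation.

Lemma L2_rot (h : T) gr gi : L2 mu gr -> L2 mu gi ->
  [/\ L2 mu (rotre h gr gi), L2 mu (rotim h gr gi) &
   nsq mu (rotre h gr gi) + nsq mu (rotim h gr gi) = nsq mu gr + nsq mu gi].
Proof.
move=> Lr Li.
have mc := meas_cosdot h; have ms := meas_sindot h.
have bc xi := cos_abs_le1 (dotN h xi); have bs xi := sin_abs_le1 (dotN h xi).
have L1 := L2B (L2_bound Lr mc bc) (L2_bound Li ms bs).
have L2' := L2D (L2_bound Li mc bc) (L2_bound Lr ms bs).
split => //.
rewrite /nsq -(IID L1.2 L2'.2) -(IID Lr.2 Li.2); apply: eq_II => xi; rewrite /rotre /rotim.
have := cos2Dsin2 (dotN h xi); move: (cos _) (sin _) => p q pq.
rewrite -[RHS]mul1r -pq; ring.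
Qed.

(** Truncation does not commute with translation, so the translated truncations serve as the
    approximating sequence. *)
Lemma FTL2_shift u gr gi (h : T) : L2 mu u -> FTL2 u gr gi ->
  FTL2 (fun x => u (addT x h)) (rotre h gr gi) (rotim h gr gi).
Proof.
move=> Lu [Lr Li cr ci]; have [Lr' Li' _] := L2_rot h Lr Li.
have L k := L2_FT (L12_trunc k Lu).
have it k : itg mu (trunc u k) by case: (L12_trunc k Lu).
pose v_ k x := trunc u k (addT x h).
have Lv k : L12 (v_ k).
  have [m i] := L2_shift h (L12_L2 (L12_trunc k Lu)).
  by split => //; exact: (itg_shift h (it k)).
have D k : nsq mu (fun xi => FTre (v_ k) xi - rotre h gr gi xi) +
    nsq mu (fun xi => FTim (v_ k) xi - rotim h gr gi xi) =
    nsq mu (fun xi => FTre (trunc u k) xi - gr xi) +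
    nsq mu (fun xi => FTim (trunc u k) xi - gi xi).
  have [_ _ <-] := L2_rot h (L2B (L k).1 Lr) (L2B (L k).2 Li).
  congr (_ + _); congr nsq; apply/funext => xi.
    by rewrite (FT_shift h xi (it k)).1 /rotre; ring.
  by rewrite (FT_shift h xi (it k)).2 /rotim; ring.
have cD : (fun k => nsq mu (fun xi => FTre (trunc u k) xi - gr xi) +
    nsq mu (fun xi => FTim (trunc u k) xi - gi xi)) @ \oo --> (0 : R).
  by rewrite -[X in _ --> X](addr0 0); exact: cvgD.
apply: (FTL2_approx (v_ := v_)) => //; first exact: L2_shift.
- apply: eq_cvgR (trunc_L2cvg Lu) => k.
  by rewrite -(nsq_shift h (L2B (L12_L2 (L12_trunc k Lu)) Lu)).
- apply: squeeze0 cD => k; rewrite nsq_ge0 /=.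
  by rewrite -(D k) lerDl nsq_ge0.
- apply: squeeze0 cD => k; rewrite nsq_ge0 /=.
  by rewrite -(D k) lerDr nsq_ge0.
Qed.

(** Plancherel for the difference, with [|exp (i a) - 1|^2 = 2 - 2 cos a]. *)
Lemma omega_FT u gr gi (h : T) : L2 mu u -> FTL2 u gr gi ->
  itg mu (fun xi => (2 - 2 * cos (dotN h xi)) * (gr xi ^+ 2 + gi xi ^+ 2)) /\
  omega u h = II mu (fun xi => (2 - 2 * cos (dotN h xi)) * (gr xi ^+ 2 + gi xi ^+ 2)).
Proof.
move=> Lu Fu; have [Lr Li _ _] := Fu; have Fh := FTL2_shift h Lu Fu.
have Lh := L2_shift h Lu; have [Lr' Li' _ _] := Fh.
have Fd := FTL2_comb 1 (-1) Lh Lu Fh Fu.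
have Ld := L2_comb 1 (-1) Lh Lu; have Lrd := L2_comb 1 (-1) Lr' Lr.
have Lid := L2_comb 1 (-1) Li' Li.
have E : (fun xi => (1 * rotre h gr gi xi + -1 * gr xi) ^+ 2 +
    (1 * rotim h gr gi xi + -1 * gi xi) ^+ 2) =
  (fun xi => (2 - 2 * cos (dotN h xi)) * (gr xi ^+ 2 + gi xi ^+ 2)).
  apply/funext => xi; rewrite /rotre /rotim.
  have := cos2Dsin2 (dotN h xi); move: (cos _) (sin _) => p q pq.
  transitivity ((p ^+ 2 + q ^+ 2 + 1 - 2 * p) * (gr xi ^+ 2 + gi xi ^+ 2)); first by ring.
  by rewrite pq; ring.
rewrite -E; split; first exact: itgD Lrd.2 Lid.2.
rewrite (IID Lrd.2 Lid.2); have := FTL2_nsq Ld Fd; rewrite /nsq => ->.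
by apply: eq_II => x; rewrite mul1r mulN1r.
Qed.

End FTL2.

(** * The kinetic energy *)

Section SequenceLimits.
Variable R : realType.
Implicit Types (u v : nat -> R) (a b c : R).

Lemma cvgRD u v a b : u @ \oo --> a -> v @ \oo --> b ->
  (fun n => u n + v n) @ \oo --> a + b.
Proof. by move=> ua vb; exact: (cvgD ua vb). Qed.

Lemma cvgRZ u a c : u @ \oo --> a -> (fun n => c * u n) @ \oo --> c * a.
Proof. by move=> ua; exact: (cvgM (cvg_cst c) ua). Qed.
Arguments cvgRZ {u a} c _.

Lemma cvgR_cst c : (fun _ : nat => c) @ \oo --> c.
Proof. exact: cvg_cst. Qed.

Lemma cvgR_le u a b : u @ \oo --> a -> (forall n, u n <= b) -> a <= b.
Proof.
move=> ua ub; apply/ler_addgt0Pr => e /(eps_cvg ua)[m /(_ _ (leqnn m))].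
by rewrite ler_norml => /andP[h _]; have := ub m; lra.
Qed.

Lemma cvgR_ge u a b : u @ \oo --> a -> (forall n, b <= u n) -> b <= a.
Proof.
move=> ua ub; apply/ler_addgt0Pr => e /(eps_cvg ua)[m /(_ _ (leqnn m))].
by rewrite ler_norml => /andP[_ h]; have := ub m; lra.
Qed.

End SequenceLimits.
Arguments cvgR_cst {R} c.
Arguments cvgRZ {R u a} c _.

Section Trig.
Variable R : realType.

Lemma abs_sin_le (x : R) : `|sin x| <= `|x|.
Proof.
wlog x0 : x / 0 <= x.
  move=> H; have [/H//|x0] := lerP 0 x.
  have nx : 0 <= - x by rewrite oppr_ge0 ltW.
  by have := H _ nx; rewrite sinN !normrN.
have [|c _] := @MVT_segment R sin cos 0 x x0 (fun y _ => is_derive_sin y).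
  by apply: continuous_subspaceT; exact: continuous_sin.
rewrite sin0 !subr0 => ->; rewrite normrM -[leRHS]mul1r ler_wpM2r//.
exact: cos_abs_le1.
Qed.

Lemma two_sub_cos (a : R) : 0 <= 2 - 2 * cos a <= a ^+ 2.
Proof.
have -> : 2 - 2 * cos a = 4 * sin (a / 2) ^+ 2.
  rewrite -{1}[a](divfK (_ : 2 != 0 :> R))// mulr_natr cos_mulr2n.
  have := cos2Dsin2 (a / 2); move: (cos _) (sin _) => p q pq.
  have -> : p ^+ 2 = 1 - q ^+ 2 by lra.
  by rewrite !mulr2n; ring.
rewrite mulr_ge0 ?sqr_ge0//=.
have := abs_sin_le (a / 2).
rewrite -ler_sqr ?nnegrE// !real_normK ?num_real//; rewrite exprMn; lra.
Qed.

(** For [r >= 1] the trivial bound 4 is enough; for [r < 1] the left side is at most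
    [a^2 <= r^2 <= r^(2s)], because [2s <= 2]. *)
Lemma two_sub_cos_powR (a s r : R) : 0 < s < 1 -> 0 <= r -> `|a| <= r ->
  2 - 2 * cos a <= 4 * r `^ (2 * s).
Proof.
move=> /andP[s0 s1] r0 ar; have /andP[h0 h1] := two_sub_cos a.
have [r1|r1] := lerP 1 r.
  have : 1 <= r `^ (2 * s) by rewrite -[leLHS](powRr0 r) ler_powR// mulr_ge0// ltW.
  by have := cos_geN1 a; lra.
have ar2 : a ^+ 2 <= r ^+ 2.
  by rewrite -[a ^+ 2]real_normK ?num_real// ler_pXn2r// nnegrE.
have rr : r ^+ 2 <= r `^ (2 * s).
  have [->|rn0] := eqVneq r 0; first by rewrite expr0n powR_ge0.
  have rp : 0 < r by rewrite lt_neqAle eq_sym rn0.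
  rewrite -powR_mulrn//; apply: ger_powR; first by rewrite rp ltW.
  by rewrite -[leRHS]mulr1 ler_pM2l// ltW.
by have := powR_ge0 r (2 * s); lra.
Qed.

End Trig.

(** * The quadratic form of the kinetic energy *)

Section Kinetic.
Variables (R : realType) (N : nat) (s : R).
Hypothesis s01 : 0 < s < 1.
Local Notation T := (N.-tuple R).
Local Notation mu := (muN R N).
Implicit Types (u v w g : T -> R) (x y z xi : T).

Definition wt xi : R := powR (euclN xi) (2 * s).

Lemma wt_ge0 xi : 0 <= wt xi. Proof. exact: powR_ge0. Qed.

Lemma meas_wt : measurable_fun setT wt.
Proof.
apply: (@measurableT_comp _ _ _ _ _ _ (@powR R ^~ (2 * s))).
  exact: measurable_powR.
exact: meas_euclN.
Qed.

Definition kdens gr gi xi := wt xi * (gr xi ^+ 2 + gi xi ^+ 2).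

Lemma kdens_ge0 gr gi xi : 0 <= kdens gr gi xi.
Proof. by rewrite mulr_ge0 ?wt_ge0// addr_ge0 ?sqr_ge0. Qed.

Lemma meas_kdens gr gi : measurable_fun setT gr -> measurable_fun setT gi ->
  measurable_fun setT (kdens gr gi).
Proof.
move=> mr mi; apply: measurable_funM; first exact: meas_wt.
by apply: measurable_funD; exact: measurable_funX.
Qed.

(** All transforms of [u] agree almost everywhere, so the infimum in [kineticE] runs over a single
    value. *)
Lemma kineticE_FT u gr gi : L2 mu u -> FTL2 u gr gi ->
  (kineticE s u = \int[mu]_xi (kdens gr gi xi)%:E)%E.
Proof.
move=> Lu Fu; have [[mr _] [mi _] _ _] := Fu.
have E (hr hi : T -> R) : measurable_fun setT hr -> measurable_fun setT hi ->
  (iintN (fun xi => (powR (euclN xi) (2 * s) * (hr xi ^+ 2 + hi xi ^+ 2))%:E) =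
   \int[mu]_xi (kdens hr hi xi)%:E)%E.
  move=> mhr mhi; apply: iintN_muN.
    by apply/measurable_EFinP; exact: meas_kdens.
  by move=> xi; rewrite lee_fin kdens_ge0.
rewrite /kineticE -[RHS]ereal_inf1; congr ereal_inf; apply/seteqP; split => e /=.
  move=> [hr [hi [Fh ->]]]; have [mhr [mhi _]] := Fh.
  have [ar ai] := FTL2_unique Lu (isFT_FTL2 Lu Fh) Fu.
  rewrite E//; apply: ge0_ae_eq_integral => //.
  - by apply/measurable_EFinP; exact: meas_kdens.
  - by apply/measurable_EFinP; exact: meas_kdens.
  - by move=> xi _; rewrite lee_fin kdens_ge0.
  - by move=> xi _; rewrite lee_fin kdens_ge0.
  - by apply: filterS2 ar ai => xi; rewrite /kdens => -> -> _.
move=> ->; exists gr, gi; split; first exact: FTL2_isFT.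
by rewrite E.
Qed.

Definition Hs u := L2 mu u /\ (kineticE s u < +oo)%E.
Definition Kin u := fine (kineticE s u).

Lemma HsP u gr gi : L2 mu u -> FTL2 u gr gi -> Hs u <-> itg mu (kdens gr gi).
Proof.
move=> Lu Fu; have [[mr _] [mi _] _ _] := Fu; have mk := meas_kdens mr mi.
split=> [[_]|ik].
  by rewrite (kineticE_FT Lu Fu) => ?; apply: itg_ge0 => // xi; exact: kdens_ge0.
by split => //; rewrite (kineticE_FT Lu Fu) -(II_EFin ik) ltry.
Qed.

Lemma KinE u gr gi : L2 mu u -> FTL2 u gr gi -> itg mu (kdens gr gi) ->
  Kin u = II mu (kdens gr gi).
Proof. by move=> Lu Fu ik; rewrite /Kin (kineticE_FT Lu Fu) -(II_EFin ik). Qed.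

Lemma Hs_FT u : Hs u -> exists gr gi,
  [/\ FTL2 u gr gi, itg mu (kdens gr gi) & Kin u = II mu (kdens gr gi)].
Proof.
move=> Hu; have [Lu _] := Hu; have [gr [gi Fu]] := FTL2_exists Lu.
have ik := (HsP Lu Fu).1 Hu.
by exists gr, gi; split => //; exact: KinE.
Qed.

Lemma Kin_EFin u : Hs u -> kineticE s u = (Kin u)%:E.
Proof.
move=> [Lu]; have [gr [gi Fu]] := FTL2_exists Lu.
rewrite /Kin (kineticE_FT Lu Fu) => h.
rewrite fineK// ge0_fin_numE//; apply: integral_ge0 => xi _.
by rewrite lee_fin kdens_ge0.
Qed.

Lemma Kin_ge0 u : 0 <= Kin u.
Proof.
have [Hu|nHu] := pselect (Hs u).
  have [gr [gi [_ ik ->]]] := Hs_FT Hu; apply: II_ge0 => xi; exact: kdens_ge0.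
rewrite /Kin; apply: fine_ge0; apply: le_ereal_inf_tmp => _ [gr [gi [Fu ->]]].
rewrite iintN_muN; first by apply: integral_ge0 => xi _; rewrite lee_fin kdens_ge0.
  by case: Fu => mr [mi _]; apply/measurable_EFinP; exact: (meas_kdens mr mi).
by move=> xi; rewrite lee_fin kdens_ge0.
Qed.

Definition kpair gr gi hr hi xi := wt xi * (gr xi * hr xi + gi xi * hi xi).

Lemma itg_kpair gr gi hr hi : measurable_fun setT gr -> measurable_fun setT gi ->
  measurable_fun setT hr -> measurable_fun setT hi ->
  itg mu (kdens gr gi) -> itg mu (kdens hr hi) -> itg mu (kpair gr gi hr hi).
Proof.
move=> m1 m2 m3 m4 i1 i2; apply: (itg_le _ _ (itgD i1 i2)).
  apply: measurable_funM; first exact: meas_wt.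
  by apply: measurable_funD; exact: measurable_funM.
move=> xi; rewrite normrM (ger0_norm (wt_ge0 xi)) -mulrDr ler_wpM2l ?wt_ge0//.
move: (gr xi) (gi xi) (hr xi) (hi xi) => p q p' q'.
have := sqr_ge0 (p - p'); have := sqr_ge0 (p + p').
have := sqr_ge0 (q - q'); have := sqr_ge0 (q + q').
by rewrite ler_norml; move=> *; apply/andP; split; nra.
Qed.

Lemma kdens_comb gr gi hr hi (a b : R) xi :
  kdens (fun xi => a * gr xi + b * hr xi) (fun xi => a * gi xi + b * hi xi) xi =
  a ^+ 2 * kdens gr gi xi + (2 * a * b) * kpair gr gi hr hi xi + b ^+ 2 * kdens hr hi xi.
Proof. by rewrite /kdens /kpair; ring. Qed.

Lemma Kin_comb_FT u v gr gi hr hi (a b : R) : L2 mu u -> L2 mu v ->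
  FTL2 u gr gi -> FTL2 v hr hi -> itg mu (kdens gr gi) -> itg mu (kdens hr hi) ->
  Hs (fun x => a * u x + b * v x) /\
  Kin (fun x => a * u x + b * v x) =
    a ^+ 2 * Kin u + 2 * a * b * II mu (kpair gr gi hr hi) + b ^+ 2 * Kin v.
Proof.
move=> Lu Lv Fu Fv i1 i2.
have [[m1 _] [m2 _] _ _] := Fu; have [[m3 _] [m4 _] _ _] := Fv.
have ip := itg_kpair m1 m2 m3 m4 i1 i2.
have F := FTL2_comb a b Lu Lv Fu Fv; have L := L2_comb a b Lu Lv.
have i1' := itgZ (a ^+ 2) i1; have ip' := itgZ (2 * a * b) ip; have i2' := itgZ (b ^+ 2) i2.
have ik : itg mu (kdens (fun xi => a * gr xi + b * hr xi) (fun xi => a * gi xi + b * hi xi)).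
  have := itgD (itgD i1' ip') i2'; congr itg; apply/funext => xi.
  by rewrite kdens_comb.
split; first exact/(HsP L F).
rewrite (KinE L F ik) (KinE Lu Fu i1) (KinE Lv Fv i2).
rewrite -(IIZ _ i1) -(IIZ _ ip) -(IIZ _ i2) -(IID i1' ip') -(IID (itgD i1' ip') i2').
by apply: eq_II => xi; rewrite kdens_comb.
Qed.

(** [B] is the value of the polar form at [(u, v)]. It is left existential, but the same [B] serves
    all coefficients, and this is all that later arguments use. *)
Lemma Kin_comb u v : Hs u -> Hs v -> exists B, forall a b : R,
  Hs (fun x => a * u x + b * v x) /\
  Kin (fun x => a * u x + b * v x) = a ^+ 2 * Kin u + 2 * a * b * B + b ^+ 2 * Kin v.
Proof.
move=> Hu Hv; have [gr [gi [Fu i1 _]]] := Hs_FT Hu; have [hr [hi [Fv i2 _]]] := Hs_FT Hv.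
by exists (II mu (kpair gr gi hr hi)) => a b; exact: Kin_comb_FT Hu.1 Hv.1 Fu Fv i1 i2.
Qed.

Lemma kdens_rot (h : T) gr gi xi : kdens (rotre h gr gi) (rotim h gr gi) xi = kdens gr gi xi.
Proof.
rewrite /kdens /rotre /rotim; congr (_ * _).
have := cos2Dsin2 (dotN h xi); move: (cos _) (sin _) => p q pq.
by rewrite -[RHS]mul1r -pq; ring.
Qed.

Lemma Hs_shift u (h : T) : Hs u -> Hs (fun x => u (addT x h)) /\
  Kin (fun x => u (addT x h)) = Kin u.
Proof.
move=> Hu; have [Lu _] := Hu; have [gr [gi [Fu ik ->]]] := Hs_FT Hu.
have F := FTL2_shift h Lu Fu; have L := L2_shift h Lu.
have E : kdens (rotre h gr gi) (rotim h gr gi) = kdens gr gi.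
  by apply/funext => xi; exact: kdens_rot.
have i' : itg mu (kdens (rotre h gr gi) (rotim h gr gi)) by rewrite E.
by split; [exact/(HsP L F)|rewrite (KinE L F i') E].
Qed.

(** Lagrange's identity: the sum of the squares of the 2 by 2 minors is nonnegative. *)
Lemma dotN_cauchy x y : `|dotN x y| <= euclN x * euclN y.
Proof.
rewrite /euclN -sqrtrM ?dotN_ge0// -sqrtr_sqr ler_wsqrtr//.
have : 0 <= \sum_(i < N) \sum_(j < N)
    (tnth x i * tnth y j - tnth x j * tnth y i) ^+ 2.
  by apply: sumr_ge0 => i _; apply: sumr_ge0 => j _; exact: sqr_ge0.
have -> : \sum_(i < N) \sum_(j < N) (tnth x i * tnth y j - tnth x j * tnth y i) ^+ 2 =
  \sum_(i < N) \sum_(j < N) ((tnth x i * tnth x i) * (tnth y j * tnth y j) +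
    (tnth x j * tnth x j) * (tnth y i * tnth y i) -
    2 * ((tnth x i * tnth y i) * (tnth x j * tnth y j))).
  by apply: eq_bigr => i _; apply: eq_bigr => j _; ring.
have dd (a b : 'I_N -> R) : \sum_(i < N) \sum_(j < N) a i * b j =
    (\sum_(i < N) a i) * (\sum_(j < N) b j).
  by rewrite mulr_suml; apply: eq_bigr => i _; rewrite mulr_sumr.
under eq_bigr do rewrite sumrB big_split /=.
rewrite sumrB big_split /= dd.
under [X in _ + X - _]eq_bigr do under eq_bigr do rewrite mulrC.
rewrite dd; under [X in _ - X]eq_bigr do rewrite -mulr_sumr.
rewrite -mulr_sumr dd -/(dotN x x) -/(dotN y y) -/(dotN x y) expr2; lra.
Qed.

Lemma omega_Kin u (h : T) : Hs u -> omega u h <= 4 * euclN h `^ (2 * s) * Kin u.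
Proof.
move=> Hu; have [Lu _] := Hu; have [gr [gi [Fu ik ->]]] := Hs_FT Hu.
have [io ->] := omega_FT h Lu Fu; rewrite -(IIZ _ ik).
apply: II_le => //; first exact: itgZ.
move=> xi; rewrite /kdens mulrA ler_wpM2r ?addr_ge0 ?sqr_ge0//.
have e0 x : 0 <= euclN x by exact: sqrtr_ge0.
rewrite -mulrA -powRM ?e0//; apply: two_sub_cos_powR => //.
  by rewrite mulr_ge0 ?e0.
exact: dotN_cauchy.
Qed.

Lemma powR_2s_le (r : R) : 0 <= r -> r `^ (2 * s) <= 1 + r ^+ 2.
Proof.
have /andP[s0 s1] := s01; move=> r0; have [r1|r1] := lerP 1 r.
  have : r `^ (2 * s) <= r `^ 2.
    by apply: ler_powR => //; rewrite -[leRHS]mulr1 ler_pM2l// ltW.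
  by rewrite powR_mulrn// => h; rewrite (le_trans h)// lerDr.
have [->|rn0] := eqVneq r 0.
  by rewrite powR0 ?addr_ge0 ?sqr_ge0// mulf_neq0// gt_eqF.
have : r `^ (2 * s) <= r `^ 0.
  apply: ger_powR; last by rewrite mulr_ge0// ltW.
  by rewrite lt_neqAle eq_sym rn0 r0 ltW.
by rewrite powRr0 => h; rewrite (le_trans h)// lerDl sqr_ge0.
Qed.

(** Lets one of the two factors in the squared transform of [wexp] absorb the weight
    [|xi|^(2s) <= 1 + |xi|^2]. *)
Lemma prod_1Dsqr_ge x : 1 + dotN x x <= \prod_(i < N) (1 + tnth x i ^+ 2).
Proof.
rewrite /dotN; elim: (index_enum _) => [|i r IH]; first by rewrite !big_nil addr0.
rewrite !big_cons.
have s0 : 0 <= \sum_(j <- r) tnth x j * tnth x j.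
  by apply: sumr_ge0 => j _; rewrite -expr2 sqr_ge0.
apply: le_trans (_ : (1 + tnth x i ^+ 2) * (1 + \sum_(j <- r) tnth x j * tnth x j) <= _).
  by rewrite expr2; have := sqr_ge0 (tnth x i); rewrite expr2; nra.
by rewrite ler_wpM2l// addr_ge0// sqr_ge0.
Qed.

Lemma L12_wexp : L12 (@wexp R N).
Proof.
have iw := itg_wexp R N; have mw := itg_meas iw; split => //.
apply: itg_le iw; first exact: measurable_funX.
move=> x; rewrite ger0_norm ?sqr_ge0// expr2 -[leRHS]mulr1 ler_wpM2l ?(ltW (wexp_gt0 _))//.
apply: le_trans (_ : \prod_(i < N) 1 <= _); last by rewrite big1.
by apply: ler_prod => i _; rewrite expR_ge0 /= -[leRHS]expR0 ler_expR oppr_le0.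
Qed.

(** Supplies a positive element of the space, from which a Nehari point is built. Its kinetic
    density is at most a multiple of [k1]. *)
Lemma Hs_wexp : Hs (@wexp R N).
Proof.
have Lw := L12_wexp; have [mw iw i2] := Lw.
have F := FTL2_L12 Lw; apply/(HsP (L12_L2 Lw) F).
pose C : R := (FTconst R N * 2 ^+ N) ^+ 2 * pi ^+ N.
have [[mr _] [mi _]] := L2_FT Lw.
apply: (itg_le _ _ (itgZ C (itg_k1 R N))); first exact: meas_kdens.
move=> xi; rewrite ger0_norm ?kdens_ge0//.
have Er : FTre (@wexp R N) xi = FTconst R N * \prod_(i < N) (2 / (1 + tnth xi i ^+ 2)).
  rewrite (FTreE _ iw); congr (_ * _); rewrite -(II_wexp_cs xi).1.
  by apply: eq_II => x; rewrite dotNC.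
have Ei : FTim (@wexp R N) xi = 0.
  rewrite (FTimE _ iw) (_ : II _ _ = 0) ?mulr0 ?oppr0// -(II_wexp_cs xi).2.
  by apply: eq_II => x; rewrite dotNC.
rewrite /kdens Er Ei expr0n addr0 /wt.
set P := \prod_(i < N) (1 + tnth xi i ^+ 2).
have P0 : 0 < P by apply: prodr_gt0 => i _; exact: denom_gt0.
have -> : \prod_(i < N) (2 / (1 + tnth xi i ^+ 2)) = 2 ^+ N / P.
  by rewrite big_split /= prodfV prodr_const card_ord.
have -> : k1 xi = pi^-1 ^+ N / P.
  have -> : (pi^-1 : R) ^+ N = \prod_(i < N) pi^-1 by rewrite prodr_const card_ord.
  by rewrite /k1 -prodfV -big_split /=; apply: eq_bigr => i _; rewrite invfM.
have p0 : (pi : R) != 0 by rewrite gt_eqF// pi_gt0.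
have -> : C * (pi^-1 ^+ N / P) = (FTconst R N * 2 ^+ N) ^+ 2 / P.
  by rewrite /C -mulrA [pi ^+ N * _]mulrA -(exprMn _ pi) mulfV// expr1n mul1r.
have -> : (FTconst R N * (2 ^+ N / P)) ^+ 2 = (FTconst R N * 2 ^+ N) ^+ 2 / P / P.
  by rewrite mulrA expr_div_n expr2 invfM mulrA.
set D := (FTconst R N * 2 ^+ N) ^+ 2 / P; have D0 : 0 <= D by rewrite divr_ge0 ?sqr_ge0// ltW.
rewrite mulrCA -[leRHS]mulr1 ler_wpM2l// ler_pdivrMr// mul1r.
apply: le_trans (powR_2s_le (sqrtr_ge0 _)) _.
by rewrite sqr_sqrtr ?dotN_ge0// prod_1Dsqr_ge.
Qed.

Lemma wt_chi_bound (r : R) xi : `|chi r xi * wt xi| <= 1 + r ^+ 2.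
Proof.
rewrite /chi; case: ifPn => [xr|_]; last by rewrite mul0r normr0 addr_ge0 ?sqr_ge0.
rewrite mul1r ger0_norm ?wt_ge0//; apply: le_trans (powR_2s_le (sqrtr_ge0 _)) _.
have e0 : 0 <= euclN xi by exact: sqrtr_ge0.
by rewrite lerD2l lerXn2r// nnegrE// (le_trans e0).
Qed.

Lemma meas_wtchi (r : R) : measurable_fun setT (fun xi : T => chi r xi * wt xi).
Proof. by apply: measurable_funM; [exact: meas_chi|exact: meas_wt]. Qed.

Lemma L12_wtchi (r : R) g : L2 mu g -> L12 (fun xi => chi r xi * wt xi * g xi).
Proof.
move=> Lg; have L := L2_bound Lg (meas_wtchi r) (wt_chi_bound r).
have := L12_chi r L; congr L12; apply/funext => xi.
by rewrite !mulrA -expr2 chi_sqr.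
Qed.

(** With frequencies cut off at [r] the multiplier is bounded, and the pairing becomes one of [u]
    with fixed L2 functions. This is the form to which weak convergence applies. *)
Lemma kpair_chi (r : R) u gr gi hr hi : L2 mu u -> FTL2 u gr gi -> L2 mu hr -> L2 mu hi ->
  itg mu (fun xi => chi r xi * kpair gr gi hr hi xi) /\
  II mu (fun xi => chi r xi * kpair gr gi hr hi xi) =
  II mu (fun x => u x * FTre (fun xi => chi r xi * wt xi * hr xi) x) +
  II mu (fun x => u x * FTim (fun xi => chi r xi * wt xi * hi xi) x).
Proof.
move=> Lu Fu Lr Li; have [Lgr Lgi _ _] := Fu.
have Ar := L12_wtchi r Lr; have Ai := L12_wtchi r Li.
have [<- _] := FTL2_adj Lu Fu Ar; have [_ <-] := FTL2_adj Lu Fu Ai.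
have i1 := L2_itgM Lgr (L12_L2 Ar); have i2 := L2_itgM Lgi (L12_L2 Ai).
have E : (fun xi => chi r xi * kpair gr gi hr hi xi) =
  (fun xi => gr xi * (chi r xi * wt xi * hr xi) + gi xi * (chi r xi * wt xi * hi xi)).
  by apply/funext => xi; rewrite /kpair; ring.
by rewrite E -(IID i1 i2); split => //; exact: itgD.
Qed.

Lemma kpair_diag gr gi : kpair gr gi gr gi = kdens gr gi.
Proof. by apply/funext => xi; rewrite /kpair /kdens !expr2. Qed.

Lemma kpair_young gr gi hr hi (e : R) xi : 0 < e ->
  2 * `|kpair gr gi hr hi xi| <= e * kdens gr gi xi + e^-1 * kdens hr hi xi.
Proof.
move=> e0; rewrite /kpair /kdens normrM (ger0_norm (wt_ge0 xi)).
rewrite [leLHS]mulrCA [e * _]mulrCA [e^-1 * _]mulrCA -mulrDr ler_wpM2l ?wt_ge0//.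
move: (gr xi) (gi xi) (hr xi) (hi xi) => p q p' q'.
have Y (a b : R) : 2 * `|a * b| <= e * a ^+ 2 + e^-1 * b ^+ 2.
  rewrite normrM -[a ^+ 2]real_normK ?num_real// -[b ^+ 2]real_normK ?num_real//.
  have := mulr_ge0 (ltW (_ : 0 < e^-1)) (sqr_ge0 (e * `|a| - `|b|)).
  rewrite invr_gt0 => /(_ e0).
  have -> : e^-1 * (e * `|a| - `|b|) ^+ 2 =
    (e^-1 * e) * (e * `|a| ^+ 2) - (e^-1 * e) * (2 * (`|a| * `|b|)) + e^-1 * `|b| ^+ 2 by ring.
  by rewrite mulVf ?gt_eqF// !mul1r; lra.
have := Y p p'; have := Y q q'; have := ler_normD (p * p') (q * q').
by rewrite !mulrDr; lra.
Qed.

(** Weak L2 convergence passes to the polar form on bounded frequencies, and the high frequencies of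
    the fixed function [w] are uniformly negligible. Expanding the square of the difference then
    gives the splitting. *)
Lemma Kin_weak (w_ : nat -> T -> R) w (M : R) : (forall n, Hs (w_ n)) ->
  (forall n, Kin (w_ n) <= M) -> L2 mu w ->
  (forall psi, L2 mu psi ->
    (fun n => II mu (fun x => w_ n x * psi x)) @ \oo --> II mu (fun x => w x * psi x)) ->
  Hs w /\ (fun n => Kin (fun x => w_ n x - w x) - Kin (w_ n)) @ \oo --> - Kin w.
Proof.
move=> Hw KM Lw wk.
have [gr_ /choice[gi_ Fn]] := choice (fun n => Hs_FT (Hw n)).
have [gr [gi Fw]] := FTL2_exists Lw; have [Lr Li _ _] := Fw.
pose A (k : nat) := II mu (fun xi => chi k%:R xi * kdens gr gi xi).
pose P (k : nat) n := II mu (fun xi => chi k%:R xi * kpair (gr_ n) (gi_ n) gr gi xi).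
have iA (k : nat) : itg mu (fun xi => chi k%:R xi * kdens gr gi xi).
  by have [+ _] := kpair_chi k%:R Lw Fw Lr Li; rewrite kpair_diag.
have iP (k n : nat) : itg mu (fun xi => chi k%:R xi * kpair (gr_ n) (gi_ n) gr gi xi).
  by have [F _ _] := Fn n; have [] := kpair_chi k%:R (Hw n).1 F Lr Li.
have cP k : P k @ \oo --> A k.
  have [Wr Wi] := (L2_FT (L12_wtchi k%:R Lr), L2_FT (L12_wtchi k%:R Li)).
  have := cvgRD (wk _ Wr.1) (wk _ Wi.2).
  have [_] := kpair_chi k%:R Lw Fw Lr Li; rewrite kpair_diag => <-.
  apply: eq_cvgR => n; have [F _ _] := Fn n.
  by have [_ <-] := kpair_chi k%:R (Hw n).1 F Lr Li.
(* Weak lower semicontinuity: [2 * P k n <= M + A k], and [P k n] tends to [A k]. *)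
have AM k : A k <= M.
  have h n : 2 * P k n <= M + A k.
    have [F ik Kn] := Fn n; rewrite -(IIZ _ (iP k n)).
    apply: le_trans (_ : II mu (fun xi => kdens (gr_ n) (gi_ n) xi +
        chi k%:R xi * kdens gr gi xi) <= _).
      apply: II_le; [exact: itgZ|exact: itgD|move=> xi].
      have /andP[c0 c1] := chi01 k%:R xi.
      have := @kpair_young (gr_ n) (gi_ n) gr gi 1 xi ltr01; rewrite invr1 !mul1r => h.
      have k0 := kdens_ge0 (gr_ n) (gi_ n) xi.
      have := ler_norm (kpair (gr_ n) (gi_ n) gr gi xi).
      by rewrite /chi; case: ifPn => _; rewrite ?mul1r ?mul0r; lra.
    by rewrite (IID ik (iA k)) -Kn lerD2r.
  suff : 2 * A k <= M + A k by lra.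
  have c2 := cvgRZ 2 (cP k); exact: (cvgR_le c2 h).
have [mr mi] : measurable_fun setT gr /\ measurable_fun setT gi by split; [exact: Lr.1|exact: Li.1].
have mk := meas_kdens mr mi.
have ck xi : (fun k : nat => chi k%:R xi * kdens gr gi xi) @ \oo --> kdens gr gi xi.
  have := cvgRZ (kdens gr gi xi) (chi_cvg xi); rewrite mulr1.
  by apply: eq_cvgR => k; rewrite mulrC.
have [ik KwM] := @II_fatou _ _ _ mu (fun k xi => chi k%:R xi * kdens gr gi xi) (kdens gr gi) M
  iA mk (fun k xi => mulr_ge0 (andP (chi01 _ _)).1 (kdens_ge0 _ _ _))
  (kdens_ge0 gr gi) (aeW _ ck) AM.
have Hw0 : Hs w by apply/(HsP Lw Fw).
have Kw := KinE Lw Fw ik.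
have [_ cA] : itg mu (kdens gr gi) /\ A @ \oo --> Kin w.
  rewrite Kw; apply: (@II_dct _ _ _ mu _ _ (kdens gr gi)) ik => //.
  - by move=> k; exact: itg_meas (iA k).
  - exact: aeW.
  - move=> k xi; rewrite normrM (ger0_norm (kdens_ge0 _ _ _)) -[leRHS]mul1r.
    by rewrite ler_wpM2r ?kdens_ge0 ?chi_abs.
split => //.
pose B n := II mu (kpair (gr_ n) (gi_ n) gr gi).
have iB n : itg mu (kpair (gr_ n) (gi_ n) gr gi).
  by have [F ikn _] := Fn n; have [[? _] [? _] _ _] := F; apply: itg_kpair.
(* Young's inequality beyond frequency [k]: the bounded sequence receives the small weight, and the
   tail of [w], made small by [k] alone, the large one. *)
have tail n k (e : R) : 0 < e -> 2 * `|B n - P k n| <= e * M + e^-1 * (Kin w - A k).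
  move=> e0; have [F ikn Kn] := Fn n.
  rewrite -(IIB (iB n) (iP k n)).
  have i1 := itgB (iB n) (iP k n).
  apply: le_trans (_ : 2 * II mu (fun x => `|kpair (gr_ n) (gi_ n) gr gi x -
     chi k%:R x * kpair (gr_ n) (gi_ n) gr gi x|) <= _).
    by rewrite ler_pM2l// II_abs.
  rewrite -(IIZ _ (itg_abs i1)) Kw -(IIB ik (iA k)).
  apply: le_trans (_ : e * Kin (w_ n) + e^-1 * II mu (fun x => kdens gr gi x -
      chi k%:R x * kdens gr gi x) <= _); last by rewrite lerD2r ler_pM2l.
  have i2 := itgB ik (iA k).
  rewrite Kn -(IIZ _ ikn) -(IIZ _ i2) -(IID (itgZ _ ikn) (itgZ _ i2)).
  apply: II_le; [exact/itgZ/itg_abs|exact: itgD (itgZ _ ikn) (itgZ _ i2)|move=> xi].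
  have h := @kpair_young (gr_ n) (gi_ n) gr gi e xi e0.
  have k0 := kdens_ge0 (gr_ n) (gi_ n) xi.
  have k1 := kdens_ge0 gr gi xi.
  rewrite /chi; case: ifPn => _.
    by rewrite !mul1r !subrr normr0 !mulr0 addr0 mulr_ge0// ltW.
  by rewrite !mul0r !subr0.
have cB : B @ \oo --> Kin w.
  have M0 : 0 <= M := le_trans (Kin_ge0 _) (KM 0%N).
  apply: cvg_eps => e e0.
  pose d := e / (M + 1).
  have d0 : 0 < d by rewrite divr_gt0// ltr_wpDl.
  have dM : d * M <= e.
    rewrite /d mulrAC ler_pdivrMr ?ltr_wpDl// ler_pM2l//; lra.
  have de0 : 0 < d * e / 4 by rewrite divr_gt0// mulr_gt0.
  have e8 : 0 < e / 8 by rewrite divr_gt0.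
  have m0 : 0 < Num.min (d * e / 4) (e / 8) by rewrite lt_min de0.
  have [k hk] := eps_cvg cA m0.
  have := hk _ (leqnn k); rewrite le_min => /andP[h1 h2].
  have [m hm] := eps_cvg (cP k) e8.
  exists m => n mn; have h3 := hm _ mn; have h4 := tail n k d d0.
  have h5 : d^-1 * (Kin w - A k) <= e / 4.
    rewrite mulrC ler_pdivrMr//; move: h1; rewrite ler_norml => /andP[h1 _].
    by move: de0; lra.
  have -> : B n - Kin w = (B n - P k n) + (P k n - A k) + (A k - Kin w) by ring.
  apply: le_trans (ler_normD _ _) _; apply: le_trans (lerD (ler_normD _ _) (lexx _)) _.
  by lra.
have E n : Kin (fun x => w_ n x - w x) - Kin (w_ n) = - 2 * B n + Kin w.
  have [F ikn _] := Fn n.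
  have [_] := Kin_comb_FT 1 (-1) (Hw n).1 Lw F Fw ikn ik.
  have -> : (fun x => 1 * w_ n x + -1 * w x) = (fun x => w_ n x - w x).
    by apply/funext => x; rewrite mul1r mulN1r.
  by move=> ->; rewrite -/(B n); ring.
have -> : - Kin w = - 2 * Kin w + Kin w by ring.
have := cvgRD (cvgRZ (- 2) cB) (cvgR_cst (Kin w)).
by apply: eq_cvgR => n; rewrite E.
Qed.

End Kinetic.

(** * Averages over cubes *)

Section Averages.
Variables (R : realType) (N : nat) (s : R).
Hypothesis s01 : 0 < s < 1.
Local Notation T := (N.-tuple R).
Local Notation mu := (muN R N).
Local Notation lebR := (@lebesgue_measure R).
Local Notation mR := (measurableTypeR R).
Implicit Types (u v w g : T -> R) (x y z h : T).

Definition kap1 (t : R) : R := \1_(`[0, 1]%classic : set mR) t.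

Lemma kap1E t : kap1 t = if 0 <= t <= 1 then 1 else 0.
Proof. by rewrite /kap1 indicE mem_setE in_itv /=; case: ifP. Qed.

Lemma II_kap1 : itg lebR kap1 /\ II lebR kap1 = 1.
Proof.
have mA : measurable (`[0, 1]%classic : set mR) by exact: measurable_itv.
have m1 : measurable_fun (setT : set mR) kap1 by exact: measurable_indic.
have k0 (t : mR) : 0 <= kap1 t by rewrite kap1E; case: ifP.
have E : (\int[lebR]_t (kap1 t)%:E = 1%:E)%E.
  rewrite integral_indic// setIT.
  have /= := @lebesgue_measure_itv R (Interval (BLeft 0) (BRight 1)).
  by rewrite lte_fin ltr01 oppr0 adde0 => <-.
have i1 : itg lebR kap1 by apply: itg_ge0 => //; rewrite E ltry.
by split => //; apply: EFin_inj; rewrite (II_EFin i1).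
Qed.

Definition kap h : R := \prod_(i < N) kap1 (tnth h i).

Lemma II_kap : itg mu kap /\ II mu kap = 1.
Proof.
have [i1 e1] := II_kap1.
have [|i t|ik ->] := @muN_prodR R N (fun=> kap1) _ _.
- by move=> _; exact: i1.
- by rewrite kap1E; case: ifP.
by split => //; rewrite big1.
Qed.

Lemma kap01 h : kap h = 1 /\ (forall i, 0 <= tnth h i <= 1) \/ kap h = 0.
Proof.
have [H|] := boolP [forall i, 0 <= tnth h i <= 1].
  left; split; last exact/forallP.
  by rewrite /kap big1// => i _; rewrite kap1E (forallP H i).
rewrite negb_forall => /existsP[i Hi]; right.
by rewrite /kap (bigD1 i)//= kap1E (negbTE Hi) mul0r.
Qed.

Lemma kap_ge0 h : 0 <= kap h. Proof. by have [[-> _]|->] := kap01 h. Qed.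
Lemma kap_le1 h : kap h <= 1. Proof. by have [[-> _]|->] := kap01 h. Qed.
Lemma kap_abs h : `|kap h| <= 1.
Proof. by rewrite ger0_norm ?kap_ge0 ?kap_le1. Qed.

Lemma meas_kap : measurable_fun setT kap.
Proof. exact: itg_meas II_kap.1. Qed.

Lemma L2_kap : L2 mu kap.
Proof.
split; first exact: meas_kap.
have [+ _] := II_kap; congr itg; apply/funext => h.
by have [[-> _]|->] := kap01 h; rewrite ?expr1n ?expr0n.
Qed.

Lemma itg_kapM g : itg mu g -> itg mu (fun h => kap h * g h).
Proof.
move=> ig; under eq_fun do rewrite mulrC.
exact: (itg_bound ig meas_kap kap_abs).
Qed.

(** The variance of [g] under the probability density [kap] is nonnegative. *)
Lemma kap_jensen g : L2 mu g ->
  II mu (fun h => kap h * g h) ^+ 2 <= II mu (fun h => kap h * g h ^+ 2).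
Proof.
move=> Lg; have i1 := L2_itgM L2_kap Lg; have i2 := itg_kapM Lg.2.
have [ik ek] := II_kap.
set t := II mu (fun h => kap h * g h).
have h0 : 0 <= II mu (fun h => kap h * (g h - t) ^+ 2).
  by apply: II_ge0 => h; rewrite mulr_ge0 ?kap_ge0 ?sqr_ge0.
suff E : II mu (fun h => kap h * (g h - t) ^+ 2) =
    II mu (fun h => kap h * g h ^+ 2) - t ^+ 2 by move: h0; rewrite E subr_ge0.
have j1 := itgZ (- 2 * t) i1; have j2 := itgZ (t ^+ 2) ik.
transitivity (II mu (fun h => kap h * g h ^+ 2 + - 2 * t * (kap h * g h) + t ^+ 2 * kap h)).
  by apply: eq_II => h; ring.
rewrite (IID (itgD i2 j1) j2) (IID i2 j1) (IIZ _ i1) (IIZ _ ik) ek -/t; ring.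
Qed.

(* kap is the indicator of the unit cube, so avg e u x is the mean of u over the cube x + [0, e]^N *)
Definition avg (e : R) u x : R := II mu (fun h => kap h * u (addT x (scaleT e h))).

Lemma L2_addscale (e : R) u x : 0 < e -> L2 mu u ->
  L2 mu (fun h => u (addT x (scaleT e h))) /\
  nsq mu (fun h => u (addT x (scaleT e h))) = (e ^+ N)^-1 * nsq mu u.
Proof.
move=> e0 [mu_ iu].
have is_ := itg_shift x iu.
have [i2 e2] := II_scaleR e0 is_.
have E : (fun h => u (addT (scaleT e h) x) ^+ 2) = (fun h => u (addT x (scaleT e h)) ^+ 2).
  by apply/funext => h; rewrite addTC.
rewrite E in i2 e2; split.
  split => //; apply: (measurableT_comp mu_); apply: meas_addT; first exact: measurable_cst.
  exact: meas_scaleT.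
rewrite /nsq -(II_shift x iu) e2 mulKf// expf_neq0// gt_eqF//.
Qed.

Lemma itg_avg (e : R) u x : 0 < e -> L2 mu u ->
  itg mu (fun h => kap h * u (addT x (scaleT e h))).
Proof. by move=> e0 Lu; have [L _] := L2_addscale x e0 Lu; exact: L2_itgM L2_kap L. Qed.

Lemma avg_sqr_loc (e : R) u x : 0 < e -> L2 mu u ->
  avg e u x ^+ 2 <= II mu (fun h => kap h * u (addT x (scaleT e h)) ^+ 2).
Proof. by move=> e0 Lu; have [L _] := L2_addscale x e0 Lu; exact: kap_jensen L. Qed.

Lemma avg_sqr_le (e : R) u x : 0 < e -> L2 mu u ->
  avg e u x ^+ 2 <= (e ^+ N)^-1 * nsq mu u.
Proof.
move=> e0 Lu; apply: le_trans (avg_sqr_loc x e0 Lu) _.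
have [L <-] := L2_addscale x e0 Lu.
apply: II_le; [exact: itg_kapM L.2|exact: L.2|move=> h].
by rewrite -[leRHS]mul1r ler_wpM2r ?sqr_ge0 ?kap_le1.
Qed.

Lemma avg_sup (e m : R) u x : 0 < e -> L2 mu u -> (forall y, `|u y| <= m) ->
  `|avg e u x| <= m.
Proof.
move=> e0 Lu um; have [ik ek] := II_kap; have i1 := itg_avg x e0 Lu.
apply: le_trans (II_abs i1) _; rewrite -[leRHS]mulr1 -ek -(IIZ _ ik).
apply: II_le; [exact: itg_abs|exact: itgZ|move=> h].
by rewrite normrM (ger0_norm (kap_ge0 h)) mulrC ler_wpM2r ?kap_ge0.
Qed.

Lemma avgB (e : R) u v x : 0 < e -> L2 mu u -> L2 mu v ->
  avg e (fun y => u y - v y) x = avg e u x - avg e v x.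
Proof.
move=> e0 Lu Lv; rewrite /avg -(IIB (itg_avg x e0 Lu) (itg_avg x e0 Lv)).
by apply: eq_II => h; rewrite mulrBr.
Qed.

Lemma avg_shift (e : R) u x (a : T) :
  avg e (fun y => u (addT y a)) x = avg e u (addT x a).
Proof. by apply: eq_II => h; rewrite -!addTA (addTC a). Qed.

Lemma meas_avg_arg (e : R) : measurable_fun setT (fun p : T * T => addT p.1 (scaleT e p.2)).
Proof.
apply: meas_addT; first exact: measurable_fst.
exact: (measurableT_comp (meas_scaleT e) measurable_snd).
Qed.

Lemma meas_avg (e : R) u : measurable_fun setT u -> measurable_fun setT (avg e u).
Proof.
move=> mu_; apply: (@measurable_IIl _ _ _ _ _ mu
  (fun p : T * T => kap p.2 * u (addT p.1 (scaleT e p.2)))).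
apply: measurable_funM; first exact: (measurableT_comp meas_kap measurable_snd).
exact: (measurableT_comp mu_ (meas_avg_arg e)).
Qed.

Lemma dotN_cube h : (forall i, 0 <= tnth h i <= 1) -> dotN h h <= N%:R.
Proof.
move=> h1; rewrite /dotN -[N in leRHS]card_ord -sumr_const.
by apply: ler_sum => i _; have /andP[a b] := h1 i; exact: mulr_ile1.
Qed.

Lemma euclN_scale (e : R) h : 0 <= e -> euclN (scaleT e h) = e * euclN h.
Proof.
move=> e0; rewrite /euclN -[X in X * _](ger0_norm e0) -sqrtr_sqr -sqrtrM ?sqr_ge0//.
congr Num.sqrt; rewrite /dotN mulr_sumr; apply: eq_bigr => i _.
by rewrite tnth_mktuple; ring.
Qed.

(** The 4 is that of [omega_Kin]; [1 + N] bounds [|h|^(2s) <= 1 + |h|^2] on the unit cube. *)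
Definition Cavg : R := 4 * (1 + N%:R).

Lemma Cavg_gt0 : 0 < Cavg.
Proof. by rewrite /Cavg mulr_gt0// ltr_wpDr. Qed.

(** By Jensen, [(u - avg e u)^2] is at most the mean of [(u(x + e h) - u(x))^2] over the cube.
    Exchanging the integrals leaves the mean of [omega u (e h)], which the kinetic energy
    controls. *)
Lemma avg_close (e : R) u : 0 < e -> Hs s u ->
  L2 mu (fun x => u x - avg e u x) /\
  nsq mu (fun x => u x - avg e u x) <= Cavg * e `^ (2 * s) * Kin s u.
Proof.
move=> e0 Hu; have [Lu _] := Hu; have [mu_ iu] := Lu; have [ik ek] := II_kap.
pose G (h x : T) := kap h * (u (addT x (scaleT e h)) - u x) ^+ 2.
have G0 h x : 0 <= G h x by rewrite mulr_ge0 ?kap_ge0 ?sqr_ge0.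
have mG : measurable_fun setT (fun p : T * T => G p.1 p.2).
  apply: measurable_funM; first exact: (measurableT_comp meas_kap measurable_fst).
  apply: measurable_funX; apply: measurable_funB.
    apply: (measurableT_comp mu_); apply: meas_addT; first exact: measurable_snd.
    exact: (measurableT_comp (meas_scaleT e) measurable_fst).
  exact: (measurableT_comp mu_ measurable_snd).
have i1 h : itg mu (G h) by apply: itgZ; exact: itg_omega.
have i2 x : itg mu (G^~ x).
  have [L _] := L2_addscale x e0 Lu.
  have j := itgD (itgD (itg_kapM L.2) (itgZ (- 2 * u x) (itg_avg x e0 Lu)))
     (itgZ (u x ^+ 2) ik).
  by move: j; congr itg; apply/funext => h; rewrite /G; ring.
have E1 h : II mu (G h) = kap h * omega u (scaleT e h).
  by rewrite -(IIZ _ (itg_omega (scaleT e h) mu_ iu)).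
have b1 h : 0 <= II mu (G h) <= Cavg * e `^ (2 * s) * Kin s u * kap h.
  apply/andP; split; first by apply: II_ge0 => x; exact: G0.
  rewrite E1 mulrC; have [[-> hc]|->] := kap01 h; last by rewrite !mulr0.
  rewrite !mulr1; apply: le_trans (omega_Kin s01 _ Hu) _.
  rewrite ler_wpM2r ?Kin_ge0// /Cavg -!mulrA ler_wpM2l// euclN_scale ?(ltW e0)//.
  rewrite powRM ?(ltW e0) ?sqrtr_ge0// mulrC ler_wpM2r ?powR_ge0//.
  apply: le_trans (powR_2s_le s01 (sqrtr_ge0 _)) _.
  by rewrite sqr_sqrtr ?dotN_ge0// lerD2l dotN_cube.
have m1 : measurable_fun setT (fun h => II mu (G h)).
  exact: (@measurable_IIl _ _ _ _ _ mu _ mG).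
have [j1 k1] := II_ge0_le m1 b1 (itgZ _ ik).
have [j2 k2] := II_tonelli mG (fun p : T * T => G0 p.1 p.2) i1 i2 j1.
have mw : measurable_fun setT (fun x => u x - avg e u x).
  by apply: measurable_funB; [exact: mu_|exact: meas_avg].
have bw x : 0 <= (u x - avg e u x) ^+ 2 <= II mu (G^~ x).
  rewrite sqr_ge0 /=.
  have [L _] := L2_addscale x e0 Lu.
  have [ik' i3] := (itg_avg x e0 Lu, itg_kapM L.2).
  have E : avg e u x - u x = II mu (fun h => kap h * (u (addT x (scaleT e h)) - u x)).
    rewrite /avg -[X in _ - X]mulr1 -ek -(IIZ _ ik) -(IIB ik' (itgZ _ ik)).
    by apply: eq_II => h; ring.
  rewrite -sqrrN opprB.
  have h0 : 0 <= II mu (fun h => kap h * (u (addT x (scaleT e h)) - avg e u x) ^+ 2).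
    by apply: II_ge0 => h; rewrite mulr_ge0 ?kap_ge0 ?sqr_ge0.
  apply: le_trans (_ : II mu (fun h => kap h * (u (addT x (scaleT e h)) - avg e u x) ^+ 2)
     + (avg e u x - u x) ^+ 2 <= _); first by rewrite lerDr.
  have j0 := itgZ (- 2 * avg e u x) ik'; have j3 := itgZ (avg e u x ^+ 2) ik.
  have E3 : II mu (fun h => kap h * (u (addT x (scaleT e h)) - avg e u x) ^+ 2) =
      II mu (fun h => kap h * u (addT x (scaleT e h)) ^+ 2) - avg e u x ^+ 2.
    transitivity (II mu (fun h => kap h * u (addT x (scaleT e h)) ^+ 2 +
      - 2 * avg e u x * (kap h * u (addT x (scaleT e h))) + avg e u x ^+ 2 * kap h)).
      by apply: eq_II => h; ring.
    rewrite (IID (itgD i3 j0) j3) (IID i3 j0) (IIZ _ ik') (IIZ _ ik) ek -/(avg e u x); ring.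
  have j4 := itgZ (- 2 * u x) ik'; have j5 := itgZ (u x ^+ 2) ik.
  have E4 : II mu (G^~ x) = II mu (fun h => kap h * u (addT x (scaleT e h)) ^+ 2)
      - 2 * u x * avg e u x + u x ^+ 2.
    transitivity (II mu (fun h => kap h * u (addT x (scaleT e h)) ^+ 2 +
      - 2 * u x * (kap h * u (addT x (scaleT e h))) + u x ^+ 2 * kap h)).
      by apply: eq_II => h; rewrite /G; ring.
    rewrite (IID (itgD i3 j4) j5) (IID i3 j4) (IIZ _ ik') (IIZ _ ik) ek -/(avg e u x); ring.
  by rewrite E3 E4 le_eqVlt; apply/orP; left; apply/eqP; ring.
have mw2 : measurable_fun setT (fun x => (u x - avg e u x) ^+ 2) by exact: measurable_funX.
have [j3 k3] := II_ge0_le mw2 bw j2.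
split; first by split; [exact: mw|exact: j3].
apply: le_trans k3 _; rewrite -k2; apply: le_trans k1 _.
by rewrite (IIZ _ ik) ek mulr1.
Qed.

Lemma L2_avg (e : R) u : 0 < e -> Hs s u -> L2 mu (avg e u).
Proof.
move=> e0 Hu; have [L _] := avg_close e0 Hu; have := L2B Hu.1 L.
by congr L2; apply/funext => x; rewrite opprB addrC subrK.
Qed.

(** The mean of [u(. + a) - u] is bounded in sup norm by its L2 norm. The resulting Hoelder modulus
    depends on [u] only through its energy, which gives equicontinuity. *)
Lemma avg_holder (e : R) u x (a : T) : 0 < e -> Hs s u ->
  (avg e u (addT x a) - avg e u x) ^+ 2 <=
  (e ^+ N)^-1 * (4 * euclN a `^ (2 * s) * Kin s u).
Proof.
move=> e0 Hu; have [Lu _] := Hu; have Ls := L2_shift a Lu.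
rewrite -avg_shift -(avgB x e0 Ls Lu).
apply: le_trans (avg_sqr_le x e0 (L2B Ls Lu)) _.
rewrite ler_wpM2l ?invr_ge0 ?exprn_ge0 ?(ltW e0)//; exact: omega_Kin.
Qed.

(** The cube of side [e <= 1] lies in the ball of radius [1 + N], as its diameter is at most
    [sqrt N]. *)
Lemma avg_loc (e : R) u x : 0 < e <= 1 -> L2 mu u ->
  avg e u x ^+ 2 <= (e ^+ N)^-1 * II mu (fun y => chi (1 + N%:R) y * u (addT y x) ^+ 2).
Proof.
move=> /andP[e0 e1] Lu; apply: le_trans (avg_sqr_loc x e0 Lu) _.
have i1 : itg mu (fun y => chi (1 + N%:R) y * u (addT y x) ^+ 2).
  have := itg_bound (itg_shift x Lu.2) (meas_chi (1 + N%:R)) (chi_abs (1 + N%:R)).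
  by congr itg; apply/funext => y; rewrite mulrC.
have [i2 ->] := II_scaleR e0 i1.
rewrite mulKf ?expf_neq0 ?gt_eqF//.
have [L _] := L2_addscale x e0 Lu.
apply: II_le; [exact: itg_kapM L.2|exact: i2|move=> h].
rewrite (addTC x); have [[-> hc]|->] := kap01 h; last first.
  by rewrite mul0r mulr_ge0 ?sqr_ge0//; have /andP[] := chi01 (1 + N%:R) (scaleT e h).
rewrite mul1r /chi ifT ?mul1r// euclN_scale ?(ltW e0)//.
apply: le_trans (_ : euclN h <= _); first by rewrite ler_piMl// sqrtr_ge0.
rewrite -[leRHS]ger0_norm ?addr_ge0// -sqrtr_sqr ler_wsqrtr//.
apply: le_trans (dotN_cube hc) _; have := ler0n R N; nra.
Qed.

End Averages.

(** * Embedding and Lions' lemma *)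

Lemma bernoulli_ge (R : realType) (b : R) n : 1 <= b -> 1 + n%:R * (b - 1) <= b ^+ n.
Proof.
move=> b1; elim: n => [|n IH]; first by rewrite mul0r addr0 expr0.
rewrite exprS -natr1.
have n0 := ler0n R n.
have b0 : 0 <= b by lra.
apply: le_trans (ler_wpM2l b0 IH).
have := mulr_ge0 n0 (sqr_ge0 (b - 1)); nra.
Qed.

Lemma expr_unbounded (R : realType) (b z : R) : 1 < b -> exists m, forall n, (m <= n)%N ->
  z <= b ^+ n.
Proof.
move=> b1; have b0 : 0 < b - 1 by rewrite subr_gt0.
have z0 : 0 <= `|z| / (b - 1) by rewrite divr_ge0// ltW.
exists (Num.bound (`|z| / (b - 1))) => n mn.
apply: le_trans (bernoulli_ge n (ltW b1)).
apply: le_trans (ler_norm z) _.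
have : `|z| / (b - 1) <= n%:R.
  by apply: le_trans (ltW (archi_boundP z0)) _; rewrite ler_nat.
by rewrite ler_pdivrMr//; lra.
Qed.

Lemma powR_exprn (R : realType) (a b : R) k : 0 <= a -> (a ^+ k) `^ b = (a `^ b) ^+ k.
Proof.
by move=> a0; rewrite -powR_mulrn// -powRrM mulrC powRrM powR_mulrn// powR_ge0.
Qed.

Section Embedding.
Variables (R : realType) (N : nat) (s r : R).
Hypotheses (s01 : 0 < s < 1) (sN : 2 * s < N%:R) (r0 : 0 < r)
  (rN : r * (N%:R - 2 * s) < 4 * s).
Local Notation T := (N.-tuple R).
Local Notation mu := (muN R N).
Implicit Types (u v w g : T -> R) (x y z h : T).

Definition ek k : R := 2^-1 ^+ k.
(** Rates per halving of the cubes: [tau] for the squared distance of [u] to its means, [beta] for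
    the sup norm of the means, where [beta ^+ 2 = 2 ^+ N * tau], and [rho] for the contribution of
    one layer to [int |u|^(2 + r)]. The inequality [rho < 1] is subcriticality. *)
Definition tau : R := 2 `^ (- (2 * s)).
Definition beta : R := 2 `^ (N%:R / 2 - s).
Definition rho : R := beta `^ r * tau.

Lemma ek_gt0 k : 0 < ek k. Proof. by rewrite exprn_gt0. Qed.

Lemma ek_le1 k : ek k <= 1.
Proof. by apply: exprn_ile1; rewrite ?invr_ge0// invf_le1// ler1n. Qed.

Lemma powR_2gt0 (a : R) : 0 < 2 `^ a :> R. Proof. by rewrite powR_gt0. Qed.

Lemma powR_2gt1 (a : R) : (1 < 2 `^ a :> R) = (0 < a).
Proof.
have l2 : 0 < ln 2 :> R by rewrite ln_gt0// ltr1n.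
by rewrite /powR pnatr_eq0 /= -[ltLHS]expR0 ltr_expR pmulr_lgt0.
Qed.

Lemma powR_2lt1 (a : R) : (2 `^ a < 1 :> R) = (a < 0).
Proof.
have l2 : 0 < ln 2 :> R by rewrite ln_gt0// ltr1n.
by rewrite /powR pnatr_eq0 /= -[ltRHS]expR0 ltr_expR pmulr_llt0.
Qed.

Lemma ek_pow k : ek k `^ (2 * s) = tau ^+ k.
Proof.
rewrite /ek /tau powR_exprn ?invr_ge0//; congr (_ ^+ _).
by rewrite -powR_inv1// -powRrM mulN1r.
Qed.

Lemma beta_gt1 : 1 < beta.
Proof.
have a0 : 0 < N%:R / 2 - s by move: sN; lra.
by rewrite /beta powR_2gt1.
Qed.

Lemma beta_sqr : beta ^+ 2 = 2 ^+ N * tau.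
Proof.
rewrite /beta /tau -powR_mulrn ?powR_ge0// -powRrM -[2 ^+ N]powR_mulrn// -powRD.
  by congr (_ `^ _); field.
by apply/implyP; rewrite pnatr_eq0.
Qed.

Lemma rho01 : 0 < rho < 1.
Proof.
rewrite /rho /beta /tau -powRrM -powRD; last by apply/implyP; rewrite pnatr_eq0.
rewrite powR_2gt0 powR_2lt1.
by move: rN; lra.
Qed.

Lemma invek k : (ek k ^+ N)^-1 = (2 ^+ N) ^+ k.
Proof. by rewrite /ek exprVn exprVn invrK exprAC. Qed.

(** [|z|^(2 + r)], that is [|z|^(p + 1)] for [r = p - 1], with the square kept apart so that layer
    estimates in L2 apply directly. *)
Definition pw (z : R) : R := z ^+ 2 * `|z| `^ r.

Lemma pw_ge0 (t : R) : 0 <= pw t. Proof. by rewrite mulr_ge0 ?sqr_ge0 ?powR_ge0. Qed.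

Lemma meas_pw d (S : measurableType d) (g : S -> R) : measurable_fun setT g ->
  measurable_fun setT (fun y : S => pw (g y)).
Proof.
move=> mg; apply: measurable_funM; first exact: measurable_funX.
apply: (@measurableT_comp _ _ _ _ _ _ (@powR R ^~ r)); first exact: measurable_powR.
exact: measurableT_comp.
Qed.

Section Bounded.
Variable M : R.
Hypothesis M0 : 0 < M.

(** [sqrt M] bounds the means at scale 1. The second term makes [Dbound * (beta - 1)] at least the
    coefficient of the increments, so that the induction in [avg_bound] closes. *)
Definition Dbound : R :=
  Num.sqrt M + Num.sqrt (2 ^+ N * (Cavg R N * M)) / (beta - 1).

Lemma Dbound_gt0 : 0 < Dbound.
Proof.
rewrite ltr_wpDr ?sqrtr_gt0// divr_ge0 ?sqrtr_ge0// ltW// subr_gt0.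
exact: beta_gt1.
Qed.

Section OneFunction.
Variable u : T -> R.
Hypotheses (Hu : Hs s u) (uM : nsq mu u <= M) (uK : Kin s u <= M).

Lemma avg_close_k k : L2 mu (fun x => u x - avg (ek k) u x) /\
  nsq mu (fun x => u x - avg (ek k) u x) <= Cavg R N * M * tau ^+ k.
Proof.
have [L h] := avg_close s01 (ek_gt0 k) Hu; split => //; apply: le_trans h _.
rewrite ek_pow mulrAC ler_wpM2r ?exprn_ge0 ?powR_ge0//.
by rewrite ler_wpM2l// ltW// Cavg_gt0.
Qed.

Lemma avg_bound k x : `|avg (ek k) u x| <= Dbound * beta ^+ k.
Proof.
have b1 := beta_gt1; have bm : 0 < beta - 1 by rewrite subr_gt0.
set E := Num.sqrt (2 ^+ N * (Cavg R N * M)).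
have E0 : 0 <= E by exact: sqrtr_ge0.
have C0 := Cavg_gt0 R N.
elim: k x => [|k IH] x.
  rewrite expr0 mulr1; apply: le_trans (_ : Num.sqrt M <= _); last first.
    by rewrite /Dbound lerDl divr_ge0// ltW.
  apply: norm_le_sqr; first exact: sqrtr_ge0.
  rewrite sqr_sqrtr ?(ltW M0)//; apply: le_trans (avg_sqr_le x (ek_gt0 0) Hu.1) _.
  by rewrite invek expr0 mul1r.
have [L h] := avg_close_k k; have La := L2_avg s01 (ek_gt0 k) Hu.
(* The mean of the previous mean keeps its sup bound. The mean of the remainder is at most
   [2 ^+ (N (k + 1))] times its squared norm, under a square root, hence of order [beta ^+ k]. *)
have -> : avg (ek k.+1) u x = avg (ek k.+1) (fun y => u y - avg (ek k) u y) x +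
    avg (ek k.+1) (avg (ek k) u) x.
  by rewrite (avgB _ (ek_gt0 _) Hu.1 La) subrK.
apply: le_trans (ler_normD _ _) _.
apply: le_trans (_ : E * beta ^+ k + Dbound * beta ^+ k <= _).
  apply: lerD; last exact: avg_sup (ek_gt0 _) La IH.
  apply: norm_le_sqr; first by rewrite mulr_ge0// exprn_ge0// ltW// (lt_trans ltr01).
  apply: le_trans (avg_sqr_le x (ek_gt0 k.+1) L) _.
  rewrite invek exprMn sqr_sqrtr; last first.
    by rewrite mulr_ge0 ?exprn_ge0// mulr_ge0 ?(ltW C0) ?(ltW M0).
  rewrite [beta ^+ k ^+ 2]exprAC beta_sqr (exprMn _ (2 ^+ N)) exprS.
  have a0 : 0 <= 2 ^+ N * 2 ^+ N ^+ k :> R by rewrite mulr_ge0 ?exprn_ge0.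
  apply: le_trans (ler_wpM2l a0 h) _.
  by rewrite le_eqVlt; apply/orP; left; apply/eqP; ring.
rewrite -mulrDl exprS mulrA ler_wpM2r ?exprn_ge0 ?(ltW (lt_trans ltr01 b1))//.
have -> : Dbound * beta = Dbound * (beta - 1) + Dbound by ring.
rewrite lerD2r /Dbound mulrDl divfK ?gt_eqF// lerDr mulr_ge0 ?sqrtr_ge0//.
exact: ltW.
Qed.

Definition above (l : R) x : R := if l < `|u x| then 1 else 0.

Lemma meas_above l : measurable_fun setT (above l).
Proof.
apply: measurable_fun_ifT => //; apply: measurable_fun_ltr => //.
by apply: measurableT_comp => //; exact: Hu.1.1.
Qed.

Lemma itg_above l : itg mu (fun x => above l x * u x ^+ 2).
Proof.
apply: (itg_le _ _ Hu.1.2) => [|x].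
  by apply: measurable_funM; [exact: meas_above|apply: measurable_funX; exact: Hu.1.1].
by rewrite /above; case: ifP => _; rewrite ?mul1r ?mul0r ?normr0 ?sqr_ge0// ger0_norm ?sqr_ge0.
Qed.

(** Where [|u|] exceeds twice its mean, [|u| <= 2 |u - avg u|], so the mass of [u] there is
    controlled by the distance to the means. *)
Lemma II_above k l : (forall x, 2 * `|avg (ek k) u x| <= l) ->
  II mu (fun x => above l x * u x ^+ 2) <= 4 * (Cavg R N * M) * tau ^+ k.
Proof.
move=> al; have [L h] := avg_close_k k.
apply: le_trans (_ : 4 * nsq mu (fun x => u x - avg (ek k) u x) <= _); last first.
  by rewrite -[leRHS]mulrA ler_wpM2l.
rewrite -(IIZ _ L.2); apply: II_le; [exact: itg_above|exact: itgZ L.2|move=> x].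
rewrite /above; case: ifPn => [ul|_]; last by rewrite mul0r mulr_ge0 ?sqr_ge0.
rewrite mul1r; have := al x; move: (avg _ _ _) => a aL.
have : `|u x| <= 2 * `|u x - a|.
  have := ler_normD (u x - a) a; rewrite subrK; lra.
rewrite -(@ler_pXn2r _ 2) ?nnegrE ?mulr_ge0// exprMn !real_normK ?num_real//.
by rewrite -natrX.
Qed.

Definition Clay : R := (2 * Dbound * beta) `^ r * (4 * (Cavg R N * M)).

(** Heights of the layers: twice the sup bound of the means at scale [k0 + j], except the lowest,
    which is left free so that Lions' lemma can take it small. *)
Definition lay (k0 : nat) (l0 : R) j : R :=
  if j is 0%N then l0 else 2 * Dbound * beta ^+ (k0 + j).

Lemma pw_layers k0 (l0 : R) n x : 0 <= l0 -> `|u x| <= lay k0 l0 n ->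
  pw (u x) <= l0 `^ r * u x ^+ 2 +
    \sum_(j < n) (2 * Dbound * beta ^+ (k0 + j).+1) `^ r * (above (lay k0 l0 j) x * u x ^+ 2).
Proof.
move=> l00; have D0 := Dbound_gt0; have b0 := lt_trans ltr01 beta_gt1.
have t0 j : 0 <= (2 * Dbound * beta ^+ (k0 + j).+1) `^ r *
    (above (lay k0 l0 j) x * u x ^+ 2).
  by rewrite mulr_ge0 ?powR_ge0// mulr_ge0 ?sqr_ge0// /above; case: ifP.
elim: n => [|n IH] ul.
  rewrite big_ord0 addr0 /pw mulrC ler_wpM2r ?sqr_ge0//.
  by apply: ge0_ler_powR; rewrite ?nnegrE// ltW.
rewrite big_ord_recr /=; have [un|un] := leP `|u x| (lay k0 l0 n).
  by apply: le_trans (IH un) _; rewrite addrA lerDl.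
rewrite {2}/above un mul1r.
apply: le_trans (_ : (2 * Dbound * beta ^+ (k0 + n).+1) `^ r * u x ^+ 2 <= _); last first.
  rewrite addrA lerDr addr_ge0//; first by rewrite mulr_ge0 ?powR_ge0 ?sqr_ge0.
  by apply: sumr_ge0 => j _; exact: t0.
rewrite /pw mulrC ler_wpM2r ?sqr_ge0//; apply: ge0_ler_powR; rewrite ?nnegrE ?(ltW r0)//.
  by rewrite mulr_ge0 ?exprn_ge0 ?(ltW b0)// mulr_ge0 ?(ltW D0).
by rewrite -addnS.
Qed.

(** The part with [|u| <= l0] contributes at most [l0^r M]. In layer [j] the height to the power [r]
    times the mass above it is of order [rho ^+ (k0 + j)], and the layers sum to a geometric
    series. *)
Lemma pw_bound k0 (l0 : R) : 0 <= l0 -> (forall x, 2 * `|avg (ek k0) u x| <= l0) ->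
  itg mu (fun x => pw (u x)) /\
  II mu (fun x => pw (u x)) <= l0 `^ r * M + Clay / (1 - rho) * rho ^+ k0.
Proof.
move=> l00 al; have D0 := Dbound_gt0; have b0 := lt_trans ltr01 beta_gt1.
have /andP[q0 q1] := rho01; have C0 := Cavg_gt0 R N.
have mu_ := Hu.1.1; have mp := meas_pw mu_.
(* Below height [lay k0 l0 n] only finitely many layers occur; Fatou then removes the cut, since the
   heights are unbounded. *)
pose cut n x : R := if `|u x| <= lay k0 l0 n then 1 else 0.
have mc n : measurable_fun setT (cut n).
  apply: measurable_fun_ifT => //; apply: measurable_fun_ler => //.
  exact: measurableT_comp.
pose c j := (2 * Dbound * beta ^+ (k0 + j).+1) `^ r.
have c0 j : 0 <= c j by exact: powR_ge0.
pose bd n x := l0 `^ r * u x ^+ 2 + \sum_(j < n) c j * (above (lay k0 l0 j) x * u x ^+ 2).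
have laybd j : II mu (fun x => above (lay k0 l0 j) x * u x ^+ 2) <=
    4 * (Cavg R N * M) * tau ^+ (k0 + j).
  case: j => [|j]; first by rewrite addn0; exact: II_above.
  apply: II_above => x; rewrite /lay -mulrA ler_wpM2l//; exact: avg_bound.
have bdP n : itg mu (bd n) /\ II mu (bd n) <=
    l0 `^ r * M + \sum_(j < n) Clay * rho ^+ k0 * rho ^+ j.
  elim: n => [|n [iIH IH]].
    rewrite /bd big_ord0 addr0; under eq_fun do rewrite big_ord0 addr0.
    split; first by apply: itgZ; exact: Hu.1.2.
    by rewrite (IIZ _ Hu.1.2) ler_wpM2l ?powR_ge0.
  have E : bd n.+1 = (fun x => bd n x + c n * (above (lay k0 l0 n) x * u x ^+ 2)).
    by apply/funext => x; rewrite /bd big_ord_recr /= addrA.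
  have i1 := itgZ (c n) (itg_above (lay k0 l0 n)).
  rewrite E; split; first exact: itgD.
  rewrite (IID iIH i1) (IIZ _ (itg_above _)) big_ord_recr /= addrA lerD//.
  apply: le_trans (ler_wpM2l (c0 n) (laybd n)) _.
  rewrite le_eqVlt; apply/orP; left; apply/eqP.
  have -> : c n = (2 * Dbound * beta) `^ r * (beta `^ r) ^+ (k0 + n).
    rewrite /c exprS mulrA powRM ?powR_exprn ?exprn_ge0 ?(ltW b0)//.
    by rewrite mulr_ge0 ?(ltW b0)// mulr_ge0 ?(ltW D0).
  rewrite /Clay /rho !exprMn !exprD; ring.
have hbd n x : 0 <= cut n x * pw (u x) <= bd n x.
  rewrite /cut; case: ifPn => h; first by rewrite mul1r pw_ge0; exact: pw_layers.
  rewrite mul0r lexx /bd addr_ge0//; first by rewrite mulr_ge0 ?powR_ge0 ?sqr_ge0.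
  apply: sumr_ge0 => j _; rewrite mulr_ge0// mulr_ge0 ?sqr_ge0// /above.
  by case: ifP.
have mcp n : measurable_fun setT (fun x => cut n x * pw (u x)).
  by apply: measurable_funM; [exact: mc|exact: mp].
have hn n := II_ge0_le (mcp n) (hbd n) (bdP n).1.
apply: (@II_fatou _ _ _ mu (fun n x => cut n x * pw (u x))).
- by move=> n; have [] := hn n.
- exact: mp.
- by move=> n x; have /andP[] := hbd n x.
- by move=> x; exact: pw_ge0.
- apply: aeW => x; apply: cvg_eps => e e0.
  have [m hm] := expr_unbounded (`|u x| / (2 * Dbound)) beta_gt1.
  exists m.+1 => n mn; rewrite /cut ifT ?mul1r ?subrr ?normr0 ?(ltW e0)//.
  case: n mn => // n mn; rewrite /lay.
  have : `|u x| / (2 * Dbound) <= beta ^+ (k0 + n.+1).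
    by apply: hm; rewrite (leq_trans _ (leq_addl _ _))// ltnW.
  by rewrite ler_pdivrMr ?mulr_gt0// mulrC.
- move=> n; have [_ h] := hn n; apply: le_trans h _; apply: le_trans (bdP n).2 _.
  rewrite lerD2l -mulr_sumr -mulrA [leRHS]mulrAC -[leRHS]mulrA.
  rewrite ler_wpM2l//; first by rewrite mulr_ge0 ?powR_ge0 ?mulr_ge0 ?(ltW C0) ?(ltW M0).
  by rewrite ler_wpM2l ?exprn_ge0 ?(ltW q0)// geo_sum_le// q1 ltW.
Qed.

End OneFunction.

Lemma pw_embed : exists C : R, forall u, Hs s u -> nsq mu u <= M -> Kin s u <= M ->
  itg mu (fun x => pw (u x)) /\ II mu (fun x => pw (u x)) <= C.
Proof.
eexists => u Hu uM uK; apply: (@pw_bound u Hu uM uK 0 (2 * Dbound)).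
  by rewrite mulr_ge0// ltW// Dbound_gt0.
by move=> x; rewrite ler_wpM2l//; have := avg_bound Hu uM uK 0 x; rewrite expr0 mulr1.
Qed.

(** The scale [k0] makes the layer series at most [e / 2], then [l0] makes the low part equal to
    [e / 2]. Small mass on all balls forces the means at scale [k0] below [l0 / 2]. *)
Lemma lions (e : R) : 0 < e -> exists2 eta : R, 0 < eta &
  forall u, Hs s u -> nsq mu u <= M -> Kin s u <= M ->
  (forall x, II mu (fun y => chi (1 + N%:R) y * u (addT y x) ^+ 2) <= eta) ->
  II mu (fun x => pw (u x)) <= e.
Proof.
move=> e0; have /andP[q0 q1] := rho01; have C0 := Cavg_gt0 R N.
have [k0 hk0] : exists k0, Clay / (1 - rho) * rho ^+ k0 <= e / 2.
  have q2 : 1 < rho^-1 by rewrite invf_gt1.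
  have [m hm] := expr_unbounded (Clay / (1 - rho) / (e / 2)) q2.
  exists m; have := hm m (leqnn m).
  rewrite exprVn ler_pdivrMr ?divr_gt0// => h.
  have := ler_wpM2r (exprn_ge0 m (ltW q0)) h.
  by rewrite mulrC [leRHS]mulrAC mulVf ?mul1r ?expf_neq0 ?gt_eqF// mulrC.
pose l0 := (e / (2 * M)) `^ r^-1.
have l00 : 0 < l0 by rewrite powR_gt0// divr_gt0// mulr_gt0.
have l0r : l0 `^ r * M = e / 2.
  rewrite /l0 -powRrM mulVf ?gt_eqF// powRr1 ?divr_ge0 ?(ltW e0) ?mulr_ge0 ?(ltW M0)//.
  by field; rewrite gt_eqF.
exists (ek k0 ^+ N * (l0 / 2) ^+ 2).
  by rewrite mulr_gt0 ?exprn_gt0 ?ek_gt0// divr_gt0.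
move=> u Hu uM uK hu.
have [|_ h] := @pw_bound u Hu uM uK k0 l0 (ltW l00).
  move=> x; rewrite mulrC -ler_pdivlMr//; apply: norm_le_sqr.
    by rewrite divr_ge0// ltW.
  have ee : 0 < ek k0 <= 1 by rewrite ek_gt0 ek_le1.
  apply: le_trans (avg_loc x ee Hu.1) _.
  rewrite mulrC ler_pdivrMr ?exprn_gt0 ?ek_gt0// mulrC; exact: hu.
by apply: le_trans h _; rewrite l0r; lra.
Qed.

End Bounded.

Lemma pwZ (a t : R) : 0 <= a -> pw (a * t) = a ^+ 2 * a `^ r * pw t.
Proof.
by move=> a0; rewrite /pw normrM (ger0_norm a0) powRM// exprMn; ring.
Qed.

End Embedding.

(** * Local compactness *)

Lemma sqr_sum3_le (R : realType) (a b c : R) :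
  (a + b + c) ^+ 2 <= 3 * (a ^+ 2 + b ^+ 2 + c ^+ 2).
Proof.
have := sqr_ge0 (a - b); have := sqr_ge0 (a - c); have := sqr_ge0 (b - c); nra.
Qed.

Lemma cvgRB (R : realType) (u v : nat -> R) (a b : R) : u @ \oo --> a -> v @ \oo --> b ->
  (fun n => u n - v n) @ \oo --> a - b.
Proof. by move=> ua vb; exact: (cvgB ua vb). Qed.

Lemma cvgRM (R : realType) (u v : nat -> R) (a b : R) : u @ \oo --> a -> v @ \oo --> b ->
  (fun n => u n * v n) @ \oo --> a * b.
Proof. by move=> ua vb; exact: (cvgM ua vb). Qed.

Lemma cauchy_cvgR (R : realType) (u : nat -> R) :
  (forall e : R, 0 < e -> exists m, forall i j, (m <= i)%N -> (m <= j)%N ->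
    `|u i - u j| <= e) -> exists l : R, u @ \oo --> l.
Proof.
move=> cu; suff /cvg_ex[l ul] : cvg (u @ \oo) by exists l.
apply/cauchy_cvgP/cauchy_exP => e e0.
have e2 : 0 < e / 2 by rewrite divr_gt0.
have [m hm] := cu _ e2; exists (u m); exists m => // n /= mn.
by rewrite /ball /=; have := hm m n (leqnn m) mn; lra.
Qed.

(* an ultrafilter finer than \oo yields the limits of all the sequences at once *)
Lemma diagonal_extraction (R : realType) (a : nat -> nat -> R) (B : nat -> R) :
  (forall n i, `|a n i| <= B i) ->
  exists2 phi : nat -> nat, (forall k, (phi k < phi k.+1)%N) &
    forall i, exists l : R, (fun k => a (phi k) i) @ \oo --> l.
Proof.
move=> aB; have [U [UU sU]] := ultraFilterLemma (F := \oo) _.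
have PU : ProperFilter U by exact: ultra_proper.
have /choice[l hl] : forall i, exists l : R, forall e : R, 0 < e -> U [set n | `|a n i - l| < e].
  move=> i; pose F := (fun n => a n i) @ U.
  have FK : F `[- B i, B i]%classic.
    have -> : F `[- B i, B i]%classic = U [set n | `[- B i, B i]%classic (a n i)] by [].
    apply: filterS filterT => n _ /=; rewrite in_itv /= -ler_norml; exact: aB.
  have PF : ProperFilter F by exact: fmap_proper_filter.
  have [l [_ cl]] := @segment_compact R _ _ F PF FK; exists l => e e0.
  have [//|nU] := in_ultra_setVsetC [set n | `|a n i - l| < e] UU.
  have FA : F [set x | ~ (`|x - l| < e)] by exact: nU.
  have lB : nbhs l [set x | `|x - l| < e].
    exists e => //= x; rewrite /ball /= distrC; exact.
  by have [x []] := cl _ _ FA lB.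
have [|phi ip hphi] := extract (P := fun k n => forall i, (i < k)%N ->
    `|a n i - l i| < k.+1%:R^-1).
  move=> k m.
  have Uk : U [set n | forall i, (i < k)%N -> `|a n i - l i| < k.+1%:R^-1].
    have H j : U [set n | forall i, (i < j)%N -> `|a n i - l i| < k.+1%:R^-1].
      elim: j => [|j IH]; first by apply: filterS filterT => n _ i.
      apply: filterS2 IH (hl j k.+1%:R^-1 _) => [n h1 h2 i|].
        by rewrite ltnS leq_eqVlt => /predU1P[->//|/h1].
      by rewrite invr_gt0.
    exact: H.
  have Um : U [set n | (m <= n)%N] by apply: sU; exists m.
  have [n [h1 h2]] := filter_ex (filterI Um Uk).
  by exists n.
exists phi => // i; exists (l i); apply: cvg_eps => e e0.
exists (maxn i.+1 (Num.bound e^-1)) => k; rewrite geq_max => /andP[ik bk].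
apply: ltW; apply: lt_le_trans (hphi k i ik) _.
rewrite -[leRHS]invrK lef_pV2 ?posrE ?invr_gt0//.
have e1 : 0 <= e^-1 by rewrite invr_ge0 ltW.
apply: le_trans (ltW (archi_boundP e1)) _; rewrite ler_nat; exact: leqW.
Qed.

Section LocalCompactness.
Variables (R : realType) (N : nat) (s : R).
Hypothesis s01 : 0 < s < 1.
Local Notation T := (N.-tuple R).
Local Notation mu := (muN R N).
Implicit Types (u v w g : T -> R) (x y z h : T).

Definition ratT (q : N.-tuple rat) : T := [tuple ratr (tnth q i) | i < N].

Lemma euclN_le (a : T) (d : R) : 0 <= d -> (forall i, `|tnth a i| <= d) ->
  euclN a <= N.+1%:R * d.
Proof.
move=> d0 ad; rewrite -[leRHS]ger0_norm ?mulr_ge0// -sqrtr_sqr ler_wsqrtr//.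
apply: le_trans (_ : \sum_(i < N) d ^+ 2 <= _).
  apply: ler_sum => i _; rewrite -expr2 -[X in X <= _]real_normK ?num_real//.
  by rewrite lerXn2r ?nnegrE.
rewrite sumr_const card_ord -[d ^+ 2 *+ N]mulr_natl exprMn ler_wpM2r ?sqr_ge0//.
by rewrite -natrX ler_nat; nia.
Qed.

Lemma ratT_dense x (d : R) : 0 < d -> exists q, euclN (addT (ratT q) (oppT x)) <= d.
Proof.
move=> d0; pose d' := d / N.+1%:R.
have d'0 : 0 < d' by rewrite divr_gt0.
have /choice[q hq] : forall i : 'I_N, exists q : rat, `|ratr q - tnth x i| <= d'.
  move=> i; have [|q] := @rat_in_itvoo R (tnth x i) (tnth x i + d'); first by rewrite ltrDl.
  rewrite in_itv /= => /andP[h1 h2]; exists q; rewrite ger0_norm ?subr_ge0 ?(ltW h1)//.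
  by rewrite lerBlDr addrC ltW.
exists [tuple q i | i < N]; apply: le_trans (euclN_le (ltW d'0) _) _.
  by move=> i; rewrite !tnth_mktuple.
by rewrite /d' mulrC divfK// pnatr_eq0.
Qed.

Section Sequence.
Variables (u_ : nat -> T -> R) (M : R).
Hypotheses (M0 : 0 < M) (Hu : forall n, Hs s (u_ n)) (uM : forall n, nsq mu (u_ n) <= M)
  (uK : forall n, Kin s (u_ n) <= M).

Let Bk k : R := 1 + (ek R k ^+ N)^-1 * M.

Let avgB k n x : `|avg (ek R k) (u_ n) x| <= Bk k.
Proof.
have e0 : 0 < ek R k ^+ N by rewrite exprn_gt0// ek_gt0.
have h : avg (ek R k) (u_ n) x ^+ 2 <= (ek R k ^+ N)^-1 * M.
  apply: le_trans (avg_sqr_le x (ek_gt0 R k) (Hu n).1) _.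
  by rewrite ler_wpM2l// invr_ge0 ltW.
have a0 : 0 <= (ek R k ^+ N)^-1 * M.
  by rewrite mulr_ge0 ?(ltW M0)// invr_ge0 ltW.
apply: norm_le_sqr; first by rewrite addr_ge0.
by apply: le_trans h _; rewrite /Bk; move: a0; set a := _ * M => a0; nra.
Qed.

(** The means at all scales and all rational points form one countable family of bounded sequences;
    the Hoelder modulus extends their convergence to every point. *)
Lemma avg_pointwise : exists2 phi : nat -> nat, (forall k, (phi k < phi k.+1)%N) &
  forall k x, exists l : R, (fun n => avg (ek R k) (u_ (phi n)) x) @ \oo --> l.
Proof.
pose a n i : R := if @unpickle (nat * N.-tuple rat)%type i is Some p
  then avg (ek R p.1) (u_ n) (ratT p.2) else 0.
pose B i : R := if @unpickle (nat * N.-tuple rat)%type i is Some p then Bk p.1 else 0.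
have [|phi ip hphi] := @diagonal_extraction R a B.
  by move=> n i; rewrite /a /B; case: unpickle => [p|]; rewrite ?normr0.
exists phi => // k x; apply: cauchy_cvgR => e e0.
have e6 : 0 < e / 6 by rewrite divr_gt0.
have s2 : 0 < 2 * s by have /andP[] := s01; lra.
(* Solves [4 * c * M / ek k ^+ N = (e / 6)^2]: with [d ^ (2 s) = c], the Hoelder bound at distance
   [d] is exactly [e / 6]. *)
pose c : R := (e / 6) ^+ 2 * (ek R k ^+ N) / (4 * M).
have k0 : 0 < ek R k ^+ N by rewrite exprn_gt0// ek_gt0.
have c0 : 0 < c by rewrite divr_gt0 ?mulr_gt0 ?exprn_gt0.
pose d := c `^ (2 * s)^-1.
have d0 : 0 < d by rewrite powR_gt0.
have [q hq] := ratT_dense x d0.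
have close n : `|avg (ek R k) (u_ n) (ratT q) - avg (ek R k) (u_ n) x| <= e / 6.
  apply: norm_le_sqr; first exact: ltW.
  have := avg_holder s01 x (addT (ratT q) (oppT x)) (ek_gt0 R k) (Hu n).
  rewrite (addTC x) addTNK => h; apply: le_trans h _.
  rewrite mulrC ler_pdivrMr//.
  apply: le_trans (_ : 4 * d `^ (2 * s) * M <= _).
    apply: ler_pM; rewrite ?mulr_ge0 ?powR_ge0 ?Kin_ge0 ?uK//.
    by rewrite ler_wpM2l// ge0_ler_powR ?nnegrE ?(ltW s2) ?sqrtr_ge0 ?(ltW d0).
  rewrite /d -powRrM mulVf ?gt_eqF// powRr1 ?(ltW c0)//.
  rewrite -mulrA [c * M]mulrC mulrA /c mulrC divfK// mulf_neq0 ?gt_eqF//.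
have [l hl] := hphi (pickle (k, q)).
have hl' : (fun n => avg (ek R k) (u_ (phi n)) (ratT q)) @ \oo --> l.
  by apply: eq_cvgR hl => n; rewrite /a pickleK.
have [m hm] := eps_cvg hl' e6.
exists m => i j mi mj.
have := close (phi i); have := close (phi j); have := hm i mi; have := hm j mj.
rewrite !ler_norml => /andP[? ?] /andP[? ?] /andP[? ?] /andP[? ?].
by apply/andP; split; lra.
Qed.

Let CM : R := Cavg R N * M.

Let closeM k n : L2 mu (fun x => u_ n x - avg (ek R k) (u_ n) x) /\
  nsq mu (fun x => u_ n x - avg (ek R k) (u_ n) x) <= CM * tau s ^+ k.
Proof. by have := avg_close_k s01 (Hu n) (uK n) k. Qed.

Let tau01 : 0 < tau s < 1.
Proof.
by have /andP[s0 _] := s01; rewrite /tau powR_2gt0 powR_2lt1 oppr_lt0 mulr_gt0.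
Qed.

Let tau_small (e : R) : 0 < e -> exists m, forall k, (m <= k)%N -> CM * tau s ^+ k <= e.
Proof.
have /andP[t0 t1] := tau01; have C0 : 0 < CM by rewrite mulr_gt0// Cavg_gt0.
move=> e0; have q2 : 1 < (tau s)^-1 by rewrite invf_gt1.
have [m hm] := expr_unbounded (CM / e) q2; exists m => k mk.
have := hm k mk; rewrite exprVn ler_pdivrMr// => h.
have := ler_wpM2r (exprn_ge0 k (ltW t0)) h.
by rewrite [leRHS]mulrAC mulVf ?mul1r// expf_neq0// gt_eqF.
Qed.

Lemma itg_chiM (q : R) g : itg mu g -> itg mu (fun x => chi q x * g x).
Proof.
move=> ig; have := itg_bound ig (meas_chi q) (chi_abs q).
by congr itg; apply/funext => x; rewrite mulrC.
Qed.

(** Split [u - w] as [(u - A k) + (A k - E k) + (E k - w)]: the first term is small uniformly in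
    [n], the third for large [k], and on a ball the middle one tends to 0 by dominated
    convergence. *)
Lemma L2loc_subseq : exists2 phi : nat -> nat, (forall k, (phi k < phi k.+1)%N) &
  exists2 w, L2 mu w & forall q : R,
  (fun n => II mu (fun x => chi q x * (u_ (phi n) x - w x) ^+ 2)) @ \oo --> (0 : R).
Proof.
have [phi ip hphi] := avg_pointwise; exists phi => //.
pose A k n := avg (ek R k) (u_ (phi n)).
have LA k n : L2 mu (A k n) by exact: (L2_avg s01 (ek_gt0 R k) (Hu _)).
pose E k := lims (A k).
have cE k x : (fun n => A k n x) @ \oo --> E k x.
  by have [l hl] := hphi k x; rewrite /E (lims_cvg hl).
have mE k : measurable_fun setT (E k).
  by apply: meas_lims => n; exact: (LA k n).1.
have C0 : 0 < CM by rewrite mulr_gt0// Cavg_gt0.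
have /andP[t0 t1] := tau01.
have cl k n : nsq mu (fun x => A k n x - u_ (phi n) x) <= CM * tau s ^+ k.
  by rewrite nsq_subC; exact: (closeM k (phi n)).2.
have LE k : L2 mu (E k).
  split => //; apply: (@II_fatou _ _ _ mu (fun n x => A k n x ^+ 2) _ (2 * CM + 2 * M) _ _ _ _ _ _).1.
  - by move=> n; exact: (LA k n).2.
  - exact: measurable_funX.
  - by move=> n x; exact: sqr_ge0.
  - by move=> x; exact: sqr_ge0.
  - by apply: aeW => x; exact: cvgRM (cE k x) (cE k x).
  - move=> n.
    have E1 : A k n = (fun x => (A k n x - u_ (phi n) x) + u_ (phi n) x).
      by apply/funext => x; rewrite subrK.
    rewrite -/(nsq mu (A k n)) E1.
    apply: le_trans (nsqD_le (L2B (LA k n) (Hu _).1) (Hu _).1) _.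
    apply: lerD; rewrite ler_wpM2l ?uM//.
    apply: le_trans (cl k n) _.
    by rewrite ler_piMr ?(ltW C0)// exprn_ile1 ?(ltW t0) ?(ltW t1).
have dE k j : nsq mu (fun x => E k x - E j x) <= 2 * (CM * tau s ^+ k) + 2 * (CM * tau s ^+ j).
  apply: (@II_fatou _ _ _ mu (fun n x => (A k n x - A j n x) ^+ 2) _ _ _ _ _ _ _ _).2.
  - by move=> n; exact: (L2B (LA k n) (LA j n)).2.
  - by apply: measurable_funX; exact: measurable_funB.
  - by move=> n x; exact: sqr_ge0.
  - by move=> x; exact: sqr_ge0.
  - apply: aeW => x; have c := cvgRB (cE k x) (cE j x); exact: (cvgRM c c).
  - move=> n; apply: le_trans (nsq_sub_le (LA k n) (Hu (phi n)).1 (LA j n)) _.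
    have := cl k n; have := (closeM j (phi n)).2; rewrite -/(A j n); lra.
have [|w [mw iw cw]] := L2_complete mE (fun k => (LE k).2).
  move=> e e0; have e4 : 0 < e / 4 by rewrite divr_gt0.
  have [m hm] := tau_small e4; exists m => i j mi mj.
  apply: le_trans (dE i j) _; have := hm i mi; have := hm j mj; lra.
have Lw : L2 mu w by [].
exists w => // q; apply: cvg_eps => e e0.
have e9 : 0 < e / 9 by rewrite divr_gt0.
have [m1 h1] := tau_small e9; have [m2 h2] := eps_cvg cw e9.
pose k := maxn m1 m2.
have Ek : nsq mu (fun x => E k x - w x) <= e / 9.
  by have := h2 k (leq_maxr _ _); rewrite subr0; apply: le_trans; exact: ler_norm.
have EB x : `|E k x| <= Bk k.
  rewrite ler_norml; apply/andP; split.
    apply: (cvgR_ge (cE k x)) => n.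
    by have := avgB k (phi n) x; rewrite ler_norml => /andP[].
  apply: (cvgR_le (cE k x)) => n.
  by have := avgB k (phi n) x; rewrite ler_norml => /andP[].
have cmid : (fun n => II mu (fun x => chi q x * (A k n x - E k x) ^+ 2)) @ \oo --> (0 : R).
  apply: (@II_dct0 _ _ _ mu _ (fun x => (2 * Bk k) ^+ 2 * chi q x)).
  - move=> n; apply: measurable_funM; first exact: meas_chi.
    by apply: measurable_funX; apply: measurable_funB; [exact: (LA k n).1|].
  - apply: aeW => x; have c := cvgRB (cE k x) (cvgR_cst (E k x)); rewrite subrr in c.
    by have := cvgRZ (chi q x) (cvgRM c c); rewrite mulr0 mulr0.
  - move=> n x; have /andP[c0 c1] := chi01 q x.
    rewrite normrM (ger0_norm c0) (ger0_norm (sqr_ge0 _)) mulrC ler_wpM2r//.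
    rewrite -[leLHS]real_normK ?num_real// lerXn2r ?nnegrE//.
      by rewrite mulr_ge0// (le_trans _ (EB x)).
    apply: le_trans (ler_normB _ _) _; have := EB x; have := avgB k (phi n) x.
    by rewrite /A; lra.
  - by apply: itgZ; exact: itg_chi.
have [m hm] := eps_cvg cmid e9; exists m => n mn.
have := hm n mn; rewrite !subr0 !ger0_norm; last 2 first.
- by apply: II_ge0 => x; rewrite mulr_ge0 ?sqr_ge0//; have /andP[] := chi01 q x.
- by apply: II_ge0 => x; rewrite mulr_ge0 ?sqr_ge0//; have /andP[] := chi01 q x.
move=> h3; have [Lc hc] := closeM k (phi n).
have hc' : nsq mu (fun x => u_ (phi n) x - A k n x) <= e / 9.
  by apply: le_trans hc (h1 k (leq_maxl _ _)).
have i1 : itg mu (fun x => (u_ (phi n) x - A k n x) ^+ 2) := Lc.2.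
have i2 := itg_chiM q (L2B (LA k n) (LE k)).2; have i3 := (L2B (LE k) Lw).2.
apply: le_trans (_ : 3 * (nsq mu (fun x => u_ (phi n) x - A k n x) +
   II mu (fun x => chi q x * (A k n x - E k x) ^+ 2) + nsq mu (fun x => E k x - w x)) <= _);
   last by lra.
rewrite /nsq -(IID i1 i2) -(IID (itgD i1 i2) i3) -(IIZ _ (itgD (itgD i1 i2) i3)).
apply: II_le; [exact: itg_chiM (L2B (Hu _).1 Lw).2|exact/itgZ/itgD/i3/itgD|move=> x].
rewrite /chi; case: ifPn => _; rewrite ?mul1r ?mul0r ?addr0; last first.
  by rewrite mulr_ge0// addr_ge0 ?sqr_ge0.
move: (u_ _ x) (A k n x) (E k x) (w x) => a b c d.
have -> : a - d = (a - b) + (b - c) + (c - d) by ring.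
exact: sqr_sum3_le.
Qed.

End Sequence.

(** Local convergence handles the test function on a large ball; outside it the test function is
    small and the sequence bounded. *)
Lemma L2loc_weak (u_ : nat -> T -> R) w (M : R) : (forall n, L2 mu (u_ n)) ->
  (forall n, nsq mu (u_ n) <= M) -> L2 mu w ->
  (forall q : R, (fun n => II mu (fun x => chi q x * (u_ n x - w x) ^+ 2)) @ \oo --> (0 : R)) ->
  forall psi, L2 mu psi ->
    (fun n => II mu (fun x => u_ n x * psi x)) @ \oo --> II mu (fun x => w x * psi x).
Proof.
move=> Lu uM Lw loc psi Lp; apply: cvg_eps => e e0.
pose M' := 2 * M + 2 * nsq mu w + 1.
have M'1 : 1 <= M'.
  have := nsq_ge0 mu w; have := nsq_ge0 mu (u_ 0%N); have := uM 0%N; rewrite /M'; lra.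
have M'0 : 0 < M' := lt_le_trans ltr01 M'1.
have dM n : nsq mu (fun x => u_ n x - w x) <= M'.
  apply: le_trans (nsqB_le (Lu n) Lw) _; have := uM n; rewrite /M'; lra.
pose P := nsq mu psi + 1.
have P0 : 0 < P by rewrite ltr_wpDl ?nsq_ge0.
pose t := e / (2 * M'); have t0 : 0 < t by rewrite divr_gt0// mulr_gt0.
pose t' := e / (2 * P); have t'0 : 0 < t' by rewrite divr_gt0// mulr_gt0.
have cp := trunc_L2cvg Lp.
have te0 : 0 < t * e / 2 by rewrite divr_gt0// mulr_gt0.
have [k hk] := eps_cvg cp te0.
have := hk k (leqnn k); rewrite subr0 ger0_norm ?nsq_ge0// => {}hk.
have te1 : 0 < t' * e / 2 by rewrite divr_gt0// mulr_gt0.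
have [m hm] := eps_cvg (loc k%:R) te1; exists m => n mn.
have Ld := L2B (Lu n) Lw; have Lt := L12_L2 (L12_trunc k Lp).
have Lc : L2 mu (fun x => chi k%:R x * (u_ n x - w x)).
  exact: L2_bound Ld (meas_chi k%:R) (chi_abs k%:R).
have nc : nsq mu (fun x => chi k%:R x * (u_ n x - w x)) <= t' * e / 2.
  have := hm n mn; rewrite subr0; apply: le_trans; apply: le_trans (ler_norm _).
  rewrite le_eqVlt; apply/orP; left; apply/eqP.
  by apply: eq_II => x; rewrite exprMn chi_sqr.
have Lr := L2B Lt Lp.
have -> : II mu (fun x => u_ n x * psi x) - II mu (fun x => w x * psi x) =
  II mu (fun x => chi k%:R x * (u_ n x - w x) * psi x) -
  II mu (fun x => (u_ n x - w x) * (trunc psi k x - psi x)).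
  rewrite -(IIB (L2_itgM (Lu n) Lp) (L2_itgM Lw Lp)).
  rewrite -(IIB (L2_itgM Lc Lp) (L2_itgM Ld Lr)).
  by apply: eq_II => x; rewrite truncE; ring.
have y1 := pair_young t'0 Lp Lc; have y2 := pair_young t0 Ld Lr.
have E1 : II mu (fun x => chi k%:R x * (u_ n x - w x) * psi x) =
    II mu (fun x => psi x * (chi k%:R x * (u_ n x - w x))).
  by apply: eq_II => x; rewrite mulrC.
have b1 : t' * nsq mu psi <= e / 2.
  have -> : e / 2 = t' * P by rewrite /t'; field; rewrite gt_eqF.
  by rewrite ler_pM2l// /P lerDl.
have b2 : t * nsq mu (fun x => u_ n x - w x) <= e / 2.
  have -> : e / 2 = t * M' by rewrite /t; field; rewrite gt_eqF.
  by rewrite ler_pM2l.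
have b3 : t'^-1 * nsq mu (fun x => chi k%:R x * (u_ n x - w x)) <= e / 2.
  by rewrite mulrC ler_pdivrMr// mulrC mulrA.
have b4 : t^-1 * nsq mu (fun x => trunc psi k x - psi x) <= e / 2.
  by rewrite mulrC ler_pdivrMr// mulrC mulrA.
apply: le_trans (ler_normB _ _) _; rewrite E1; lra.
Qed.

Theorem local_compactness (u_ : nat -> T -> R) (M : R) : 0 < M -> (forall n, Hs s (u_ n)) ->
  (forall n, nsq mu (u_ n) <= M) -> (forall n, Kin s (u_ n) <= M) ->
  exists2 phi : nat -> nat, (forall k, (phi k < phi k.+1)%N) &
  exists w, [/\ L2 mu w,
   forall q : R, (fun n => II mu (fun x => chi q x * (u_ (phi n) x - w x) ^+ 2)) @ \oo --> (0 : R),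
   forall psi, L2 mu psi ->
    (fun n => II mu (fun x => u_ (phi n) x * psi x)) @ \oo --> II mu (fun x => w x * psi x) &
   {ae mu, forall x, (fun n => u_ (phi n) x) @ \oo --> w x}].
Proof.
move=> M0 Hu uM uK; have [phi ip [w Lw loc]] := L2loc_subseq M0 Hu uM uK.
(* A second extraction, along the balls of integer radius, adds almost everywhere convergence. *)
have [|||||||||phi' ip' ae'] := @L2loc_ae_subseq _ _ _ mu (fun n => u_ (phi n)) w
  (fun k : nat => chi k%:R).
- by move=> n; exact: (Hu _).1.1.
- exact: Lw.1.
- by move=> k; exact: meas_chi.
- by move=> k x; have /andP[] := chi01 k%:R x.
- by move=> n; exact: (Hu _).1.2.
- exact: Lw.2.
- by move=> k x; have /andP[] := chi01 k%:R x.
- move=> x; exists (Num.bound (euclN x)) => k mk; rewrite /chi ifT//.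
  have x0 : 0 <= euclN x by exact: sqrtr_ge0.
  by apply: le_trans (ltW (archi_boundP x0)) _; rewrite ler_nat.
- by move=> k; exact: loc.
have loc' q := cvg_extract ip' (loc q).
exists (phi \o phi').
  by move=> k /=; apply: leq_trans (extract_le ip (ip' k)).
exists w; split => //.
exact: (L2loc_weak (fun n => (Hu (phi (phi' n))).1) (fun n => uM (phi (phi' n))) Lw loc').
Qed.

End LocalCompactness.

(** * The potential and the nonlinearity *)

Section MeasurableContinuous.
Variables (R : realType) (N : nat).
Local Notation T := (N.-tuple R).

Lemma measurable_factor_countable d (S : measurableType d) (Z : countType) (h : S -> Z)
    (G : Z -> R) : (forall z, measurable [set x | h x = z]) -> measurable_fun setT (G \o h).
Proof.
move=> mh _ B mB; rewrite setTI.
have -> : (G \o h) @^-1` B =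
    \bigcup_(z : Z) (if G z \in B then [set x | h x = z] else set0).
  apply/seteqP; split => x /=; first by move=> GB; exists (h x) => //; rewrite mem_set.
  by move=> [z _]; case: ifPn => [+ /= hz|_ []]; rewrite in_setE hz.
apply: countable_bigcupT_measurable; first exact: countableP.
by move=> z; case: ifP.
Qed.

Definition gridT (n : nat) (x : T) : N.-tuple int :=
  [tuple Num.floor (n.+1%:R * tnth x i) | i < N].
Definition gridV (n : nat) (z : N.-tuple int) : T :=
  [tuple (tnth z i)%:~R / n.+1%:R | i < N].

Lemma measurable_gridT n z : measurable [set x : T | gridT n x = z].
Proof.
have -> : [set x : T | gridT n x = z] = \bigcap_(i in [set: 'I_N])
    ((fun x : T => n.+1%:R * tnth x i) @^-1` `[(tnth z i)%:~R, (tnth z i + 1)%:~R[).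
  apply/seteqP; split => x /=.
    by move=> <- i _ /=; rewrite in_itv /= tnth_mktuple floor_itv.
  move=> H; apply: eq_from_tnth => i; rewrite tnth_mktuple; apply/eqP.
  by rewrite floor_eq; have := H i I; rewrite /= in_itv.
apply: fin_bigcap_measurable => // i _.
have m1 : measurable_fun setT (fun x : T => n.+1%:R * tnth x i).
  by apply: measurable_funM => //; exact: meas_tnth.
by rewrite -[X in measurable X]setTI; exact: m1.
Qed.

Lemma gridP n (x : T) i : `|tnth (gridV n (gridT n x)) i - tnth x i| <= n.+1%:R^-1.
Proof.
rewrite !tnth_mktuple; have /andP[h1 h2] := floor_itv (n.+1%:R * tnth x i).
have n0 : 0 < n.+1%:R :> R by [].
move: (Num.floor _) h1 h2 => z; rewrite intrD.
rewrite mulrC -ler_pdivrMr// -ltr_pdivlMr// mulrDl mul1r => h1 h2.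
rewrite distrC ger0_norm ?subr_ge0//; rewrite lerBlDr addrC; exact: ltW.
Qed.

(** Continuity refers to the norm topology of row vectors, measurability to the product
    sigma-algebra of tuples. [V] is the limit of its values at nearby grid points, which depend
    measurably on a countable index. *)
Lemma measurable_continuous_rv2t (V : T -> R) :
  (forall x : 'rV[R]_N, {for x, continuous (V \o @rv2t R N)}) -> measurable_fun setT V.
Proof.
move=> cV; apply: (@measurable_fun_cvg _ _ _ setT (fun n => V \o gridV n \o gridT n)).
  by move=> n; exact: measurable_factor_countable (measurable_gridT n).
move=> x _; pose xv : 'rV[R]_N := \row_i tnth x i.
have Ex : rv2t xv = x by apply: eq_from_tnth => i; rewrite tnth_mktuple mxE.
apply: cvg_eps => e e0.
have /cvgrPdist_le /(_ _ e0) := cV xv; rewrite /= Ex => /nbhs_ballP[d /= d0 hd].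
exists (Num.bound d^-1) => n bn.
pose yv : 'rV[R]_N := \row_i tnth (gridV n (gridT n x)) i.
have Ey : rv2t yv = gridV n (gridT n x).
  by apply: eq_from_tnth => i; rewrite tnth_mktuple mxE.
rewrite distrC -Ey; apply: hd; split => // a b; rewrite /ball /= ord1 !mxE distrC.
apply: le_lt_trans (gridP n x b) _.
rewrite -[ltRHS]invrK ltf_pV2 ?posrE ?invr_gt0//.
have d1 : 0 <= d^-1 by rewrite invr_ge0 ltW.
by apply: lt_le_trans (archi_boundP d1) _; rewrite ler_nat leqW.
Qed.

End MeasurableContinuous.

Section RealMVT.
Variable R : realType.

Lemma MVT_shift (H dH : R -> R) (a y : R) : (forall t : R, is_derive t (1 : R) H (dH t)) ->
  exists2 q : R, 0 <= q <= 1 & H (a + y) - H a = dH (a + q * y) * y.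
Proof.
move=> DH.
have cH : continuous H.
  by move=> t; apply: differentiable_continuous; apply/derivable1_diffP; by have [] := DH t.
have sub (b c : R) : b < c -> exists2 q : R, 0 <= q <= 1 & H c - H b = dH (b + q * (c - b)) * (c - b).
  move=> bc; have [|t] := @MVT_segment R H dH b c (ltW bc) (fun t _ => DH t).
    exact: continuous_subspaceT.
  rewrite in_itv /= => /andP[t1 t2] E.
  have cb : 0 < c - b by rewrite subr_gt0.
  exists ((t - b) / (c - b)); last by rewrite divfK ?gt_eqF// (addrC b) subrK.
  by rewrite divr_ge0 ?subr_ge0// ?(ltW bc)//= ler_pdivrMr// mul1r lerD2r.
have [y0|y0|->] := ltgtP y 0.
- have ay : a + y < a by rewrite gtrDl.
  have [q /andP[q0 q1] E] := sub _ _ ay; exists (1 - q).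
    by rewrite subr_ge0 q1 /= gerBl.
  rewrite -[LHS]opprB E (_ : a - (a + y) = - y); last by ring.
  by rewrite mulrN opprK; congr (dH _ * _); ring.
- have ay : a < a + y by rewrite ltrDl.
  have [q q01] := sub _ _ ay; rewrite (addrC a) addrK => E.
  by exists q => //; rewrite -E addrC.
- by exists 0; rewrite ?lexx ?ler01// addr0 subrr mulr0.
Qed.

End RealMVT.

(** * Differentiability of the primitive *)

Section Primitive.
Variables (R : realType) (f : R -> R).
Hypothesis cf : continuous f.
Local Notation lebR := (@lebesgue_measure R).

Let integrable_f (a b : R) : lebR.-integrable `[a, b]%classic (EFin \o f).
Proof.
apply: continuous_compact_integrable; first exact: segment_compact.
exact: continuous_subspaceT.
Qed.

(** Moving the base point to [- A] removes the case distinction at 0, so one application of the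
    fundamental theorem covers both signs. *)
Lemma primitive_base (A x : R) : - A <= 0 <= A -> - A <= x <= A ->
  primitive f x = (\int[lebR]_(t in `[- A, x]) f t)%R - (\int[lebR]_(t in `[- A, 0]) f t)%R.
Proof.
move=> /andP[A0 _] /andP[Ax xA]; rewrite /primitive; case: ifPn => x0.
  rewrite (Rintegral_itvB (integrable_f _ _)) ?bnd_simp//.
  rewrite Rintegral_itv_obnd_cbnd//; apply: integrableS (integrable_f 0 x) => //.
  by apply: subset_itvr; rewrite bnd_simp.
rewrite -ltNge in x0.
rewrite -[RHS]opprB (Rintegral_itvB (integrable_f _ _)) ?bnd_simp ?(ltW x0)//.
congr (- _); rewrite Rintegral_itv_obnd_cbnd//; apply: integrableS (integrable_f x 0) => //.
by apply: subset_itvr; rewrite bnd_simp.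
Qed.

Lemma is_derive_primitive (x : R) : is_derive x (1 : R) (primitive f) (f x).
Proof.
pose A : R := `|x| + 1; have xA : `|x| < A by rewrite ltrDl.
have A0 : 0 < A by rewrite ltr_wpDl.
move: (xA); rewrite ltr_norml => /andP[x1 x2].
pose G (y : R) : R := (\int[lebR]_(t in `[- A, y]) f t)%R.
have [dG eG] := @continuous_FTC1_closed R f (- A) x A x2 (integrable_f _ _) x1 (@cf x).
have DG : is_derive x (1 : R) G (f x).
  by rewrite -eG derive1E; apply: DeriveDef.
have DB : is_derive x (1 : R) (G - cst (G 0)) (f x).
  by apply: is_derive_eq; rewrite subr0.
have near_eq : {near x, G - cst (G 0) =1 primitive f}.
  have : nbhs x `]- A, A[%classic by apply: near_in_itvoo; rewrite in_itv /= x1.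
  apply: filterS => y /=; rewrite in_itv /= => /andP[y1 y2].
  rewrite (@primitive_base A)// ?oppr_le0 ?(ltW A0)//.
  by rewrite !ltW.
apply: DeriveDef.
  apply: (near_eq_derivable near_eq); exact: ex_derive.
by rewrite -(near_eq_derive (1 : R) near_eq) derive_val.
Qed.

End Primitive.

(** Conditions (f1) to (f5) for one nonlinearity, with [r] for [p - 1] and [m] for the constant mu
    of (f4). *)
Record nonlin (R : realType) (f : R -> R) (a1 a2 r m : R) : Prop := Nonlin {
  nl_df : forall t : R, derivable f t 1;
  nl_cdf : continuous (derive1 f);
  nl_f0 : f 0 = 0;
  nl_df0 : derive1 f 0 = 0;
  nl_a1 : 0 < a1;
  nl_a2 : 0 < a2;
  nl_r : 0 < r;
  nl_grow : forall t : R, `|derive1 f t| <= a1 + a2 * powR `|t| r;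
  nl_m : 2 < m;
  nl_AR : forall t : R, t != 0 -> 0 < m * primitive f t <= t * f t;
  nl_mono : forall z t1 t2 : R, z != 0 -> 0 < t1 -> t1 < t2 ->
     z * f (t1 * z) / t1 < z * f (t2 * z) / t2 }.

(** * Pointwise estimates for the nonlinearity *)

Section Nonlinearity.
Variables (R : realType) (f : R -> R) (a1 a2 r m : R).
Hypothesis nf : nonlin f a1 a2 r m.

Let df := nl_df nf.
Let cdf := nl_cdf nf.
Let f0 := nl_f0 nf.
Let df0 := nl_df0 nf.
Let a1_gt0 := nl_a1 nf.
Let a2_gt0 := nl_a2 nf.
Let r0 := nl_r nf.
Let fgrow := nl_grow nf.
Let m2 := nl_m nf.
Let AR := nl_AR nf.
Let mono := nl_mono nf.

Implicit Types z y t : R.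

Local Notation F := (primitive f).
Local Notation f' := (derive1 f).
Local Notation pw := (pw r).

Definition th z := z ^+ 2 + pw z.
Definition fz z := f z * z.
Definition Gz z := 2^-1 * fz z - F z.

Lemma th_ge0 z : 0 <= th z. Proof. by rewrite addr_ge0 ?sqr_ge0 ?pw_ge0. Qed.

Lemma cont_f : continuous f.
Proof. by move=> t; apply: differentiable_continuous; apply/derivable1_diffP. Qed.

Lemma Df t : is_derive t (1 : R) f (f' t).
Proof. by rewrite derive1E; exact: DeriveDef. Qed.

Lemma DF t : is_derive t (1 : R) F (f t).
Proof. exact: (is_derive_primitive cont_f). Qed.

Lemma Dfz t : is_derive t (1 : R) fz (f' t * t + f t).
Proof.
have D1 := Df t.
have : is_derive t (1 : R) (f * (@id R)) (f t *: 1 + t *: f' t) by exact: is_deriveM.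
by move=> /is_derive_eq; apply; rewrite /GRing.scale /= mulr1 addrC mulrC.
Qed.

Lemma cont_fz : continuous fz.
Proof.
by move=> t; apply: differentiable_continuous; apply/derivable1_diffP; have [] := Dfz t.
Qed.

Lemma cont_F : continuous F.
Proof.
by move=> t; apply: differentiable_continuous; apply/derivable1_diffP; have [] := DF t.
Qed.

Lemma F0 : F 0 = 0.
Proof. by rewrite /primitive lexx /Rintegral set_itv1 integral_set1. Qed.

(** Near 0 the derivative is below [e] by continuity and [f'(0) = 0]; away from 0 the constant [a1]
    is absorbed into [|t|^r / d^r]. *)
Lemma f'_eps (e : R) : 0 < e -> exists2 C, 0 < C & forall t, `|f' t| <= e + C * `|t| `^ r.
Proof.
move=> e0; have /cvgrPdist_le /(_ _ e0) := @cdf 0; rewrite df0 => /nbhs_ballP[d /= d0 hd].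
pose C := a1 * (d `^ r)^-1 + a2.
have C0 : 0 < C by rewrite addr_gt0// mulr_gt0// invr_gt0 powR_gt0.
exists C => // t; have [td|td] := ltP `|t| d.
  have : `|f' t| <= e.
    by have := hd t; rewrite sub0r normrN; apply; rewrite /ball /= sub0r normrN.
  by move=> h; apply: le_trans h _; rewrite lerDl mulr_ge0 ?powR_ge0// ltW.
apply: le_trans (fgrow t) _; rewrite /C mulrDl addrA lerD2r.
apply: le_trans (_ : a1 * (d `^ r)^-1 * `|t| `^ r <= _); last by rewrite lerDr ltW.
rewrite -mulrA -[leLHS]mulr1 ler_pM2l// mulrC ler_pdivlMr ?powR_gt0// mul1r.
by apply: ge0_ler_powR => //; rewrite ?nnegrE// ltW.
Qed.

Lemma abs_convex z y (q : R) : 0 <= q <= 1 -> `|z + q * y| <= `|z| + `|y|.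
Proof.
move=> /andP[q0 q1]; apply: le_trans (ler_normD _ _) _.
by rewrite lerD2l normrM (ger0_norm q0) -[leRHS]mul1r ler_wpM2r.
Qed.

Lemma f_eps (e C : R) : 0 <= C -> (forall t, `|f' t| <= e + C * `|t| `^ r) ->
  forall z, `|f z| <= (e + C * `|z| `^ r) * `|z|.
Proof.
move=> C0 h z; have [q /andP[q0 q1]] := MVT_shift 0 z Df.
rewrite !add0r f0 subr0 => ->; rewrite normrM ler_wpM2r//.
apply: le_trans (h _) _; rewrite lerD2l ler_wpM2l//.
apply: ge0_ler_powR; rewrite ?nnegrE ?(ltW r0)//.
by rewrite normrM (ger0_norm q0) -[leRHS]mul1r ler_wpM2r.
Qed.

Lemma fz_eps (e : R) : 0 < e -> exists2 C, 0 < C &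
  forall z, `|fz z| <= e * z ^+ 2 + C * pw z.
Proof.
move=> e0; have [C C0 h] := f'_eps e0; exists C => // z.
rewrite /fz normrM; apply: le_trans (ler_wpM2r (normr_ge0 z) (f_eps (ltW C0) h z)) _.
by rewrite -mulrA -expr2 real_normK ?num_real// /pw; rewrite le_eqVlt; apply/orP; left;
  apply/eqP; ring.
Qed.

Lemma f_bound z : `|f z| <= (a1 + a2 * `|z| `^ r) * `|z|.
Proof. exact: f_eps (ltW a2_gt0) fgrow z. Qed.

Lemma fz_ge0 z : 0 <= fz z.
Proof.
have [->|z0] := eqVneq z 0; first by rewrite /fz f0 mul0r.
by have /andP[h1 h2] := AR z0; rewrite /fz mulrC ltW// (lt_le_trans h1).
Qed.

Lemma F_ge0 z : 0 <= F z.
Proof.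
have [->|z0] := eqVneq z 0; first by rewrite F0.
by have /andP[h1 _] := AR z0; rewrite ltW// -(pmulr_rgt0 _ (lt_trans _ m2)).
Qed.

Lemma F_gt0 z : z != 0 -> 0 < F z.
Proof.
by move=> z0; have /andP[h1 _] := AR z0; rewrite -(pmulr_rgt0 _ (lt_trans _ m2)).
Qed.

Lemma F_le_fz z : m * F z <= fz z.
Proof.
have [->|z0] := eqVneq z 0; first by rewrite F0 mulr0 fz_ge0.
by have /andP[_ h2] := AR z0; rewrite /fz [f z * z]mulrC.
Qed.

Lemma Gz_ge z : (2^-1 - m^-1) * fz z <= Gz z.
Proof.
have m0 : 0 < m by apply: lt_trans m2.
rewrite /Gz mulrBl lerD2l lerN2 mulrC ler_pdivlMr// mulrC; exact: F_le_fz.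
Qed.

Lemma Gz_ge0 z : 0 <= Gz z.
Proof.
apply: le_trans (Gz_ge z); rewrite mulr_ge0 ?fz_ge0// subr_ge0.
by rewrite lef_pV2 ?posrE ?(lt_trans _ m2)// ltW.
Qed.

Lemma Gz_gt0 z : z != 0 -> 0 < Gz z.
Proof.
move=> z0; apply: lt_le_trans (Gz_ge z); rewrite mulr_gt0//.
  by rewrite subr_gt0 ltf_pV2 ?posrE// (lt_trans _ m2).
have m0 : 0 < m by apply: lt_trans m2.
by apply: lt_le_trans (F_le_fz z); rewrite mulr_gt0// F_gt0.
Qed.

Lemma fz_scale_lt z t : z != 0 -> 0 < t < 1 -> fz (t * z) < t ^+ 2 * fz z.
Proof.
move=> z0 /andP[t0 t1]; have := mono z0 t0 t1; rewrite mul1r divr1 ltr_pdivrMr// => h.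
have -> : fz (t * z) = t * (z * f (t * z)) by rewrite /fz; ring.
have -> : t ^+ 2 * fz z = t * (z * f z * t) by rewrite /fz; ring.
by rewrite ltr_pM2l.
Qed.

Lemma fz_scale_gt z t : z != 0 -> 1 < t -> t ^+ 2 * fz z < fz (t * z).
Proof.
move=> z0 t1; have t0 : 0 < t := lt_trans ltr01 t1.
have := mono z0 ltr01 t1; rewrite mul1r divr1 ltr_pdivlMr// => h.
have -> : fz (t * z) = t * (z * f (t * z)) by rewrite /fz; ring.
have -> : t ^+ 2 * fz z = t * (z * f z * t) by rewrite /fz; ring.
by rewrite ltr_pM2l.
Qed.

Lemma fz0 : fz 0 = 0. Proof. by rewrite /fz mulr0. Qed.

Lemma fz_scale_le z t : 0 <= t <= 1 -> fz (t * z) <= t ^+ 2 * fz z.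
Proof.
move=> /andP[t0 t1]; have [->|z0] := eqVneq z 0; first by rewrite mulr0 fz0 mulr0.
have [->|tn0] := eqVneq t 0; first by rewrite mul0r fz0 expr0n mul0r.
have [->|tn1] := eqVneq t 1; first by rewrite mul1r expr1n mul1r.
by apply/ltW/fz_scale_lt => //; rewrite !lt_neqAle t0 t1 eq_sym tn0 tn1.
Qed.

Lemma fz_scale_ge z t : 1 <= t -> t ^+ 2 * fz z <= fz (t * z).
Proof.
move=> t1; have [->|z0] := eqVneq z 0; first by rewrite mulr0 fz0 mulr0.
have [->|tn1] := eqVneq t 1; first by rewrite mul1r expr1n mul1r.
by apply/ltW/fz_scale_gt => //; rewrite lt_neqAle t1 eq_sym tn1.
Qed.

(** By (f5) the function [q -> F(q z) - q^2 / 2 * f(z) z] decreases up to [q = 1] and increases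
    afterwards. Integrated, this makes [J] maximal at the Nehari point of a ray. *)
Lemma F_ray z t : 0 <= t -> F z + (t ^+ 2 - 1) / 2 * fz z <= F (t * z).
Proof.
move=> t0; have [->|z0] := eqVneq z 0.
  by rewrite fz0 !mulr0 F0 addr0.
pose D (q : R) : R := F (q * z) - q ^+ 2 / 2 * fz z.
have dD (q : R) : is_derive q (1 : R) D (f (q * z) * z - q * fz z).
  have d1 : is_derive q (1 : R) (fun q : R => q * z) z.
    have : is_derive q (1 : R) (@id R * cst z) (q *: 0 + z *: 1) by exact: is_deriveM.
    by move=> /is_derive_eq; apply; rewrite scaler0 add0r /GRing.scale /= mulr1.
  have d2 := @is_derive1_comp R F (fun q : R => q * z) q _ _ (DF (q * z)) d1.
  have d3 : is_derive q (1 : R) (fun q : R => q ^+ 2 / 2 * fz z) (q * fz z).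
    have d4 : is_derive q (1 : R) (@id R * @id R) (q *: 1 + q *: 1) by exact: is_deriveM.
    have d5 : is_derive q (1 : R) ((@id R * @id R) * cst (2^-1 * fz z))
        ((q * q) *: 0 + (2^-1 * fz z) *: (q *: 1 + q *: 1)) by exact: is_deriveM.
    have E : (fun q : R => q ^+ 2 / 2 * fz z) = (@id R * @id R) * cst (2^-1 * fz z).
      by apply/funext => p; rewrite /GRing.mul /= expr2 mulrA.
    rewrite E; apply: is_derive_eq d5 _.
    by rewrite scaler0 add0r /GRing.scale /= mulr1; field.
  exact: is_deriveB.
have [q /andP[q0 q1] E] := MVT_shift 1 (t - 1) dD.
rewrite (addrC 1 (t - 1)) subrK in E.
suff : 0 <= D t - D 1 by rewrite /D mul1r expr1n; lra.
rewrite E; set c := 1 + q * (t - 1).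
have c0 : 0 <= c by rewrite /c; nra.
have cz : fz (c * z) = c * (f (c * z) * z) by rewrite /fz; ring.
have [c0'|cn0] := eqVneq c 0.
  have -> : f (c * z) * z - c * fz z = 0 by rewrite c0' mul0r f0 !mul0r subr0.
  by rewrite mul0r.
have cp : 0 < c by rewrite lt_neqAle eq_sym cn0.
have [t1|t1] := leP 1 t.
  rewrite mulr_ge0 ?subr_ge0// -(ler_pM2l cp) -cz mulrA -expr2 fz_scale_ge//.
  by rewrite /c lerDl mulr_ge0 ?subr_ge0.
rewrite -mulrNN mulr_ge0// oppr_ge0 ?subr_le0 ?(ltW t1)//.
rewrite -(ler_pM2l cp) -cz mulrA -expr2 fz_scale_le// c0 /c /=.
by rewrite gerDl mulr_ge0_le0// subr_le0 ltW.
Qed.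

Lemma Gz_scale z t : 0 <= t <= 1 -> Gz (t * z) <= Gz z.
Proof.
move=> t01; have /andP[t0 _] := t01.
by have := F_ray z t0; have := fz_scale_le z t01; rewrite /Gz; lra.
Qed.

(** With the ray written as [expR q * z], (f4) says that [expR (- m * q) * F (expR q * z)] has
    nonnegative derivative. *)
Lemma F_superquadratic z t : 0 <= t -> expR (m * t) * F z <= F (expR t * z).
Proof.
move=> t0; have [->|z0] := eqVneq z 0; first by rewrite !mulr0 F0 mulr0.
pose D (q : R) : R := expR (- m * q) * F (expR q * z).
have dD (q : R) : is_derive q (1 : R) D (expR (- m * q) * (fz (expR q * z) - m * F (expR q * z))).
  have d1 : is_derive q (1 : R) (fun q : R => - m * q) (- m).
    have : is_derive q (1 : R) (cst (- m) * @id R) (- m *: 1 + q *: 0) by exact: is_deriveM.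
    by move=> /is_derive_eq; apply; rewrite scaler0 addr0 /GRing.scale /= mulr1.
  have d2 := is_derive1_comp (is_derive_expR (- m * q)) d1.
  have d3 : is_derive q (1 : R) (fun q : R => expR q * z) (expR q * z).
    have d3' := is_derive_expR q.
    have : is_derive q (1 : R) (expR * cst z) (expR q *: 0 + z *: expR q) by exact: is_deriveM.
    by move=> /is_derive_eq; apply; rewrite scaler0 add0r /GRing.scale /= mulrC.
  have d4 := @is_derive1_comp R F (fun q : R => expR q * z) q _ _ (DF (expR q * z)) d3.
  have d5 := is_deriveM d2 d4.
  apply: is_derive_eq d5 _.
  by rewrite /GRing.scale /= /fz; ring.
have [q /andP[q0 q1] E] := MVT_shift 0 t dD.
rewrite !add0r in E.
have : 0 <= D t - D 0.
  by rewrite E mulr_ge0// mulr_ge0 ?expR_ge0// subr_ge0 F_le_fz.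
rewrite subr_ge0 /D mulr0 expR0 !mul1r mulNr => h.
have := ler_wpM2l (expR_ge0 (m * t)) h.
by rewrite mulrA -expRD subrr expR0 mul1r.
Qed.

Lemma powR_le_scale (K z c : R) : 1 <= K -> 0 <= c -> c <= K * `|z| ->
  c `^ r <= K `^ r * `|z| `^ r.
Proof.
move=> K1 c0 h; have K0 : 0 <= K := le_trans ler01 K1.
rewrite -powRM//; apply: ge0_ler_powR; rewrite ?nnegrE ?(ltW r0)//.
by rewrite mulr_ge0.
Qed.

(** By the mean value theorem the increment is at most [A S (1 + S^r) |y|] with [S = |z| + |y|]. If
    [|y| <= d |z|] the last factor makes this small against [th z]; otherwise [S] is at most
    [(1 + 1/d) |y|] and everything is charged to [th y]. *)
Lemma diff_eps (H dH : R -> R) (A : R) : 0 < A -> (forall t : R, is_derive t (1 : R) H (dH t)) ->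
  (forall t, `|dH t| <= A * (`|t| * (1 + `|t| `^ r))) ->
  forall e : R, 0 < e -> exists2 C : R, 0 < C &
  forall z y, `|H (z + y) - H z| <= e * th z + C * th y.
Proof.
move=> A0 DH hH e e0.
(* In the first case [S <= 2 |z|], which costs the factor [2 * 2^r]. *)
pose d : R := Num.min 1 (e / (A * (2 * 2 `^ r))).
have p2 : 0 < 2 `^ r :> R by rewrite powR_gt0.
have d0 : 0 < d by rewrite lt_min ltr01 divr_gt0// !mulr_gt0.
have d1 : d <= 1 by rewrite ge_min lexx.
have dA : A * (2 * 2 `^ r) * d <= e.
  by rewrite mulrC -ler_pdivlMr ?mulr_gt0// ge_min lexx orbT.
pose K : R := 1 + d^-1.
have K1 : 1 <= K by rewrite /K lerDl invr_ge0 ltW.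
have K0 : 0 < K := lt_le_trans ltr01 K1.
have one_le (b : R) : 1 <= b -> 1 <= b `^ r.
  by move=> b1; rewrite -[leLHS](powRr0 b) ler_powR// ltW.
have KK := one_le _ K1.
have p21 : 1 <= 2 `^ r :> R by apply: one_le; rewrite ler1n.
exists (A * (K * K `^ r)); first by rewrite !mulr_gt0// powR_gt0.
move=> z y; have [q q01 ->] := MVT_shift z y DH.
pose S : R := `|z| + `|y|.
have S0 : 0 <= S by rewrite addr_ge0.
have b1 : `|dH (z + q * y)| <= A * (S * (1 + S `^ r)).
  apply: le_trans (hH _) _; rewrite ler_pM2l//.
  have cS := abs_convex z y q01.
  apply: ler_pM => //; rewrite ?addr_ge0 ?powR_ge0//.
  by rewrite lerD2l; apply: ge0_ler_powR; rewrite ?nnegrE ?(ltW r0).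
rewrite normrM; apply: le_trans (ler_wpM2r (normr_ge0 y) b1) _.
have [yz|yz] := leP `|y| (d * `|z|).
  have S2 : S <= 2 * `|z|.
    have : d * `|z| <= 1 * `|z| by rewrite ler_wpM2r.
    by rewrite /S; lra.
  have Sr := powR_le_scale (_ : 1 <= 2) S0 S2.
  rewrite ler1n in Sr; move: (Sr isT) => {}Sr.
  apply: le_trans (_ : A * (2 * 2 `^ r) * d * th z <= _); last first.
    by rewrite -[leLHS]addr0 lerD// ?ler_wpM2r ?th_ge0// !mulr_ge0 ?th_ge0 ?powR_ge0 ?(ltW A0) ?(ltW K0).
  have -> : A * (2 * 2 `^ r) * d * th z =
      A * ((2 * `|z|) * (2 `^ r * (1 + `|z| `^ r))) * (d * `|z|).
    rewrite /th /pw -[z ^+ 2]real_normK ?num_real//; ring.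
  apply: ler_pM => //.
    by rewrite mulr_ge0 ?(ltW A0)// mulr_ge0// addr_ge0// powR_ge0.
  rewrite ler_pM2l//; apply: ler_pM => //; rewrite ?addr_ge0 ?powR_ge0//.
  by rewrite mulrDr mulr1 lerD.
have Sy : S <= K * `|y|.
  rewrite /S /K mulrDl mul1r addrC lerD2l -(ler_pM2l d0) mulrA divff ?gt_eqF// mul1r.
  exact: ltW.
have Sr := powR_le_scale K1 S0 Sy.
apply: le_trans (_ : A * (K * K `^ r) * th y <= _); last by rewrite lerDr mulr_ge0 ?th_ge0 ?(ltW e0).
have -> : A * (K * K `^ r) * th y = A * ((K * `|y|) * (K `^ r * (1 + `|y| `^ r))) * `|y|.
  rewrite /th /pw -[y ^+ 2]real_normK ?num_real//; ring.
rewrite ler_wpM2r// ler_pM2l//; apply: ler_pM => //; rewrite ?addr_ge0 ?powR_ge0//.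
by rewrite mulrDr mulr1 lerD.
Qed.

Lemma f_lin z : `|f z| <= (a1 + a2) * (`|z| * (1 + `|z| `^ r)).
Proof.
apply: le_trans (f_bound z) _; have := powR_ge0 `|z| r; have := normr_ge0 z.
move: (`|z| `^ r) `|z| => p q q0 p0; move: a1_gt0 a2_gt0 => b1 b2.
have := mulr_ge0 (ltW b1) (mulr_ge0 q0 p0); have := mulr_ge0 (ltW b2) q0; nra.
Qed.

Lemma F_diff_eps (e : R) : 0 < e -> exists2 C : R, 0 < C &
  forall z y, `|F (z + y) - F z| <= e * th z + C * th y.
Proof. exact: diff_eps (addr_gt0 a1_gt0 a2_gt0) DF f_lin e. Qed.

Lemma fz_diff_eps (e : R) : 0 < e -> exists2 C : R, 0 < C &
  forall z y, `|fz (z + y) - fz z| <= e * th z + C * th y.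
Proof.
have A0 : 0 < 2 * (a1 + a2) by rewrite mulr_gt0// addr_gt0.
apply: (diff_eps A0 Dfz) => t; apply: le_trans (ler_normD _ _) _.
have := f_lin t; rewrite normrM; have := ler_wpM2r (normr_ge0 t) (fgrow t).
have := powR_ge0 `|t| r; have := normr_ge0 t.
move: (`|t| `^ r) `|t| `|f' t| `|f t| => p q b c q0 p0; move: a1_gt0 a2_gt0 => b1 b2.
have := mulr_ge0 (ltW b1) (mulr_ge0 q0 p0); have := mulr_ge0 (ltW b2) q0; nra.
Qed.

Lemma F_second_order z y :
  `|F (z + y) - F z - f z * y| <= y ^+ 2 * (a1 + a2 * (`|z| + `|y|) `^ r).
Proof.
have [q q01 E] := MVT_shift z y DF; have /andP[q0 q1] := q01.
have [q' /andP[q'0 q'1] E'] := MVT_shift z (q * y) Df.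
rewrite E -mulrBl E' normrM normrM [`|q * y|]normrM (ger0_norm q0) -[y ^+ 2]real_normK ?num_real//.
have h : `|f' (z + q' * (q * y))| <= a1 + a2 * (`|z| + `|y|) `^ r.
  apply: le_trans (fgrow _) _; rewrite lerD2l ler_pM2l//.
  apply: ge0_ler_powR; rewrite ?nnegrE ?addr_ge0 ?(ltW r0)//.
  rewrite mulrA; apply: abs_convex; rewrite mulr_ge0//=.
  by rewrite mulr_ile1.
have c0 := le_trans (normr_ge0 _) h.
rewrite mulrC -mulrA; apply: le_trans (_ : `|y| * ((a1 + a2 * (`|z| + `|y|) `^ r) * `|y|) <= _).
  rewrite ler_wpM2l//; apply: ler_pM => //; first by rewrite mulr_ge0.
  by rewrite -[leRHS]mul1r ler_wpM2r.
by rewrite le_eqVlt; apply/orP; left; apply/eqP; ring.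
Qed.

Lemma f_lip z y : `|f (z + y) - f z| <= `|y| * (a1 + a2 * (`|z| + `|y|) `^ r).
Proof.
have [q q01 ->] := MVT_shift z y Df.
rewrite normrM mulrC ler_wpM2l//; apply: le_trans (fgrow _) _; rewrite lerD2l ler_pM2l//.
by apply: ge0_ler_powR; rewrite ?nnegrE ?addr_ge0 ?(ltW r0)//; exact: abs_convex.
Qed.

End Nonlinearity.

(** * The energy functional and its Nehari set *)

(** Continuity is given only along the interval; composing with the projection [cl] onto it gives a
    globally continuous function to which the intermediate value theorem applies. *)
Lemma ivt_eps (R : realType) (g : R -> R) (a b : R) : a <= b ->
  (forall t, a <= t <= b -> forall e : R, 0 < e -> exists2 d : R, 0 < d &
    forall t', a <= t' <= b -> `|t' - t| < d -> `|g t' - g t| <= e) ->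
  0 <= g a -> g b <= 0 -> exists2 c, a <= c <= b & g c = 0.
Proof.
move=> ab cg ga gb.
pose cl (t : R) := Num.max a (Num.min b t).
have clab t : a <= cl t <= b.
  by rewrite /cl le_max lexx /= ge_max ab ge_min lexx.
have clE t : a <= t <= b -> cl t = t.
  by move=> /andP[at_ tb]; rewrite /cl min_r// max_r.
have clip t t' : `|cl t' - cl t| <= `|t' - t|.
  wlog tt : t t' / t <= t'.
    by move=> H; have [/H//|/ltW/H] := leP t t'; rewrite distrC (distrC t).
  rewrite (ger0_norm (_ : 0 <= t' - t)) ?subr_ge0//.
  rewrite /cl; case: (leP b t) => h1; case: (leP b t') => h2;
  rewrite ?(max_r ab) ?subrr ?normr0 ?subr_ge0//.
  - by lra.
  - by case: (leP a t) => h3; rewrite ger0_norm; lra.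
  - by case: (leP a t) => h3; case: (leP a t') => h4; rewrite ger0_norm; lra.
have cG : continuous (g \o cl).
  move=> t; apply/cvgrPdist_le => e e0; have [d d0 hd] := cg _ (clab t) e e0.
  exists d => //= t'; rewrite /ball /= => td.
  rewrite distrC; apply: hd; first exact: clab.
  by apply: le_lt_trans (clip t t') _; rewrite distrC.
have [||c cab E] := @IVT R (g \o cl) a b 0 ab.
- exact: continuous_subspaceT.
- by rewrite /= !clE ?lexx ?ab//= ge_min gb orbT le_max ga.
exists (cl c) => //; exact: clab.
Qed.

Lemma max_shift_dist (R : realType) (k a b c d e : R) : `|c - d| <= e / 2 ->
  `|a - b| <= e / 2 -> `|a + Num.max 0 (k - c) - (b + Num.max 0 (k - d))| <= e.
Proof.
rewrite !ler_norml => /andP[? ?] /andP[? ?]; apply/andP.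
by case: (leP 0 (k - c)) => ?; case: (leP 0 (k - d)) => ?; split; lra.
Qed.

Section Energy.
Variables (R : realType) (N : nat) (s : R) (f : R -> R) (a1 a2 r m V0 Vinf : R).
Hypotheses (s01 : 0 < s < 1) (sN : 2 * s < N%:R) (nf : nonlin f a1 a2 r m)
  (rN : r * (N%:R - 2 * s) < 4 * s) (V0_gt0 : 0 < V0).
Local Notation T := (N.-tuple R).
Local Notation mu := (muN R N).
Local Notation F := (primitive f).
Local Notation Hs := (Hs s).
Implicit Types (u v w h W : T -> R) (x : T).

Let r0 := nl_r nf.

(** A class closed under translation and containing the constant [Vinf], so that estimates are
    uniform over [V], its translates and their limits. *)
Definition pot W := measurable_fun setT W /\ forall x, V0 <= W x <= Vinf.

(** The squared norm of [E^s] with potential [W]. With it [JW] is the energy, and [Phi W u] is the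
    derivative of [JW W] at [u] in the direction [u]. *)
Definition Qf W u := Kin s u + II mu (fun x => W x * u x ^+ 2).
Definition Nfz u := II mu (fun x => fz f (u x)).
Definition NF u := II mu (fun x => F (u x)).
Definition NG u := II mu (fun x => Gz f (u x)).
Definition Phi W u := Qf W u - Nfz u.
Definition JW W u := 2^-1 * Qf W u - NF u.

Lemma pot_abs W x : pot W -> `|W x| <= Vinf.
Proof.
by move=> [_ hW]; have /andP[h1 h2] := hW x; rewrite ger0_norm// (le_trans (ltW V0_gt0)).
Qed.

Lemma itg_potM W g : pot W -> itg mu g -> itg mu (fun x => W x * g x).
Proof.
move=> pW ig; have := itg_bound ig pW.1 (fun x => pot_abs x pW).
by congr itg; apply/funext => x; rewrite mulrC.
Qed.

Lemma pot_nsq W u : pot W -> L2 mu u ->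
  V0 * nsq mu u <= II mu (fun x => W x * u x ^+ 2) <= Vinf * nsq mu u.
Proof.
move=> pW Lu; have iW := itg_potM pW Lu.2; rewrite /nsq -!(IIZ _ Lu.2).
by apply/andP; split; (apply: II_le; [exact: itgZ Lu.2 || exact: iW|
  exact: iW || exact: itgZ Lu.2|move=> x; have /andP[h1 h2] := pW.2 x;
  rewrite ler_wpM2r ?sqr_ge0]).
Qed.

Lemma Qf_ge W u : pot W -> L2 mu u -> Kin s u <= Qf W u /\ V0 * nsq mu u <= Qf W u.
Proof.
move=> pW Lu; have /andP[h _] := pot_nsq pW Lu; have := Kin_ge0 s u.
have := mulr_ge0 (ltW V0_gt0) (nsq_ge0 mu u); rewrite /Qf; split; lra.
Qed.

Lemma Qf_ge0 W u : pot W -> L2 mu u -> 0 <= Qf W u.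
Proof. by move=> pW Lu; have [h _] := Qf_ge pW Lu; exact: le_trans (Kin_ge0 _ _) h. Qed.

Lemma Qf_comb W u v : pot W -> Hs u -> Hs v -> exists B : R, forall a b : R,
  Hs (fun x => a * u x + b * v x) /\
  Qf W (fun x => a * u x + b * v x) = a ^+ 2 * Qf W u + 2 * a * b * B + b ^+ 2 * Qf W v.
Proof.
move=> pW Hu Hv; have [B hB] := Kin_comb Hu Hv.
have i1 := itg_potM pW Hu.1.2; have i2 := itg_potM pW (L2_itgM Hu.1 Hv.1).
have i3 := itg_potM pW Hv.1.2.
exists (B + II mu (fun x => W x * (u x * v x))) => a b; have [H E] := hB a b; split => //.
rewrite /Qf E.
have -> : II mu (fun x => W x * (a * u x + b * v x) ^+ 2) =
    II mu (fun x => a ^+ 2 * (W x * u x ^+ 2) + 2 * a * b * (W x * (u x * v x)) +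
       b ^+ 2 * (W x * v x ^+ 2)).
  by apply: eq_II => x; ring.
have j1 := itgZ (a ^+ 2) i1; have j2 := itgZ (2 * a * b) i2; have j3 := itgZ (b ^+ 2) i3.
rewrite (IID (itgD j1 j2) j3) (IID j1 j2) (IIZ _ i1) (IIZ _ i2) (IIZ _ i3); ring.
Qed.

Lemma QfZ W u (a : R) : pot W -> Hs u -> Hs (fun x => a * u x) /\
  Qf W (fun x => a * u x) = a ^+ 2 * Qf W u.
Proof.
move=> pW Hu; have [B /(_ a 0)[H E]] := Qf_comb pW Hu Hu.
have -> : (fun x => a * u x) = (fun x => a * u x + 0 * u x).
  by apply/funext => x; rewrite mul0r addr0.
by split => //; rewrite E; ring.
Qed.

Lemma HsD u v : Hs u -> Hs v -> Hs (fun x => u x + v x).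
Proof.
move=> Hu Hv; have [B /(_ 1 1)[H _]] := Kin_comb Hu Hv.
by move: H; congr Hs; apply/funext => x; rewrite !mul1r.
Qed.

Lemma HsB u v : Hs u -> Hs v -> Hs (fun x => u x - v x).
Proof.
move=> Hu Hv; have [B /(_ 1 (-1))[H _]] := Kin_comb Hu Hv.
by move: H; congr Hs; apply/funext => x; rewrite mul1r mulN1r.
Qed.

(** The polar term is bounded by positivity of the form at [e u + v] and [e u - v]. *)
Lemma Qf_cross W u v (e : R) : pot W -> Hs u -> Hs v -> 0 < e ->
  `|Qf W (fun x => u x + v x) - Qf W u| <= e * Qf W u + (1 + e^-1) * Qf W v.
Proof.
move=> pW Hu Hv e0; have [B hB] := Qf_comb pW Hu Hv.
have Qv := Qf_ge0 pW Hv.1; have Qu := Qf_ge0 pW Hu.1.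
have [_ E] := hB 1 1.
have -> : (fun x => u x + v x) = (fun x => 1 * u x + 1 * v x).
  by apply/funext => x; rewrite !mul1r.
rewrite E !expr1n !mul1r !mulr1.
have e0' : 0 < e^-1 by rewrite invr_gt0.
have p1 : 0 <= e * Qf W u - 2 * B + e^-1 * Qf W v.
  have [H1 E1] := hB e (-1); have := Qf_ge0 pW H1.1; rewrite E1 => /(mulr_ge0 (ltW e0')).
  have -> : e^-1 * (e ^+ 2 * Qf W u + 2 * e * -1 * B + (-1) ^+ 2 * Qf W v) =
    (e^-1 * e) * (e * Qf W u - 2 * B) + e^-1 * Qf W v by ring.
  by rewrite mulVf ?gt_eqF// mul1r.
have p2 : 0 <= e * Qf W u + 2 * B + e^-1 * Qf W v.
  have [H1 E1] := hB e 1; have := Qf_ge0 pW H1.1; rewrite E1 => /(mulr_ge0 (ltW e0')).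
  have -> : e^-1 * (e ^+ 2 * Qf W u + 2 * e * 1 * B + 1 ^+ 2 * Qf W v) =
    (e^-1 * e) * (e * Qf W u + 2 * B) + e^-1 * Qf W v by ring.
  by rewrite mulVf ?gt_eqF// mul1r.
by rewrite ler_norml; apply/andP; split; rewrite mulrDl mul1r; lra.
Qed.

(** The embedding is applied to [u / d] and scaled back by homogeneity. Any [d] above the norm is
    allowed, so that functions of zero norm need no division by it; [M = 1 + 1 / V0] bounds both
    parts of the unit ball. *)
Lemma pw_hom : exists2 C : R, 0 < C & forall W u (d : R), pot W -> Hs u -> 0 < d ->
  Qf W u <= d ^+ 2 -> itg mu (fun x => pw r (u x)) /\
  II mu (fun x => pw r (u x)) <= C * d ^+ 2 * d `^ r.
Proof.
pose M := 1 + V0^-1.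
have M0 : 0 < M by rewrite addr_gt0// invr_gt0.
have [C hC] := pw_embed s01 sN r0 rN M0.
exists (`|C| + 1); first by rewrite ltr_wpDl.
move=> W u d pW Hu d0 Qd; pose v x := d^-1 * u x.
have [Hv Ev] := QfZ d^-1 pW Hu; rewrite -/v in Hv Ev.
have Q1 : Qf W v <= 1.
  rewrite Ev exprVn mulrC ler_pdivrMr ?exprn_gt0// mul1r; exact: Qd.
have [h1 h2] := Qf_ge pW Hv.1.
have nv : nsq mu v <= M.
  have : nsq mu v <= V0^-1 by rewrite -[leRHS]mul1r ler_pdivlMr// mulrC (le_trans h2).
  by rewrite /M; lra.
have kv : Kin s v <= M.
  have iV : 0 < V0^-1 by rewrite invr_gt0.
  by rewrite /M; lra.
have [i1 h] := hC v Hv nv kv.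
have E : (fun x => pw r (u x)) = (fun x => d ^+ 2 * d `^ r * pw r (v x)).
  apply/funext => x; rewrite -pwZ ?(ltW d0)// /v mulrA divff ?gt_eqF// mul1r//.
rewrite E; split; first exact: itgZ.
have p0 : 0 <= d ^+ 2 * d `^ r by apply: mulr_ge0; [exact: sqr_ge0|exact: powR_ge0].
rewrite (IIZ _ i1) mulrC -[leRHS]mulrA ler_wpM2r//.
by apply: le_trans h _; have := ler_norm C; lra.
Qed.

Lemma itg_pw W u : pot W -> Hs u -> itg mu (fun x => pw r (u x)).
Proof.
move=> pW Hu; have [C _ hC] := pw_hom; have Q0 := Qf_ge0 pW Hu.1.
have d0 : 0 < 1 + Qf W u by rewrite ltr_wpDr.
by apply: (hC W u _ pW Hu d0 _).1; nra.
Qed.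

Lemma pw_Q : exists2 C : R, 0 < C & forall W u, pot W -> Hs u ->
  II mu (fun x => pw r (u x)) <= C * Qf W u * Num.sqrt (Qf W u) `^ r.
Proof.
have [C C0 hC] := pw_hom; exists C => // W u pW Hu; have Q0 := Qf_ge0 pW Hu.1.
have [Qz|Qnz] := eqVneq (Qf W u) 0; last first.
  have Qp : 0 < Qf W u by rewrite lt_neqAle eq_sym Qnz.
  have d0 : 0 < Num.sqrt (Qf W u) by rewrite sqrtr_gt0.
  have [|_] := hC W u _ pW Hu d0; first by rewrite sqr_sqrtr.
  by rewrite sqr_sqrtr.
rewrite Qz mulr0 mul0r; apply/ler_addgt0Pr => e e0; rewrite add0r.
pose d : R := Num.min 1 (e / C).
have d0 : 0 < d by rewrite lt_min ltr01 divr_gt0.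
have d1 : d <= 1 by rewrite ge_min lexx.
have [|_ h] := hC W u d pW Hu d0; first by rewrite Qz sqr_ge0.
apply: le_trans h _.
have dr : d `^ r <= 1.
  apply: le_trans (_ : 1 `^ r <= _); last by rewrite powR1.
  by apply: ge0_ler_powR; rewrite ?nnegrE ?(ltW r0) ?(ltW d0).
have dC : C * d <= e by rewrite mulrC -ler_pdivlMr// ge_min lexx orbT.
have : C * d ^+ 2 * d `^ r <= C * d ^+ 2 * 1.
  by rewrite ler_wpM2l// mulr_ge0 ?sqr_ge0// ltW.
move=> h'; apply: le_trans h' _; rewrite mulr1 expr2 mulrA.
by apply: le_trans (_ : e * d <= _); rewrite ?ler_wpM2r ?(ltW d0)// ger_pMr.
Qed.

Lemma itg_th W u : pot W -> Hs u -> itg mu (fun x => th r (u x)).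
Proof. by move=> pW Hu; apply: itgD; [exact: Hu.1.2|exact: itg_pw pW Hu]. Qed.

Lemma meas_comp (H : R -> R) u : continuous H -> measurable_fun setT u ->
  measurable_fun setT (fun x => H (u x)).
Proof.
move=> cH mu_; apply: (@measurableT_comp _ _ _ _ _ _ H) => //.
exact: continuous_measurable_fun.
Qed.

Lemma itg_fz W u : pot W -> Hs u -> itg mu (fun x => fz f (u x)).
Proof.
move=> pW Hu; have [C C0 hC] := fz_eps nf ltr01.
apply: (itg_le _ _ (itgD (itgZ 1 Hu.1.2) (itgZ C (itg_pw pW Hu)))).
  by apply: meas_comp; [exact: cont_fz nf|exact: Hu.1.1].
by move=> x; exact: hC.
Qed.

Lemma itg_F W u : pot W -> Hs u -> itg mu (fun x => F (u x)).
Proof.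
move=> pW Hu; apply: (itg_le _ _ (itg_fz pW Hu)).
  by apply: meas_comp; [exact: cont_F nf|exact: Hu.1.1].
move=> x; rewrite ger0_norm ?(F_ge0 nf)//; apply: le_trans (F_le_fz nf _).
by rewrite ler_peMl ?(F_ge0 nf)// (le_trans _ (ltW (nl_m nf)))// ler1n.
Qed.

Lemma itg_Gz W u : pot W -> Hs u -> itg mu (fun x => Gz f (u x)).
Proof. by move=> pW Hu; apply: itgB; [exact/itgZ/(itg_fz pW Hu)|exact: itg_F pW Hu]. Qed.

Lemma JW_Phi W u : pot W -> Hs u -> JW W u = 2^-1 * Phi W u + NG u.
Proof.
move=> pW Hu; have i1 := itg_fz pW Hu; have i2 := itg_F pW Hu.
by rewrite /JW /Phi /NG /Gz (IIB (itgZ _ i1) i2) (IIZ _ i1) /Nfz /NF; ring.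
Qed.

Lemma NG_ge W u : pot W -> Hs u -> (2^-1 - m^-1) * Nfz u <= NG u.
Proof.
move=> pW Hu; have i1 := itg_fz pW Hu; rewrite /Nfz -(IIZ _ i1).
by apply: II_le; [exact: itgZ|exact: itg_Gz pW Hu|move=> x; exact: Gz_ge nf _].
Qed.

Lemma NG_ge0 u : 0 <= NG u.
Proof. by apply: II_ge0 => x; exact: Gz_ge0 nf _. Qed.

Lemma NG_scale W u (t : R) : pot W -> Hs u -> 0 <= t <= 1 -> NG (fun x => t * u x) <= NG u.
Proof.
move=> pW Hu t01; have [Ht _] := QfZ t pW Hu.
by apply: II_le; [exact: itg_Gz pW Ht|exact: itg_Gz pW Hu|move=> x; exact: Gz_scale nf _ _ t01].
Qed.

Lemma Nfz_eps (e : R) : 0 < e -> exists2 C : R, 0 < C & forall W u, pot W -> Hs u ->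
  Nfz u <= e * nsq mu u + C * II mu (fun x => pw r (u x)).
Proof.
move=> e0; have [C C0 hC] := fz_eps nf e0; exists C => // W u pW Hu.
have i1 := itg_pw pW Hu.
rewrite /nsq -(IIZ _ Hu.1.2) -(IIZ _ i1) -(IID (itgZ _ Hu.1.2) (itgZ _ i1)).
apply: II_le; [exact: itg_fz pW Hu|exact: itgD (itgZ _ Hu.1.2) (itgZ _ i1)|move=> x].
by apply: le_trans (ler_norm _) _; exact: hC.
Qed.

(** On a small ball both parts of [int f(u) u] are at most a quarter of the form: the quadratic part
    by the choice [V0 / 4], the superquadratic one by its higher homogeneity. *)
Lemma Phi_small : exists2 rho : R, 0 < rho & forall W u, pot W -> Hs u ->
  Qf W u <= rho -> 2^-1 * Qf W u <= Phi W u.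
Proof.
have e0 : 0 < V0 / 4 by rewrite divr_gt0.
have [C C0 hC] := Nfz_eps e0; have [C' C'0 hC'] := pw_Q.
(* Chosen so that [C * C' * k = 1/4], where [k] bounds the [r]-th power of the norm. *)
pose k : R := (4 * (C * C'))^-1; have k0 : 0 < k by rewrite invr_gt0 !mulr_gt0.
pose q := k `^ r^-1; have q0 : 0 < q by rewrite powR_gt0.
exists (q ^+ 2); first by rewrite exprn_gt0.
move=> W u pW Hu Qq; have Q0 := Qf_ge0 pW Hu.1.
have h1 := hC W u pW Hu; have h2 := hC' W u pW Hu; have [_ h3] := Qf_ge pW Hu.1.
have sq : Num.sqrt (Qf W u) `^ r <= k.
  have -> : k = q `^ r by rewrite /q -powRrM mulVf ?gt_eqF// powRr1// ltW.
  apply: ge0_ler_powR; rewrite ?nnegrE ?sqrtr_ge0 ?(ltW r0) ?(ltW q0)//.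
  by rewrite -[leRHS]ger0_norm ?(ltW q0)// -sqrtr_sqr ler_wsqrtr.
have h4 : C * II mu (fun x => pw r (u x)) <= Qf W u / 4.
  apply: le_trans (ler_wpM2l (ltW C0) h2) _.
  apply: le_trans (_ : C * (C' * Qf W u * k) <= _).
    by rewrite ler_pM2l// ler_wpM2l// mulr_ge0// ltW.
  rewrite /k le_eqVlt; apply/orP; left; apply/eqP; field.
  by rewrite !gt_eqF.
have h5 : V0 / 4 * nsq mu u <= Qf W u / 4 by lra.
by rewrite /Phi; lra.
Qed.

Lemma th_Q : exists2 C : R, 0 < C & forall W u, pot W -> Hs u -> Qf W u <= 1 ->
  II mu (fun x => th r (u x)) <= C * Qf W u.
Proof.
have [C C0 hC] := pw_Q; have iV : 0 < V0^-1 by rewrite invr_gt0.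
exists (V0^-1 + C); first exact: addr_gt0.
move=> W u pW Hu Q1; have Q0 := Qf_ge0 pW Hu.1.
rewrite /th (IID Hu.1.2 (itg_pw pW Hu)) mulrDl; apply: lerD.
  by have [_ h] := Qf_ge pW Hu.1; rewrite mulrC ler_pdivlMr// mulrC.
apply: le_trans (hC W u pW Hu) _.
rewrite -[leRHS]mulr1; apply: ler_wpM2l; first by apply: mulr_ge0; [exact: ltW|].
apply: le_trans (_ : 1 `^ r <= _); last by rewrite powR1.
apply: ge0_ler_powR; rewrite ?nnegrE ?sqrtr_ge0 ?(ltW r0)//.
by rewrite -[leRHS]sqrtr1 ler_wsqrtr.
Qed.

Lemma II_diff_cont (H : R -> R) : continuous H ->
  (forall W u, pot W -> Hs u -> itg mu (fun x => H (u x))) ->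
  (forall e : R, 0 < e -> exists2 C : R, 0 < C &
    forall z y, `|H (z + y) - H z| <= e * th r z + C * th r y) ->
  forall W u (e : R), pot W -> Hs u -> 0 < e -> exists2 d : R, 0 < d &
  forall h, Hs h -> Qf W h <= d ->
  `|II mu (fun x => H (u x + h x)) - II mu (fun x => H (u x))| <= e.
Proof.
move=> cH iH dH W u e pW Hu e0; have iu := itg_th pW Hu.
pose A := II mu (fun x => th r (u x)) + 1.
have A1 : 0 <= II mu (fun x => th r (u x)) by apply: II_ge0 => x; exact: th_ge0.
have A0 : 0 < A by rewrite ltr_wpDl.
have e'0 : 0 < e / (2 * A) by rewrite divr_gt0// mulr_gt0.
have [C C0 hC] := dH _ e'0; have [C' C'0 hC'] := th_Q.
pose d : R := Num.min 1 (e / (2 * (C * C'))).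
have d0 : 0 < d by rewrite lt_min ltr01 divr_gt0// !mulr_gt0.
exists d => // h Hh Qd; have ih := itg_th pW Hh.
have i1 := iH W _ pW (HsD Hu Hh); have i2 := iH W _ pW Hu.
rewrite -(IIB i1 i2); apply: le_trans (II_abs (itgB i1 i2)) _.
apply: le_trans (_ : e / (2 * A) * II mu (fun x => th r (u x)) +
   C * II mu (fun x => th r (h x)) <= _).
  rewrite -(IIZ _ iu) -(IIZ _ ih) -(IID (itgZ _ iu) (itgZ _ ih)).
  apply: II_le; [exact: itg_abs (itgB i1 i2)|exact: itgD (itgZ _ iu) (itgZ _ ih)|].
  by move=> x; exact: hC.
have Q1 : Qf W h <= 1 by apply: le_trans Qd _; rewrite ge_min lexx.
have h1 : C * II mu (fun x => th r (h x)) <= e / 2.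
  apply: le_trans (ler_wpM2l (ltW C0) (hC' W h pW Hh Q1)) _.
  rewrite mulrA; apply: le_trans (_ : C * C' * d <= _).
    by rewrite ler_pM2l// mulr_gt0.
  have CC : 0 < C * C' by rewrite mulr_gt0.
  have : d <= e / (2 * (C * C')) by rewrite ge_min lexx orbT.
  by rewrite ler_pdivlMr ?mulr_gt0// => ?; lra.
have h2 : e / (2 * A) * II mu (fun x => th r (u x)) <= e / 2.
  apply: le_trans (_ : e / (2 * A) * A <= _).
    by rewrite ler_pM2l// /A lerDl.
  by rewrite le_eqVlt; apply/orP; left; apply/eqP; field; rewrite gt_eqF.
by move: h1 h2; move: (_ * II mu _) (_ * II mu _) => b c; lra.
Qed.

Lemma Qf_cont W u (e : R) : pot W -> Hs u -> 0 < e -> exists2 d : R, 0 < d &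
  forall h, Hs h -> Qf W h <= d -> `|Qf W (fun x => u x + h x) - Qf W u| <= e.
Proof.
move=> pW Hu e0; have Q0 := Qf_ge0 pW Hu.1.
pose a : R := e / (2 * (Qf W u + 1)).
have Q1 : 0 < Qf W u + 1 by rewrite ltr_wpDl.
have a0 : 0 < a by rewrite divr_gt0// mulr_gt0.
have b0 : 0 < 1 + a^-1 by rewrite addr_gt0// invr_gt0.
exists (e / (2 * (1 + a^-1))); first by rewrite divr_gt0// mulr_gt0.
move=> h Hh Qd; apply: le_trans (Qf_cross pW Hu Hh a0) _.
have h1 : a * Qf W u <= e / 2.
  apply: le_trans (_ : a * (Qf W u + 1) <= _); first by rewrite ler_pM2l// lerDl.
  by rewrite /a le_eqVlt; apply/orP; left; apply/eqP; field; rewrite gt_eqF.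
have h2 : (1 + a^-1) * Qf W h <= e / 2.
  by move: Qd; rewrite ler_pdivlMr ?mulr_gt0//; lra.
by lra.
Qed.

Lemma Phi_cont W u (e : R) : pot W -> Hs u -> 0 < e -> exists2 d : R, 0 < d &
  forall h, Hs h -> Qf W h <= d -> `|Phi W (fun x => u x + h x) - Phi W u| <= e.
Proof.
move=> pW Hu e0; have e2 : 0 < e / 2 by rewrite divr_gt0.
have [d1 d10 h1] := Qf_cont pW Hu e2.
have [d2 d20 h2] := II_diff_cont (cont_fz nf) itg_fz (fz_diff_eps nf) pW Hu e2.
exists (Num.min d1 d2); first by rewrite lt_min d10.
move=> h Hh; rewrite le_min => /andP[q1 q2].
have := h1 h Hh q1; have := h2 h Hh q2; rewrite /Phi /Nfz !ler_norml.
by move=> /andP[? ?] /andP[? ?]; apply/andP; split; lra.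
Qed.

Lemma Phi_ray_cont W u (t e : R) : pot W -> Hs u -> 0 < e -> exists2 d : R, 0 < d &
  forall t' : R, `|t' - t| < d ->
  `|Phi W (fun x => t' * u x) - Phi W (fun x => t * u x)| <= e.
Proof.
move=> pW Hu e0; have [Ht _] := QfZ t pW Hu; have Q0 := Qf_ge0 pW Hu.1.
have [d d0 hd] := Phi_cont pW Ht e0.
have Q1 : 0 < Qf W u + 1 by rewrite ltr_wpDl.
pose d' : R := Num.min 1 (d / (Qf W u + 1)).
have d'0 : 0 < d' by rewrite lt_min ltr01 divr_gt0.
exists d' => // t' tt; have [Hh Eh] := QfZ (t' - t) pW Hu.
have := hd _ Hh; have -> : (fun x => t * u x + (t' - t) * u x) = (fun x => t' * u x).
  by apply/funext => x; ring.
apply; rewrite Eh -[(t' - t) ^+ 2]real_normK ?num_real//.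
move: tt; move: `|t' - t| (normr_ge0 (t' - t)) => q q0.
rewrite lt_min => /andP[q1 q2].
move: q2; rewrite ltr_pdivlMr// => q2.
move: (Qf W u) Q0 q2 => Q Q0 q2.
have : q ^+ 2 * Q <= q * Q by rewrite ler_wpM2r// expr2 ler_piMr// ltW.
by rewrite mulrDr mulr1 in q2; lra.
Qed.

(** Along the ray [Phi] is nonnegative at a small [t0] and nonpositive at 1; the intermediate value
    theorem gives the zero. That [t <= 1] is what keeps the energy from rising. *)
Lemma nehari_projection W u : pot W -> Hs u -> 0 < Qf W u -> Phi W u <= 0 ->
  exists2 t : R, 0 < t <= 1 & Phi W (fun x => t * u x) = 0.
Proof.
move=> pW Hu Q0 P0; have [rho rho0 hrho] := Phi_small.
pose t0 : R := Num.min 1 (rho / Qf W u).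
have t00 : 0 < t0 by rewrite lt_min ltr01 divr_gt0.
have t01 : t0 <= 1 by rewrite ge_min lexx.
have [Ht Et] := QfZ t0 pW Hu.
have Qt : Qf W (fun x => t0 * u x) <= rho.
  rewrite Et; have : t0 <= rho / Qf W u by rewrite ge_min lexx orbT.
  rewrite ler_pdivlMr//; have : t0 ^+ 2 * Qf W u <= t0 * Qf W u.
    by rewrite ler_pM2r// expr2 ger_pMr.
  by lra.
have := hrho W _ pW Ht Qt; rewrite Et => Pt.
have [|||c /andP[c0 c1] Ec] := @ivt_eps R (fun t => Phi W (fun x => t * u x)) t0 1 t01.
- move=> t _ e e0; have [d d0 hd] := Phi_ray_cont t pW Hu e0.
  by exists d => // t' _; exact: hd.
- by apply: le_trans Pt; rewrite mulr_ge0// mulr_ge0 ?sqr_ge0 ?(ltW Q0).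
- by under eq_fun do rewrite mul1r.
by exists c => //; rewrite c1 (lt_le_trans t00).
Qed.

Lemma ray_max W u (t : R) : pot W -> Hs u -> 0 <= t -> Phi W u = 0 ->
  JW W (fun x => t * u x) <= JW W u.
Proof.
move=> pW Hu t0 P0; have [Ht Et] := QfZ t pW Hu.
have i1 := itg_F pW Hu; have i2 := itg_fz pW Hu.
have h : NF u + (t ^+ 2 - 1) / 2 * Nfz u <= NF (fun x => t * u x).
  rewrite /NF /Nfz -(IIZ _ i2) -(IID i1 (itgZ _ i2)).
  apply: II_le; [exact: itgD i1 (itgZ _ i2)|exact: itg_F pW Ht|move=> x].
  exact: F_ray nf _ _ t0.
move: P0 h; rewrite /JW /Phi Et.
move: (Qf W u) (Nfz u) (NF u) (NF _) => Q A B C /eqP; rewrite subr_eq0 => /eqP ->; lra.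
Qed.

Lemma ray_end W u : pot W -> Hs u -> 0 < NF u -> exists2 t : R, 1 <= t &
  JW W (fun x => t * u x) < 0.
Proof.
move=> pW Hu F0; have Q0 := Qf_ge0 pW Hu.1; have m2 := nl_m nf.
have m20 : 0 < m - 2 by rewrite subr_gt0.
(* Gives [(m - 2) * q * NF u = Qf W u], so already [1 + x <= expR x] makes the nonlinear term exceed
   half the quadratic one. *)
pose q : R := Qf W u / NF u / (m - 2).
have q0 : 0 <= q by rewrite !divr_ge0// ltW.
exists (expR q); first by rewrite -[leLHS]expR0 ler_expR.
have [Ht Et] := QfZ (expR q) pW Hu.
have i1 := itg_F pW Hu.
have h : expR (m * q) * NF u <= NF (fun x => expR q * u x).
  rewrite /NF -(IIZ _ i1).
  apply: II_le; [exact: itgZ|exact: itg_F pW Ht|move=> x].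
  exact: F_superquadratic nf _ _ q0.
rewrite /JW Et; apply: le_lt_trans (_ : 2^-1 * (expR q ^+ 2 * Qf W u) - expR (m * q) * NF u < 0).
  by rewrite lerD2l lerN2.
have -> : expR (m * q) = expR q ^+ 2 * expR ((m - 2) * q).
  by rewrite expr2 -!expRD; congr expR; ring.
have -> : 2^-1 * (expR q ^+ 2 * Qf W u) - expR q ^+ 2 * expR ((m - 2) * q) * NF u =
   expR q ^+ 2 * (2^-1 * Qf W u - expR ((m - 2) * q) * NF u) by ring.
rewrite pmulr_rlt0 ?exprn_gt0 ?expR_gt0// subr_lt0.
have h1 : 1 + (m - 2) * q <= expR ((m - 2) * q) by exact: expR_ge1Dx.
have h2 : (m - 2) * q * NF u = Qf W u.
  rewrite /q; move: (Qf W u) (NF u) F0 => Q A A0.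
  by rewrite [(m - 2) * _]mulrC divfK ?gt_eqF// divfK// gt_eqF.
have := ler_wpM2r (ltW F0) h1; rewrite mulrDl h2 mul1r.
move: F0 Q0 => + + {h h1 h2 i1 Et Ht}; move: (expR _ * NF u) => {q q0} C.
by move: (NF u) (Qf W u) => A B; lra.
Qed.

Lemma th0 : th r (0 : R) = 0.
Proof. by rewrite /th /pw expr0n mul0r addr0. Qed.

Lemma Gz_diff_eps (e : R) : 0 < e -> exists2 C : R, 0 < C &
  forall z y : R, `|Gz f (z + y) - Gz f z| <= e * th r z + C * th r y.
Proof.
move=> e0; have e2 : 0 < e / 2 by rewrite divr_gt0.
have [C1 C10 h1] := fz_diff_eps nf e0; have [C2 C20 h2] := F_diff_eps nf e2.
exists (C1 + C2); first exact: addr_gt0.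
move=> z y; have := h1 z y; have := h2 z y; have := th_ge0 r z; have := th_ge0 r y.
rewrite /Gz; move: (th r z) (th r y) (fz f _) (fz f _) (F _) (F _) => A B p q p' q' B0 A0.
have := mulr_ge0 (ltW C10) B0; have := mulr_ge0 (ltW C20) B0.
have := mulr_ge0 (ltW e0) A0.
rewrite !ler_norml => ? ? ? /andP[? ?] /andP[? ?]; apply/andP; split; lra.
Qed.

Lemma cont_Gz : continuous (Gz f).
Proof.
move=> t; apply: cvgB; last exact: (cont_F nf).
by apply: cvgM; [exact: cvg_cst|exact: (cont_fz nf)].
Qed.

Lemma cvg_comp_cont (H : R -> R) (a : nat -> R) (l : R) : continuous H ->
  a @ \oo --> l -> (fun n => H (a n)) @ \oo --> H l.
Proof. by move=> cH al; apply: (cvg_comp _ _ al); exact: cH. Qed.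

Lemma KinB_le u v : Hs u -> Hs v -> Kin s (fun x => u x - v x) <= 2 * Kin s u + 2 * Kin s v.
Proof.
move=> Hu Hv; have [B hB] := Kin_comb Hu Hv.
have [_ E1] := hB 1 (-1); have [_ E2] := hB 1 1.
have := Kin_ge0 s (fun x => 1 * u x + 1 * v x); rewrite E2.
have -> : (fun x => u x - v x) = (fun x => 1 * u x + -1 * v x).
  by apply/funext => x; rewrite mul1r mulN1r.
by rewrite E1; move: (Kin s u) (Kin s v) => p q {E1 E2 hB}; lra.
Qed.

(** * Brezis-Lieb splittings along a weakly convergent sequence *)

Section Splitting.
Variables (w_ : nat -> T -> R) (w : T -> R) (M : R) (P : T -> R).
Hypotheses (pP : pot P) (Hw_ : forall n, Hs (w_ n)) (Hw : Hs w)
  (nM : forall n, nsq mu (w_ n) <= M) (kM : forall n, Kin s (w_ n) <= M)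
  (wae : {ae mu, forall x, (fun n => w_ n x) @ \oo --> w x}).

Let v_ n x := w_ n x - w x.

Lemma th_bounded : exists D : R, forall n, II mu (fun x => th r (v_ n x)) <= D.
Proof.
have [C C0 hC] := pw_hom.
pose K := 2 * M + 2 * Kin s w; pose L := 2 * M + 2 * nsq mu w.
have Vi : 0 <= Vinf by apply: le_trans (normr_ge0 _) (pot_abs [tuple 0 | i < N] pP).
have Hv n : Hs (v_ n) by exact: HsB.
have kv n : Kin s (v_ n) <= K.
  apply: le_trans (KinB_le (Hw_ n) Hw) _; rewrite /K lerD2r ler_pM2l//; exact: kM.
have nv n : nsq mu (v_ n) <= L.
  apply: le_trans (nsqB_le (Hw_ n).1 Hw.1) _; rewrite /L lerD2r ler_pM2l//; exact: nM.
have Qv n : Qf P (v_ n) <= K + Vinf * L.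
  have /andP[_ h] := pot_nsq pP (Hv n).1; apply: lerD; first exact: kv.
  by apply: le_trans h _; rewrite ler_wpM2l.
pose d := 1 + (K + Vinf * L).
have B0 : 0 <= K + Vinf * L := le_trans (Qf_ge0 pP (Hv 0%N).1) (Qv 0%N).
have d0 : 0 < d by rewrite ltr_wpDr.
exists (L + C * d ^+ 2 * d `^ r) => n.
rewrite /th (IID (Hv n).1.2 (itg_pw pP (Hv n))); apply: lerD; first exact: nv.
apply: (hC P (v_ n) d pP (Hv n) d0 _).2; apply: le_trans (Qv n) _.
by rewrite /d; move: (K + _) B0 => b b0; nra.
Qed.

(** Stated for a general integrand so as to serve both [f(z) z] and [G]. The defect is dominated
    through the increment estimate at [(v_n, w)], small in [v_n], and at [(0, w)]. *)
Lemma bl_split (H : R -> R) : continuous H -> H 0 = 0 ->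
  (forall W u, pot W -> Hs u -> itg mu (fun x => H (u x))) ->
  (forall e : R, 0 < e -> exists2 C : R, 0 < C &
    forall z y : R, `|H (z + y) - H z| <= e * th r z + C * th r y) ->
  (fun n => II mu (fun x => H (v_ n x)) - II mu (fun x => H (w_ n x))) @ \oo -->
  - II mu (fun x => H (w x)).
Proof.
move=> cH H0 iH dH; have [D hD] := th_bounded.
have Hv n : Hs (v_ n) by exact: HsB.
have iw := iH P w pP Hw; have ith := itg_th pP Hw.
pose d_ n x := H (w_ n x) - H (v_ n x) - H (w x).
have [|||||||id cd] := @brezis_lieb _ _ _ mu d_ (fun n x => th r (v_ n x))
    (fun x => th r (w x)) D.
- move=> n; have i1 := iH P _ pP (Hw_ n); have i2 := iH P _ pP (Hv n).
  exact: itg_meas (itgB (itgB i1 i2) iw).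
- apply: filterS wae => x cx.
  have cv : (fun n => v_ n x) @ \oo --> (0 : R).
    by have := cvgRB cx (cvgR_cst (w x)); rewrite subrr.
  have := cvgRB (cvgRB (cvg_comp_cont cH cx) (cvg_comp_cont cH cv)) (cvgR_cst (H (w x))).
  by rewrite H0 subr0 subrr.
- by move=> n; exact: itg_th pP (Hv n).
- by move=> n x; exact: th_ge0.
- exact: hD.
- exact: ith.
- move=> e e0; have [C C0 hC] := dH e e0; have [C' C'0 hC'] := dH 1 ltr01.
  exists (C + C') => n x.
  have := hC (v_ n x) (w x); have := hC' 0 (w x).
  rewrite add0r H0 subr0 th0 mulr0 add0r /v_ subrK -/(v_ n x) => h1 h2.
  rewrite /d_ mulrDl addrA; apply: le_trans (ler_normB _ _) _; exact: lerD.
have cd' : (fun n => II mu (d_ n)) @ \oo --> (0 : R).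
  apply: cvg_eps => e e0; have [m0 hm] := eps_cvg cd e0; exists m0 => n mn.
  rewrite subr0; apply: le_trans (II_abs (id n)) _.
  by have := hm n mn; rewrite subr0; apply: le_trans; exact: ler_norm.
have := cvgRB (cvgRZ (-1) cd') (cvgR_cst (II mu (fun x => H (w x)))).
rewrite mulr0 sub0r; apply: eq_cvgR => n.
have i1 := iH P _ pP (Hw_ n); have i2 := iH P _ pP (Hv n).
rewrite /d_ (IIB (itgB i1 i2) iw) (IIB i1 i2).
by move: (II _ _) (II _ _) (II _ _) => p q b; ring.
Qed.

Variables (W_ : nat -> T -> R) (W : T -> R).
Hypotheses (pW_ : forall n, pot (W_ n)) (pW : pot W)
  (cW : forall x, (fun n => W_ n x) @ \oo --> W x)
  (wk : forall psi, L2 mu psi ->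
    (fun n => II mu (fun x => w_ n x * psi x)) @ \oo --> II mu (fun x => w x * psi x)).

(** Although the potential varies with [n], [(W_n - W) w] tends to 0 in L2 by dominated convergence,
    which leaves the weak convergence tested against [W w]. *)
Lemma Qf_split : (fun n => Qf (W_ n) (v_ n) - Qf (W_ n) (w_ n)) @ \oo --> - Qf W w.
Proof.
have [_ cK] := Kin_weak s01 Hw_ kM Hw.1 wk.
have LW (U : T -> R) u : pot U -> L2 mu u -> L2 mu (fun x => U x * u x).
  by move=> pU Lu; exact: L2_bound Lu pU.1 (fun x => pot_abs x pU).
have Vi : 0 <= Vinf by apply: le_trans (normr_ge0 _) (pot_abs [tuple 0 | i < N] pP).
have c1 : (fun n => nsq mu (fun x => (W_ n x - W x) * w x)) @ \oo --> (0 : R).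
  apply: (@II_dct0 _ _ _ mu _ (fun x => (2 * Vinf) ^+ 2 * w x ^+ 2)).
  - move=> n; apply: measurable_funX; apply: measurable_funM; last exact: Hw.1.1.
    by apply: measurable_funB; [exact: (pW_ n).1|exact: pW.1].
  - apply: aeW => x; have c := cvgRB (@cW x) (cvgR_cst (W x)); rewrite subrr in c.
    have c' := cvgRZ (w x) c; rewrite mulr0 in c'.
    have := cvgRM c' c'; rewrite mulr0; apply: eq_cvgR => n.
    by rewrite expr2 (mulrC (_ - _)).
  - move=> n x; rewrite ger0_norm ?sqr_ge0// exprMn ler_wpM2r ?sqr_ge0//.
    rewrite -[leLHS]real_normK ?num_real// lerXn2r ?nnegrE ?mulr_ge0//.
    apply: le_trans (ler_normB _ _) _; have := pot_abs x (pW_ n); have := pot_abs x pW.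
    by move=> h1 h2; apply: le_trans (lerD h2 h1) _; rewrite mulr_natl mulr2n.
  - exact: itgZ Hw.1.2.
have LD n : L2 mu (fun x => (W_ n x - W x) * w x).
  have := L2B (LW _ _ (pW_ n) Hw.1) (LW _ _ pW Hw.1).
  by congr L2; apply/funext => x; rewrite mulrBl.
have pairD (a_ : nat -> T -> R) (A : R) : (forall n, L2 mu (a_ n)) ->
    (forall n, nsq mu (a_ n) <= A) ->
    (fun n => II mu (fun x => a_ n x * ((W_ n x - W x) * w x))) @ \oo --> (0 : R).
  move=> La aA; apply: cvg_eps => e e0.
  have A0 : 0 <= A := le_trans (nsq_ge0 _ _) (aA 0%N).
  pose b : R := e / (A + 1).
  have b0 : 0 < b by rewrite divr_gt0// ltr_wpDl.
  have bA : b * A <= e.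
    rewrite /b mulrAC ler_pdivrMr ?ltr_wpDl// ler_pM2l// lerDl ler01//.
  have be : 0 < b * e by rewrite mulr_gt0.
  have [m0 hm] := eps_cvg c1 be; exists m0 => n mn; rewrite subr0.
  have := hm n mn; rewrite subr0 ger0_norm ?nsq_ge0// => h1.
  have y := pair_young b0 (La n) (LD n).
  have h2 : b^-1 * nsq mu (fun x => (W_ n x - W x) * w x) <= e.
    by rewrite mulrC ler_pdivrMr// mulrC.
  have h3 : b * nsq mu (a_ n) <= e.
    by apply: le_trans bA; rewrite ler_pM2l.
  rewrite -(@ler_pM2l _ 2)//; apply: le_trans y _; apply: le_trans (lerD h3 h2) _.
  by rewrite mulr_natl mulr2n.
have c2 := pairD w_ M (fun n => (Hw_ n).1) nM.
have c3 := pairD (fun=> w) (nsq mu w) (fun=> Hw.1) (fun=> lexx _).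
have c4 := @wk _ (LW _ _ pW Hw.1).
have E0 : II mu (fun x => w x * (W x * w x)) = II mu (fun x => W x * w x ^+ 2).
  by apply: eq_II => x; ring.
rewrite E0 in c4.
have := cvgRD cK (cvgRD (cvgRZ (-2) (cvgRD c2 c4))
  (cvgRD c3 (cvgR_cst (II mu (fun x => W x * w x ^+ 2))))).
have -> : - Kin s w + (-2 * (0 + II mu (fun x => W x * w x ^+ 2)) +
   (0 + II mu (fun x => W x * w x ^+ 2))) = - Qf W w.
  by rewrite /Qf; move: (Kin s w) (II _ _) => p q; ring.
apply: eq_cvgR => n; rewrite /Qf.
have i1 := L2_itgM (Hw_ n).1 (LD n); have i2 := L2_itgM (Hw_ n).1 (LW _ _ pW Hw.1).
have i3 := L2_itgM Hw.1 (LD n); have i4 := itg_potM pW Hw.1.2.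
have i5 := itg_potM (pW_ n) (Hw_ n).1.2; have i6 := itg_potM (pW_ n) (HsB (Hw_ n) Hw).1.2.
have E : II mu (fun x => W_ n x * v_ n x ^+ 2) - II mu (fun x => W_ n x * w_ n x ^+ 2) =
   -2 * (II mu (fun x => w_ n x * ((W_ n x - W x) * w x)) + II mu (fun x => w_ n x * (W x * w x))) +
   (II mu (fun x => w x * ((W_ n x - W x) * w x)) + II mu (fun x => W x * w x ^+ 2)).
  rewrite -(IIB i6 i5) -(IID i1 i2) -(IIZ _ (itgD i1 i2)) -(IID i3 i4).
  rewrite -(IID (itgZ _ (itgD i1 i2)) (itgD i3 i4)).
  by apply: eq_II => x; rewrite /v_; ring.
rewrite -E; move: (Kin _ _) (Kin _ _) (II _ _) (II _ _) => p q a b; ring.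
Qed.

End Splitting.

Lemma euclN_triangle (x y : T) : euclN (addT x y) <= euclN x + euclN y.
Proof.
have x0 : 0 <= euclN x by exact: sqrtr_ge0.
have y0 : 0 <= euclN y by exact: sqrtr_ge0.
rewrite -[leRHS]ger0_norm ?addr_ge0// -sqrtr_sqr ler_wsqrtr//.
rewrite dotN_addl (dotNC x) (dotNC y) !dotN_addl (dotNC y x).
have := le_trans (ler_norm _) (dotN_cauchy x y).
have e1 : euclN x ^+ 2 = dotN x x by rewrite sqr_sqrtr ?dotN_ge0.
have e2 : euclN y ^+ 2 = dotN y y by rewrite sqr_sqrtr ?dotN_ge0.
by rewrite -e1 -e2; move: (dotN x y) (euclN x) (euclN y) => a b c; nra.
Qed.

Lemma Qf_shift W u (a : T) : pot W -> Hs u ->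
  Qf (fun x => W (addT x a)) (fun x => u (addT x a)) = Qf W u.
Proof.
move=> pW Hu; have [_ E] := Hs_shift a Hu; rewrite /Qf E; congr (_ + _).
exact: (II_shift a (itg_potM pW Hu.1.2)).
Qed.

Lemma pot_shift W (a : T) : pot W -> pot (fun x => W (addT x a)).
Proof. by move=> [mW hW]; split => [|x //]; exact: meas_shift. Qed.

Lemma Nfz_shift W u (a : T) : pot W -> Hs u -> Nfz (fun x => u (addT x a)) = Nfz u.
Proof. by move=> pW Hu; exact: (II_shift a (itg_fz pW Hu)). Qed.

Lemma NG_shift W u (a : T) : pot W -> Hs u -> NG (fun x => u (addT x a)) = NG u.
Proof. by move=> pW Hu; exact: (II_shift a (itg_Gz pW Hu)). Qed.

(** Elements are functions rather than classes, so [u <> 0] is expressed by a positive norm. *)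
Definition nehari W u := [/\ Hs u, Phi W u = 0 & 0 < Qf W u].

Lemma nehari_project W u : pot W -> Hs u -> 0 < Qf W u -> Phi W u <= 0 ->
  exists2 t : R, 0 < t <= 1 & nehari W (fun x => t * u x).
Proof.
move=> pW Hu Q0 P0; have [t t01 Pt] := nehari_projection pW Hu Q0 P0.
exists t; first exact: t01.
have [Ht Et] := QfZ t pW Hu; split; [exact: Ht|exact: Pt|].
by rewrite Et; apply: mulr_gt0; [apply: exprn_gt0; have /andP[] := t01|exact: Q0].
Qed.

Lemma nehari_JW W u : pot W -> nehari W u -> JW W u = NG u.
Proof. by move=> pW [Hu P0 _]; rewrite (JW_Phi pW Hu) P0 mulr0 add0r. Qed.

Lemma mu_pos : 0 < 2^-1 - m^-1 :> R.
Proof. by rewrite subr_gt0 ltf_pV2 ?posrE ?(nl_m nf)// (lt_trans _ (nl_m nf)). Qed.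

(** Coercivity of [J] on the Nehari set; the factor is positive because the constant of (f4) exceeds
    2. *)
Lemma nehari_bound W u : pot W -> nehari W u -> (2^-1 - m^-1) * Qf W u <= NG u.
Proof.
move=> pW [Hu P0 _]; have := NG_ge pW Hu; suff -> : Nfz u = Qf W u by [].
by move: P0; rewrite /Phi => /eqP; rewrite subr_eq0 => /eqP.
Qed.

(** The Nehari set stays away from 0 in the norm, and [Qf = int f(u) u] passes this on to the power
    [2 + r]. This is what excludes vanishing in Lions' lemma. *)
Lemma nehari_pw : exists2 e : R, 0 < e & forall W u, pot W -> nehari W u ->
  e <= II mu (fun x => pw r (u x)).
Proof.
have [rho rho0 hrho] := Phi_small.
have e0 : 0 < V0 / 2 by rewrite divr_gt0.
have [C C0 hC] := Nfz_eps e0.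
exists (rho / (2 * C)); first by rewrite divr_gt0// mulr_gt0.
move=> W u pW [Hu P0 Q0].
have Qr : rho <= Qf W u.
  rewrite leNgt; apply/negP => /ltW h; have := hrho W u pW Hu h.
  by rewrite P0 pmulr_rle0// leNgt Q0.
have [_ h3] := Qf_ge pW Hu.1; have h := hC W u pW Hu.
have E : Nfz u = Qf W u.
  by move: P0; rewrite /Phi => /eqP; rewrite subr_eq0 => /eqP.
rewrite ler_pdivrMr ?mulr_gt0//; move: h; rewrite E.
move: h3 Qr; move: (II _ _) (Qf W u) (nsq mu u) => a b c h3 Qr.
by move=> {E hC hrho}; lra.
Qed.

(** * Existence of a minimizer on the Nehari set *)

Section Minimizer.
Variable V : T -> R.
Hypotheses (pV : pot V)
  (Vlim : forall e : R, 0 < e -> exists M : R, forall x, M <= euclN x -> Vinf - e <= V x).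

Lemma pot_Vinf : pot (fun=> Vinf).
Proof.
split; first exact: measurable_cst.
by move=> x; have /andP[h1 h2] := pV.2 x; rewrite lexx (le_trans h1).
Qed.

Definition zeroT : T := [tuple 0 | i < N].

Lemma addT0 x : addT x zeroT = x.
Proof. by apply: eq_from_tnth => i; rewrite !tnth_mktuple addr0. Qed.

(** If infinitely many centres stay in a ball of radius [q], no translation is made, the ball of
    observation grows by [q], and [W = V]. Otherwise the centres go to infinity and the translated
    potentials tend to [Vinf]. *)
Lemma concentration (u_ : nat -> T -> R) (x_ : nat -> T) (eta : R) : (forall n, L2 mu (u_ n)) ->
  (forall n, eta <= II mu (fun y => chi (1 + N%:R) y * u_ n (addT y (x_ n)) ^+ 2)) ->
  exists2 phi : nat -> nat, (forall k, (phi k < phi k.+1)%N) &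
  exists (y_ : nat -> T) (W : T -> R) (q : R),
  [/\ pot W, forall x, V x <= W x,
     forall x, (fun n => V (addT x (y_ n))) @ \oo --> W x &
     forall n, eta <= II mu (fun y => chi q y * u_ (phi n) (addT y (y_ n)) ^+ 2)].
Proof.
move=> Lu hu.
have [[q hq]|nb] := pselect (exists q : R, forall m0, exists2 n, (m0 <= n)%N & euclN (x_ n) <= q).
  have [phi ip hphi] := extract (P := fun _ n => euclN (x_ n) <= q) (fun _ => hq).
  exists phi => //; exists (fun=> zeroT), V, (1 + N%:R + q); split => //.
    by move=> x; rewrite addT0; exact: cvgR_cst.
  move=> n; apply: le_trans (hu (phi n)) _.
  pose x := x_ (phi n).
  have L := Lu (phi n).
  have i1 : itg mu (fun y => chi (1 + N%:R) (addT y (oppT x)) * u_ (phi n) y ^+ 2).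
    apply: (itg_le _ _ L.2) => [|y].
      apply: measurable_funM; last by apply: measurable_funX; exact: L.1.
      exact: (meas_shift _ (meas_chi _)).
    rewrite normrM (ger0_norm (sqr_ge0 _)) -[leRHS]mul1r ler_wpM2r ?sqr_ge0//.
    exact: chi_abs.
  rewrite [leLHS](_ : _ = II mu (fun y => chi (1 + N%:R) (addT y (oppT x)) * u_ (phi n) y ^+ 2)).
    apply: II_le => //.
      have := itg_chiM (1 + N%:R + q) L.2; congr itg; apply/funext => y.
      by rewrite addT0.
    move=> y; rewrite addT0 ler_wpM2r ?sqr_ge0// /chi.
    case: ifPn => h; last by case: ifP.
    rewrite ifT//; have := euclN_triangle (addT y (oppT x)) x; rewrite addTNK => h'.
    by apply: le_trans h' _; apply: lerD => //; exact: hphi.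
  rewrite -(II_shift x i1); apply: eq_II => y; by rewrite addTK.
exists id => //; exists x_, (fun=> Vinf), (1 + N%:R); split => //.
- exact: pot_Vinf.
- by move=> x; have /andP[] := pV.2 x.
move=> x; apply: cvg_eps => e e0; have [M hM] := Vlim e0.
have [m0 hm] : exists m0, forall n, (m0 <= n)%N -> M + euclN (oppT x) <= euclN (x_ n).
  apply: contrapT => H; apply: nb; exists (M + euclN (oppT x)) => m0.
  apply: contrapT => H'; apply: H; exists m0 => n mn.
  rewrite leNgt; apply/negP => h; apply: H'; exists n => //; exact: ltW.
exists m0 => n mn; have := hm n mn.
have := euclN_triangle (addT x (x_ n)) (oppT x).
rewrite (addTC x) addTK => h1 h2.
have := hM (addT (x_ n) x) _; move=> /(_ _).
have hMx : M <= euclN (addT (x_ n) x) by lra.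
move=> /(_ hMx) h3; have /andP[_ h4] := pV.2 (addT (x_ n) x).
by rewrite ler0_norm; lra.
Qed.

Lemma NG_gt0 W w : pot W -> Hs w -> 0 < nsq mu w -> 0 < NG w.
Proof.
move=> pW Hw n0; apply: II_gt0; [by move=> x; exact: Gz_ge0 nf _|exact: itg_Gz pW Hw|move=> ae0].
have : nsq mu w = II mu (fun=> 0).
  apply: II_ae_eq; [exact: itg_meas Hw.1.2|exact: measurable_cst|].
  apply: filterS ae0 => x Gx; have [->|wx] := eqVneq (w x) 0; first by rewrite expr0n.
  by have := Gz_gt0 nf wx; rewrite Gx ltxx.
by rewrite II_cst0 => E; move: n0; rewrite E ltxx.
Qed.

Let limit_neg (a b c d e g : R) : 0 < a - g -> c - e = 0 ->
  b - c - (d - e) - (- a - - g) <= (a - g) / 2 -> b - d < 0.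
Proof. by move=> *; lra. Qed.

Let limit_drop (a b c d i : R) : 0 < d -> b <= c + i -> i <= d / 4 ->
  a - b - - d <= d / 4 -> a < c.
Proof. by move=> *; lra. Qed.

Lemma nehari_minimizer : (exists u, nehari V u) -> exists2 u, nehari V u &
  forall v, nehari V v -> JW V u <= JW V v.
Proof.
move=> [u0 Nu0].
pose E : set R := [set c | exists2 u, nehari V u & c = JW V u].
have hE : has_inf E.
  split; first by exists (JW V u0), u0.
  by exists 0 => _ [u Nu ->]; rewrite (nehari_JW pV Nu) NG_ge0.
pose c := inf E.
have cle v : nehari V v -> c <= JW V v by move=> Nv; apply: (ge_inf hE.2); exists v.
have /choice[u_ Hu_] : forall n : nat, exists u, nehari V u /\ JW V u <= c + n.+1%:R^-1.
  move=> n; have n0 : 0 < n.+1%:R^-1 :> R by rewrite invr_gt0.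
  have [_ [u Nu ->] h] := inf_adherent n0 hE.
  by exists u; split => //; exact: ltW.
have Nu n : nehari V (u_ n) by have [] := Hu_ n.
have Hu n : Hs (u_ n) by have [] := Nu n.
have Gu n : NG (u_ n) <= c + n.+1%:R^-1.
  by rewrite -(nehari_JW pV (Nu n)); exact: (Hu_ n).2.
have m0 := mu_pos.
have inv1 n : n.+1%:R^-1 <= 1 :> R by rewrite invf_le1// ler1n.
pose QM : R := (c + 1) / (2^-1 - m^-1).
have Qu n : Qf V (u_ n) <= QM.
  rewrite /QM ler_pdivlMr// mulrC; apply: le_trans (nehari_bound pV (Nu n)) _.
  by apply: le_trans (Gu n) _; rewrite lerD2l.
have QM0 : 0 < QM by have [_ _ q0] := Nu 0%N; exact: lt_le_trans q0 (Qu 0%N).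
pose M : R := QM + QM / V0.
have M0 : 0 < M by rewrite addr_gt0// divr_gt0.
have kM n : Kin s (u_ n) <= M.
  have [h _] := Qf_ge pV (Hu n).1; apply: le_trans h _; apply: le_trans (Qu n) _.
  by rewrite /M lerDl divr_ge0// ltW.
have nM n : nsq mu (u_ n) <= M.
  have [_ h] := Qf_ge pV (Hu n).1.
  apply: le_trans (_ : QM / V0 <= _); last by rewrite /M lerDr ltW.
  by rewrite ler_pdivlMr// mulrC; apply: le_trans h _; exact: Qu.
have [e0 e00 he0] := nehari_pw.
have e02 : 0 < e0 / 2 by rewrite divr_gt0.
have [eta eta0 heta] := lions s01 sN r0 rN M0 e02.
have /choice[x_ hx] : forall n, exists x,
    eta <= II mu (fun y => chi (1 + N%:R) y * u_ n (addT y x) ^+ 2).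
  move=> n; apply: contrapT => H.
  have : II mu (fun x => pw r (u_ n x)) <= e0 / 2.
    apply: heta (Hu n) (nM n) (kM n) _ => x; rewrite leNgt; apply/negP => h.
    by apply: H; exists x; exact: ltW.
  have := he0 V (u_ n) pV (Nu n); move: (II _ _) => a; lra.
have [phi ip [y_ [W [q [pW VW cW hq]]]]] := concentration (fun n => (Hu n).1) hx.
pose w'_ n x := u_ (phi n) (addT x (y_ n)).
have Hw' n : Hs (w'_ n) by have [] := Hs_shift (y_ n) (Hu (phi n)).
have kw' n : Kin s (w'_ n) <= M.
  by have [_ ->] := Hs_shift (y_ n) (Hu (phi n)); exact: kM.
have nw' n : nsq mu (w'_ n) <= M.
  by rewrite (nsq_shift (y_ n) (Hu (phi n)).1); exact: nM.
have [psi ip' [w [Lw loc wk wae]]] := local_compactness s01 M0 Hw' nw' kw'.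
pose w_ n := w'_ (psi n).
pose W_ n x := V (addT x (y_ (psi n))).
have pW_ n : pot (W_ n) by exact: pot_shift.
have cW' x : (fun n => W_ n x) @ \oo --> W x by exact: (cvg_extract ip' (@cW x)).
have Hw_ n : Hs (w_ n) by exact: Hw'.
have nw n : nsq mu (w_ n) <= M by exact: nw'.
have kw n : Kin s (w_ n) <= M by exact: kw'.
have [Hw _] := Kin_weak s01 Hw_ kw Lw wk.
have nsqw : 0 < nsq mu w.
  apply: lt_le_trans (_ : eta / 2 <= _); first by rewrite divr_gt0.
  (* The mass at least [eta] on a fixed ball survives in the limit, since the right-hand side tends
     to 0. *)
  have h n : eta / 2 - nsq mu w <= II mu (fun x => chi q x * (w_ n x - w x) ^+ 2).
    have i1 := itg_chiM q (L2B (Hw_ n).1 Lw).2; have i2 := itg_chiM q (Hw_ n).1.2.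
    have i3 : itg mu (fun x => 2 * (chi q x * (w_ n x - w x) ^+ 2) + 2 * w x ^+ 2).
      exact: itgD (itgZ _ i1) (itgZ _ Lw.2).
    have : eta <= 2 * II mu (fun x => chi q x * (w_ n x - w x) ^+ 2) + 2 * nsq mu w.
      apply: le_trans (hq (psi n)) _.
      rewrite /nsq -(IIZ _ i1) -(IIZ _ Lw.2) -(IID (itgZ _ i1) (itgZ _ Lw.2)).
      apply: II_le; [exact: i2|exact: i3|move=> x].
      have -> : u_ (phi (psi n)) (addT x (y_ (psi n))) = w_ n x by [].
      rewrite /chi; case: ifP => _; rewrite ?mul0r ?mulr0 ?add0r ?mul1r.
        by move: (w_ n x) (w x) => a b; have := sqr_ge0 (a - b - b); nra.
      by rewrite mulr_ge0 ?sqr_ge0.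
    by move: (II _ _) (nsq mu w) => a b; lra.
  have := cvgR_ge (loc q) h; move: (nsq mu w) => b; lra.
have Gw0 : 0 < NG w by exact: NG_gt0 pW Hw nsqw.
have Gw_ n : NG (w_ n) <= c + n.+1%:R^-1.
  have -> : NG (w_ n) = NG (u_ (phi (psi n))) by exact: NG_shift pV (Hu _).
  apply: le_trans (Gu _) _; rewrite lerD2l lef_pV2 ?posrE// ler_nat ltnS.
  by apply: leq_trans (extract_ge ip' n) (extract_ge ip _).
have Pw_ n : Phi (W_ n) (w_ n) = 0.
  have [_ P0 _] := Nu (phi (psi n)); rewrite -P0 /Phi; congr (_ - _).
    exact: (Qf_shift (y_ (psi n)) pV (Hu _)).
  exact: (Nfz_shift (y_ (psi n)) pV (Hu _)).
pose v_ n x := w_ n x - w x.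
have Hv n : Hs (v_ n) by exact: HsB.
have PW : Phi W w <= 0.
  rewrite leNgt; apply/negP => PW0.
  have cQ := Qf_split pV Hw_ Hw nw kw pW_ pW cW' wk.
  have cN := bl_split pV Hw_ Hw nw kw wae (cont_fz nf) (fz0 f) itg_fz (fz_diff_eps nf).
  have G0 : Gz f 0 = 0 by rewrite /Gz fz0 mulr0 F0 subr0.
  have cG := bl_split pV Hw_ Hw nw kw wae cont_Gz G0 itg_Gz Gz_diff_eps.
  have P2 : 0 < Phi W w / 2 by rewrite divr_gt0.
  have G4 : 0 < NG w / 4 by rewrite divr_gt0.
  have [n1 h1] := eps_cvg (cvgRB cQ cN) P2.
  have [n2 h2] := eps_cvg cG G4.
  pose n := maxn (maxn n1 n2) (Num.bound (NG w / 4)^-1).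
  have n1n : (n1 <= n)%N by rewrite /n (leq_trans _ (leq_maxl _ _))// leq_maxl.
  have n2n : (n2 <= n)%N by rewrite /n (leq_trans _ (leq_maxl _ _))// leq_maxr.
  have ninv : n.+1%:R^-1 <= NG w / 4.
    rewrite -[leRHS]invrK lef_pV2 ?posrE ?invr_gt0//.
    have g0 : 0 <= (NG w / 4)^-1 by rewrite invr_ge0 ltW.
    apply: le_trans (ltW (archi_boundP g0)) _; rewrite ler_nat /n.
    by apply: leq_trans (leq_maxr _ _) (leqnSn _).
  (* As [Phi (W_ n) (w_ n) = 0], the two splittings make [Phi (W_ n) (v_ n)] tend to
     [- Phi W w < 0]; likewise [NG (v_ n)] falls below [c] by nearly [NG w]. *)
  have Pv : Phi (W_ n) (v_ n) < 0.
    have := h1 n n1n; rewrite ler_norml => /andP[_ h].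
    exact: (limit_neg PW0 (Pw_ n) h).
  have Gv : NG (v_ n) < c.
    have := h2 n n2n; rewrite ler_norml => /andP[_ h].
    exact: (limit_drop Gw0 (Gw_ n) ninv h).
  (* The remainder is translated back, so that it is measured with [V] itself and competes in the
     infimum. *)
  pose z x := v_ n (addT x (oppT (y_ (psi n)))).
  have Hz : Hs z by have [] := Hs_shift (oppT (y_ (psi n))) (Hv n).
  have Ez : (fun x => z (addT x (y_ (psi n)))) = v_ n.
    by apply/funext => x; rewrite /z addTK.
  have Pz : Phi V z < 0.
    rewrite /Phi -(Qf_shift (y_ (psi n)) pV Hz) -(Nfz_shift (y_ (psi n)) pV Hz) Ez.
    exact: Pv.
  have Gz' : NG z = NG (v_ n) by exact: NG_shift pV (Hv n).
  have Qz : 0 < Qf V z.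
    rewrite lt_neqAle eq_sym (Qf_ge0 pV Hz.1) andbT; apply/eqP => Q0.
    have [rho rho0 hrho] := Phi_small; have := hrho V z pV Hz.
    by rewrite Q0 mulr0 => /(_ (ltW rho0)); rewrite leNgt Pz.
  have [t /andP[t0 t1] Nt] := nehari_project pV Hz Qz (ltW Pz).
  have t01 : 0 <= t <= 1 by rewrite (ltW t0).
  have := cle _ Nt; rewrite (nehari_JW pV Nt) leNgt => /negP; apply.
  apply: le_lt_trans (NG_scale pV Hz t01) _.
  by rewrite Gz'; exact: Gv.
have Gwc : NG w <= c.
  apply/ler_addgt0Pr => e ee.
  (* Dropping the first [k] terms makes the bound [c + e] hold for every index, as Fatou requires
     here. *)
  pose k := Num.bound e^-1.
  have einv : k.+1%:R^-1 <= e.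
    rewrite -[leRHS]invrK lef_pV2 ?posrE ?invr_gt0//.
    have g0 : 0 <= e^-1 by rewrite invr_ge0 ltW.
    by apply: le_trans (ltW (archi_boundP g0)) _; rewrite ler_nat.
  apply: (@II_fatou _ _ _ mu (fun n x => Gz f (w_ (n + k)%N x)) _ _ _ _ _ _ _ _).2.
  - by move=> n; exact: itg_Gz pV (Hw_ _).
  - exact: itg_meas (itg_Gz pV Hw).
  - by move=> n x; exact: Gz_ge0 nf _.
  - by move=> x; exact: Gz_ge0 nf _.
  - apply: filterS wae => x cx; apply: (cvg_comp_cont cont_Gz).
    have ik j : ((j + k) < (j.+1 + k))%N by [].
    exact: (cvg_extract ik cx).
  - move=> n; apply: le_trans (Gw_ _) _; rewrite lerD2l; apply: le_trans einv.
    by rewrite lef_pV2 ?posrE// ler_nat ltnS leq_addl.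
have PV : Phi V w <= 0.
  apply: le_trans PW; rewrite /Phi lerD2r /Qf lerD2l.
  apply: II_le; [exact: itg_potM pV Lw.2|exact: itg_potM pW Lw.2|move=> x].
  by rewrite ler_wpM2r ?sqr_ge0.
have QV : 0 < Qf V w.
  have [_ h] := Qf_ge pV Lw; apply: lt_le_trans h; exact: mulr_gt0.
have [t /andP[t0 t1] Nt] := nehari_project pV Hw QV PV.
have t01 : 0 <= t <= 1 by rewrite (ltW t0).
exists (fun x => t * w x); first exact: Nt.
move=> v Nv; apply: le_trans (cle v Nv).
rewrite (nehari_JW pV Nt); apply: le_trans Gwc; exact: NG_scale pV Hw t01.
Qed.

End Minimizer.

(** * Minimizers on the Nehari set are critical points *)

Section Critical.
Variable V : T -> R.
Hypothesis pV : pot V.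

Lemma Nfz_gt0_ne W u : pot W -> Hs u -> 0 < Nfz u -> ~ {ae mu, forall x, u x = 0}.
Proof.
move=> pW Hu N0 ae0; have : Nfz u = II mu (fun=> 0).
  apply: II_ae_eq; [exact: itg_meas (itg_fz pW Hu)|exact: measurable_cst|].
  by apply: filterS ae0 => x ->; rewrite fz0.
by rewrite II_cst0 => E; move: N0; rewrite E ltxx.
Qed.

(** For a Nehari point [Phi (t u)] is the integral of [t^2 f(u) u - f(t u) t u], which by (f5) has a
    strict sign wherever [u <> 0], a set that is not negligible. *)
Lemma Phi_ray_strict u (t : R) : nehari V u -> 0 < t ->
  (t < 1 -> 0 < Phi V (fun x => t * u x)) /\ (1 < t -> Phi V (fun x => t * u x) < 0).
Proof.
move=> [Hu P0 Q0] t0; have [Ht Et] := QfZ t pV Hu.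
have EN : Nfz u = Qf V u by move: P0; rewrite /Phi => /eqP; rewrite subr_eq0 => /eqP.
have i1 := itg_fz pV Hu; have i2 := itg_fz pV Ht.
have N0 : 0 < Nfz u by rewrite EN.
have nae := Nfz_gt0_ne pV Hu N0.
have E : Phi V (fun x => t * u x) = II mu (fun x => t ^+ 2 * fz f (u x) - fz f (t * u x)).
  by rewrite (IIB (itgZ _ i1) i2) (IIZ _ i1) /Phi Et -EN.
split => t1.
  rewrite E; apply: II_gt0.
  - by move=> x; rewrite subr_ge0; apply: (fz_scale_le nf); rewrite !ltW.
  - exact: itgB (itgZ _ i1) i2.
  - move=> h; apply: nae; apply: filterS h => x /eqP; rewrite subr_eq0 => /eqP h.
    apply/eqP; apply: contraT => ux; have tt : 0 < t < 1 by rewrite t0.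
    by have := fz_scale_lt nf ux tt; rewrite h ltxx.
rewrite -oppr_gt0 E -(IIN (itgB (itgZ _ i1) i2)); apply: II_gt0.
- by move=> x; rewrite opprB subr_ge0; apply: (fz_scale_ge nf); exact: ltW.
- exact: itgN (itgB (itgZ _ i1) i2).
- move=> h; apply: nae; apply: filterS h => x; rewrite opprB => /eqP; rewrite subr_eq0 => /eqP h.
  apply/eqP; apply: contraT => ux.
  by have := fz_scale_gt nf ux t1; rewrite h ltxx.
Qed.

Let A : R := a1 + a2.
Let A0 : 0 < A. Proof. exact: addr_gt0 (nl_a1 nf) (nl_a2 nf). Qed.
Let K2 : R := 2 `^ r.
Let K21 : 1 <= K2.
Proof. by rewrite /K2 -[leLHS](powRr0 2) ler_powR ?ler1n ?(ltW r0). Qed.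

Lemma th_add (z y : R) : th r (`|z| + `|y|) <= 4 * K2 * (th r z + th r y).
Proof.
wlog zy : z y / `|z| <= `|y|.
  move=> H; have [/H//|/ltW/H] := leP `|z| `|y|.
  by rewrite addrC [th r y + _]addrC.
apply: le_trans (_ : 4 * K2 * th r y <= _); last first.
  by rewrite ler_wpM2l ?lerDr ?th_ge0// mulr_ge0 ?powR_ge0.
have h : `|z| + `|y| <= 2 * `|y| by rewrite mulr_natl mulr2n lerD2r.
have s0 : 0 <= `|z| + `|y| by rewrite addr_ge0.
rewrite /th /pw (ger0_norm s0) mulrDr.
have h2 : (`|z| + `|y|) ^+ 2 <= 4 * y ^+ 2.
  have -> : 4 * y ^+ 2 = (2 * `|y|) ^+ 2 by rewrite exprMn real_normK ?num_real// -natrX.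
  by rewrite lerXn2r ?nnegrE ?mulr_ge0.
have h3 := powR_le_scale nf (_ : 1 <= 2) s0 h; rewrite ler1n in h3.
have {}h3 := h3 isT; rewrite -/K2 in h3.
apply: lerD.
  by apply: le_trans h2 _; rewrite ler_wpM2r ?sqr_ge0// ler_peMr.
have -> : 4 * K2 * (y ^+ 2 * `|y| `^ r) = (4 * y ^+ 2) * (K2 * `|y| `^ r) by ring.
by apply: ler_pM; rewrite ?sqr_ge0 ?powR_ge0.
Qed.

Lemma itg_th2 u v : Hs u -> Hs v -> itg mu (fun x => th r (`|u x| + `|v x|)) /\
  II mu (fun x => th r (`|u x| + `|v x|)) <=
  4 * K2 * (II mu (fun x => th r (u x)) + II mu (fun x => th r (v x))).
Proof.
move=> Hu Hv; have i1 := itg_th pV Hu; have i2 := itg_th pV Hv.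
rewrite -(IID i1 i2) -(IIZ _ (itgD i1 i2)).
apply: II_ge0_le; last exact: itgZ (itgD i1 i2).
  have ms : measurable_fun setT (fun x => `|u x| + `|v x|).
    by apply: measurable_funD; apply: measurableT_comp => //; [exact: Hu.1.1|exact: Hv.1.1].
  by apply: measurable_funD; [exact: measurable_funX|exact: meas_pw].
by move=> x; rewrite th_ge0 th_add.
Qed.

(** One majorant for all first and second order terms below, with [S = |u| + |phi|]; the multipliers
    there lie in [[0, 2]]. *)
Lemma grow_th (S b c d : R) : 0 <= S -> 0 <= b <= S -> 0 <= c <= S -> 0 <= d <= 2 * S ->
  b * c * (a1 + a2 * d `^ r) <= A * K2 * th r S.
Proof.
move=> S0 /andP[b0 bS] /andP[c0 cS] /andP[d0 dS].
have p1 : 0 < a1 := nl_a1 nf.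
have p2 : 0 < a2 := nl_a2 nf.
have bc : b * c <= S ^+ 2 by rewrite expr2; apply: ler_pM.
have dr : d `^ r <= K2 * S `^ r.
  have := powR_le_scale nf (_ : 1 <= 2) d0 (_ : d <= 2 * `|S|).
  by rewrite (ger0_norm S0) ler1n; apply.
have h : a1 + a2 * d `^ r <= A * K2 * (1 + S `^ r).
  have S1 := powR_ge0 S r; have k1 := K21.
  apply: le_trans (_ : a1 + a2 * (K2 * S `^ r) <= _).
    by rewrite lerD2l ler_pM2l.
  rewrite /A; move: (S `^ r) K2 S1 k1 => q k q0 k1.
  have q1 := mulr_ge0 (ltW p1) q0.
  have q2 := mulr_ge0 q1 (le_trans ler01 k1).
  have q3 := ler_wpM2l (ltW p1) k1.
  have q4 := mulr_ge0 (ltW p2) (le_trans ler01 k1).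
  by lra.
have -> : A * K2 * th r S = S ^+ 2 * (A * K2 * (1 + S `^ r)).
  by rewrite /th /pw (ger0_norm S0); ring.
apply: ler_pM => //; first exact: mulr_ge0.
by rewrite addr_ge0 ?mulr_ge0 ?powR_ge0// ltW.
Qed.

Section Direction.
Variables (u phi : T -> R).
Hypotheses (Hu : Hs u) (Hp : Hs phi).
Let S x := `|u x| + `|phi x|.
Let iS : itg mu (fun x => th r (S x)) := (itg_th2 Hu Hp).1.
Let D : R := A * K2 * II mu (fun x => th r (S x)).

Let S0 x : 0 <= S x. Proof. by rewrite addr_ge0. Qed.
Let uS x : 0 <= `|u x| <= S x. Proof. by rewrite normr_ge0 lerDl normr_ge0. Qed.
Let pS x : 0 <= `|phi x| <= S x. Proof. by rewrite normr_ge0 lerDr normr_ge0. Qed.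

Let D0 : 0 <= D.
Proof.
rewrite /D mulr_ge0 ?mulr_ge0 ?powR_ge0 ?(ltW A0)//.
by apply: II_ge0 => x; exact: th_ge0.
Qed.

Let mf (t : R) : measurable_fun setT (fun x => f (t * u x)).
Proof.
apply: (meas_comp (cont_f nf)); apply: measurable_funM; first exact: measurable_cst.
exact: Hu.1.1.
Qed.

Lemma itg_fphi (t : R) : 0 <= t <= 2 -> itg mu (fun x => f (t * u x) * phi x).
Proof.
move=> /andP[t0 t2]; apply: (itg_le _ _ (itgZ (2 * (A * K2)) iS)).
  by apply: measurable_funM; [exact: mf|exact: Hp.1.1].
move=> x; rewrite normrM.
have := f_bound nf (t * u x); rewrite normrM (ger0_norm t0) => h.
apply: le_trans (ler_wpM2r (normr_ge0 _) h) _.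
have h1 := grow_th (S0 x) (uS x) (pS x) (_ : 0 <= t * `|u x| <= 2 * S x).
have tu : 0 <= t * `|u x| <= 2 * S x.
  by rewrite mulr_ge0//=; apply: ler_pM => //; have /andP[] := uS x.
have {}h1 := h1 tu.
have -> : (a1 + a2 * (t * `|u x|) `^ r) * (t * `|u x|) * `|phi x| =
   t * (`|u x| * `|phi x| * (a1 + a2 * (t * `|u x|) `^ r)) by ring.
rewrite -[leRHS]mulrA; apply: ler_pM => //.
by rewrite mulr_ge0// ?mulr_ge0// addr_ge0 ?mulr_ge0 ?powR_ge0 ?(ltW (nl_a1 nf)) ?(ltW (nl_a2 nf)).
Qed.

Lemma fphi_lip (t : R) : `|t - 1| <= 1 ->
  `|II mu (fun x => f (t * u x) * phi x) - II mu (fun x => f (u x) * phi x)| <= `|t - 1| * D.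
Proof.
move=> t1; have t02 : 0 <= t <= 2.
  by move: t1; rewrite ler_norml => /andP[? ?]; apply/andP; split; lra.
have i1 := itg_fphi t02.
have i2 : itg mu (fun x => f (u x) * phi x).
  have : itg mu (fun x => f (1 * u x) * phi x) by apply: itg_fphi; rewrite ler01 ler1n.
  by congr itg; apply/funext => x; rewrite mul1r.
rewrite -(IIB i1 i2) /D mulrA -(IIZ _ iS).
apply: II_absle; [exact: itgZ iS|exact: itg_meas (itgB i1 i2)|move=> x].
rewrite -mulrBl normrM.
have -> : t * u x = u x + (t - 1) * u x by ring.
have := f_lip nf (u x) ((t - 1) * u x); rewrite normrM => h.
apply: le_trans (ler_wpM2r (normr_ge0 _) h) _.
have h2 : 0 <= `|u x| + `|t - 1| * `|u x| <= 2 * S x.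
  rewrite addr_ge0 ?mulr_ge0//= mulr_natl mulr2n; have /andP[_ us] := uS x.
  apply: lerD => //; apply: le_trans us; exact: ler_piMl.
have h1 := grow_th (S0 x) (uS x) (pS x) h2.
have -> : `|t - 1| * `|u x| * (a1 + a2 * (`|u x| + `|t - 1| * `|u x|) `^ r) * `|phi x| =
   `|t - 1| * (`|u x| * `|phi x| * (a1 + a2 * (`|u x| + `|t - 1| * `|u x|) `^ r)) by ring.
by rewrite -[leRHS]mulrA ler_wpM2l.
Qed.

Lemma NF_expand (t e : R) : 0 <= t <= 2 -> 0 <= e <= 1 ->
  `|NF (fun x => t * u x + (e * t) * phi x) - NF (fun x => t * u x) -
    (e * t) * II mu (fun x => f (t * u x) * phi x)| <= 4 * e ^+ 2 * D.
Proof.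
move=> t02 /andP[e0 e1]; have /andP[t0 t2] := t02.
have [B /(_ t (e * t))[H1 _]] := Kin_comb Hu Hp.
have [Ht _] := QfZ t pV Hu.
have i1 := itg_F pV H1; have i2 := itg_F pV Ht; have i3 := itg_fphi t02.
rewrite -(IIZ _ i3) /NF -(IIB i1 i2) -(IIB (itgB i1 i2) (itgZ _ i3)) /D mulrA -(IIZ _ iS).
apply: II_absle; [exact: itgZ iS|exact: itg_meas (itgB (itgB i1 i2) (itgZ _ i3))|move=> x].
have -> : e * t * (f (t * u x) * phi x) = f (t * u x) * (e * t * phi x) by ring.
apply: le_trans (F_second_order nf _ _) _.
have et : 0 <= e * t <= 2.
  rewrite mulr_ge0//=; apply: le_trans t2; exact: ler_piMl.
have /andP[et0 et2] := et.
rewrite !normrM (ger0_norm t0) (ger0_norm e0).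
have h2 : 0 <= t * `|u x| + e * t * `|phi x| <= 2 * S x.
  by rewrite addr_ge0 ?mulr_ge0//= mulrDr; apply: lerD; exact: ler_wpM2r.
have h1 := grow_th (S0 x) (pS x) (pS x) h2.
move: h1; move: (_ `^ r) (powR_ge0 (t * `|u x| + e * t * `|phi x|) r) => X X0.
have -> : (e * t * phi x) ^+ 2 * (a1 + a2 * X) =
   (e ^+ 2 * t ^+ 2) * (`|phi x| * `|phi x| * (a1 + a2 * X)).
  by rewrite -[`|phi x| * _]expr2 real_normK ?num_real//; ring.
have -> : 4 * e ^+ 2 * (A * K2) * th r (S x) = (e ^+ 2 * 4) * (A * K2 * th r (S x)) by ring.
move=> h1; apply: ler_pM => //.
- by apply: mulr_ge0; exact: sqr_ge0.
- by rewrite !mulr_ge0// addr_ge0 ?mulr_ge0 ?(ltW (nl_a1 nf)) ?(ltW (nl_a2 nf)).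
- by rewrite ler_wpM2l ?sqr_ge0//; nra.
Qed.

End Direction.

Let near_one_bounds (d : R) : 0 < d -> d <= 2^-1 ->
  [/\ 0 < 1 - d, 0 < 1 + d, 1 - d <= 1 + d, 0 <= 1 - d <= 2 & 0 <= 1 + d <= 2].
Proof. by move=> *; split; try lra; apply/andP; split; lra. Qed.

Let near_one_points (d t : R) : 0 < d -> d <= 2^-1 -> 1 - d <= t -> t <= 1 + d ->
  [/\ 0 < t, `|t - 1| <= d, 0 <= t <= 2, 2^-1 <= t <= 2 & `|t - 1| <= 1].
Proof.
by move=> *; rewrite !ler_norml; split; try lra; apply/andP; split; lra.
Qed.

(* Quf, Qu, Qp: Qf at t (u + e phi), u, phi; n, n0: NF at t (u + e phi) and t u;
   i, i0: the pairings of f (t u) and f u with phi. *)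
Let descent (Quf Qu Qp B n n0 i i0 j D t e l : R) :
  Quf = t ^+ 2 * Qu + 2 * t * (e * t) * B + (e * t) ^+ 2 * Qp ->
  `|n - n0 - (e * t) * i| <= 4 * e ^+ 2 * D -> `|i - i0| <= `|t - 1| * D ->
  2^-1 * (t ^+ 2 * Qu) - n0 <= j -> B - i0 = - (2 * l) -> `|t - 1| * (`|B| + D) <= l ->
  2^-1 <= t <= 2 -> 0 < e -> 0 <= Qp -> 0 <= D -> e * (2 * Qp + 4 * D) < l / 2 ->
  2^-1 * Quf - n < j.
Proof.
move=> -> h1 h2 h3 h4 h5 /andP[t1 t2] e0 Q0 D0 h6.
move: h1; rewrite ler_norml => /andP[h1 _].
move: h2; rewrite ler_norml => /andP[h2 _].
have tB : (t - 1) * B <= `|t - 1| * `|B| by rewrite -normrM ler_norm.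
have h7 : t * B - i <= - l by move: h5; rewrite mulrDr => h5; lra.
have t0 : 0 < t by lra.
have et : 0 < e * t by rewrite mulr_gt0.
have l0 : 0 <= l by apply: le_trans h5; rewrite mulr_ge0 ?addr_ge0.
have h8 : (e * t) * (t * B - i) <= - (e * l / 2).
  apply: le_trans (ler_wpM2l (ltW et) h7) _.
  have := mulr_ge0 (mulr_ge0 (ltW e0) l0) (_ : 0 <= t - 2^-1); rewrite subr_ge0 => /(_ t1); lra.
have h9 : (e * t) ^+ 2 * Qp <= 4 * (e ^+ 2 * Qp).
  have -> : (e * t) ^+ 2 * Qp = t ^+ 2 * (e ^+ 2 * Qp) by ring.
  apply: ler_wpM2r; first by apply: mulr_ge0; [exact: sqr_ge0|].
  have : t ^+ 2 <= 2 ^+ 2 by rewrite lerXn2r ?nnegrE ?(ltW t0).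
  by rewrite -natrX.
have h10 : e * (e * (2 * Qp + 4 * D)) < e * (l / 2) by rewrite ltr_pM2l.
have E : 2^-1 * (t ^+ 2 * Qu + 2 * t * (e * t) * B + (e * t) ^+ 2 * Qp) =
   2^-1 * (t ^+ 2 * Qu) + (e * t) * (t * B) + 2^-1 * ((e * t) ^+ 2 * Qp) by field.
rewrite E; move: h8 h10; rewrite mulrBr; rewrite !mulrDr !mulrA -expr2.
by move: h1 h3 h9; rewrite !mulrA; lra.
Qed.

(** [B] is the scalar product of [u] and [phi] in [E^s], so a failure makes [phi] a descent
    direction. No derivative of the projection is needed: the zero of [Phi] on the perturbed ray is
    found by signs, and [J (t u) <= J u] absorbs the unknown factor [t]. *)
Lemma minimizer_dir u phi (B : R) : nehari V u -> (forall v, nehari V v -> JW V u <= JW V v) ->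
  Hs phi -> (forall a b : R, Hs (fun x => a * u x + b * phi x) /\
    Qf V (fun x => a * u x + b * phi x) = a ^+ 2 * Qf V u + 2 * a * b * B + b ^+ 2 * Qf V phi) ->
  II mu (fun x => f (u x) * phi x) <= B.
Proof.
move=> Nu umin Hp hB; rewrite leNgt; apply/negP => BI.
have [Hu Pu Qu] := Nu; have Qp := Qf_ge0 pV Hp.1.
pose D := A * K2 * II mu (fun x => th r (`|u x| + `|phi x|)).
have D0 : 0 <= D.
  rewrite /D; apply: mulr_ge0; first by rewrite mulr_ge0 ?powR_ge0 ?(ltW A0).
  by apply: II_ge0 => x; exact: th_ge0.
pose l : R := (II mu (fun x => f (u x) * phi x) - B) / 2.
have l0 : 0 < l by rewrite divr_gt0// subr_gt0.
have hl : B - II mu (fun x => f (u x) * phi x) = - (2 * l).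
  by rewrite /l; move: (II _ _) => a; field.
have BD : 0 < `|B| + D + 1 by rewrite ltr_wpDl// addr_ge0.
(* For [|t - 1| <= d] the slope along [phi] changes by at most [l], half of its value [- 2 l] at
   [t = 1]. *)
pose d : R := Num.min 2^-1 (l / (`|B| + D + 1)).
have d0 : 0 < d by rewrite lt_min invr_gt0 ltr0n divr_gt0.
have d1 : d <= 2^-1 by rewrite ge_min lexx.
have dl : d * (`|B| + D) <= l.
  have : d <= l / (`|B| + D + 1) by rewrite ge_min lexx orbT.
  by rewrite ler_pdivlMr// mulrDr mulr1; lra.
have [t1 t2 dd1 b1 b2] := near_one_bounds d0 d1.
have tfacts := fun t => @near_one_points d t d0 d1.
(* [Phi] is strictly positive at [(1 - d) u] and strictly negative at [(1 + d) u], and these signs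
   persist weakly for [u + e phi] with [e] small. *)
have [P1 _] := Phi_ray_strict Nu t1; have [_ P2] := Phi_ray_strict Nu t2.
have {}P1 : 0 < Phi V (fun x => (1 - d) * u x) by apply: P1; rewrite gtrBl.
have {}P2 : Phi V (fun x => (1 + d) * u x) < 0 by apply: P2; rewrite ltrDl.
have [H1 _] := QfZ (1 - d) pV Hu; have [H2 _] := QfZ (1 + d) pV Hu.
have [d3 d30 c3] := Phi_cont pV H1 P1.
have P2' : 0 < - Phi V (fun x => (1 + d) * u x) by rewrite oppr_gt0.
have [d4 d40 c4] := Phi_cont pV H2 P2'.
have Q2 : 0 < Qf V u / 2 by rewrite divr_gt0.
have [d5 d50 c5] := Qf_cont pV Hu Q2.
pose dd : R := Num.min d3 (Num.min d4 d5).
have dd0 : 0 < dd by rewrite !lt_min d30 d40.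
have Qp1 : 0 < Qf V phi + 1 by rewrite ltr_wpDl.
pose Kq := 2 * Qf V phi + 4 * D.
have Kq0 : 0 <= Kq by apply: addr_ge0; apply: mulr_ge0.
have Kq1 : 0 < Kq + 1 by rewrite ltr_wpDl.
(* The second entry keeps the perturbations [e b phi], [0 <= b <= 2], within the continuity radii;
   the third makes the quadratic error smaller than the linear gain. *)
pose e : R := Num.min 1 (Num.min (dd / (4 * (Qf V phi + 1))) (l / (4 * (Kq + 1)))).
have q1 : 0 < dd / (4 * (Qf V phi + 1)) by apply: divr_gt0 => //; exact: mulr_gt0.
have q2 : 0 < l / (4 * (Kq + 1)) by apply: divr_gt0 => //; exact: mulr_gt0.
have e0 : 0 < e by rewrite /e lt_min ltr01 /= lt_min q1 q2.
have e1 : e <= 1 by rewrite ge_min lexx.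
have ed : e * (4 * (Qf V phi + 1)) <= dd.
  by rewrite -ler_pdivlMr ?mulr_gt0// !ge_min lexx orbT.
have el : e * Kq < l / 2.
  have : e * (4 * (Kq + 1)) <= l by rewrite -ler_pdivlMr ?mulr_gt0// !ge_min lexx !orbT.
  have := mulr_ge0 (ltW e0) Kq0; move: e0; move: (Kq) => k {ed}.
  by rewrite !mulrDr mulr1; lra.
have small (b : R) : 0 <= b <= 2 -> Qf V (fun x => (e * b) * phi x) <= dd.
  move=> /andP[b0 b02]; have [_ ->] := QfZ (e * b) pV Hp; apply: le_trans ed.
  have b4 : b ^+ 2 <= 4.
    have : b ^+ 2 <= 2 ^+ 2 by rewrite lerXn2r ?nnegrE.
    by rewrite -natrX.
  have e2 : e ^+ 2 <= e by rewrite expr2 ler_piMr// ltW.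
  apply: le_trans (_ : e * 4 * Qf V phi <= _).
    by apply: ler_wpM2r => //; rewrite exprMn; apply: ler_pM => //; exact: sqr_ge0.
  by rewrite -mulrA ler_pM2l// ler_pM2l// lerDl.
pose v x := u x + e * phi x.
have Hv : Hs v.
  have [H _] := hB 1 e; move: H; congr Hs; apply/funext => x; by rewrite mul1r.
have He b : Hs (fun x => (e * b) * phi x) by have [] := QfZ (e * b) pV Hp.
have vE b : (fun x => b * v x) = (fun x => b * u x + (e * b) * phi x).
  by apply/funext => x; rewrite /v; ring.
have Qv : 0 < Qf V v.
  have s1 : Qf V (fun x => (e * 1) * phi x) <= d5.
    apply: le_trans (small 1 _) _; first by rewrite ler01 ler1n.
    by rewrite /dd !ge_min lexx !orbT.
  have := c5 _ (He 1) s1; have := vE 1.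
  have -> : (fun x => 1 * v x) = v by apply/funext => x; rewrite mul1r.
  have -> : (fun x => 1 * u x + e * 1 * phi x) = (fun x => u x + e * 1 * phi x).
    by apply/funext => x; rewrite mul1r.
  move=> <-; rewrite ler_norml => /andP[h _]; move: h Qu.
  by move: (Qf V v) (Qf V u) => a b; lra.
have Pv1 : 0 <= Phi V (fun x => (1 - d) * v x).
  have s1 : Qf V (fun x => (e * (1 - d)) * phi x) <= d3.
    apply: le_trans (small (1 - d) _) _; first exact: b1.
    by rewrite /dd !ge_min lexx.
  have := c3 _ (He (1 - d)) s1; rewrite -vE ler_norml => /andP[h _]; move: h.
  by rewrite lerBrDr addNr.
have Pv2 : Phi V (fun x => (1 + d) * v x) <= 0.
  have s1 : Qf V (fun x => (e * (1 + d)) * phi x) <= d4.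
    apply: le_trans (small (1 + d) _) _; first exact: b2.
    by rewrite /dd !ge_min lexx !orbT.
  have := c4 _ (He (1 + d)) s1; rewrite -vE ler_norml => /andP[_ h]; move: h.
  by rewrite lerBlDr addNr.
have [|||t /andP[td1 td2] Pt] := @ivt_eps R (fun t => Phi V (fun x => t * v x)) (1 - d) (1 + d) dd1.
- move=> t _ a a0; have [b b0 hb] := Phi_ray_cont t pV Hv a0.
  by exists b => // t' _; exact: hb.
- exact: Pv1.
- exact: Pv2.
have [Ht Et] := QfZ t pV Hv.
have [t0 td t02 t22 tt1] := tfacts t td1 td2.
have Nt : nehari V (fun x => t * v x).
  by split; [exact: Ht|exact: Pt|rewrite Et; apply: mulr_gt0 => //; exact: exprn_gt0].
have := umin _ Nt; rewrite leNgt => /negP; apply.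
have e01 : 0 <= e <= 1 by rewrite (ltW e0).
have [_ EQ] := hB t (e * t).
have RM := ray_max pV Hu (ltW t0) Pu.
have [_ Etu] := QfZ t pV Hu.
rewrite /JW Etu -/(JW V u) in RM.
rewrite vE {1}/JW.
have h5 : `|t - 1| * (`|B| + D) <= l.
  by apply: le_trans dl; apply: ler_wpM2r => //; apply: addr_ge0.
exact: (descent EQ (NF_expand Hu Hp t02 e01) (fphi_lip Hu Hp tt1) RM hl h5 t22 e0 Qp D0 el).
Qed.

(** The weak Euler-Lagrange equation: the reverse inequality is the previous lemma for [- phi]. *)
Lemma minimizer_eq u phi (B : R) : nehari V u -> (forall v, nehari V v -> JW V u <= JW V v) ->
  Hs phi -> (forall a b : R, Hs (fun x => a * u x + b * phi x) /\
    Qf V (fun x => a * u x + b * phi x) = a ^+ 2 * Qf V u + 2 * a * b * B + b ^+ 2 * Qf V phi) ->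
  II mu (fun x => f (u x) * phi x) = B.
Proof.
move=> Nu umin Hp hB; apply/eqP; rewrite eq_le (minimizer_dir Nu umin Hp hB) /=.
have [Hn En] := QfZ (-1) pV Hp; have [Hu _ _] := Nu.
have hB' (a b : R) : Hs (fun x => a * u x + b * (-1 * phi x)) /\
    Qf V (fun x => a * u x + b * (-1 * phi x)) =
    a ^+ 2 * Qf V u + 2 * a * b * (- B) + b ^+ 2 * Qf V (fun x => -1 * phi x).
  have [H E] := hB a (- b).
  have -> : (fun x => a * u x + b * (-1 * phi x)) = (fun x => a * u x + (- b) * phi x).
    by apply/funext => x; ring.
  by split; [exact: H|rewrite E En; move: (Qf V u) (Qf V phi) => p q; ring].
have := minimizer_dir Nu umin Hn hB'.
have i1 : itg mu (fun x => f (u x) * phi x).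
  have : itg mu (fun x => f (1 * u x) * phi x) by apply: itg_fphi; rewrite ?ler01 ?ler1n.
  by congr itg; apply/funext => x; rewrite mul1r.
rewrite [leLHS](_ : _ = - II mu (fun x => f (u x) * phi x)) ?lerN2//.
by rewrite -(IIN i1); apply: eq_II => x; ring.
Qed.

(** Writing [h = d k] with [k] in the unit ball, the linear terms cancel by the Euler-Lagrange
    equation and the second-order remainder is uniform over the unit ball. Again [d] is any bound of
    the norm, not the norm itself. *)
Lemma minimizer_frechet u : nehari V u -> (forall v, nehari V v -> JW V u <= JW V v) ->
  exists2 C : R, 0 < C & forall h (d : R), Hs h -> 0 < d <= 1 -> Qf V h <= d ^+ 2 ->
  `|JW V (fun x => u x + h x) - JW V u| <= C * d ^+ 2.
Proof.
move=> Nu umin; have [Hu _ _] := Nu; have [C1 C10 hC1] := th_Q.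
pose U := II mu (fun x => th r (u x)).
have U0 : 0 <= U by apply: II_ge0 => x; exact: th_ge0.
pose C := 2^-1 + 4 * (A * K2 * (4 * K2 * (U + C1))).
have K20 : 0 < K2 := lt_le_trans ltr01 K21.
have C0 : 0 < C.
  rewrite /C ltr_wpDr ?invr_gt0// !mulr_ge0 ?(ltW A0) ?(ltW K20)//.
  by apply: addr_ge0 => //; exact: ltW.
exists C => // h d Hh /andP[d0 d1] Qd.
pose k x := d^-1 * h x; have [Hk Ek] := QfZ d^-1 pV Hh; rewrite -/k in Hk Ek.
have Qk1 : Qf V k <= 1.
  by rewrite Ek exprVn mulrC ler_pdivrMr ?exprn_gt0// mul1r.
have Qk0 := Qf_ge0 pV Hk.1.
have thk : II mu (fun x => th r (k x)) <= C1.
  apply: le_trans (hC1 V k pV Hk Qk1) _; rewrite -[leRHS]mulr1; apply: ler_wpM2l => //.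
  exact: ltW.
have [_ hS] := itg_th2 Hu Hk.
have [B hB] := Qf_comb pV Hu Hk.
have EB := minimizer_eq Nu umin Hk hB.
have [_ EQ] := hB 1 d.
have d01 : 0 <= d <= 1 by rewrite (ltW d0).
have t12 : 0 <= (1 : R) <= 2 by rewrite ler01 ler1n.
have NE := NF_expand Hu Hk t12 d01.
have Eh : (fun x => 1 * u x + d * k x) = (fun x => u x + h x).
  by apply/funext => x; rewrite mul1r /k mulrA divff ?gt_eqF// mul1r.
have E1 : (fun x => 1 * u x) = u by apply/funext => x; rewrite mul1r.
have E2 : (fun x => f (1 * u x) * k x) = (fun x => f (u x) * k x).
  by apply/funext => x; rewrite mul1r.
have E3 : (fun x => 1 * u x + d * 1 * k x) = (fun x => u x + h x).
  by rewrite -Eh; apply/funext => x; rewrite mulr1.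
rewrite E1 E2 E3 EB mulr1 in NE; rewrite Eh in EQ.
have -> : JW V (fun x => u x + h x) - JW V u =
   2^-1 * (d ^+ 2 * Qf V k) - (NF (fun x => u x + h x) - NF u - d * B).
  rewrite /JW EQ; by move: (Qf V u) (Qf V k) (NF _) (NF _) => p q a b; field.
apply: le_trans (ler_normB _ _) _; rewrite /C mulrDl; apply: lerD.
  rewrite ger0_norm; last by rewrite !mulr_ge0// ltW.
  apply: ler_wpM2l; first by rewrite invr_ge0.
  by rewrite -[leRHS]mulr1; apply: ler_wpM2l => //; exact: sqr_ge0.
apply: le_trans NE _.
rewrite mulrAC; apply: ler_wpM2r; first exact: sqr_ge0.
apply: ler_wpM2l => //; apply: ler_wpM2l; first by apply: mulr_ge0; exact: ltW.
apply: le_trans hS _; apply: ler_wpM2l; first by apply: mulr_ge0 => //; exact: ltW.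
by apply: lerD.
Qed.

Lemma NF_gt0 u : Hs u -> ~ {ae mu, forall x, u x = 0} -> 0 < NF u.
Proof.
move=> Hu nae; apply: II_gt0; [by move=> x; exact: F_ge0 nf _|exact: itg_F pV Hu|move=> ae0].
apply: nae; apply: filterS ae0 => x Fx; apply/eqP; apply: contraT => ux.
by have := F_gt0 nf ux; rewrite Fx ltxx.
Qed.

Lemma JW_neg u : Hs u -> JW V u < 0 -> Phi V u < 0.
Proof.
move=> Hu; rewrite (JW_Phi pV Hu); have := NG_ge0 u.
by move: (Phi V u) (NG u) => a b; lra.
Qed.

Lemma nehari_nonempty : exists u, nehari V u.
Proof.
have Hw := Hs_wexp N s01.
have nae : ~ {ae mu, forall x, wexp x = 0}.
  move=> ae0; have : nsq mu (@wexp R N) = II mu (fun=> 0).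
    apply: II_ae_eq; [exact: itg_meas Hw.1.2|exact: measurable_cst|].
    by apply: filterS ae0 => x ->; rewrite expr0n.
  rewrite II_cst0 => E.
  have : {ae mu, forall x : T, False}.
    by apply: filterS ae0 => x h; have := wexp_gt0 x; rewrite h ltxx.
  (* The indicator of the unit cube has integral 1, so the empty property cannot hold almost
     everywhere. *)
  move=> aeF; have : II mu (@kap R N) = II mu (fun=> 0).
    apply: II_ae_eq; [exact: meas_kap|exact: measurable_cst|].
    by apply: filterS aeF.
  by rewrite II_cst0 (II_kap R N).2 => /eqP; rewrite oner_eq0.
have [t t1 Jt] := ray_end pV Hw (NF_gt0 Hw nae).
have [Ht _] := QfZ t pV Hw; have Pt := JW_neg Ht Jt.
have Qt : 0 < Qf V (fun x => t * wexp x).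
  rewrite lt_neqAle eq_sym (Qf_ge0 pV Ht.1) andbT; apply/eqP => Q0.
  have [rho rho0 hrho] := Phi_small; have := hrho V _ pV Ht.
  by rewrite Q0 mulr0 => /(_ (ltW rho0)); rewrite leNgt Pt.
have [t' _ Nt] := nehari_project pV Ht Qt (ltW Pt).
by eexists; exact: Nt.
Qed.

End Critical.

(** * The mountain pass level and the conclusion *)

Section MountainPass.
Variable V : T -> R.
Hypothesis pV : pot V.

Lemma iintN_pot u : L2 mu u ->
  iintN (fun x => (V x * u x ^+ 2)%:E) = (II mu (fun x => (V x * u x ^+ 2)%R))%:E.
Proof.
move=> Lu; apply: iintN_EFin; first exact: itg_potM pV Lu.2.
by move=> x; apply: mulr_ge0 (sqr_ge0 _); have /andP[h _] := pV.2 x; exact: le_trans (ltW V0_gt0) h.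
Qed.

Lemma inEs_Hs u : inEs s V u <-> Hs u.
Proof.
split=> [[mu_ [fu]]|Hu].
  have Lu : L2 mu u.
    split; first exact: mu_.
    apply: iintN_itg fu; first exact: measurable_funX.
    by move=> x; exact: sqr_ge0.
  rewrite /Esnormsq (iintN_pot Lu) => h; split; first exact: Lu.
  by move: h; case: (kineticE s u) => [k _|//|_]; rewrite ?ltry// ltNyr.
have Lu := Hu.1; split; first exact: Lu.1; split.
  by rewrite (iintN_EFin Lu.2) ?ltry// => x; exact: sqr_ge0.
by rewrite /Esnormsq (iintN_pot Lu) (Kin_EFin Hu) -EFinD ltry.
Qed.

Lemma Esnormsq_Qf u : Hs u -> Esnormsq s V u = (Qf V u)%:E.
Proof. by move=> Hu; rewrite /Esnormsq (iintN_pot Hu.1) (Kin_EFin Hu) -EFinD. Qed.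

Lemma Esnorm_Qf u : Hs u -> Esnorm s V u = Num.sqrt (Qf V u).
Proof. by move=> Hu; rewrite /Esnorm (Esnormsq_Qf Hu). Qed.

Lemma Jfun_JW u : Hs u -> Jfun s V f u = JW V u.
Proof. by move=> Hu; rewrite /Jfun (Esnormsq_Qf Hu) (RintN_II (itg_F pV Hu)). Qed.

Lemma critical_minimizer u : nehari V u -> (forall v, nehari V v -> JW V u <= JW V v) ->
  critical_point s V f u.
Proof.
move=> Nu umin; have [Hu _ _] := Nu; split; first exact/inEs_Hs.
have [C C0 hC] := minimizer_frechet pV Nu umin.
move=> e e0; exists (Num.min 1 (e / C)); first by rewrite lt_min ltr01 divr_gt0.
move=> h /inEs_Hs Hh; rewrite (Esnorm_Qf Hh) lt_min => /andP[n1 n2].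
rewrite (Jfun_JW (HsD Hu Hh)) (Jfun_JW Hu).
have Q0 := Qf_ge0 pV Hh.1; have n0 : 0 <= Num.sqrt (Qf V h) := sqrtr_ge0 _.
(* A function of zero norm need not be the zero function; there the bound [C * d ^+ 2] holds for
   every [d] in [(0, 1]], so the increment vanishes. *)
have [nz|nz] := eqVneq (Num.sqrt (Qf V h)) 0.
  rewrite nz mulr0; apply/ler_addgt0Pr => b b0; rewrite add0r.
  pose d : R := Num.min 1 (b / C).
  have d0 : 0 < d by rewrite lt_min ltr01 divr_gt0.
  have d1 : d <= 1 by rewrite ge_min lexx.
  have d01 : 0 < d <= 1 by rewrite d0.
  have Qz : Qf V h <= d ^+ 2.
    by move/eqP: nz; rewrite sqrtr_eq0 => /le_trans; apply; exact: sqr_ge0.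
  apply: le_trans (hC h d Hh d01 Qz) _.
  apply: le_trans (_ : C * d <= _).
    by rewrite ler_pM2l// expr2 ler_piMr// ltW.
  by rewrite mulrC -ler_pdivlMr// ge_min lexx orbT.
have np : 0 < Num.sqrt (Qf V h) by rewrite lt_neqAle eq_sym nz.
have n01 : 0 < Num.sqrt (Qf V h) <= 1 by rewrite np ltW.
have Qn : Qf V h <= Num.sqrt (Qf V h) ^+ 2 by rewrite sqr_sqrtr.
apply: le_trans (hC h _ Hh n01 Qn) _.
rewrite expr2 mulrA ler_pM2r// mulrC -ler_pdivlMr//; exact: ltW.
Qed.

Lemma ray_path u (t : R) : nehari V u -> JW V (fun x => t * u x) < 0 ->
  Gamma s V f (fun a x => (a * t) * u x).
Proof.
move=> [Hu Pu Qu] Jt; have HZ a : Hs (fun x => a * u x) by have [] := QfZ a pV Hu.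
split; first by move=> a _; exact/inEs_Hs.
split; last first.
  split; last by under eq_fun do rewrite mul1r; rewrite (Jfun_JW (HZ t)).
  rewrite (Esnorm_Qf (HZ (0 * t))); have [_ ->] := QfZ (0 * t) pV Hu.
  by rewrite mul0r expr0n mul0r sqrtr0.
move=> a _ e e0; pose k : R := `|t| * Num.sqrt (Qf V u) + 1.
have k0 : 0 < k by rewrite ltr_wpDl// mulr_ge0 ?sqrtr_ge0.
exists (e / k); first exact: divr_gt0.
move=> a' _; rewrite ltr_pdivlMr// => h.
have -> : (fun x => a' * t * u x - a * t * u x) = (fun x => ((a' - a) * t) * u x).
  by apply/funext => x; ring.
rewrite (Esnorm_Qf (HZ _)); have [_ ->] := QfZ ((a' - a) * t) pV Hu.
rewrite sqrtrM ?sqr_ge0// sqrtr_sqr normrM -mulrA; apply: le_lt_trans h.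
by apply: ler_wpM2l => //; rewrite /k lerDl.
Qed.

(** [Phi] also vanishes at the start of the path, so its bare zeros are not enough. The added term
    [max 0 (rho / 2 - Qf)] is positive near the origin and absent at the end point, and no zero of
    the sum has [Qf <= rho / 2], because there [Phi >= Qf / 2]. *)
Lemma path_crosses g : Gamma s V f g -> exists2 t : R, 0 <= t <= 1 & nehari V (g t).
Proof.
move=> [gE [gc [g0 g1]]]; have [rho rho0 hrho] := Phi_small.
have itv01 (t : R) : 0 <= t <= 1 -> t \in `[0, 1] by rewrite in_itv.
have Hg (t : R) : 0 <= t <= 1 -> Hs (g t) by move=> /itv01/gE/inEs_Hs.
pose X t := Phi V (g t) + Num.max 0 (rho / 2 - Qf V (g t)).
have b0 : 0 <= (0 : R) <= 1 by rewrite lexx ler01.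
have b1 : 0 <= (1 : R) <= 1 by rewrite lexx ler01.
have [|||t t01 Xt] := @ivt_eps R X 0 1 ler01.
- move=> t t01 e e0; have e2 : 0 < e / 2 by rewrite divr_gt0.
  have [d1 d10 h1] := Phi_cont pV (Hg t t01) e2.
  have [d2 d20 h2] := Qf_cont pV (Hg t t01) e2.
  pose d : R := Num.min d1 d2.
  have d0 : 0 < d by rewrite lt_min d10.
  have sd0 : 0 < Num.sqrt d by rewrite sqrtr_gt0.
  have [d' d'0 hd'] := gc t (itv01 _ t01) _ sd0.
  exists d' => // t' t'01 tt; have := hd' t' (itv01 _ t'01) tt.
  have Hh := HsB (Hg t' t'01) (Hg t t01).
  rewrite (Esnorm_Qf Hh) ltr_sqrt// => /ltW; rewrite le_min => /andP[q1 q2].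
  have := h1 _ Hh q1; have := h2 _ Hh q2.
  have -> : (fun x => g t x + (g t' x - g t x)) = g t'.
    by apply/funext => x; rewrite addrC subrK.
  rewrite /X; move: (Phi V (g t')) (Phi V (g t)) (Qf V (g t')) (Qf V (g t)) => a b c a'.
  exact: max_shift_dist.
- have Q0 : Qf V (g 0) <= 0.
    by move/eqP: g0; rewrite (Esnorm_Qf (Hg _ b0)) sqrtr_eq0.
  have := hrho V _ pV (Hg _ b0) (le_trans Q0 (ltW rho0)).
  move=> h; rewrite /X; apply: addr_ge0; last by rewrite le_max lexx.
  by apply: le_trans h; apply: mulr_ge0 => //; exact: Qf_ge0 pV (Hg _ b0).1.
- have P1 : Phi V (g 1) < 0.
    by apply: (JW_neg pV (Hg _ b1)); rewrite -(Jfun_JW (Hg _ b1)).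
  have Q1 : rho < Qf V (g 1).
    rewrite ltNge; apply/negP => h; have := hrho V _ pV (Hg _ b1) h.
    have := Qf_ge0 pV (Hg _ b1).1; move: P1.
    by move: (Phi V _) (Qf V _) => a b; lra.
  rewrite /X max_l; first by rewrite addr0 ltW.
  by move: (Qf V _) Q1 => a; lra.
exists t => //; have Ht := Hg t t01; have hr := hrho V _ pV Ht.
have Q0 := Qf_ge0 pV Ht.1.
have Qr : rho / 2 < Qf V (g t).
  rewrite ltNge; apply/negP => h.
  have h' : Qf V (g t) <= rho by move: h rho0; move: (Qf V _) => a; lra.
  have := hr h'; move: Xt; rewrite /X max_r; last by rewrite subr_ge0.
  by move: h rho0 Q0; move: (Phi V _) (Qf V _) => a b; lra.
have Pt : Phi V (g t) = 0.
  by move: Xt; rewrite /X max_l ?addr0// subr_le0 ltW.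
split; [exact: Ht|exact: Pt|].
by apply: lt_trans Qr; rewrite divr_gt0.
Qed.

Lemma mp_level_nehari u : nehari V u -> (forall v, nehari V v -> JW V u <= JW V v) ->
  mp_level s V f = (Jfun s V f u)%:E.
Proof.
move=> Nu umin; have [Hu Pu Qu] := Nu; rewrite (Jfun_JW Hu).
apply/eqP; rewrite eq_le; apply/andP; split; last first.
  apply: le_ereal_inf_tmp => _ [g Gg <-]; have [t t01 Nt] := path_crosses Gg.
  apply: le_ereal_sup_tmp; exists (Jfun s V f (g t))%:E.
    by exists t => //=; rewrite in_itv.
  by have [Ht _ _] := Nt; rewrite lee_fin (Jfun_JW Ht); exact: umin.
(* The upper bound uses the ray through [u], continued until [J] is negative; this needs
   [int F(u) > 0], hence that [u] is not almost everywhere 0. *)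
have N0 : 0 < Nfz u.
  by move: Pu; rewrite /Phi => /eqP; rewrite subr_eq0 => /eqP <-.
have F0 := NF_gt0 pV Hu (Nfz_gt0_ne pV Hu N0).
have [t t1 Jt] := ray_end pV Hu F0.
apply: ge_ereal_inf; eexists; first by exists (fun a x => (a * t) * u x); [exact: ray_path|].
apply: ge_ereal_sup => _ [a aI <-]; move: aI; rewrite /= in_itv /= => /andP[a0 _].
have [Ha _] := QfZ (a * t) pV Hu.
rewrite lee_fin (Jfun_JW Ha); apply: (ray_max pV Hu _ Pu).
by apply: mulr_ge0 => //; apply: le_trans t1.
Qed.

Lemma mp_level_critical :
  (forall e : R, 0 < e -> exists M : R, forall x, M <= euclN x -> Vinf - e <= V x) ->
  critical_value s V f (mp_level s V f).
Proof.
move=> Vlim; have [u Nu umin] := nehari_minimizer pV Vlim (nehari_nonempty pV).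
exists u; split; first exact: critical_minimizer.
exact: mp_level_nehari.
Qed.

End MountainPass.

End Energy.

Theorem theorem5p3 (R : realType) (N : nat) (s : R)
  (V : N.-tuple R -> R) (f : R -> R) (a1 a2 p mu Vinf : R) :
  (1 <= N)%N -> 0 < s < 1 ->
  (* (V1) *)
  (forall x : 'rV[R]_N, differentiable (V \o @rv2t R N) x) ->
  (forall v : 'rV[R]_N, continuous (fun x => 'D_v (V \o @rv2t R N) x)) ->
  0 < inf (range V) ->
  (* (f1) *)
  (forall t, derivable f t 1) -> continuous (derive1 f) ->
  (* (f2) *)
  f 0 = 0 -> (derive1 f) 0 = 0 ->
  (* (f3) *)
  0 < a1 -> 0 < a2 -> 2 * s < N%:R -> 1 < p -> p < (N%:R + 2 * s) / (N%:R - 2 * s) ->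
  (forall t, `|(derive1 f) t| <= a1 + a2 * powR `|t| (p - 1)) ->
  (* (f4) *)
  2 < mu -> (forall t, t != 0 -> 0 < mu * primitive f t <= t * f t) ->
  (* (f5) *)
  (forall z t1 t2, z != 0 -> 0 < t1 -> t1 < t2 ->
     z * f (t1 * z) / t1 < z * f (t2 * z) / t2) ->
  (* (V3): liminf_{|x| -> oo} V(x) = Vinf *)
  0 < Vinf ->
  (forall e, 0 < e -> exists M, forall x, M <= euclN x -> Vinf - e <= V x) ->
  (forall e, 0 < e -> forall M, exists x, M <= euclN x /\ V x <= Vinf + e) ->
  (* (V4) *)
  (forall x, V x <= Vinf) -> (exists x, V x != Vinf) ->
  critical_value s V f (mp_level s V f).
Proof.
move=> _ s01 dV _ V0 df cdf f0 df0 a10 a20 sN p1 pN fg mu2 AR mono _ Vlim _ Vle _.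
have r0 : 0 < p - 1 by rewrite subr_gt0.
have nf := Nonlin df cdf f0 df0 a10 a20 r0 fg mu2 AR mono.
(* Equivalent to the upper bound on [p] in (f3), since [N + 2s - (N - 2s) = 4s]. *)
have rN : (p - 1) * (N%:R - 2 * s) < 4 * s.
  by move: pN; rewrite ltr_pdivlMr ?subr_gt0// => h; lra.
(* [inf] takes the default value 0 on sets without infimum, so its positivity shows that [V] is
   bounded below. *)
have hV : has_inf (range V).
  by apply: contrapT => /inf_out E; move: V0; rewrite E ltxx.
have pV : pot (inf (range V)) Vinf V.
  split; first by apply: measurable_continuous_rv2t => x; exact: differentiable_continuous.
  by move=> x; rewrite Vle andbT; apply: (ge_inf hV.2); exists x.
exact: (mp_level_critical s01 sN nf rN V0 pV Vlim).
Qed.
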